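(* Let $n\ge1$, $\alpha\in[0,n)$, and let $V$ be a finite positive measure on $\mathbb{R}^n$ absolutely continuous with respect to Lebesgue measure. Suppose $\Omega$ is a homogeneous function of degree zero on $\mathbb{R}^n\setminus\{0\}$ satisfying the $L^{\frac{n}{n-\alpha}}$-Dini condition, and, when $\alpha=0$, $\int_{\mathbb{S}^{n-1}}\Omega\,d\sigma=0$. If $T^{\alpha}_{\Omega}$ is bounded from $L^1(\mathbb{R}^n)$ to $L^{\frac{n}{n-\alpha},\infty}(\mathbb{R}^n)$, then: (1) $\frac{\Omega(x)}{|x|^{n-\alpha}}\in L^{\frac{n}{n-\alpha},\infty}$ and $\big\|\frac{\Omega(\cdot)}{|\cdot|^{n-\alpha}}\big\|_{L^{\frac{n}{n-\alpha},\infty}}\le C\|T^{\alpha}_{\Omega}\|_{L^1\to L^{\frac{n}{n-\alpha},\infty}}$; (2) $\Omega\in L^{\frac{n}{n-\alpha}}(\mathbb{S}^{n-1})$ and $\|\Omega\|_{L^{\frac{n}{n-\alpha}}(\mathbb{S}^{n-1})}\le C\|T^{\alpha}_{\Omega}\|_{L^1\to L^{\frac{n}{n-\alpha},\infty}}$; (3) for every $\rho>0$, $$\lim_{t\to0^+}\Big\|T^{\alpha}_{\Omega}(V_t)-\frac{\Omega(\cdot)}{|\cdot|^{n-\alpha}}V(\mathbb{R}^n)\Big\|_{L^{\frac{n}{n-\alpha},\infty}(\mathbb{R}^n\setminus B(0,\rho))}=0,$$ where $C$ depends only on $n,\alpha$.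
   Context: $\Omega$ homogeneous of degree zero: $\Omega(sx)=\Omega(x)$ for $s>0$, $x\ne0$. For $1\le q<\infty$, the $L^q$-Dini condition means $\Omega\in L^q(\mathbb{S}^{n-1})$ and $\int_0^1\frac{\omega_q(t)}{t}dt<\infty$, with $\omega_q(t)=\big(\sup_{|h|\le t}\int_{\mathbb{S}^{n-1}}|\Omega(x'+h)-\Omega(x')|^q d\sigma(x')\big)^{1/q}$. $T^{\alpha}_{\Omega}\mu(x)=\int_{\mathbb{R}^n}\frac{\Omega(x-y)}{|x-y|^{n-\alpha}}d\mu(y)$ (principal value when $\alpha=0$; functions act via $d\mu=f\,dy$). $V_t(E)=V(E/t)$. For a measurable set $E$, $\|f\|_{L^{p,\infty}(E)}=\sup_{\lambda>0}\lambda|\{x\in E:|f(x)|>\lambda\}|^{1/p}$. *)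

(* Defs.v *)
From HB Require Import structures.
From mathcomp Require Import all_boot all_order all_algebra.
From mathcomp Require Import all_classical all_reals all_analysis.
Set Implicit Arguments.
Unset Strict Implicit.
Unset Printing Implicit Defensive.
Import Order.TTheory GRing.Theory Num.Theory.
Import numFieldNormedType.Exports.
Local Open Scope classical_set_scope.
Local Open Scope ring_scope.

Definition enorm (R : realType) (n : nat) (x : 'rV[R]_n) : R :=
  Num.sqrt (\sum_(i < n) x ord0 i ^+ 2).

Section lebesgue_Rn.
Variables (R : realType) (n : nat).

(* auxiliary copy of 'rV[R]_n in which every set is "measurable", used only
   so that covers in the definition of the outer measure may be arbitrary
   families of sets (non-boxes get volume +oo, so only box covers count). *)
Definition allsetsT := 'rV[R]_n.
HB.instance Definition _ := Pointed.on allsetsT.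
HB.instance Definition _ := @isMeasurable.Build default_measure_display
  allsetsT discrete_measurable discrete_measurable0
  discrete_measurableC discrete_measurableU.

Definition box (a b : 'rV[R]_n) : set 'rV[R]_n :=
  [set x | forall i, a ord0 i <= x ord0 i < b ord0 i].

Definition box_vol (A : set allsetsT) : \bar R :=
  if `[< A = set0 >] then 0%E else
  ereal_inf [set (\prod_(i < n) (ab.2 ord0 i - ab.1 ord0 i))%:E |
    ab in [set ab : 'rV[R]_n * 'rV[R]_n |
             (forall i, ab.1 ord0 i <= ab.2 ord0 i) /\ A = box ab.1 ab.2]].

Lemma box_vol0 : box_vol set0 = 0%E.
Proof. by rewrite /box_vol; case: asboolP. Qed.

Lemma box_vol_ge0 A : (0 <= box_vol A)%E.
Proof.
rewrite /box_vol; case: asboolP => // _.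
apply: le_ereal_inf_tmp => _ [[a b] /= [ab _] <-].
rewrite lee_fin; apply: prodr_ge0 => i _; rewrite subr_ge0; exact: ab.
Qed.

Definition lebesgue_outer : set allsetsT -> \bar R := mu_ext box_vol.

HB.instance Definition _ := isOuterMeasure.Build R allsetsT lebesgue_outer
  (mu_ext0 box_vol0 box_vol_ge0) (mu_ext_ge0 box_vol_ge0)
  (le_mu_ext box_vol) (mu_ext_sigma_subadditive box_vol_ge0).

Definition Rn := caratheodory_type lebesgue_outer.

Definition lebn : set Rn -> \bar R := lebesgue_outer.

HB.instance Definition _ := isMeasure.Build _ Rn R lebn
  (caratheodory_measure0 lebesgue_outer)
  (@caratheodory_measure_ge0 R allsetsT lebesgue_outer)
  (@caratheodory_measure_sigma_additive R allsetsT lebesgue_outer).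

End lebesgue_Rn.

Section operators.
Variables (R : realType) (n : nat).
Local Notation Rn := (Rn R n).
Local Notation lebn := (@lebn R n).
Local Open Scope ereal_scope.

Definition homogeneous0 (Omega : 'rV[R]_n -> R) : Prop :=
  forall (s : R) (x : 'rV[R]_n), (0 < s)%R -> x != 0%R -> Omega (s *: x) = Omega x.

(* Integral over the unit sphere S^{n-1} w.r.t. its surface measure sigma,
   defined (as usual) through  sigma(E) = n |{ r x' : 0 < r <= 1, x' in E }|,
   i.e.  int_{S^{n-1}} g dsigma = n int_{0<|x|<=1} g(x/|x|) dx. *)
Definition sphere_integral (g : 'rV[R]_n -> \bar R) : \bar R :=
  (n%:R)%:E * \int[lebn]_(x in [set x : Rn | (0 < enorm x)%R /\ (enorm x <= 1)%R])
                 g ((enorm x)^-1 *: x).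

Definition LqS (q : R) (Omega : 'rV[R]_n -> R) : Prop :=
  measurable_fun [set: Rn] (Omega : Rn -> R) /\
  sphere_integral (fun x => (`|Omega x| `^ q)%:E) < +oo.

Definition omega_q (q : R) (Omega : 'rV[R]_n -> R) (t : R) : \bar R :=
  poweR (ereal_sup [set sphere_integral
                          (fun x => (`|Omega (x + h) - Omega x| `^ q)%:E)
                    | h in [set h : 'rV[R]_n | (enorm h <= t)%R]]) q^-1.

Definition Lq_Dini (q : R) (Omega : 'rV[R]_n -> R) : Prop :=
  LqS q Omega /\
  \int[lebesgue_measure]_(t in `]0%R, 1%R]) (omega_q q Omega t * (t^-1)%:E)
    < +oo.

Definition omega_kernel (alpha : R) (Omega : 'rV[R]_n -> R) (x : 'rV[R]_n) : R :=
  (Omega x / (enorm x `^ (n%:R - alpha)))%R.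

(* real-valued Lebesgue integral w.r.t. a set function (same as the
   library's Rintegral, which however requires a bundled measure) *)
Definition Rint (mu : set Rn -> \bar R) (D : set Rn) (f : Rn -> R) : R :=
  fine (\int[mu]_(x in D) (f x)%:E).

Definition Tgen (alpha : R) (Omega : 'rV[R]_n -> R) (mu : set Rn -> \bar R)
    (g : 'rV[R]_n -> R) (x : 'rV[R]_n) : R :=
  if alpha == 0%R then
    lim ((fun eps : R => Rint mu [set y : Rn | (eps < enorm (x - y))%R]
           (fun y => omega_kernel alpha Omega (x - y) * g y)%R) @ 0%R^'+)
  else Rint mu [set: Rn] (fun y => omega_kernel alpha Omega (x - y) * g y)%R.

Definition Tf alpha Omega (f : 'rV[R]_n -> R) := Tgen alpha Omega lebn f.
Definition Tmu alpha Omega (mu : set Rn -> \bar R) :=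
  Tgen alpha Omega mu (fun=> 1%R).

Definition weak_norm (p : R) (E : set 'rV[R]_n) (f : 'rV[R]_n -> R) : \bar R :=
  ereal_sup [set l%:E * poweR (lebn [set x : Rn | E x /\ (l < `|f x|)%R]) p^-1
            | l in [set l : R | (0 < l)%R]].

Definition L1_norm (f : 'rV[R]_n -> R) : \bar R :=
  \int[lebn]_(x in [set: Rn]) (`|f x|)%:E.

Definition L1_weak_bound (alpha : R) (Omega : 'rV[R]_n -> R) (C : R) : Prop :=
  (0 <= C)%R /\
  forall f : 'rV[R]_n -> R, lebn.-integrable [set: Rn] (fun x => (f x)%:E) ->
    weak_norm (n%:R / (n%:R - alpha)) [set: 'rV[R]_n] (Tf alpha Omega f)
      <= C%:E * L1_norm f.

Definition T_bounded alpha Omega : Prop := exists C, L1_weak_bound alpha Omega C.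

Definition T_opnorm alpha Omega : \bar R :=
  ereal_inf [set C%:E | C in L1_weak_bound alpha Omega].

Definition dilate (V : set Rn -> \bar R) (t : R) : set Rn -> \bar R :=
  fun E => V ((fun x : 'rV[R]_n => t^-1 *: x) @` E).

End operators.

(* Main.v *)
Require Import Defs.
From HB Require Import structures.
From mathcomp Require Import all_boot all_order all_algebra.
From mathcomp Require Import all_classical all_reals all_analysis.
From mathcomp Require Import measurable_realfun ring lra.
Import Order.TTheory GRing.Theory Num.Theory.
Import numFieldNormedType.Exports.
Local Open Scope classical_set_scope.
Local Open Scope ring_scope.
Set Implicit Arguments.
Unset Strict Implicit.
Unset Printing Implicit Defensive.

(** The kernel [K = Omega / |x|^(n - alpha)] is homogeneous of degree [-n/q],
    [q = n / (n - alpha)], and the Dini condition gives the L^q smoothness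
    [int_(|x| > rho) |K (x - y) - K x|^q dx -> 0] as [rho / |y| -> oo].  Hence,
    for an integrable [f], [T f - K * int f] is weakly small far from the
    origin: the part of [f] in a large ball is handled by smoothness, the rest
    by the weak bound on [T].  Scaling by [t] turns this into (3), a finite
    measure [V << dx] being [f dx] by Radon-Nikodym; for [f] the indicator of a
    cube it bounds the level sets of [K] at all scales, which is (1); (2)
    follows by slicing these level sets along the cones
    [2^k s <= |Omega| < 2^(k + 1) s].

    When [alpha = 0] the additivity of [T] needs the principal values to exist
    almost everywhere for every integrable [f].  This comes from a weak bound
    for the maximal truncations of dyadic step functions: Calderon-Zygmund
    decomposition for the bad part, and a Cotlar argument based on the
    hypothesis for the good part; density of step functions and Borel-Cantelli
    then give convergence. *)

(** * The Euclidean norm, Lebesgue measure and its invariance *)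

(** [lebn] is an outer measure defined on all sets, so level sets of maximal functions and of [Tf]
    are estimated by monotonicity and subadditivity, without a proof that they are measurable.
    Tonelli's theorem is less lenient: K (x - y) has to be measurable for the product of two
    Caratheodory sigma-algebras, which measurability of K in one variable does not provide. Hence K
    is replaced by a Borel function [K0] equal to it almost everywhere; as reflections and
    translations preserve null sets, T is unchanged at every point. Integrals and limits have
    default values where they diverge, so the weak bound alone does not make T additive. For alpha >
    0 the kernel is locally integrable and T f converges absolutely almost everywhere. For alpha = 0
    one has q = 1, and the cancellation of Omega makes the truncations at x independent of e as soon
    as f is constant near x, which is why step functions are the dense class. *)

Section EuclideanNorm.
Context {R : realType} {n : nat}.
Implicit Types x y : 'rV[R]_n.

Lemma sum_sqr_ge0 x : 0 <= \sum_(i < n) x ord0 i ^+ 2.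
Proof. by apply: sumr_ge0 => i _; exact: sqr_ge0. Qed.

Lemma enorm_ge0 x : 0 <= enorm x.
Proof. exact: sqrtr_ge0. Qed.

Lemma sqr_enorm x : enorm x ^+ 2 = \sum_(i < n) x ord0 i ^+ 2.
Proof. by rewrite sqr_sqrtr// sum_sqr_ge0. Qed.

Lemma coord_le_enorm x i : `|x ord0 i| <= enorm x.
Proof.
rewrite -sqrtr_sqr ler_wsqrtr// (bigD1 i)//= lerDl.
by apply: sumr_ge0 => j _; exact: sqr_ge0.
Qed.

Lemma enorm0 : enorm (0 : 'rV[R]_n) = 0.
Proof.
by rewrite /enorm big1 ?sqrtr0// => i _; rewrite mxE expr0n.
Qed.

Lemma enorm_eq0 x : (enorm x == 0) = (x == 0).
Proof.
apply/eqP/eqP => [x0|->]; last exact: enorm0.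
apply/rowP => i; apply/eqP; rewrite mxE -normr_eq0 eq_le normr_ge0 andbT.
by rewrite -x0 coord_le_enorm.
Qed.

Lemma enorm_gt0 x : (0 < enorm x) = (x != 0).
Proof. by rewrite lt0r enorm_ge0 andbT enorm_eq0. Qed.

Lemma enormZ s x : enorm (s *: x) = `|s| * enorm x.
Proof.
rewrite /enorm -sqrtr_sqr -sqrtrM ?sqr_ge0//; congr Num.sqrt.
by rewrite mulr_sumr; apply: eq_bigr => i _; rewrite mxE exprMn.
Qed.

Lemma enormN x : enorm (- x) = enorm x.
Proof. by rewrite -scaleN1r enormZ normrN1 mul1r. Qed.

(** Cauchy-Schwarz, by expanding the square of |y| x - |x| y. *)
Lemma dot_le_enorm x y : \sum_(i < n) x ord0 i * y ord0 i <= enorm x * enorm y.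
Proof.
have [x0|x0] := eqVneq x 0.
  by rewrite x0 enorm0 mul0r big1// => i _; rewrite mxE mul0r.
have [y0|y0] := eqVneq y 0.
  by rewrite y0 enorm0 mulr0 big1// => i _; rewrite mxE mulr0.
have A0 : 0 < enorm x by rewrite enorm_gt0.
have B0 : 0 < enorm y by rewrite enorm_gt0.
have : 0 <= \sum_(i < n) (enorm y * x ord0 i - enorm x * y ord0 i) ^+ 2.
  by apply: sumr_ge0 => i _; exact: sqr_ge0.
have -> : \sum_(i < n) (enorm y * x ord0 i - enorm x * y ord0 i) ^+ 2 =
    2 * (enorm x * enorm y) * (enorm x * enorm y -
      \sum_(i < n) x ord0 i * y ord0 i).
  transitivity (enorm y ^+ 2 * \sum_(i < n) x ord0 i ^+ 2 -
     2 * enorm x * enorm y * (\sum_(i < n) x ord0 i * y ord0 i) +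
     enorm x ^+ 2 * \sum_(i < n) y ord0 i ^+ 2).
    rewrite !mulr_sumr -sumrB -big_split/=; apply: eq_bigr => i _; ring.
  rewrite -!sqr_enorm; ring.
by rewrite pmulr_rge0 ?subr_ge0// mulr_gt0// mulr_gt0.
Qed.

Lemma ler_enormD x y : enorm (x + y) <= enorm x + enorm y.
Proof.
rewrite -(@ler_pXn2r _ 2)// ?nnegrE ?addr_ge0 ?enorm_ge0// sqr_enorm.
have -> : \sum_(i < n) (x + y) ord0 i ^+ 2 = enorm x ^+ 2 + enorm y ^+ 2 +
    2 * \sum_(i < n) x ord0 i * y ord0 i.
  rewrite !sqr_enorm mulr_sumr -!big_split/=; apply: eq_bigr => i _.
  rewrite mxE; ring.
have := dot_le_enorm x y; nra.
Qed.

Lemma ler_enormB x y : enorm (x - y) <= enorm x + enorm y.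
Proof. by rewrite -(enormN y) ler_enormD. Qed.

Lemma lerB_enorm x y : enorm x - enorm y <= enorm (x - y).
Proof. by rewrite lerBlDr -{1}(subrK y x) ler_enormD. Qed.

Lemma enorm_le_coord x (r : R) : (forall i, `|x ord0 i| <= r) ->
  enorm x <= n%:R * r.
Proof.
move=> xr.
(* The sign of r is read off from a coordinate, so dimension 0 is treated apart. *)
have [n0|n0] := posnP n.
  rewrite /enorm big1 ?sqrtr0 ?n0 ?mul0r// => i _.
  by have := ltn_ord i; rewrite {2}n0 ltn0.
have r0 : 0 <= r by exact: le_trans (normr_ge0 _) (xr (Ordinal n0)).
have nr0 : 0 <= n%:R * r by rewrite mulr_ge0.
rewrite -(@ler_pXn2r _ 2 _ (enorm x))// ?nnegrE ?enorm_ge0// sqr_enorm.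
apply: (@le_trans _ _ (\sum_(i < n) r ^+ 2)).
  apply: ler_sum => i _.
  by rewrite -real_normK ?num_real// ler_pXn2r ?nnegrE.
rewrite sumr_const card_ord exprMn -[leLHS]mulr_natl; apply: ler_wpM2r.
  exact: sqr_ge0.
by rewrite expr2 ler_peMl// ler1n.
Qed.

End EuclideanNorm.

Section LebesgueMeasure.
Context {R : realType} {n : nat}.
Local Notation V := 'rV[R]_n.
Local Notation E := (Rn R n).
Local Notation mu := (@lebn R n).
Local Open Scope ereal_scope.
Implicit Types (a b x y : V) (A B : set V).

Definition vol (a b : V) : R := (\prod_(i < n) (b ord0 i - a ord0 i))%R.

Lemma vol_ge0 a b : (forall i, a ord0 i <= b ord0 i)%R -> (0 <= vol a b)%R.
Proof. by move=> ab; apply: prodr_ge0 => i _; rewrite subr_ge0. Qed.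

Lemma box_vol_le a b : (forall i, a ord0 i <= b ord0 i)%R ->
  box_vol (box a b) <= (vol a b)%:E.
Proof.
move=> ab; rewrite /box_vol; case: asboolP => _; first by rewrite lee_fin vol_ge0.
by apply: ereal_inf_lbound; exists (a, b).
Qed.

Lemma le_box_vol (c : \bar R) (A : set V) : (A = set0 -> c <= 0) ->
  (forall a b : V, (forall i, a ord0 i <= b ord0 i)%R -> A = box a b ->
     c <= (vol a b)%:E) -> c <= box_vol A.
Proof.
move=> c0 cab; rewrite /box_vol; case: asboolP => //= _.
by apply: le_ereal_inf_tmp => _ [[a b] /= [ab AE] <-]; exact: cab.
Qed.

Lemma lebn_ge0 (A : set V) : 0 <= mu A. Proof. exact: (mu_ext_ge0 (@box_vol_ge0 R n)). Qed.

Lemma le_lebn (A B : set V) : A `<=` B -> mu A <= mu B.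
Proof. exact: (le_outer_measure (@lebesgue_outer R n)). Qed.

Lemma lebn_set0 : mu set0 = 0. Proof. exact: measure0. Qed.

Lemma lebn_le_box_vol (A : set V) : mu A <= box_vol A.
Proof.
apply: ereal_inf_lbound; exists (fun k : nat => if k == 0%N then A else set0).
  by split=> // x Ax; exists 0%N.
rewrite (nneseries_split 0%N 1)//=; last by move=> k _; exact: box_vol_ge0.
rewrite big_nat1 eseries0 ?adde0//.
by move=> [|k]//= _ _; rewrite box_vol0.
Qed.

Lemma lebn_box_le a b : (forall i, a ord0 i <= b ord0 i)%R ->
  mu (box a b) <= (vol a b)%:E.
Proof. by move=> ab; exact: le_trans (lebn_le_box_vol _) (box_vol_le ab). Qed.

Lemma lebn_bigcup_le (F : nat -> set V) : mu (\bigcup_k F k) <= \sum_(k <oo) mu (F k).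
Proof. exact: (outer_measure_sigma_subadditive (@lebesgue_outer R n)). Qed.

Lemma lebn_setU_le (A B : set V) : mu (A `|` B) <= mu A + mu B.
Proof. exact: (outer_measureU2 (@lebesgue_outer R n)). Qed.

(** A box cover of A pulls back to a cover of the preimage, so it is enough to control preimages of
    boxes. Applied to an affine map and to its inverse, the two inequalities give the exact scaling
    factor. *)
Lemma lebn_preimage_le (phi : V -> V) (c : R) : (0 < c)%R ->
  (forall a b : V, (forall i, a ord0 i <= b ord0 i)%R ->
     mu (phi @^-1` (box a b)) <= (c * vol a b)%:E) ->
  forall A, mu (phi @^-1` A) <= c%:E * mu A.
Proof.
move=> c0 hc A; rewrite -lee_pdivrMl//.
apply: le_ereal_inf_tmp => _ [F [_ AF] <-].
rewrite lee_pdivrMl// -nneseriesZl; last first.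
  by move=> k _; exact: box_vol_ge0.
apply: (@le_trans _ _ (mu (\bigcup_k phi @^-1` (F k)))).
  by apply: le_lebn => x /AF[k _ Fk]; exists k.
apply: (le_trans (lebn_bigcup_le _)); apply: lee_nneseries.
  by move=> *; exact: lebn_ge0.
move=> k _; rewrite -lee_pdivrMl//; apply: le_box_vol => [->|a b ab ->].
  by rewrite preimage_set0 lebn_set0 mule0.
by rewrite lee_pdivrMl// -EFinM; exact: hc.
Qed.

Definition setc (x : V) (i : 'I_n) (c : R) : V :=
  \row_j (if j == i then c else x ord0 j).

(** Cutting every box of a cover of X along the hyperplane yields covers of the two halves of X, and
    the volumes of the two pieces of a box add up. This is the Caratheodory condition. *)
Lemma measurable_halfspace (i : 'I_n) (c : R) :
  measurable ([set x : V | x ord0 i < c]%R : set E).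
Proof.
pose H : set V := [set x | x ord0 i < c]%R.
suff : (@lebesgue_outer R n).-caratheodory H by [].
apply: le_caratheodory_measurable => X.
apply: le_ereal_inf_tmp => _ [F [_ XF] <-].
have sub (H' : set V) : mu (X `&` H') <= \sum_(k <oo) box_vol (F k `&` H').
  apply: ereal_inf_lbound; exists (fun k => F k `&` H') => //; split=> //.
  by move=> x [/XF[k _ Fk] Hx]; exists k.
apply: (le_trans (leeD (sub H) (sub (~` H)))).
rewrite -nneseriesD; try by move=> *; exact: box_vol_ge0.
apply: lee_nneseries; first by move=> *; apply: adde_ge0; exact: box_vol_ge0.
move=> k _; apply: le_box_vol => [->|a b ab ->].
  by rewrite !set0I box_vol0 adde0.
(* c clamped to the i-th side of the box, so that both pieces are again boxes, possibly empty. *)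
pose c' := Num.max (a ord0 i) (Num.min c (b ord0 i)).
have ac' : (a ord0 i <= c')%R by rewrite le_max lexx.
have cb' : (c' <= b ord0 i)%R by rewrite ge_max ab ge_min lexx orbT.
have -> : box a b `&` H = box a (setc b i c').
  apply/seteqP; split => x; rewrite /box /H /=.
    move=> [xab xc] j; rewrite mxE; case: eqP => [->|_]; last exact: xab.
    move/andP: (xab i) => [-> xb]/=.
    by rewrite /c' lt_max lt_min xb xc orbT.
  move=> xab; move: (xab i); rewrite mxE eqxx => /andP[ax xc'].
  have xcb : (x ord0 i < c)%R /\ (x ord0 i < b ord0 i)%R.
    by move: xc'; rewrite /c' lt_max ltNge ax/= lt_min => /andP[].
  split; last by case: xcb.
  move=> j; move: (xab j); rewrite mxE; case: eqP => [->|//] _.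
  by rewrite ax; case: xcb.
have -> : box a b `&` ~` H = box (setc a i c') b.
  apply/seteqP; split => x; rewrite /box /H /=.
    move=> [xab /negP]; rewrite -leNgt => cx j; rewrite mxE.
    case: eqP => [->|_]; last exact: xab.
    move/andP: (xab i) => [xa ->]/=; rewrite andbT.
    by rewrite /c' ge_max xa ge_min cx.
  move=> xab; move: (xab i); rewrite mxE eqxx => /andP[c'x xb].
  have [ax cx] : (a ord0 i <= x ord0 i)%R /\ (c <= x ord0 i)%R.
    move: c'x; rewrite /c' ge_max ge_min [(b _ _ <= _)%R]leNgt xb orbF.
    by move/andP.
  split; last by apply/negP; rewrite -leNgt.
  move=> j; move: (xab j); rewrite mxE; case: eqP => [->|//] _.
  by rewrite ax.
apply: (le_trans (leeD (box_vol_le _) (box_vol_le _))).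
- by move=> j; rewrite mxE; case: eqP => [->|].
- by move=> j; rewrite mxE; case: eqP => [->|].
rewrite -EFinD lee_fin /vol (bigD1 i)//= [X in (_ + X)%R](bigD1 i)//=.
rewrite [leRHS](bigD1 i)//= !mxE eqxx.
have -> : (\prod_(j < n | j != i) (setc b i c' ord0 j - a ord0 j) =
   \prod_(j < n | j != i) (b ord0 j - a ord0 j))%R.
  by apply: eq_bigr => j /negPf ji; rewrite mxE ji.
have -> : (\prod_(j < n | j != i) (b ord0 j - setc a i c' ord0 j) =
   \prod_(j < n | j != i) (b ord0 j - a ord0 j))%R.
  by apply: eq_bigr => j /negPf ji; rewrite mxE ji.
by rewrite -mulrDl addrC addrA subrK.
Qed.

Lemma measurable_coord i : measurable_fun setT (fun x : E => (x : V) ord0 i).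
Proof.
apply: (measurability (@RGenInftyO.G R)); first exact: RGenInftyO.measurableE.
move=> _ [_ [c ->] <-]; rewrite setTI.
rewrite (_ : _ @^-1` _ = [set x : V | x ord0 i < c]%R); last first.
  by apply/seteqP; split => x /=; rewrite in_itv.
exact: measurable_halfspace.
Qed.

End LebesgueMeasure.

Section AffineInvariance.
Context {R : realType} {n : nat}.
Local Notation V := 'rV[R]_n.
Local Notation E := (Rn R n).
Local Notation mu := (@lebn R n).
Local Open Scope ereal_scope.
Implicit Types (a b x y : V) (A B : set V).

Lemma lebn_null_bigcup (F : nat -> set V) : (forall k, mu (F k) = 0) ->
  mu (\bigcup_k F k) = 0.
Proof.
move=> F0; apply/eqP; rewrite eq_le lebn_ge0 andbT.
by apply: (le_trans (lebn_bigcup_le _)); rewrite eseries0// => k *; exact: F0.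
Qed.

Lemma lebn_null_exists (I : countType) (F : I -> set V) :
  (forall i, mu (F i) = 0) -> mu [set x | exists i, F i x] = 0.
Proof.
move=> F0.
pose G k : set V := if unpickle k is Some i then F i else set0.
have -> : [set x | exists i, F i x] = \bigcup_k G k.
  apply/seteqP; split => [x [i Fi]|x [k _]].
    by exists (pickle i) => //; rewrite /G pickleK.
  by rewrite /G; case: unpickle => // i Fi; exists i.
apply: lebn_null_bigcup => k; rewrite /G.
by case: unpickle => [i|]; [exact: F0|exact: lebn_set0].
Qed.

Lemma sub_lebn0 A B : A `<=` B -> mu B = 0 -> mu A = 0.
Proof.
by move=> AB B0; apply/eqP; rewrite eq_le lebn_ge0 andbT -B0 le_lebn.
Qed.

Lemma cst_le_coord (x : V) : exists N : nat, forall i, (`|x ord0 i| < N%:R)%R.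
Proof.
exists (Num.trunc (enorm x)).+1 => i.
by apply: (le_lt_trans (coord_le_enorm x i)); rewrite truncnS_gt.
Qed.

Lemma lebn_hyperplane (i : 'I_n) (c : R) : mu [set x | x ord0 i = c] = 0.
Proof.
pose Q (N : nat) : set V := [set x | x ord0 i = c /\ forall j, (`|x ord0 j| < N%:R)%R].
apply: (@sub_lebn0 _ (\bigcup_N Q N)).
  by move=> x xc; have [N xN] := cst_le_coord x; exists N.
apply: lebn_null_bigcup => N.
apply/eqP; rewrite eq_le lebn_ge0 andbT; apply/lee_addgt0Pr => e e0.
rewrite add0e.
pose C : R := (\prod_(j < n | j != i) (N%:R + N%:R))%R.
have C0 : (0 <= C)%R by apply: prodr_ge0 => j _; rewrite addr_ge0.
(* The slab of thickness d inside the cube has volume C d, at most e; the 1 covers C = 0. *)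
pose d := (e / (C + 1))%R.
have d0 : (0 < d)%R by rewrite divr_gt0// ltr_wpDl.
pose a : V := \row_j (if j == i then c else - N%:R)%R.
pose b : V := \row_j (if j == i then c + d else N%:R)%R.
have ab j : (a ord0 j <= b ord0 j)%R.
  by rewrite !mxE; case: eqP => _; rewrite ?lerDl ?(ltW d0)// ge0_cp.
apply: (@le_trans _ _ (vol a b)%:E).
  apply: le_trans (lebn_box_le ab); apply: le_lebn => x [xc xN] j.
  rewrite !mxE; case: eqP => [->|_]; first by rewrite xc lexx ltrDl.
  by have := xN j; rewrite ltr_norml => /andP[/ltW -> ->].
rewrite lee_fin /vol (bigD1 i)//= !mxE eqxx.
have -> : (\prod_(j < n | j != i) (b ord0 j - a ord0 j) = C)%R.
  by apply: eq_bigr => j /negPf ji; rewrite !mxE ji opprK.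
rewrite addrAC subrr add0r /d mulrAC ler_pdivrMr ?ltr_wpDl//.
by rewrite ler_pM2l// lerDl.
Qed.

Definition affine (s : R) (c : V) : V -> V := fun x => (s *: x + c)%R.

Lemma affineK (s : R) (c : V) : (s != 0)%R ->
  cancel (affine s c) (affine s^-1 (- (s^-1 *: c))%R).
Proof. by move=> s0 x; rewrite /affine scalerDr scalerA mulVf// scale1r addrK. Qed.

Lemma affineVK (s : R) (c : V) : (s != 0)%R ->
  cancel (affine s^-1 (- (s^-1 *: c))%R) (affine s c).
Proof.
by move=> s0 x; rewrite /affine scalerBr !scalerA mulfV// !scale1r subrK.
Qed.

Lemma vol_affine (s : R) (c : V) a b :
  vol (s *: (a - c))%R (s *: (b - c))%R = (s ^+ n * vol a b)%R.
Proof.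
transitivity (\prod_(i < n) (s * (b ord0 i - a ord0 i)))%R.
  by apply: eq_bigr => i _; rewrite !mxE; ring.
by rewrite big_split/= prodr_const card_ord.
Qed.

Lemma vol_affineN (s : R) (c : V) a b :
  vol (s *: (b - c))%R (s *: (a - c))%R = ((- s) ^+ n * vol a b)%R.
Proof.
transitivity (\prod_(i < n) ((- s) * (b ord0 i - a ord0 i)))%R.
  by apply: eq_bigr => i _; rewrite !mxE; ring.
by rewrite big_split/= prodr_const card_ord.
Qed.

(** For s < 0 the reflection exchanges closed and open faces, so the preimage of a half-open box is
    a half-open box only up to pieces of finitely many hyperplanes, which are null. *)
Lemma lebn_affine_box_le (s : R) (c : V) a b : (s != 0)%R ->
  (forall i, a ord0 i <= b ord0 i)%R ->
  mu (affine s c @^-1` box a b) <= ((`|s| ^+ n)^-1 * vol a b)%:E.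
Proof.
move=> s0 ab.
have [sp|] := ltP 0%R s.
  have -> : affine s c @^-1` box a b = box (s^-1 *: (a - c))%R (s^-1 *: (b - c))%R.
    apply/seteqP; split => x /= h i; move: (h i);
    by rewrite !mxE ler_pdivrMl// ltr_pdivlMl// lerBlDr ltrBrDr.
  apply: le_trans (lebn_box_le _) _ => [i|].
    by rewrite !mxE ler_pM2l ?invr_gt0// lerD2r.
  by rewrite lee_fin vol_affine gtr0_norm// exprVn.
rewrite le_eqVlt (negPf s0)/= => sn.
pose a' := (s^-1 *: (b - c))%R : V; pose b' := (s^-1 *: (a - c))%R : V.
have ab' i : (a' ord0 i <= b' ord0 i)%R.
  by rewrite !mxE ler_nM2l ?invr_lt0// lerD2r.
apply: (@le_trans _ _ (mu (box a' b' `|` [set x | exists i, x ord0 i = b' ord0 i]))).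
  apply: le_lebn => x /= h.
  have [[i xi]|nx] := pselect (exists i, x ord0 i = b' ord0 i); first by right; exists i.
  left => i; have /andP[h1 h2] := h i; rewrite !mxE in h1 h2.
  have xb : x ord0 i != b' ord0 i by apply/eqP => xi; apply: nx; exists i.
  rewrite lt_neqAle {}xb/= !mxE ler_ndivrMl// ler_ndivlMl//.
  by rewrite lerBrDr lerBlDr h1 (ltW h2).
apply: (le_trans (lebn_setU_le _ _)).
rewrite lebn_null_exists ?adde0; last first.
  by move=> i; exact: lebn_hyperplane.
apply: (le_trans (lebn_box_le ab')).
by rewrite lee_fin vol_affineN ltr0_norm// -invrN exprVn.
Qed.

Lemma lebn_affine (s : R) (c : V) A : (s != 0)%R ->
  mu (affine s c @^-1` A) = ((`|s| ^+ n)^-1)%:E * mu A.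
Proof.
move=> s0.
have le (t : R) d B : (t != 0)%R ->
    mu (affine t d @^-1` B) <= ((`|t| ^+ n)^-1)%:E * mu B.
  move=> t0; apply: lebn_preimage_le.
    by rewrite invr_gt0 exprn_gt0// normr_gt0.
  by move=> *; exact: lebn_affine_box_le.
apply/eqP; rewrite eq_le le//=.
rewrite lee_pdivrMl ?exprn_gt0 ?normr_gt0//.
rewrite -{1}(_ : affine s^-1 (- (s^-1 *: c))%R @^-1` (affine s c @^-1` A) = A).
  by apply: le_trans (le _ _ _ _) _; rewrite ?invr_eq0// normfV exprVn invrK.
by apply/seteqP; split => x; rewrite /= affineVK.
Qed.

(** Every test set is itself a preimage, so the Caratheodory condition for A is transported with a
    common factor. *)
Lemma measurable_affine (s : R) (c : V) : (s != 0)%R ->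
  measurable_fun setT (affine s c : E -> E).
Proof.
move=> s0 _ A mA; rewrite setTI.
suff : (@lebesgue_outer R n).-caratheodory (affine s c @^-1` A) by [].
move=> X; pose Y := affine s^-1 (- (s^-1 *: c))%R @^-1` X.
have XE : X = affine s c @^-1` Y.
  by apply/seteqP; split => x; rewrite /Y /= affineK.
suff : mu (affine s c @^-1` Y) =
    mu (affine s c @^-1` (Y `&` A)) + mu (affine s c @^-1` (Y `&` ~` A)).
  by rewrite XE.
rewrite (lebn_affine c Y s0) (lebn_affine c (Y `&` A) s0).
rewrite (lebn_affine c (Y `&` ~` A) s0).
rewrite -ge0_muleDr ?lebn_ge0//; congr (_ * _).
exact: (mA : (@lebesgue_outer R n).-caratheodory A).
Qed.

Definition cube (N : nat) : set V := [set x | forall i, - N%:R <= x ord0 i < N%:R]%R.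

Lemma cubeE (N : nat) : cube N = box (const_mx (- N%:R)%R) (const_mx N%:R).
Proof.
by apply/seteqP; split => x h i; move: (h i); rewrite !mxE.
Qed.

Lemma lebn_cube_lty (N : nat) : mu (cube N) < +oo.
Proof.
rewrite cubeE; apply: le_lt_trans (lebn_box_le _) _; last exact: ltry.
by move=> i; rewrite !mxE ge0_cp.
Qed.

Lemma bigcup_cube : \bigcup_N cube N = setT.
Proof.
apply/seteqP; split => // x _; have [N xN] := cst_le_coord x; exists N => // i.
by have := xN i; rewrite ltr_norml => /andP[/ltW -> ->].
Qed.

Lemma measurable_box a b : measurable (box a b : set E).
Proof.
have -> : box a b = \bigcap_(i in [set: 'I_n])
    (~` [set x | x ord0 i < a ord0 i]%R `&` [set x | x ord0 i < b ord0 i]%R).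
  apply/seteqP; split => x h i.
    by move=> _; have /andP[h1 h2] := h i; split => //=; apply/negP; rewrite -leNgt.
  by have [/= /negP] := h i I; rewrite -leNgt => -> ->.
apply: fin_bigcap_measurable; first exact: finite_finset.
move=> i _.
apply: measurableI; last exact: measurable_halfspace.
by apply: measurableC; exact: measurable_halfspace.
Qed.

Lemma measurable_cube (N : nat) : measurable (cube N : set E).
Proof. by rewrite cubeE; exact: measurable_box. Qed.

Lemma lebn_sigma_finite : sigma_finite [set: E] mu.
Proof.
exists cube; first by rewrite bigcup_cube.
by move=> N; split; [exact: measurable_cube|exact: lebn_cube_lty].
Qed.

End AffineInvariance.

HB.instance Definition _ (R : realType) (n : nat) :=
  @Measure_isSigmaFinite.Build _ (Rn R n) R (@lebn R n) (@lebn_sigma_finite R n).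

(** Borel measurability of a map into R^n, stated on coordinates. It is what composition with a
    Borel function needs; preimages of arbitrary Caratheodory-measurable sets, such as null sets
    under (x, y) |-> x - y, are not under control on a product. *)
Definition coord_measurable {R : realType} {n : nat} d (T : measurableType d)
  (m : T -> 'rV[R]_n) := forall i, measurable_fun setT (fun p => m p ord0 i).

(** * Borel representatives and Tonelli's theorem *)

Section BorelFunctions.
Context {R : realType} {n : nat}.
Local Notation V := 'rV[R]_n.
Local Notation E := (Rn R n).
Local Notation mu := (@lebn R n).
Local Open Scope ereal_scope.
Implicit Types (a b x y : V) (A B : set V).

Definition boxes : set (set V) := [set A | exists a b, A = box a b].

Definition borel (A : set V) : Prop := (<<s boxes >>) A.

Local Notation borelRn := (g_sigma_algebraType boxes).

Lemma borel0 : borel set0.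
Proof. exact: (@measurable0 _ borelRn). Qed.

Lemma borel_bigcup (F : nat -> set V) : (forall k, borel (F k)) -> borel (\bigcup_k F k).
Proof. by move=> h; exact: (@bigcupT_measurable _ borelRn). Qed.

Lemma borel_bigcap (F : nat -> set V) : (forall k, borel (F k)) -> borel (\bigcap_k F k).
Proof. by move=> h; exact: (@bigcapT_measurable _ borelRn). Qed.

Lemma borelD A B : borel A -> borel B -> borel (A `\` B).
Proof. by move=> *; exact: (@measurableD _ borelRn). Qed.

Lemma borelU A B : borel A -> borel B -> borel (A `|` B).
Proof. by move=> *; exact: (@measurableU _ borelRn). Qed.

Lemma borel_box a b : borel (box a b).
Proof. by apply: sub_sigma_algebra; exists a, b. Qed.

Lemma borel_measurable A : borel A -> measurable (A : set E).
Proof.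
apply: (@smallest_sub _ _ _ (measurable : set (set E))).
  exact: sigma_algebra_measurable.
by move=> _ [a [b ->]]; exact: measurable_box.
Qed.

Lemma borel_hull A : mu A < +oo ->
  exists2 B, borel B & A `<=` B /\ mu B = mu A.
Proof.
move=> Afin.
have Afn : mu A \is a fin_num by rewrite ge0_fin_numE// lebn_ge0.
have h (j : nat) : exists O : set V,
    [/\ borel O, A `<=` O & mu O <= mu A + (j.+1%:R^-1)%:E].
  have [_ [F [_ AF] <-] Flt] := @lb_ereal_inf_adherent R
    [set \sum_(k <oo) box_vol (F k) | F in @measurable_cover _ (allsetsT R n) A]
    j.+1%:R^-1 (ltac:(by [])) Afn.
  exists (\bigcup_k F k); split => //.
    apply: borel_bigcup => k.
    (* In a cover of finite total volume every set is empty or a box, since all other sets have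
       volume +oo. *)
    have : box_vol (F k) < +oo.
      rewrite ltey; apply/eqP => Fk.
      suff : \sum_(k <oo) box_vol (F k) = +oo by move=> E0; rewrite E0 ltNge leey in Flt.
      apply/eqP; rewrite -leye_eq -Fk.
      rewrite (@nneseriesD1 _ _ k)//; last by move=> *; exact: box_vol_ge0.
      by rewrite leeDl//; apply: nneseries_ge0 => *; exact: box_vol_ge0.
    rewrite /box_vol; case: asboolP => [-> _|_]; first exact: borel0.
    move=> /ereal_inf_lt[_ [[a b] /= [_ ->] _] _]; exact: borel_box.
  apply: (le_trans _ (ltW Flt)); apply: (le_trans (lebn_bigcup_le _)).
  apply: lee_nneseries => [*|k _]; first exact: lebn_ge0.
  exact: lebn_le_box_vol.
have [Oj hO] := choice h.
exists (\bigcap_j Oj j); first by apply: borel_bigcap => j; case: (hO j).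
split; first by move=> x Ax j _; case: (hO j) => _ /(_ x Ax).
apply/eqP; rewrite eq_le; apply/andP; split; last first.
  by apply: le_lebn => x Ax j _; case: (hO j) => _ /(_ x Ax).
apply/lee_addgt0Pr => e e0.
have [j je] : exists j : nat, (j.+1%:R^-1 < e)%R.
  exists (Num.trunc e^-1).
  by rewrite invf_plt ?posrE// truncnS_gt.
apply: (@le_trans _ _ (mu (Oj j))); first by apply: le_lebn => x; exact.
by case: (hO j) => _ _ h'; apply: (le_trans h'); rewrite leeD2l// lee_fin ltW.
Qed.

Lemma borel_null_hull A : mu A = 0 -> exists2 N, borel N & A `<=` N /\ mu N = 0.
Proof.
by move=> A0; have [|B bB [AB BE]] := @borel_hull A; [rewrite A0|exists B => //; rewrite BE].
Qed.

(** Each A [&] cube k has finite measure, so its Borel hull exceeds it by a null set; all these null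
    sets lie in one Borel null set N. *)
Lemma borel_approx A : measurable (A : set E) ->
  exists B N, [/\ borel B, borel N, mu N = 0 & A `\` N = B `\` N].
Proof.
move=> mA.
have hk (k : nat) : exists B, [/\ borel B, A `&` cube k `<=` B &
    mu (B `\` (A `&` cube k)) = 0].
  have mAk : measurable (A `&` cube k : set E).
    by apply: measurableI => //; exact: measurable_cube.
  have Ak : mu (A `&` cube k) < +oo.
    by apply: le_lt_trans (lebn_cube_lty (R:=R) (n:=n) k); exact: le_lebn.
  have [B bB [AB BE]] := borel_hull Ak; exists B; split => //.
  have D : mu (B `\` (A `&` cube k)) = mu B - mu (A `&` cube k).
    have := @measureD _ E R mu B (A `&` cube k) (borel_measurable bB) mAk.
    by rewrite (setIidr AB); apply; change (mu B < +oo); rewrite BE.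
  by rewrite D BE subee// ge0_fin_numE// lebn_ge0.
have [B hB] := choice hk.
have [N bN [hN N0]] : exists2 N, borel N &
    (\bigcup_k (B k `\` (A `&` cube k))) `<=` N /\ mu N = 0.
  by apply: borel_null_hull; apply: lebn_null_bigcup => k; case: (hB k).
exists (\bigcup_k B k), N; split => //.
  by apply: borel_bigcup => k; case: (hB k).
apply/seteqP; split => x [h xN]; split => //.
  have : [set: V] x by []. rewrite -(@bigcup_cube R n) => -[k _ xk].
  by exists k => //; case: (hB k) => _ h' _; apply: h'.
case: h => k _ xk; apply: contrapT => nA; apply: xN; apply: hN.
by exists k => //; split => // -[].
Qed.

Lemma borel_exists (I : countType) (F : I -> set V) :
  (forall i, borel (F i)) -> borel [set x | exists i, F i x].
Proof.
move=> bF; pose G k : set V := if unpickle k is Some i then F i else set0.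
have -> : [set x | exists i, F i x] = \bigcup_k G k.
  apply/seteqP; split => [x [i Fi]|x [k _]].
    by exists (pickle i) => //; rewrite /G pickleK.
  by rewrite /G; case: unpickle => // i Fi; exists i.
apply: borel_bigcup => k; rewrite /G.
by case: unpickle => [i|]; [exact: bF|exact: borel0].
Qed.

Definition borel_fun (F : V -> R) := measurable_fun [set: borelRn] (F : borelRn -> R).

(** Only rational levels are asked for, because in [borel_repr] each level costs a null set and
    there may be only countably many. *)
Lemma borel_funP (F : V -> R) :
  (forall q : rat, borel [set x | (F x < ratr q)%R]) -> borel_fun F.
Proof.
move=> h; apply: (measurability (@RGenInftyO.G R)); first exact: RGenInftyO.measurableE.
move=> _ [_ [c ->] <-]; rewrite setTI.
pose G (q : rat) : set V := [set x | (F x < ratr q)%R /\ (ratr q < c)%R].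
rewrite (_ : _ @^-1` _ = [set x | exists q, G q x]).
  apply: borel_exists => q; rewrite /G.
  have [qc|qc] := pselect (ratr q < c)%R.
    rewrite (_ : [set x | _] = [set x | F x < ratr q]%R)//.
    by apply/seteqP; split => x //= [].
  rewrite (_ : [set x | _] = set0); first exact: borel0.
  by apply/seteqP; split => x //= [].
apply/seteqP; split => x /=; rewrite in_itv/=.
  move=> xc; have [q] := rat_in_itvoo xc; rewrite in_itv/= => /andP[h1 h2].
  by exists q.
by move=> [q [/lt_trans]]; exact.
Qed.

Lemma borel_fun_measurable (F : V -> R) : borel_fun F ->
  measurable_fun [set: E] (F : E -> R).
Proof.
move=> mF _ A mA; rewrite setTI; apply: borel_measurable.
by have := mF measurableT A mA; rewrite setTI.
Qed.

Lemma borel_repr (F : V -> R) : measurable_fun [set: E] (F : E -> R) ->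
  exists N, [/\ borel N, mu N = 0 & borel_fun (fun x => if `[< N x >] then 0%R else F x)].
Proof.
move=> mF.
have h (q : rat) : exists BN : set V * set V, [/\ borel BN.1, borel BN.2, mu BN.2 = 0 &
    [set x | (F x < ratr q)%R] `\` BN.2 = BN.1 `\` BN.2].
  have [B [N h]] := @borel_approx [set x | (F x < ratr q)%R] (
    ltac:(have := mF measurableT `]-oo, ratr q[%classic (measurable_itv _);
      rewrite setTI; congr measurable; apply/seteqP; split => x /=; by rewrite in_itv)).
  by exists (B, N).
have [BN hBN] := choice h.
pose NN := [set x | exists q : rat, (BN q).2 x].
have NN0 : mu NN = 0 by apply: lebn_null_exists => q; case: (hBN q).
have [N bN [NNN N0]] := borel_null_hull NN0.
exists N; split => //; apply: borel_funP => q.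
case: (hBN q) => b1 b2 _ E12.
(* The new function is 0 on N, so N belongs to the sublevel set exactly when the level is
   positive. *)
rewrite (_ : [set x | _] = ((BN q).1 `\` N) `|` (if (0 < ratr q :> R)%R then N else set0)).
  apply: borelU; first exact: borelD.
  by case: ifP => _; [exact: bN|exact: borel0].
apply/seteqP; split => x /=.
  case: asboolP => Nx Fx; first by right; move: Fx => ->.
  left; split => //.
  have nx : ~ (BN q).2 x by move=> h'; apply: Nx; apply: NNN; exists q.
  by have [] : ((BN q).1 `\` (BN q).2) x by rewrite -E12.
case => [[Bx Nx]|]; last first.
  by case: ifP => // q0 Nx; case: asboolP.
case: asboolP => // _.
have nx : ~ (BN q).2 x by move=> h'; apply: Nx; apply: NNN; exists q.
by have [] : ([set x | (F x < ratr q)%R] `\` (BN q).2) x by rewrite E12.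
Qed.

Lemma borel_fun_comp d (T : measurableType d) (K : V -> R) (m : T -> V) :
  borel_fun K -> coord_measurable m ->
  measurable_fun setT (fun p => K (m p)).
Proof.
move=> mK mm.
have mm' : measurable_fun [set: T] (m : T -> borelRn).
  apply: (@measurability _ _ T borelRn setT m boxes) => // _ [_ [a [b ->]] <-].
  rewrite setTI.
  have -> : m @^-1` (box a b) = \bigcap_(i in [set: 'I_n])
      ((fun p => m p ord0 i) @^-1` `[a ord0 i, b ord0 i[%classic).
    apply/seteqP; split => p /= h i; first by move=> _; rewrite /= in_itv; exact: h.
    by have := h i I; rewrite /= in_itv.
  apply: fin_bigcap_measurable; first exact: finite_finset.
  by move=> i _; rewrite -[X in measurable X]setTI; exact: mm.
exact: (measurableT_comp mK mm').
Qed.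

Lemma measurable_enorm d (T : measurableType d) (m : T -> V) :
  coord_measurable m -> measurable_fun setT (fun p => enorm (m p)).
Proof.
move=> mm; rewrite /enorm.
apply: (@measurableT_comp _ _ _ _ _ _ (@Num.sqrt R)).
  apply: continuous_measurable_fun; exact: sqrt_continuous.
by apply: measurable_sum => i; exact: measurable_funX.
Qed.

End BorelFunctions.

(** * Change of variables, Tonelli's theorem and monotonicity of integrals *)

Section Integrals.
Context {R : realType} {n : nat}.
Local Notation V := 'rV[R]_n.
Local Notation E := (Rn R n).
Local Notation mu := (@lebn R n).
Local Open Scope ereal_scope.

Lemma ge0_integral_affine (s : R) (c : V) (D : set E) (F : E -> \bar R) :
  (s != 0)%R -> measurable D -> measurable_fun D F ->
  (forall x, 0 <= F x) ->
  \int[mu]_(x in (affine s c : E -> E) @^-1` D) F (affine s c x) =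
    ((`|s| ^+ n)^-1)%:E * \int[mu]_(x in D) F x.
Proof.
move=> s0 mD mF F0.
have ms := measurable_affine c s0.
rewrite -(@ge0_integral_pushforward _ _ E E R _ ms mu D F)//.
have c0 : (0 <= (`|s| ^+ n)^-1)%R by rewrite invr_ge0 exprn_ge0.
rewrite (eq_measure_integral (mscale (NngNum c0) mu)); last first.
  move=> A mA _; rewrite /mscale/=; exact: (lebn_affine c A s0).
by rewrite ge0_integral_mscale.
Qed.

Lemma tonelli (A B : set E) (F : E * E -> \bar R) :
  measurable A -> measurable B ->
  measurable_fun setT F -> (forall p, 0 <= F p) ->
  \int[mu]_(x in A) \int[mu]_(y in B) F (x, y) =
  \int[mu]_(y in B) \int[mu]_(x in A) F (x, y).
Proof.
move=> mA mB mF F0.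
pose G (p : E * E) := F p * ((\1_(A `*` B) p)%:E).
have mG : measurable_fun setT G.
  apply: emeasurable_funM => //; apply/measurable_EFinP; apply: measurable_indic.
  exact: measurableX.
have G0 p : 0 <= G p by rewrite mule_ge0.
transitivity (\int[mu]_x \int[mu]_y G (x, y)).
  rewrite integral_mkcond; apply: eq_integral => x _; rewrite patchE.
  case: ifPn => xA.
    rewrite integral_mkcond; apply: eq_integral => y _; rewrite patchE /G indicE in_setX xA.
    by case: ifPn => _; rewrite ?mule1 ?mule0.
  by rewrite integral0_eq// => y _; rewrite /G indicE in_setX (negPf xA) mule0.
transitivity (\int[mu]_y \int[mu]_x G (x, y)).
  exact: fubini_tonelli.
symmetry; rewrite integral_mkcond; apply: eq_integral => y _; rewrite patchE.
case: ifPn => yB.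
  rewrite integral_mkcond; apply: eq_integral => x _; rewrite patchE /G indicE in_setX yB andbT.
  by case: ifPn => _; rewrite ?mule1 ?mule0.
by rewrite integral0_eq// => x _; rewrite /G indicE in_setX (negPf yB) andbF mule0.
Qed.

(* No measurability is needed: for nonnegative functions the integral is a
   supremum over the simple functions below. *)
Lemma ge0_le_lower_integral d (T : measurableType d) (m : {measure set T -> \bar R})
   (D : set T) (f g : T -> \bar R) :
  (forall x, D x -> 0 <= f x) -> (forall x, D x -> f x <= g x) ->
  \int[m]_(x in D) f x <= \int[m]_(x in D) g x.
Proof.
move=> f0 fg.
have g0 x : D x -> 0 <= g x by move=> Dx; exact: le_trans (f0 _ Dx) (fg _ Dx).
rewrite [leLHS]integral_mkcond [leRHS]integral_mkcond !ge0_integralTE//; try by move=> x; apply: erestrict_ge0.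
rewrite /=; apply: ereal_sup_le => /= _ [h hf <-]; exists h => // x.
apply: le_trans (hf x) _; rewrite !patchE; case: ifPn => //; rewrite inE; exact: fg.
Qed.

Lemma ge0_subset_lower_integral d (T : measurableType d) (m : {measure set T -> \bar R})
   (A B : set T) (f : T -> \bar R) :
  (forall x, 0 <= f x) -> A `<=` B ->
  \int[m]_(x in A) f x <= \int[m]_(x in B) f x.
Proof.
move=> f0 AB; rewrite [leLHS]integral_mkcond [leRHS]integral_mkcond.
apply: ge0_le_lower_integral => x _; first by rewrite patchE; case: ifP.
rewrite !patchE; case: ifPn => xA; last by case: ifP.
by rewrite mem_set//; apply: AB; rewrite inE in xA.
Qed.

Lemma lebn_integralZl (D : set E) (f : E -> \bar R) (k : R) :
  measurable D -> measurable_fun setT f -> (forall x, 0 <= f x) -> (0 <= k)%R ->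
  \int[mu]_(x in D) (k%:E * f x) = k%:E * \int[mu]_(x in D) f x.
Proof.
move=> mD mf f0 k0; apply: ge0_integralZl_EFin => //.
exact: measurable_funTS.
Qed.

Lemma lebn_integralD (D : set E) (f g : E -> \bar R) : measurable D ->
  measurable_fun setT f -> measurable_fun setT g ->
  (forall x, 0 <= f x) -> (forall x, 0 <= g x) ->
  \int[mu]_(x in D) (f x + g x) = \int[mu]_(x in D) f x + \int[mu]_(x in D) g x.
Proof.
move=> mD mf mg f0 g0.
have mf' : measurable_fun D f by exact: measurable_funTS.
have mg' : measurable_fun D g by exact: measurable_funTS.
exact: (ge0_integralD mu mD (fun x _ => f0 x) mf' (fun x _ => g0 x) mg').
Qed.

Lemma tonelli_measurable (B : set E) (F : E * E -> \bar R) :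
  measurable B -> measurable_fun setT F -> (forall p, 0 <= F p) ->
  measurable_fun setT (fun x : E => \int[mu]_(y in B) F (x, y)).
Proof.
move=> mB mF F0.
pose G (p : E * E) := F p * ((\1_([set: E] `*` B) p)%:E).
have mG : measurable_fun setT G.
  apply: emeasurable_funM => //; apply/measurable_EFinP; apply: measurable_indic.
  exact: measurableX.
have G0 p : 0 <= G p by rewrite mule_ge0.
have := @measurable_fun_fubini_tonelli_F _ _ E E R (@lebn R n) G mG G0.
rewrite (_ : fubini_F _ _ = (fun x : E => \int[mu]_(y in B) F (x, y))); first exact.
apply/funext => x; rewrite /fubini_F [RHS]integral_mkcond.
apply: eq_integral => y _; rewrite patchE /G indicE in_setX in_setT/=.
by case: ifPn => _; rewrite ?mule1 ?mule0.
Qed.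

End Integrals.

Section CoordMeasurable.
Context {R : realType} {n : nat} d (T : measurableType d).
Local Notation V := 'rV[R]_n.
Local Notation E := (Rn R n).
Implicit Types (m : T -> V).

Lemma coordm_id : coord_measurable (fun x : E => x : V).
Proof. by move=> i; exact: measurable_coord. Qed.

Lemma coordm_fst_id : coord_measurable (fun p : E * T => p.1 : V).
Proof. by move=> i; exact: (measurableT_comp (measurable_coord i) measurable_fst). Qed.

Lemma coordm_snd_id : coord_measurable (fun p : T * E => p.2 : V).
Proof. by move=> i; exact: (measurableT_comp (measurable_coord i) measurable_snd). Qed.

Lemma coordm_cst (c : V) : coord_measurable (fun _ : T => c).
Proof. by move=> i; exact: measurable_cst. Qed.

Lemma coordmB m1 m2 : coord_measurable m1 -> coord_measurable m2 ->
  coord_measurable (fun p => m1 p - m2 p).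
Proof.
move=> h1 h2 i; under eq_fun do rewrite !mxE.
exact: measurable_funB.
Qed.

Lemma coordmZ (f : T -> R) m : measurable_fun setT f -> coord_measurable m ->
  coord_measurable (fun p => f p *: m p).
Proof.
move=> hf h i; under eq_fun do rewrite !mxE.
exact: measurable_funM.
Qed.

Lemma measurable_set_bool (b : T -> bool) : measurable_fun setT b ->
  measurable [set x | b x].
Proof.
move=> mb; have := mb measurableT [set true] I; rewrite setTI.
by congr measurable; apply/seteqP; split => x /=.
Qed.

Lemma measurable_set_lt (f g : T -> R) : measurable_fun setT f ->
  measurable_fun setT g -> measurable [set x | f x < g x].
Proof. by move=> *; apply: measurable_set_bool; exact: measurable_fun_ltr. Qed.

Lemma measurable_set_le (f g : T -> R) : measurable_fun setT f ->
  measurable_fun setT g -> measurable [set x | f x <= g x].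
Proof. by move=> *; apply: measurable_set_bool; exact: measurable_fun_ler. Qed.

Lemma measurable_natr (b : T -> bool) : measurable_fun setT b ->
  measurable_fun setT (fun x => (b x)%:R : R).
Proof.
move=> mb; rewrite (_ : (fun _ => _) = \1_[set x | b x]).
  by apply: measurable_indic; exact: measurable_set_bool.
by apply/funext => x; rewrite indicE; congr (nat_of_bool _)%:R; apply/idP/idP; rewrite inE.
Qed.

(** The inverse is discontinuous at 0; on each sign it is a real power, for which measurability is
    known. *)
Lemma measurable_inv (f : T -> R) : measurable_fun setT f ->
  measurable_fun setT (fun x => (f x)^-1).
Proof.
move=> mf; rewrite (_ : (fun _ => _) = fun x => (0 <= f x)%R%:R * powR (f x) (- 1) -
   (f x < 0)%R%:R * powR (- f x) (- 1)); last first.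
  apply/funext => x; have [f0|f0] := leP 0 (f x).
    by rewrite powR_inv1// mul1r mul0r subr0.
  by rewrite /= mul0r sub0r mul1r powR_inv1 ?oppr_ge0 ?(ltW f0)// invrN opprK.
apply: measurable_funB; apply: measurable_funM.
- by apply: measurable_natr; exact: measurable_fun_ler.
- by apply: (measurableT_comp (measurable_powR _)).
- by apply: measurable_natr; exact: measurable_fun_ltr.
- by apply: (measurableT_comp (measurable_powR _)); exact: measurable_funN.
Qed.

End CoordMeasurable.

(** * Balls, shells and polar coordinates *)

Section Balls.
Context {R : realType} {n : nat}.
Local Notation V := 'rV[R]_n.
Local Notation E := (Rn R n).
Local Notation mu := (@lebn R n).
Local Open Scope ereal_scope.

Lemma measurable_enorm_id : measurable_fun setT (fun x : E => enorm x).
Proof. exact: (measurable_enorm coordm_id). Qed.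

Definition cball (r : R) : set E := [set x : E | enorm x <= r]%R.
Definition shell (r s : R) : set E := [set x : E | r < enorm x <= s]%R.
Definition outside (r : R) : set E := [set x : E | r < enorm x]%R.

Lemma measurable_cball r : measurable (cball r).
Proof. exact: (measurable_set_le measurable_enorm_id (measurable_cst _)). Qed.

Lemma measurable_outside r : measurable (outside r).
Proof. exact: (measurable_set_lt (measurable_cst _) measurable_enorm_id). Qed.

Lemma measurable_shell r s : measurable (shell r s).
Proof.
rewrite (_ : shell r s = outside r `&` cball s).
  by apply: measurableI; [exact: measurable_outside|exact: measurable_cball].
by apply/seteqP; split => x /= => [/andP[]|[]] // ? ?; apply/andP.
Qed.

Definition vB : R := fine (mu (cball 1)).

Lemma cball_sub_cube (r : R) (N : nat) : (r < N%:R)%R -> cball r `<=` cube N.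
Proof.
move=> rN x xr i; have := le_lt_trans (le_trans (coord_le_enorm x i) xr) rN.
by rewrite ltr_norml => /andP[/ltW -> ->].
Qed.

Lemma lebn_cball_lty (r : R) : mu (cball r) < +oo.
Proof.
apply: le_lt_trans (lebn_cube_lty (R := R) (n := n) (Num.trunc r).+1).
by apply: le_lebn; apply: cball_sub_cube; rewrite truncnS_gt.
Qed.

Lemma vB_ge0 : (0 <= vB)%R.
Proof. by rewrite fine_ge0// lebn_ge0. Qed.

Lemma vBE : mu (cball 1) = vB%:E.
Proof. by rewrite fineK// ge0_fin_numE ?lebn_ge0// lebn_cball_lty. Qed.

Lemma lebn_cball (r : R) : (0 < r)%R -> mu (cball r) = (r ^+ n * vB)%:E.
Proof.
move=> r0; have -> : cball r = affine r^-1 0%R @^-1` (cball 1).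
  apply/seteqP; split => x; rewrite /cball /affine /= addr0 enormZ gtr0_norm ?invr_gt0//;
  by rewrite ler_pdivrMl// mulr1.
rewrite lebn_affine ?invr_eq0 ?gt_eqF// vBE -EFinM gtr0_norm ?invr_gt0//.
by rewrite exprVn invrK.
Qed.

Lemma lebn_shell (r s : R) : (0 < r)%R -> (r <= s)%R ->
  mu (shell r s) = ((s ^+ n - r ^+ n) * vB)%:E.
Proof.
move=> r0 rs.
have D : mu (cball s) = mu (shell r s) + mu (cball r).
  rewrite -measureU//; first last.
  - by apply/seteqP; split => // x [] /andP[h1 h2] /(lt_le_trans h1); rewrite ltxx.
  - exact: measurable_cball.
  - exact: measurable_shell.
  congr (mu _); apply/seteqP; split => x; rewrite /cball /shell /=.
    by move=> xs; case: (leP (enorm x) r) => xr; [right|left].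
  by case=> [/andP[]//|xr]; exact: le_trans xr rs.
move: D; rewrite !lebn_cball// ?(lt_le_trans r0 rs)// => D.
by rewrite mulrBl EFinB D addeK.
Qed.

(** Allows division by [vB] without a proof that it is positive: in the other case every measure
    vanishes. *)
Lemma lebn_null_of_vB : vB = 0%R -> forall A : set V, mu A = 0.
Proof.
move=> v0 A; apply: (@sub_lebn0 _ _ _ (\bigcup_k cball k.+1%:R)).
  move=> x _; exists (Num.trunc (enorm x)) => //.
  by rewrite /cball /= ltW// truncnS_gt.
by apply: lebn_null_bigcup => k; rewrite lebn_cball// v0 mulr0.
Qed.

End Balls.

Section Polar.
Context {R : realType} {n : nat}.
Local Notation V := 'rV[R]_n.
Local Notation E := (Rn R n).
Local Notation mu := (@lebn R n).
Local Open Scope ereal_scope.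

(* Tonelli replaces polar coordinates: the spheres of radius [u] in the
   hypothesis are parametrized by [u = |z|], and [z] is rescaled by [|x|]. *)
Lemma shell_integral_le (F : V -> R) (r : R) (W : \bar R) :
  (0 < n)%N -> (0 < r)%R -> borel_fun F -> (forall x, 0 <= F x)%R -> 0 <= W ->
  (forall u, (r <= u <= 4 * r)%R ->
     \int[mu]_(x in shell 0 1) (F ((u / enorm x) *: x)%R)%:E <= W) ->
  \int[mu]_(w in shell (3 / 2 * r) (2 * r)) (F w)%:E <= ((24 * r) ^+ n)%:E * W.
Proof.
move=> n0 r0 bF F0 W0 hF; set J := (X in X <= _).
have J0 : 0 <= J by apply: integral_ge0 => w _; rewrite lee_fin.
have [v0|vn0] := eqVneq (vB (R := R) (n := n)) 0%R.
  rewrite /J (eq_measure_integral mzero); last first.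
    by move=> D _ _; exact: (lebn_null_of_vB v0).
  by rewrite integral_measure_zero mule_ge0// lee_fin exprn_ge0 ?mulr_ge0 ?ltW.
have v0 : (0 < vB (R := R) (n := n))%R by rewrite lt_neqAle eq_sym vn0 vB_ge0.
pose S : set E := shell (1/2) 1.
pose A : set E := [set z : E | r <= enorm z <= 4 * r]%R.
pose A' : set E := shell (2 * r) (3 * r).
have mS : measurable S by exact: measurable_shell.
have mA' : measurable A' by exact: measurable_shell.
have mA : measurable A.
  rewrite (_ : A = [set z : E | r <= enorm z]%R `&` cball (4 * r)).
    apply: measurableI; last exact: measurable_cball.
    exact: (measurable_set_le (measurable_cst _) measurable_enorm_id).
  by apply/seteqP; split => x /= => [/andP[]|[]] // ? ?; apply/andP.
have men1 : measurable_fun setT (fun p : E * E => enorm p.1).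
  by apply: measurable_enorm; exact: coordm_fst_id.
have men2 : measurable_fun setT (fun p : E * E => enorm p.2).
  by apply: measurable_enorm; exact: coordm_snd_id.
have mG : measurable_fun setT (fun p : E * E =>
    (F ((enorm p.1 / enorm p.2) *: (p.2 : V))%R)%:E).
  apply/measurable_EFinP; apply: (borel_fun_comp bF).
  apply: coordmZ; last by exact: coordm_snd_id.
  exact: (measurable_funM men1 (measurable_inv men2)).
have mG' : measurable_fun setT (fun p : E * E => (F (enorm p.2 *: (p.1 : V))%R)%:E).
  apply/measurable_EFinP; apply: (borel_fun_comp bF).
  by apply: coordmZ => //; by exact: coordm_fst_id.
have mFs (c : E) : measurable_fun setT (fun z : E => (F (enorm z *: (c : V)))%:E).
  apply/measurable_EFinP; apply: (borel_fun_comp bF).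
  by apply: coordmZ; [exact: measurable_enorm_id|exact: coordm_cst].
(* For fixed z the inner integral is the hypothesis at u = |z|; the remaining factor is the volume
   of the ball of radius 4 r. *)
have up : \int[mu]_(z in A) \int[mu]_(x in S) (F ((enorm z / enorm x) *: (x : V))%R)%:E
    <= W * ((4 * r) ^+ n * vB (R := R) (n := n))%:E.
  apply: (@le_trans _ _ (\int[mu]_(z in A) cst W z)).
    apply: ge0_le_lower_integral => z zA.
      by apply: integral_ge0 => x _; rewrite lee_fin.
    apply: le_trans (hF (enorm z) zA).
    apply: ge0_subset_lower_integral => [x|]; first by rewrite lee_fin.
    by move=> x /= /andP[h1 h2]; apply/andP; split => //; apply: lt_trans h1; rewrite divr_gt0.
  rewrite integral_cst//; apply: lee_wpmul2l => //.
  rewrite -lebn_cball ?mulr_gt0//; apply: le_lebn => z zA.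
  by have /andP[] := zA.
(* For x in S put z = |x| z'; the argument of F becomes |z'| x, and z' may be restricted to A'. For
   fixed z' in A' put w = |z'| x: since 2 r < |z'| <= 3 r, the image of S contains the shell between
   3 r / 2 and 2 r. *)
have low : ((2%:R ^+ n)^-1)%R%:E * ((((3 * r) ^+ n)^-1)%R%:E * J * mu A') <=
    \int[mu]_(z in A) \int[mu]_(x in S) (F ((enorm z / enorm x) *: (x : V))%R)%:E.
  rewrite (tonelli mA mS mG) => [|p]; last by rewrite lee_fin.
  apply: (@le_trans _ _ (((2%:R ^+ n)^-1)%R%:E *
     \int[mu]_(x in S) \int[mu]_(z in A') (F (enorm z *: (x : V)))%:E)).
    apply: lee_wpmul2l; first by rewrite lee_fin invr_ge0 exprn_ge0.
    rewrite (tonelli mS mA' mG') => [|p]; last by rewrite lee_fin.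
    rewrite -integral_cst//.
    apply: ge0_le_lower_integral => z zA'.
      by rewrite mule_ge0// lee_fin invr_ge0 exprn_ge0// mulr_ge0// ltW.
    have z0 : (0 < enorm z)%R.
      by case/andP: zA' => h _; apply: lt_trans h; rewrite mulr_gt0.
    have := @ge0_integral_affine R n (enorm z) 0%R
       ((affine (enorm z)^-1 0%R : E -> E) @^-1` S) (fun x => (F x)%:E).
    set S' := _ @^-1` S => h.
    have mS' : measurable S'.
      rewrite -[X in measurable X]setTI.
      by apply: measurable_affine; rewrite ?invr_eq0 ?gt_eqF.
    have SE : (affine (enorm z) 0%R : E -> E) @^-1` S' = S.
      apply/seteqP; split => x; rewrite /S' /affine /= !addr0 scalerA mulVf ?gt_eqF// scale1r//.
    move: h; rewrite SE => h.
    have -> : \int[mu]_(x in S) (F (enorm z *: (x : V)))%:E =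
       ((`|enorm z| ^+ n)^-1)%:E * \int[mu]_(x in S') (F x)%:E.
      rewrite -h.
      - by apply: eq_integral => x _; rewrite /affine addr0.
      - by rewrite gt_eqF.
      - exact: mS'.
      - apply: measurable_funTS.
        by apply/measurable_EFinP; exact: borel_fun_measurable.
      - by move=> x; rewrite lee_fin.
    apply: lee_pmul => //.
    + by rewrite lee_fin invr_ge0 exprn_ge0// mulr_ge0// ltW.
    + rewrite lee_fin lef_pV2 ?posrE ?exprn_gt0 ?normr_gt0 ?gt_eqF ?mulr_gt0//.
      rewrite lerXn2r ?nnegrE ?mulr_ge0 ?(ltW r0)//.
      by rewrite gtr0_norm//; case/andP: zA'.
    + apply: ge0_subset_lower_integral => [x|]; first by rewrite lee_fin.
      move=> w /= /andP[h1 h2]; rewrite /S' /affine /S /shell /= addr0 enormZ.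
        case/andP: zA' => k1 k2.
        rewrite gtr0_norm ?invr_gt0// ltr_pdivlMl// ler_pdivrMl//.
        apply/andP; split; lra.
  have G'0 (p : E * E) : 0 <= (F (enorm p.2 *: (p.1 : V))%R)%:E by rewrite lee_fin.
  have I0 (x : E) : 0 <= \int[mu]_(z in A') (F (enorm z *: (x : V))%R)%:E.
    by apply: integral_ge0 => z _; rewrite lee_fin.
  have k0 : (0 <= (2%:R ^+ n)^-1 :> R)%R by rewrite invr_ge0 exprn_ge0.
  rewrite -(lebn_integralZl mS (tonelli_measurable mA' mG' G'0) I0 k0).
  apply: ge0_le_lower_integral => x xS.
    rewrite mule_ge0 ?lee_fin ?invr_ge0 ?exprn_ge0//.
    by apply: integral_ge0 => z _; rewrite lee_fin.
  have x0 : (0 < enorm x)%R.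
    by case/andP: xS => h _; apply: lt_trans h; rewrite divr_gt0.
  have := @ge0_integral_affine R n (enorm x) 0%R A
     (fun z => (F ((enorm z / enorm x) *: (x : V)))%:E).
  set A2 := _ @^-1` A => h.
  have -> : \int[mu]_(z in A) (F ((enorm z / enorm x) *: (x : V)))%:E =
     (enorm x ^+ n)%:E * \int[mu]_(z in A2) (F (enorm z *: (x : V)))%:E.
    rewrite (_ : \int[mu]_(z in A2) _ = ((`|enorm x| ^+ n)^-1)%:E *
      \int[mu]_(z in A) (F ((enorm z / enorm x) *: (x : V)))%:E).
      by rewrite muleA -EFinM gtr0_norm// mulfV ?mul1e// expf_neq0// gt_eqF.
    rewrite -h ?gt_eqF//.
    - apply: eq_integral => z _; congr (F _)%:E; rewrite /affine addr0 enormZ gtr0_norm//.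
      by rewrite mulrC mulKf// gt_eqF.
    - apply: measurable_funTS.
      apply/measurable_EFinP; apply: (borel_fun_comp bF).
      apply: coordmZ; last exact: coordm_cst.
      exact: (measurable_funM measurable_enorm_id (measurable_cst _)).
    - by move=> z; rewrite lee_fin.
  apply: lee_pmul => //.
  - by apply: integral_ge0 => z _; rewrite lee_fin.
  - rewrite lee_fin -exprVn; apply: lerXn2r; rewrite ?nnegrE ?invr_ge0 ?enorm_ge0//.
    by case/andP: xS => + _; rewrite div1r; exact: ltW.
  - apply: ge0_subset_lower_integral => [z|]; first by rewrite lee_fin.
    move=> z /= /andP[h1 h2]; rewrite /A2 /A /affine /= addr0 enormZ gtr0_norm//.
      by case/andP: xS => h3 h4; apply/andP; split; nra.
have := le_trans low up.
rewrite /A' lebn_shell ?mulr_gt0//; last by rewrite ler_pM2r// ler_nat.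
rewrite (_ : ((2%:R ^+ n)^-1)%R%:E * _ =
  ((2%:R ^+ n)^-1 * ((3 * r) ^+ n)^-1 * (((3 * r) ^+ n - (2 * r) ^+ n) * vB (R:=R)(n:=n)))%:E * J);
  last by rewrite !EFinM (muleAC _ J) !muleA.
rewrite -lee_pdivlMl; last first.
  rewrite !mulr_gt0 ?invr_gt0 ?exprn_gt0 ?mulr_gt0//.
  by rewrite subr_gt0 ltrXn2r ?gtn_eqF// ?mulr_ge0 ?ltW// ?ltr_pM2r// ?ltr_nat.
move/le_trans; apply.
rewrite (muleC W) muleA -EFinM; apply: lee_wpmul2r => //; rewrite lee_fin.
rewrite ler_pdivrMl; last first.
  rewrite !mulr_gt0 ?invr_gt0 ?exprn_gt0 ?mulr_gt0//.
  by rewrite subr_gt0 ltrXn2r ?gtn_eqF// ?mulr_ge0 ?ltW// ?ltr_pM2r// ?ltr_nat.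
(* In 24 = 4 * 2 * 3 the 4 is the radius of the ball in [up], the 2 comes from |x| > 1/2 and the 3
   from |z'| <= 3 r. The measure of A' is (3^n - 2^n) r^n vB, and n > 0 makes the bracket at least
   1; vB cancels. *)
have h32 : (1 <= 3 ^+ n - 2 ^+ n :> R)%R.
  rewrite -!natrX -natrB ?leq_exp2r// ler1n subn_gt0 ltn_exp2r//.
rewrite -!exprVn !exprMn !exprVn.
have -> : (24%:R : R) = (4 * 2 * 3)%R by rewrite -!natrM.
rewrite !exprMn.
have r1 : (0 < r ^+ n)%R by rewrite exprn_gt0.
have p2 : (0 < 2 ^+ n :> R)%R by rewrite exprn_gt0.
have p3 : (0 < 3 ^+ n :> R)%R by rewrite exprn_gt0.
have p4 : (0 < 4 ^+ n :> R)%R by rewrite exprn_gt0.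
rewrite (_ : (_ * (4 ^+ n * 2 ^+ n * 3 ^+ n * r ^+ n))%R =
  (4 ^+ n * r ^+ n * vB (R:=R)(n:=n) * (3 ^+ n - 2 ^+ n))%R); last first.
  by field; rewrite !gt_eqF.
by rewrite ler_peMr// !mulr_ge0 ?ltW.
Qed.

End Polar.

(** * The kernel: size, smoothness and cancellation *)

Section DiniSums.
Context {R : realType}.
Local Open Scope ereal_scope.

Lemma nondecreasing_emeasurable (f : R -> \bar R) :
  (forall s t, (s <= t)%R -> f s <= f t) -> measurable_fun setT f.
Proof.
move=> ndf; apply: (measurability (@ErealGenInftyO.G R)).
  exact: ErealGenInftyO.measurableE.
move=> _ [_ [r ->] <-]; rewrite setTI; apply: is_interval_measurable.
move=> s t /=; rewrite !in_itv/= => fs ft u /andP[su ut].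
by rewrite in_itv/=; apply: le_lt_trans ft; exact: ndf.
Qed.

Definition dyad (a : R) (k : nat) : set R := `](a ^+ k.+1)%R, (a ^+ k)%R]%classic.

(** Integral test on a geometric scale: w is nondecreasing, and dt / t gives each interval of [dyad]
    mass at least 1 - a. *)
Lemma dini_sum_lty (w : R -> \bar R) (a : R) : (0 < a < 1)%R ->
  (forall t, 0 <= w t) -> (forall s t, (s <= t)%R -> w s <= w t) ->
  \int[lebesgue_measure]_(t in `]0%R, 1%R]) (w t * (t^-1)%:E) < +oo ->
  \sum_(k <oo) w (a ^+ k.+1)%R < +oo.
Proof.
move=> /andP[a0 a1] w0 ndw; set g := (fun t => w t * _) => gfin.
have ak k : (0 < a ^+ k)%R by rewrite exprn_gt0.
have sub : \bigcup_k dyad a k `<=` `]0%R, 1%R]%classic.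
  move=> t [k _]; rewrite /dyad /= !in_itv/= => /andP[h1 h2].
  by rewrite (lt_trans _ h1)//= (le_trans h2)// exprn_ile1// ltW.
have mg : measurable_fun setT g.
  apply: emeasurable_funM; first exact: nondecreasing_emeasurable.
  by apply/measurable_EFinP; exact: measurable_inv.
have g0 t : (0 < t)%R -> 0 <= g t by move=> t0; rewrite mule_ge0// lee_fin invr_ge0 ltW.
have tI : trivIset setT (dyad a).
  have key (i j : nat) t : (i < j)%N -> dyad a i t -> dyad a j t -> False.
    move=> ij; rewrite /dyad /= !in_itv/= => /andP[h1 _] /andP[_ h2].
    have := lt_le_trans h1 h2; apply/negP; rewrite -leNgt.
    by rewrite ler_wiXn2l// ltW.
  by apply/trivIsetP => i j _ _ ij; apply/seteqP; split => t // [ti tj];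
    have [h|h|h] := ltngtP i j; [exact: (key i j t)|exact: (key j i t)|rewrite h eqxx in ij].
have : \sum_(k <oo) \int[lebesgue_measure]_(t in dyad a k) g t < +oo.
  rewrite -ge0_integral_bigcup//.
  - apply: le_lt_trans gfin; apply: ge0_subset_integral => //.
    + by apply: bigcupT_measurable => k; exact: measurable_itv.
    + exact: measurable_funTS.
    + by move=> t; rewrite /= in_itv/= => /andP[t0 _]; exact: g0.
  - by move=> k; exact: measurable_itv.
  - exact: measurable_funTS.
  - by move=> t /sub; rewrite /= in_itv/= => /andP[t0 _]; exact: g0.
have c0 : (0 < 1 - a)%R by rewrite subr_gt0.
have low k : (1 - a)%:E * w (a ^+ k.+1)%R <= \int[lebesgue_measure]_(t in dyad a k) g t.
  have -> : (1 - a)%:E * w (a ^+ k.+1)%R =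
     \int[lebesgue_measure]_(t in dyad a k) (cst (w (a ^+ k.+1)%R * ((a ^+ k)^-1)%:E) t).
    rewrite integral_cst; last exact: measurable_itv.
    transitivity (w (a ^+ k.+1)%R * ((a ^+ k)^-1)%:E * (a ^+ k - a ^+ k.+1)%:E);
      last first.
      congr (_ * _); symmetry; have := @lebesgue_measure_itv R `](a ^+ k.+1)%R, (a ^+ k)%R].
      by rewrite /= lte_fin exprS gtr_pMl// a1 -EFinB => <-; rewrite /dyad exprS.
    rewrite -muleA -EFinM muleC.
    congr (_ * _%:E); rewrite exprS; field.
    by rewrite gt_eqF.
  apply: ge0_le_integral => //.
  - exact: measurable_itv.
  - by move=> t _; rewrite /= mule_ge0// lee_fin invr_ge0 ltW.
  - exact: measurable_funTS.
  - move=> t; rewrite /dyad /= in_itv/= => /andP[h1 h2].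
    apply: lee_pmul => //; first by rewrite lee_fin invr_ge0 ltW.
      by apply: ndw; exact: ltW.
    have t0 : (0 < t)%R by exact: lt_trans h1.
    by rewrite lee_fin lef_pV2 ?posrE.
move=> fin.
have : (1 - a)%:E * \sum_(k <oo) w (a ^+ k.+1)%R < +oo.
  rewrite -nneseriesZl//; apply: le_lt_trans fin; apply: lee_nneseries => // k _.
  by rewrite mule_ge0// lee_fin ltW.
have : 0 <= \sum_(k <oo) w (a ^+ k.+1)%R by apply: nneseries_ge0.
move: (\sum_(k <oo) _) => [r _ _| |]//=; first exact: ltry.
by move=> _; rewrite mulry gtr0_sg// mul1e.
Qed.

Lemma nneseries_tail_lt (u : nat -> \bar R) (e : R) : (0 < e)%R ->
  (forall k, 0 <= u k) -> \sum_(k <oo) u k < +oo ->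
  exists N : nat, \sum_(N <= k <oo) u k < e%:E.
Proof.
move=> e0 u0 ufin.
have h := nneseries_tail_cvg ufin (fun k _ => u0 k).
have [|N _ hN] := h [set x | x < e%:E].
  by apply: open_nbhs_nbhs; split; [exact: open_ereal_lt_ereal|rewrite /= lte_fin].
by exists N; apply: hN => /=.
Qed.

End DiniSums.

(** * Elementary inequalities for real powers *)

Section RealInequalities.
Context {R : realType}.

Lemma powR_add_le (q a b : R) : 0 <= q ->
  `|a + b| `^ q <= 2 `^ q * (`|a| `^ q + `|b| `^ q).
Proof.
move=> q0; apply: (@le_trans _ _ ((2 * Num.max `|a| `|b|) `^ q)).
  apply: ge0_ler_powR; rewrite ?nnegrE ?mulr_ge0 ?le_max ?normr_ge0//.
  apply: (le_trans (ler_normD _ _)); rewrite mulr_natl mulr2n.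
  by apply: lerD; rewrite le_max lexx ?orbT.
rewrite powRM ?le_max ?normr_ge0//; apply: ler_wpM2l; first exact: powR_ge0.
by rewrite /Num.max; case: ifP => _; rewrite ?lerDl ?lerDr powR_ge0.
Qed.

Lemma bernoulli_le (s : R) (k : nat) : 0 <= s <= 1 -> 1 - k%:R * s <= (1 - s) ^+ k.
Proof.
move=> /andP[s0 s1]; elim: k => [|k IH]; first by rewrite mul0r subr0 expr0.
rewrite exprS; apply: (@le_trans _ _ ((1 - s) * (1 - k%:R * s))); last first.
  by apply: ler_wpM2l => //; rewrite subr_ge0.
have : 0 <= k%:R * s * s by rewrite !mulr_ge0.
rewrite -natr1; nra.
Qed.

Lemma powR_inv_dist (beta s t : R) (n : nat) : 0 <= beta -> beta <= n%:R ->
  0 <= s <= 1 / 4 -> 1 - s <= t <= 1 + s ->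
  `|(t `^ beta)^-1 - 1| <= n%:R * (4 / 3) ^+ n * s.
Proof.
move=> b0 bn /andP[s0 s4] /andP[t1 t2].
have s1 : 0 < 1 - s by lra.
have t0 : 0 < t by lra.
have bern := @bernoulli_le s n _.
have lowpow : (1 - s) ^+ n <= t `^ beta.
  apply: (@le_trans _ _ ((1 - s) `^ beta)); last first.
    by apply: ge0_ler_powR; rewrite ?nnegrE ?(ltW s1) ?(ltW t0).
  rewrite -powR_mulrn ?(ltW s1)//; apply: ger_powR => //; apply/andP; split => //; lra.
have uppow : t `^ beta <= (1 + s) ^+ n.
  apply: (@le_trans _ _ ((1 + s) `^ beta)).
    by apply: ge0_ler_powR; rewrite ?nnegrE ?(ltW t0)//; lra.
  rewrite -powR_mulrn; last lra.
  by apply: ler_powR => //; lra.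
have p0 : 0 < t `^ beta by rewrite powR_gt0.
have e0 : 0 < (1 - s) ^+ n by rewrite exprn_gt0.
have c1 : 1 <= (4 / 3) ^+ n :> R by rewrite exprn_ege1//; lra.
have ns0 : 0 <= n%:R * s by rewrite mulr_ge0.
rewrite ler_norml; apply/andP; split.
  have : (1 - s) ^+ n <= (t `^ beta)^-1.
    rewrite -[leLHS]invrK lef_pV2 ?posrE ?invr_gt0//.
    apply: (le_trans uppow); rewrite -exprVn; apply: lerXn2r; rewrite ?nnegrE ?invr_ge0//; try lra.
    by rewrite -[leRHS]div1r ler_pdivlMr//; nra.
  have : 1 - n%:R * s <= (1 - s) ^+ n by apply: bern; lra.
  nra.
have : (t `^ beta)^-1 <= ((1 - s) ^+ n)^-1 by rewrite lef_pV2 ?posrE.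
have : ((1 - s) ^+ n)^-1 - 1 <= n%:R * (4 / 3) ^+ n * s.
  have -> : ((1 - s) ^+ n)^-1 - 1 = (1 - (1 - s) ^+ n) * ((1 - s)^-1) ^+ n.
    by rewrite exprVn; field; rewrite gt_eqF.
  have -> : n%:R * (4 / 3) ^+ n * s = (n%:R * s) * (4 / 3) ^+ n by ring.
  apply: ler_pM.
  - by rewrite subr_ge0 exprn_ile1//; lra.
  - by rewrite exprn_ge0// invr_ge0 ltW.
  - have : 1 - n%:R * s <= (1 - s) ^+ n by apply: bern; lra.
    lra.
  - apply: lerXn2r; rewrite ?nnegrE ?invr_ge0 ?(ltW s1)//.
    by rewrite -[leLHS]div1r ler_pdivrMr//; lra.
lra.
Qed.

End RealInequalities.

(** * Pointwise differences of the kernel *)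

Section KernelEstimates.
Context {R : realType} {n : nat} {alpha : R}.
Hypothesis n0 : (0 < n)%N.
Hypothesis alpha0 : 0 <= alpha.
Hypothesis alphan : alpha < n%:R.
Local Notation V := 'rV[R]_n.
Local Notation E := (Rn R n).
Local Notation mu := (@lebn R n).
Local Notation beta := (n%:R - alpha).
Local Notation q := (n%:R / (n%:R - alpha)).

Lemma beta_gt0 : 0 < beta. Proof. by rewrite subr_gt0. Qed.

Lemma beta_le : beta <= n%:R. Proof. by rewrite gerBl. Qed.

Lemma q_ge1 : 1 <= q. Proof. by rewrite ler_pdivlMr ?beta_gt0// mul1r beta_le. Qed.

Lemma q_gt0 : 0 < q. Proof. exact: lt_le_trans ltr01 q_ge1. Qed.

Lemma q_ge0 : 0 <= q. Proof. exact: ltW q_gt0. Qed.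

Lemma beta_q : beta * q = n%:R.
Proof. by rewrite mulrC divfK// gt_eqF// beta_gt0. Qed.

Lemma powR_beta_q (t : R) : 0 <= t -> (t `^ beta) `^ q = t ^+ n.
Proof. by move=> t0; rewrite -powRrM beta_q powR_mulrn. Qed.

Variable Omega : V -> R.
Hypothesis hom : homogeneous0 Omega.
Local Notation K := (omega_kernel alpha Omega).

Definition diff_const : R := 2 `^ q * (1 + (n%:R * (4 / 3) ^+ n) `^ q).

Lemma diff_const_ge0 : 0 <= diff_const.
Proof. by rewrite mulr_ge0 ?addr_ge0 ?powR_ge0. Qed.

(** The difference splits into the variation of Omega over |x - y|^beta and the variation of the
    radial factor, which is O(s). Since q >= 1 and s <= 1, s^q <= s, so the radial error enters
    linearly and can be summed along with the modulus of Omega. The powers of r come from beta q =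
    n. *)
Lemma kernel_diff_le (r s : R) (x y : V) : 0 < r -> 3 / 2 * r < enorm x ->
  0 <= s <= 1 / 4 -> enorm y <= s * enorm x ->
  `|K (x - y) - K x| `^ q <= diff_const *
    ((r ^+ n)^-1 * `|Omega (x - y) - Omega x| `^ q + (r ^+ n)^-1 * s * `|Omega x| `^ q).
Proof.
move=> r0 rx /andP[s0 s4] ys.
have qg := q_ge0.
have A0 : 0 < enorm x by lra.
have B1 : (1 - s) * enorm x <= enorm (x - y).
  by have := lerB_enorm x y; nra.
have B2 : enorm (x - y) <= (1 + s) * enorm x.
  by have := ler_enormB x y; nra.
have B0 : 0 < enorm (x - y) by nra.
have rB : r <= enorm (x - y) by nra.
have rA : r <= enorm x by lra.
pose t := enorm (x - y) / enorm x.
have tE : enorm (x - y) = t * enorm x by rewrite /t divfK// gt_eqF.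
have t12 : 1 - s <= t <= 1 + s by rewrite /t ler_pdivlMr// ler_pdivrMr// B1 B2.
have t0 : 0 <= t by rewrite divr_ge0// ltW.
have := @powR_inv_dist R beta s t n (ltW beta_gt0) beta_le _ t12.
rewrite s0 s4 => /(_ isT) tb.
set C1 := n%:R * (4 / 3) ^+ n in tb *.
have C10 : 0 <= C1 by rewrite mulr_ge0// exprn_ge0//; lra.
have pB : 0 < enorm (x - y) `^ beta by rewrite powR_gt0.
have pA : 0 < enorm x `^ beta by rewrite powR_gt0.
have -> : K (x - y) - K x = (Omega (x - y) - Omega x) / enorm (x - y) `^ beta +
    Omega x * ((t `^ beta)^-1 - 1) / enorm x `^ beta.
  rewrite /omega_kernel tE powRM ?enorm_ge0//.
  have pt : 0 < t `^ beta by rewrite powR_gt0// divr_gt0.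
  by field; rewrite !gt_eqF.
apply: (le_trans (powR_add_le _ _ qg)).
rewrite /diff_const -[leRHS]mulrA; apply: ler_wpM2l; first exact: powR_ge0.
have e1 : `|(Omega (x - y) - Omega x) / enorm (x - y) `^ beta| `^ q <=
    (r ^+ n)^-1 * `|Omega (x - y) - Omega x| `^ q.
  rewrite normrM normfV (gtr0_norm pB) powRM ?invr_ge0 ?(ltW pB)// mulrC.
  apply: ler_wpM2r; first exact: powR_ge0.
  rewrite -[X in X `^ q](powR_inv1 (ltW pB)) powRAC powR_beta_q ?(ltW B0)//.
  rewrite powR_inv1 ?exprn_ge0 ?(ltW B0)// lef_pV2 ?posrE ?exprn_gt0//.
  by apply: lerXn2r; rewrite ?nnegrE ?(ltW r0) ?enorm_ge0.
have e2 : `|Omega x * ((t `^ beta)^-1 - 1) / enorm x `^ beta| `^ q <=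
    C1 `^ q * ((r ^+ n)^-1 * s * `|Omega x| `^ q).
  rewrite !normrM normfV (gtr0_norm pA) powRM ?invr_ge0 ?mulr_ge0 ?(ltW pA)//.
  rewrite powRM//.
  have -> : ((enorm x `^ beta)^-1) `^ q = (enorm x ^+ n)^-1.
    rewrite -[X in X `^ q](powR_inv1 (ltW pA)) powRAC powR_beta_q ?(ltW A0)//.
    by rewrite powR_inv1// exprn_ge0// ltW.
  have -> : C1 `^ q * ((r ^+ n)^-1 * s * `|Omega x| `^ q) =
     `|Omega x| `^ q * (C1 `^ q * s) * (r ^+ n)^-1 by ring.
  apply: ler_pM.
  - by rewrite mulr_ge0// powR_ge0.
  - by rewrite invr_ge0 exprn_ge0// ltW.
  - apply: ler_wpM2l; first exact: powR_ge0.
    apply: (@le_trans _ _ ((C1 * s) `^ q)).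
      apply: ge0_ler_powR; [exact: qg|exact: normr_ge0|exact: mulr_ge0|exact: tb].
    rewrite powRM//; apply: ler_wpM2l; first exact: powR_ge0.
    have [->|sn0] := eqVneq s 0; first by rewrite powR0// gt_eqF// q_gt0.
    rewrite -[leRHS]powRr1//; apply: ger_powR; last exact: q_ge1.
    by rewrite lt_neqAle eq_sym sn0 s0/=; lra.
  - rewrite lef_pV2 ?posrE ?exprn_gt0//.
    by apply: lerXn2r; rewrite ?nnegrE ?(ltW r0) ?enorm_ge0.
have := lerD e1 e2.
set a1 := (r ^+ n)^-1 * _; set a2 := (r ^+ n)^-1 * _ * _.
have a10 : 0 <= a1 by rewrite mulr_ge0 ?powR_ge0// invr_ge0 exprn_ge0// ltW.
have a20 : 0 <= a2 by rewrite !mulr_ge0 ?powR_ge0// invr_ge0 exprn_ge0// ltW.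
move/le_trans; apply; set c := C1 `^ q.
rewrite -subr_ge0 (_ : _ - _ = a2 + c * a1); last by ring.
by rewrite addr_ge0// mulr_ge0// powR_ge0.
Qed.

End KernelEstimates.

Section Homogeneous.
Context {R : realType} {n : nat}.
Local Notation V := 'rV[R]_n.
Local Notation E := (Rn R n).
Local Notation mu := (@lebn R n).
Local Open Scope ereal_scope.

Lemma sphere_integralE (g : V -> \bar R) : sphere_integral g =
  n%:R%:E * \int[mu]_(x in shell 0 1) g ((enorm x)^-1 *: (x : V))%R.
Proof.
rewrite /sphere_integral; congr (_ * integral _ _ _).
by apply/seteqP; split => x /= => [[? ?]|/andP[]] //; apply/andP.
Qed.

Lemma homogeneous_normalize (Omega : V -> R) (x : V) : homogeneous0 Omega ->
  (0 < enorm x)%R -> Omega ((enorm x)^-1 *: x)%R = Omega x.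
Proof. by move=> h x0; rewrite h ?invr_gt0// -enorm_gt0. Qed.

Lemma sphere_integral_hom (G : R -> \bar R) (Omega : V -> R) : homogeneous0 Omega ->
  sphere_integral (fun x => G (Omega x)) =
  n%:R%:E * \int[mu]_(x in shell 0 1) G (Omega x).
Proof.
move=> h; rewrite sphere_integralE; congr (_ * _); apply: eq_integral => x.
by rewrite inE => /andP[x0 _]; rewrite homogeneous_normalize.
Qed.

Lemma affine_shell (r s t : R) : (0 < r)%R ->
  (affine r 0%R : E -> E) @^-1` shell (r * s) (r * t) = shell s t.
Proof.
move=> r0; apply/seteqP; split => x; rewrite /shell /affine /= addr0 enormZ gtr0_norm//;
by rewrite ltr_pM2l// ler_pM2l.
Qed.

Lemma hom_ball_integral (F : E -> \bar R) (r : R) : (0 < r)%R ->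
  measurable_fun setT F -> (forall x, 0 <= F x) ->
  (forall (s : R) (x : V), (0 < s)%R -> x != 0%R -> F (s *: x)%R = F x) ->
  \int[mu]_(x in shell 0 r) F x = (r ^+ n)%:E * \int[mu]_(x in shell 0 1) F x.
Proof.
move=> r0 mF F0 hF.
have := @ge0_integral_affine R n r 0%R (shell 0 r) F.
have -> : (affine r 0%R : E -> E) @^-1` shell 0 r = shell 0 1.
  by have := affine_shell 0 1 r0; rewrite mulr0 mulr1.
move=> h.
transitivity ((r ^+ n)%:E * \int[mu]_(x in shell 0 1) F (affine r 0%R x)); last first.
  congr (_ * _); apply: eq_integral => x; rewrite inE => /andP[x0 _].
  by rewrite /affine addr0 hF// -enorm_gt0.
rewrite h ?gt_eqF//; first last.
- exact: measurable_funTS.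
- exact: measurable_shell.
by rewrite muleA -EFinM gtr0_norm// mulfV ?mul1e// expf_neq0// gt_eqF.
Qed.

End Homogeneous.

Section DiniKernel.
Context {R : realType} {n : nat} {alpha : R}.
Hypothesis n0 : (0 < n)%N.
Hypothesis alpha0 : 0 <= alpha.
Hypothesis alphan : alpha < n%:R.
Local Notation V := 'rV[R]_n.
Local Notation E := (Rn R n).
Local Notation mu := (@lebn R n).
Local Notation beta := (n%:R - alpha).
Local Notation q := (n%:R / (n%:R - alpha)).
Variable Omega : V -> R.
Hypothesis hom : homogeneous0 Omega.
Hypothesis dini : Lq_Dini q Omega.
Local Notation K := (omega_kernel alpha Omega).
Local Open Scope ereal_scope.

Let qge0 : (0 <= q)%R. Proof. exact: (q_ge0 alpha0 alphan). Qed.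

Lemma Omega_measurable : measurable_fun [set: E] (Omega : E -> R).
Proof. by case: dini => -[]. Qed.

Lemma measurable_Omega_powR : measurable_fun [set: E] (fun x : E => (`|Omega x| `^ q)%:E).
Proof.
apply/measurable_EFinP; apply: (measurableT_comp (measurable_powR _)).
by apply: measurableT_comp => //; exact: Omega_measurable.
Qed.

Lemma kernel_measurable : measurable_fun [set: E] (K : E -> R).
Proof.
apply: measurable_funM; first exact: Omega_measurable.
apply: measurable_inv.
exact: (measurableT_comp (measurable_powR _) measurable_enorm_id).
Qed.

(** n times this is the q-th power of the norm of Omega in L^q of the sphere. *)
Definition LqB : \bar R := \int[mu]_(x in shell 0 1) (`|Omega x| `^ q)%:E.

Lemma LqB_ge0 : 0 <= LqB.
Proof. by apply: integral_ge0 => x _; rewrite lee_fin powR_ge0. Qed.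

Lemma LqB_lty : LqB < +oo.
Proof.
case: dini => -[_ + _].
rewrite (sphere_integral_hom (fun t => (`|t| `^ q)%:E) hom) -/LqB.
have := LqB_ge0; case: LqB => [r _ _| |]//=; first exact: ltry.
by rewrite mulry gtr0_sg ?ltr0n// mul1e ltxx.
Qed.

Lemma LqB_fin : LqB = (fine LqB)%:E.
Proof. by rewrite fineK// ge0_fin_numE ?LqB_ge0// LqB_lty. Qed.

Lemma shell_Omega_le (r s : R) : (0 < s)%R -> (0 <= r)%R ->
  \int[mu]_(x in shell r s) (`|Omega x| `^ q)%:E <= (s ^+ n)%:E * LqB.
Proof.
move=> s0 r0; rewrite -(hom_ball_integral s0 measurable_Omega_powR).
- apply: ge0_subset_lower_integral => [x|x /andP[h1 h2]]; first by rewrite lee_fin powR_ge0.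
  by apply/andP; split => //; exact: le_lt_trans h1.
- by move=> x; rewrite lee_fin powR_ge0.
- by move=> t x t0 x0; rewrite hom.
Qed.

(** |K|^q is homogeneous of degree -beta q = -n, hence a bound that depends only on the ratio of the
    radii. *)
Lemma kernel_size (r s : R) : (0 < r)%R -> (r <= s)%R ->
  \int[mu]_(x in shell r s) (`|K x| `^ q)%:E <= ((s / r) ^+ n)%:E * LqB.
Proof.
move=> r0 rs.
have ri : (0 <= (r ^+ n)^-1)%R by rewrite invr_ge0 exprn_ge0// ltW.
apply: (@le_trans _ _ (\int[mu]_(x in shell r s) (((r ^+ n)^-1)%:E * (`|Omega x| `^ q)%:E))).
  apply: ge0_le_lower_integral => x /andP[rx _]; first by rewrite lee_fin powR_ge0.
  have x0 : (0 < enorm x)%R by exact: lt_trans rx.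
  have p0 : (0 < enorm x `^ beta)%R by rewrite powR_gt0.
  rewrite -EFinM lee_fin /omega_kernel normrM normfV (gtr0_norm p0) powRM ?invr_ge0 ?(ltW p0)//.
  rewrite mulrC; apply: ler_wpM2r; first exact: powR_ge0.
  rewrite -[X in (X `^ q <= _)%R](powR_inv1 (ltW p0)) powRAC (powR_beta_q alphan) ?(ltW x0)//.
  rewrite powR_inv1 ?exprn_ge0 ?(ltW x0)// lef_pV2 ?posrE ?exprn_gt0//.
  by apply: lerXn2r; rewrite ?nnegrE ?(ltW r0) ?(ltW x0) ?(ltW rx).
have f0 (x : E) : 0 <= (`|Omega x| `^ q)%:E by rewrite lee_fin powR_ge0.
rewrite (lebn_integralZl (measurable_shell _ _) measurable_Omega_powR f0 ri).
apply: (@le_trans _ _ (((r ^+ n)^-1)%:E * ((s ^+ n)%:E * LqB))).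
  apply: lee_wpmul2l; first by rewrite lee_fin.
  by apply: shell_Omega_le; [exact: lt_le_trans rs|exact: ltW].
by rewrite muleA -EFinM expr_div_n mulrC.
Qed.

(** [omega_q] before its root is taken. *)
Definition modulus (t : R) : \bar R :=
  ereal_sup [set sphere_integral (fun x => (`|Omega (x + h) - Omega x| `^ q)%:E)
            | h in [set h : V | (enorm h <= t)%R]].

Lemma sphere_integral_ge0 (g : V -> \bar R) : (forall x, 0 <= g x) -> 0 <= sphere_integral g.
Proof.
by move=> g0; rewrite sphere_integralE mule_ge0//; apply: integral_ge0 => x _.
Qed.

Lemma omega_qE t : omega_q q Omega t = poweR (modulus t) q^-1.
Proof. by []. Qed.

Lemma modulus_ge0 t : (0 <= t)%R -> 0 <= modulus t.
Proof.
move=> t0.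
apply: (@le_trans _ _ (sphere_integral (fun x : V => (`|Omega (x + 0%R) - Omega x| `^ q)%:E))).
  by apply: sphere_integral_ge0 => x; rewrite lee_fin powR_ge0.
by apply: ereal_sup_ubound; exists 0%R => //=; rewrite enorm0.
Qed.

Lemma modulus_le s t : (s <= t)%R -> modulus s <= modulus t.
Proof.
move=> st; apply: ereal_sup_le => _ [h hs <-]; exists h => //.
exact: le_trans hs st.
Qed.

(** Far out in the Dini series omega_q < 1, and then omega_q^q <= omega_q because q >= 1; so the
    series of the q-th powers is small too. The added geometric series pays for the radial error s
    of [kernel_diff_le]. *)
Lemma modulus_tail (e : R) : (0 < e)%R -> exists N : nat,
  \sum_(k <oo) (modulus ((3 / 4) ^+ (N + k).+1)%R + ((3 / 4) ^+ (N + k).+1)%R%:E) < e%:E.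
Proof.
move=> e0.
(* [dini_sum_lty] wants a nonnegative monotone function on the whole line, and [modulus] of a
   negative number is a supremum over the empty set. *)
pose w t := poweR (modulus (Num.max t 0)%R) q^-1.
have w0 t : 0 <= w t by exact: poweR_ge0.
have ndw s t : (s <= t)%R -> w s <= w t.
  move=> st; apply: gt0_ler_poweR.
  - by rewrite invr_ge0.
  - by rewrite in_itv/= modulus_ge0 ?le_max ?lexx ?orbT// leey.
  - by rewrite in_itv/= modulus_ge0 ?le_max ?lexx ?orbT// leey.
  - by apply: modulus_le; rewrite ge_max !le_max st lexx orbT.
have a01 : (0 < (3 / 4 : R) < 1)%R by apply/andP; split; lra.
have a0 : (0 < 3 / 4 :> R)%R by case/andP: a01.
have S1 : \sum_(k <oo) w ((3 / 4) ^+ k.+1)%R < +oo.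
  apply: (@dini_sum_lty R w _ a01 w0 ndw).
  case: dini => _; congr (_ < _); apply: eq_integral => t.
  rewrite inE /= in_itv/= => /andP[t0 _].
  by rewrite omega_qE /w max_l// ltW.
pose v t := (Num.max t 0)%R%:E : \bar R.
have v0 t : 0 <= v t by rewrite lee_fin le_max lexx orbT.
have S2 : \sum_(k <oo) v ((3 / 4) ^+ k.+1)%R < +oo.
  apply: (@dini_sum_lty R v _ a01 v0).
  - by move=> s t st; rewrite lee_fin ge_max !le_max st lexx orbT.
  - apply: (@le_lt_trans _ _ (\int[lebesgue_measure]_(t in `]0%R, 1%R]) (cst 1 t))).
      apply: ge0_le_lower_integral => t; rewrite /= in_itv/= => /andP[t0 _].
        by rewrite /v -EFinM lee_fin max_l ?(ltW t0)// mulfV// gt_eqF.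
      by rewrite /v -EFinM lee_fin max_l ?(ltW t0)// mulfV// gt_eqF.
    by rewrite integral_cst//= lebesgue_measure_itv/= lte_fin ltr01 oppr0 adde0 mul1e ltry.
pose u k := w ((3 / 4) ^+ k.+1)%R + v ((3 / 4) ^+ k.+1)%R.
have u0 k : 0 <= u k by rewrite adde_ge0.
have uS : \sum_(k <oo) u k < +oo by rewrite nneseriesD// lte_add_pinfty.
have e10 : (0 < Num.min e 1)%R by rewrite lt_min e0 ltr01.
have [N hN] := nneseries_tail_lt e10 u0 uS.
exists N; have : \sum_(N <= k <oo) u k < e%:E.
  by apply: lt_le_trans hN _; rewrite lee_fin ge_min lexx.
apply: le_lt_trans; rewrite -(@nneseries_addn _ _ N)//.
apply: lee_nneseries => [k _|k _]; rewrite addnC.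
  by rewrite adde_ge0 ?modulus_ge0 ?lee_fin ?exprn_ge0 ?(ltW a0).
set m := (k + N)%N; have am0 : (0 <= (3 / 4) ^+ m.+1 :> R)%R by rewrite exprn_ge0 ?(ltW a0).
apply: leeD; last by rewrite lee_fin le_max lexx.
have : w ((3 / 4) ^+ m.+1)%R < 1.
  apply: (@le_lt_trans _ _ (u m)); first by rewrite leeDl.
  apply: (@le_lt_trans _ _ (\sum_(N <= k <oo) u k)); last first.
    by apply: lt_le_trans hN _; rewrite lee_fin ge_min lexx orbT.
  rewrite -(@nneseries_addn _ _ N)//.
  have := @nneseries_lim_ge R (fun i => u (i + N)%N) xpredT 0%N k.+1 (fun _ _ _ => u0 _).
  apply: le_trans; rewrite big_nat_recr//= leeDr//.
  by apply: sume_ge0 => i _.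
rewrite /w max_l//; have := modulus_ge0 am0.
case: (modulus _) => [x| |]//=; last first.
  by rewrite invr_eq0 gt_eqF// (q_gt0 alpha0 alphan).
rewrite lee_fin => x0; rewrite lte_fin => x1; rewrite lee_fin.
have qg : (0 < q)%R by exact: (q_gt0 alpha0 alphan).
rewrite [leLHS](_ : x = ((x `^ q^-1) `^ q)%R); last by rewrite -powRrM mulVf ?gt_eqF// powRr1.
have [->|y0] := eqVneq (x `^ q^-1)%R 0%R; first by rewrite powR0 ?gt_eqF.
rewrite -[leRHS]powRr1 ?powR_ge0//; apply: ger_powR; last exact: (q_ge1 alpha0 alphan).
by rewrite lt0r y0 powR_ge0/= ltW.
Qed.

End DiniKernel.

(** * Decomposition into geometric shells and null sets in integrals *)

Section Shells.
Context {R : realType} {n : nat}.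
Local Notation V := 'rV[R]_n.
Local Notation E := (Rn R n).
Local Notation mu := (@lebn R n).
Local Open Scope ereal_scope.

Lemma expr_unbounded (c t : R) : (1 < c)%R -> exists k, (t < c ^+ k)%R.
Proof.
move=> c1; pose k := (Num.trunc ((t - 1) / (c - 1))).+1.
exists k.
have h : (1 + k%:R * (c - 1) <= c ^+ k)%R.
  elim: (k) => [|m IH]; first by rewrite mul0r addr0 expr0.
  rewrite exprS; apply: (@le_trans _ _ (c * (1 + m%:R * (c - 1)))%R); last first.
    by apply: ler_wpM2l => //; lra.
  rewrite -natr1; have : (0 <= m%:R * (c - 1) * (c - 1))%R by rewrite !mulr_ge0// subr_ge0 ltW.
  lra.
apply: lt_le_trans h; rewrite -ltrBlDl -ltr_pdivrMr ?subr_gt0//.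
by rewrite truncnS_gt.
Qed.

Lemma geometric_bracket_oc (c t : R) : (1 < c)%R -> (1 < t)%R ->
  exists k, (c ^+ k < t <= c ^+ k.+1)%R.
Proof.
move=> c1 t1.
have ex : exists k, (t <= c ^+ k)%R by have [k /ltW ?] := expr_unbounded t c1; exists k.
have := ex_minnP ex => -[[|k] tk kmin].
  by move: tk; rewrite expr0 leNgt t1.
exists k; rewrite tk andbT ltNge; apply/negP => /kmin.
by rewrite ltnn.
Qed.

Lemma geometric_bracket_co (c t : R) : (1 < c)%R -> (1 <= t)%R ->
  exists k, (c ^+ k <= t < c ^+ k.+1)%R.
Proof.
move=> c1 t1.
have := ex_minnP (expr_unbounded t c1) => -[[|k] tk kmin].
  by move: tk; rewrite expr0 ltNge t1.
exists k; rewrite tk andbT leNgt; apply/negP => /kmin.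
by rewrite ltnn.
Qed.

Lemma nneseries_ge_term (u : nat -> \bar R) (k : nat) : (forall i, 0 <= u i) ->
  u k <= \sum_(i <oo) u i.
Proof.
move=> u0; have := @nneseries_lim_ge R u xpredT 0%N k.+1 (fun _ _ _ => u0 _).
by apply: le_trans; rewrite big_nat_recr//= leeDr// sume_ge0.
Qed.

Lemma trivIset_shells (u : nat -> R) : (forall i j, (i <= j)%N -> (u i <= u j)%R) ->
  trivIset setT (fun k => shell (R := R) (n := n) (u k) (u k.+1)).
Proof.
move=> mono.
have key (i j : nat) x : (i < j)%N -> shell (u i) (u i.+1) x ->
    shell (R := R) (n := n) (u j) (u j.+1) x -> False.
  move=> ij /andP[_ h1] /andP[h2 _].
  by have := le_lt_trans (le_trans h1 (mono _ _ ij)) h2; rewrite ltxx.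
by apply/trivIsetP => i j _ _ ij; apply/seteqP; split => t // [ti tj];
    have [h|h|h] := ltngtP i j; [exact: (key i j t)|exact: (key j i t)|rewrite h eqxx in ij].
Qed.

Lemma outside_shells (rho c : R) : (0 < rho)%R -> (1 < c)%R ->
  outside (R := R) (n := n) rho = \bigcup_k shell (rho * c ^+ k)%R (rho * c ^+ k.+1)%R.
Proof.
move=> r0 c1; apply/seteqP; split => x.
  move=> rx; have [k] : exists k, (c ^+ k < enorm x / rho <= c ^+ k.+1)%R.
    by apply: geometric_bracket_oc => //; rewrite ltr_pdivlMr// mul1r.
  rewrite ltr_pdivlMr// ler_pdivrMr// => h; exists k => //.
  by rewrite /shell /= ![(rho * _)%R]mulrC.
move=> [k _ /andP[h _]]; apply: le_lt_trans h; rewrite ler_peMr ?(ltW r0)//.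
by rewrite exprn_ege1// ltW.
Qed.

Lemma unit_shells (c : R) : (1 < c)%R -> shell (R := R) (n := n) 0 1 =
  \bigcup_k shell ((c ^+ k.+1)^-1)%R ((c ^+ k)^-1)%R.
Proof.
move=> c1; have c0 k : (0 < c ^+ k)%R by rewrite exprn_gt0// (lt_trans ltr01).
apply/seteqP; split => x.
  move=> /andP[x0 x1].
  have [k /andP[h1 h2]] : exists k, (c ^+ k <= (enorm x)^-1 < c ^+ k.+1)%R.
    by apply: geometric_bracket_co => //; rewrite invf_ge1.
  exists k => //; apply/andP; split.
    by rewrite invf_plt ?posrE.
  by rewrite -[leLHS]invrK lef_pV2 ?posrE ?invr_gt0.
move=> [k _ /andP[h1 h2]]; apply/andP; split.
  by apply: lt_trans h1; rewrite invr_gt0.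
by apply: (le_trans h2); rewrite invf_le1// exprn_ege1// ltW.
Qed.

Lemma integral_outside_le (rho c : R) (F : E -> \bar R) : (0 < rho)%R -> (1 < c)%R ->
  measurable_fun setT F -> (forall x, 0 <= F x) ->
  \int[mu]_(x in outside rho) F x =
  \sum_(k <oo) \int[mu]_(x in shell (rho * c ^+ k)%R (rho * c ^+ k.+1)%R) F x.
Proof.
move=> r0 c1 mF F0; rewrite (outside_shells r0 c1).
apply: ge0_integral_bigcup => //.
- by move=> k; exact: measurable_shell.
- exact: measurable_funTS.
- apply: trivIset_shells => i j ij; rewrite ler_pM2l//.
  by rewrite ler_weXn2l// ltW.
Qed.

(** [shell_integral_le] integrates over individual spheres, where a null set of R^n may be large. An
    almost everywhere equal function is therefore useless there unless it is also below F at every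
    point; replacing F >= 0 by 0 on a null set achieves this. *)
Lemma borel_minorant (F : V -> R) : measurable_fun [set: E] (F : E -> R) ->
  (forall x, 0 <= F x)%R -> exists F0 : V -> R, [/\ borel_fun F0,
    (forall x, 0 <= F0 x <= F x)%R & mu [set x | F0 x <> F x] = 0].
Proof.
move=> mF F0; have [N [bN N0 h]] := borel_repr mF.
exists (fun x => if `[< N x >] then 0%R else F x); split => //.
- by move=> x; case: ifP => _; rewrite ?lexx ?F0.
- by apply: sub_lebn0 N0 => x /=; case: asboolP.
Qed.

Lemma integral_eq_off_null (D : set E) (F G : E -> \bar R) : measurable D ->
  measurable_fun setT F -> measurable_fun setT G ->
  mu [set x | F x <> G x] = 0 ->
  \int[mu]_(x in D) F x = \int[mu]_(x in D) G x.
Proof.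
move=> mD mF mG FG; apply: ae_eq_integral => //.
- exact: measurable_funTS.
- exact: measurable_funTS.
have mn : measurable ([set x | F x <> G x] : set E).
  apply: (measure_is_complete_caratheodory (mu := @lebesgue_outer R n)).
  have [B bB [FB B0]] := borel_null_hull FG.
  by exists B; split => //; exact: borel_measurable.
exists [set x | F x <> G x]; split => //.
by move=> x /= h FGx; apply: h.
Qed.

End Shells.

Section KernelSmoothness.
Context {R : realType} {n : nat} {alpha : R}.
Hypothesis n0 : (0 < n)%N.
Hypothesis alpha0 : 0 <= alpha.
Hypothesis alphan : alpha < n%:R.
Local Notation V := 'rV[R]_n.
Local Notation E := (Rn R n).
Local Notation mu := (@lebn R n).
Local Notation beta := (n%:R - alpha).
Local Notation q := (n%:R / (n%:R - alpha)).
Variable Omega : V -> R.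
Hypothesis hom : homogeneous0 Omega.
Hypothesis dini : Lq_Dini q Omega.
Local Notation K := (omega_kernel alpha Omega).
Local Notation LqB := (@LqB R n alpha Omega).
Local Notation modulus := (@modulus R n alpha Omega).
Local Open Scope ereal_scope.

Let qge0 : (0 <= q)%R. Proof. exact: (q_ge0 alpha0 alphan). Qed.

Lemma measurable_diff_powR (G : V -> R) (y : V) : measurable_fun [set: E] (G : E -> R) ->
  measurable_fun [set: E] (fun x : E => (`|G ((x : V) - y) - G x| `^ q)%R).
Proof.
move=> mG; apply: (measurableT_comp (measurable_powR _)).
apply: measurableT_comp; first exact: normr_measurable.
refine (measurable_funB _ mG).
rewrite (_ : (fun _ => _) = G \o affine 1 (- y)); last first.
  by apply/funext => x; rewrite /affine /= scale1r.
by apply: (measurableT_comp mG); apply: measurable_affine; exact: oner_neq0.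
Qed.

(** On the sphere of radius u >= r, homogeneity gives Omega (u x' - y) = Omega (x' + h) with h = - y
    / u and |h| <= |y| / r, so each sphere is controlled by the modulus. *)
Lemma shell_Omega_diff (r : R) (y : V) : (0 < r)%R -> (enorm y < r)%R ->
  \int[mu]_(w in shell (3 / 2 * r) (2 * r)) (`|Omega ((w : V) - y) - Omega w| `^ q)%:E <=
  ((24 * r) ^+ n)%:E * modulus (enorm y / r).
Proof.
move=> r0 yr.
have mF := measurable_diff_powR y (Omega_measurable dini).
have [F0 [bF0 F0F F0E]] := borel_minorant mF (fun x => powR_ge0 _ _).
have F00 x : (0 <= F0 x)%R by case/andP: (F0F x).
rewrite (@integral_eq_off_null _ _ _ _ (fun w => (F0 w)%:E)); first last.
- by apply: sub_lebn0 F0E => x /= h e; apply: h; rewrite e.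
- by apply/measurable_EFinP; exact: borel_fun_measurable.
- exact/measurable_EFinP.
- exact: measurable_shell.
have m0 : 0 <= modulus (enorm y / r) by apply: modulus_ge0; rewrite divr_ge0 ?enorm_ge0 ?ltW.
apply: shell_integral_le => // u /andP[ru ur].
have u0 : (0 < u)%R by exact: lt_le_trans ru.
pose h := (- (u^-1 *: y))%R : V.
apply: (@le_trans _ _ (sphere_integral (fun x => (`|Omega (x + h) - Omega x| `^ q)%:E))).
  rewrite sphere_integralE; set I := (X in _ <= _ * X).
  apply: (@le_trans _ _ I); last first.
    apply: lee_pemull.
      by apply: integral_ge0 => x _; rewrite lee_fin powR_ge0.
    by rewrite lee_fin ler1n.
  apply: ge0_le_lower_integral => x /andP[x0 x1]; first by rewrite lee_fin.
  rewrite lee_fin; case/andP: (F0F ((u / enorm x) *: x)%R) => _ /le_trans; apply.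
  have xn : (x : V) != 0%R by rewrite -enorm_gt0.
  rewrite le_eqVlt; apply/orP; left; apply/eqP; congr (`|_ - _| `^ q)%R.
    have -> : ((u / enorm x) *: (x : V) - y = u *: ((enorm x)^-1 *: (x : V) + h))%R.
      by rewrite /h scalerDr scalerN !scalerA mulfV ?gt_eqF// scale1r.
    rewrite hom// -enorm_gt0.
    have := lerB_enorm ((enorm x)^-1 *: (x : V))%R (u^-1 *: y)%R.
    apply: lt_le_trans; rewrite !enormZ !gtr0_norm ?invr_gt0// mulVf ?gt_eqF//.
    by rewrite subr_gt0 mulrC ltr_pdivrMr// mul1r (lt_le_trans yr).
  by rewrite -scalerA !hom// ?scaler_eq0 ?invr_eq0 ?negb_or ?gt_eqF ?invr_gt0.
apply: ereal_sup_ubound; exists h => //=.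
rewrite /h enormN enormZ gtr0_norm ?invr_gt0// mulrC.
by apply: ler_wpM2l; rewrite ?enorm_ge0// lef_pV2 ?posrE.
Qed.

(** Outside the ball of radius rho, cut into shells of ratio c = 4/3: each one is the shell of
    [shell_Omega_diff] for r = 2/3 rho c^k. The ratio |y| / r decreases by 3/4 from one shell to the
    next, and the sum is a tail of the Dini series. *)
Lemma kernel_smooth (e : R) : (0 < e)%R -> exists M : R, (2 <= M)%R /\
  forall (rho : R) (y : V), (0 < rho)%R -> (M * enorm y <= rho)%R ->
  \int[mu]_(x in outside rho) (`|K ((x : V) - y) - K x| `^ q)%:E <= e%:E.
Proof.
move=> e0.
have lB := LqB_fin n0 hom dini.
have l0 : (0 <= fine LqB)%R by rewrite fine_ge0// LqB_ge0.
set L := fine LqB in lB l0.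
pose C := diff_const (R := R) (n := n) (alpha := alpha).
pose C2 := (24 ^+ n + 2 ^+ n * L : R)%R.
have C0 : (0 <= C)%R := @diff_const_ge0 R n alpha.
have C20 : (0 <= C2)%R by rewrite addr_ge0 ?mulr_ge0 ?exprn_ge0.
have D0 : (0 < C * C2 + 1)%R by rewrite ltr_wpDl// mulr_ge0.
(* The bound 1/4 on the sum makes every s k at most 1/4, as [kernel_diff_le] requires. *)
have [N hN] : exists N : nat,
    \sum_(k <oo) (modulus ((3 / 4) ^+ (N + k).+1)%R + ((3 / 4) ^+ (N + k).+1)%R%:E) <
    (Num.min (e / (C * C2 + 1)) (1 / 4))%:E.
  by apply: (modulus_tail alpha0 alphan dini); rewrite lt_min !divr_gt0.
pose s k : R := ((3 / 4) ^+ (N + k).+1)%R.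
have s0 k : (0 < s k)%R by rewrite exprn_gt0// divr_gt0.
have t0 k : 0 <= modulus (s k) + (s k)%:E.
  by rewrite adde_ge0 ?modulus_ge0 ?lee_fin ?(ltW (s0 k)).
have s4 k : (s k <= 1 / 4)%R.
  rewrite -lee_fin; apply: (@le_trans _ _ (modulus (s k) + (s k)%:E)).
    by rewrite leeDr// modulus_ge0// ltW.
  apply: le_trans (nneseries_ge_term k t0) (le_trans (ltW hN) _).
  by rewrite lee_fin ge_min lexx orbT.
pose c : R := (4 / 3)%R.
have c1 : (1 < c)%R by rewrite /c; lra.
have ck k : (0 < c ^+ k)%R by rewrite exprn_gt0// (lt_trans ltr01).
have sc k m : (s (k + m)%N * c ^+ m = s k)%R.
  rewrite /s /c addnA -addSn exprD -mulrA -exprMn.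
  by rewrite (_ : (3 / 4 * (4 / 3) = 1 :> R)%R) ?expr1n ?mulr1//; lra.
(* This M gives |y| <= s (k + 5) rho c^k. The five spare factors 3/4 absorb the ratio 3/2 between
   rho c^k and r, so that |y| / r <= s k. *)
exists (c ^+ (N + 6))%R; split.
  apply: (@le_trans _ _ (c ^+ 5)%R); first by rewrite /c !exprS expr0; lra.
  by apply: ler_weXn2l; [exact: ltW|rewrite addnC leq_addr].
move=> rho y r0 yrho.
have ys k : (enorm y <= s (k + 5)%N * (rho * c ^+ k))%R.
  rewrite (mulrC rho) mulrA.
  have -> : (s (k + 5)%N * c ^+ k = s 5%N)%R by rewrite addnC sc.
  rewrite -(ler_pM2l (ck (N + 6)%N)); apply: (le_trans yrho).
  rewrite mulrA (_ : (c ^+ (N + 6) * s 5%N = 1)%R) ?mul1r//.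
  rewrite /s -addnS /c -exprMn.
  by rewrite (_ : (4 / 3 * (3 / 4) = 1 :> R)%R) ?expr1n//; lra.
have mG := measurable_diff_powR y (kernel_measurable dini).
have G0 x : 0 <= (`|K ((x : V) - y) - K x| `^ q)%:E by rewrite lee_fin powR_ge0.
have /measurable_EFinP mG' := mG.
rewrite (integral_outside_le r0 c1 mG' G0).
have CC0 : 0 <= (C * C2)%:E by rewrite lee_fin mulr_ge0.
apply: (@le_trans _ _ ((C * C2)%:E * \sum_(k <oo) (modulus (s k) + (s k)%:E))); last first.
  apply: (@le_trans _ _ ((C * C2)%:E * (e / (C * C2 + 1))%:E)).
    apply: lee_wpmul2l => //; apply: (le_trans (ltW hN)).
    by rewrite lee_fin ge_min lexx.
  rewrite -EFinM lee_fin mulrCA ler_piMr ?(ltW e0)//.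
  by rewrite ler_pdivrMr// mul1r lerDl.
rewrite -nneseriesZl//; apply: lee_nneseries => [*|k _]; first by apply: integral_ge0 => x _; exact: G0.
pose r := (2 / 3 * (rho * c ^+ k))%R.
have rk : (0 < r)%R by rewrite /r !mulr_gt0.
have -> : (rho * c ^+ k = 3 / 2 * r)%R by rewrite /r; field.
have -> : (rho * c ^+ k.+1 = 2 * r)%R by rewrite /r exprS /c; field.
have rE : (3 / 2 * r = rho * c ^+ k)%R by rewrite /r; field.
have yr : (enorm y / r <= s k)%R.
  rewrite ler_pdivrMr//; apply: (le_trans (ys k)).
  rewrite -rE -(sc k 5%N) -[leRHS]mulrA; apply: ler_wpM2l; first exact: ltW.
  by apply: ler_wpM2r; [exact: ltW|rewrite /c !exprS expr0; lra].
have yr1 : (enorm y < r)%R.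
  have := le_trans yr (s4 k); rewrite ler_pdivrMr//; have := enorm_ge0 y; lra.
clearbody r.
pose Fd (x : E) := (`|Omega ((x : V) - y) - Omega x| `^ q)%:E.
pose Fo (x : E) := (`|Omega x| `^ q)%:E.
have mFd : measurable_fun setT Fd.
  by apply/measurable_EFinP; exact: (measurable_diff_powR y (Omega_measurable dini)).
have mFo : measurable_fun setT Fo by exact: (measurable_Omega_powR dini).
have Fd0 x : 0 <= Fd x by rewrite lee_fin powR_ge0.
have Fo0 x : 0 <= Fo x by rewrite lee_fin powR_ge0.
have ri : (0 <= (r ^+ n)^-1)%R by rewrite invr_ge0 exprn_ge0// ltW.
apply: (@le_trans _ _ (\int[mu]_(x in shell (3 / 2 * r) (2 * r))
   ((C * (r ^+ n)^-1)%:E * Fd x + (C * (r ^+ n)^-1 * s k)%:E * Fo x))).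
  apply: ge0_le_lower_integral => x /andP[rx _]; first exact: G0.
  rewrite /Fd /Fo -!EFinM -EFinD lee_fin.
  have := @kernel_diff_le R n alpha alpha0 alphan Omega r (s k) x y rk rx.
  rewrite s4 (ltW (s0 k)) => /(_ isT).
  have -> : (enorm y <= s k * enorm x)%R.
    have := yr; rewrite ler_pdivrMr// => h; apply: (le_trans h).
    by apply: ler_wpM2l; [exact: ltW|have := enorm_ge0 y; lra].
  move=> /(_ isT) /le_trans; apply.
  by rewrite -/C mulrDr !mulrA.
have d1 : (0 <= C / r ^+ n)%R by rewrite mulr_ge0.
have d2 : (0 <= C / r ^+ n * s k)%R by rewrite mulr_ge0// ltW.
rewrite (lebn_integralD (measurable_shell _ _) (measurable_funeM _ mFd)
  (measurable_funeM _ mFo)); last 2 first.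
- by move=> x; rewrite mule_ge0.
- by move=> x; rewrite mule_ge0.
rewrite (lebn_integralZl (measurable_shell _ _) mFd Fd0 d1).
rewrite (lebn_integralZl (measurable_shell _ _) mFo Fo0 d2).
have b1 : \int[mu]_(x in shell (3 / 2 * r) (2 * r)) Fd x <= ((24 * r) ^+ n)%:E * modulus (s k).
  apply: (le_trans (shell_Omega_diff rk yr1)); apply: lee_wpmul2l.
    by rewrite lee_fin exprn_ge0// mulr_ge0// ltW.
  exact: modulus_le.
have b2 : \int[mu]_(x in shell (3 / 2 * r) (2 * r)) Fo x <= ((2 * r) ^+ n * L)%:E.
  rewrite EFinM -lB; apply: (shell_Omega_le hom dini).
    by rewrite mulr_gt0.
  by rewrite mulr_ge0// ltW.
apply: (le_trans (leeD (lee_wpmul2l _ b1) (lee_wpmul2l _ b2))).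
- by rewrite lee_fin mulr_ge0.
- by rewrite lee_fin !mulr_ge0// ltW.
have rn : (r ^+ n != 0)%R by rewrite expf_neq0// gt_eqF.
rewrite muleA -!EFinM.
have -> : (C / r ^+ n * (24 * r) ^+ n = C * 24 ^+ n)%R.
  by rewrite exprMn (mulrC (24 ^+ n)%R) mulrA divfK.
have -> : (C / r ^+ n * s k * ((2 * r) ^+ n * L) = C * (2 ^+ n * L) * s k)%R.
  by rewrite exprMn; move: (r ^+ n)%R rn (2 ^+ n)%R => p p0 A; field.
rewrite ge0_muleDr ?modulus_ge0 ?lee_fin ?(ltW (s0 k))// -EFinM.
apply: leeD.
  apply: lee_wpmul2r; first by rewrite modulus_ge0// ltW.
  by rewrite lee_fin; apply: ler_wpM2l => //; rewrite lerDl mulr_ge0// exprn_ge0.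
rewrite lee_fin; apply: ler_wpM2r; first exact: ltW.
by apply: ler_wpM2l => //; rewrite lerDr exprn_ge0.
Qed.

End KernelSmoothness.

(** * Radial integrals of homogeneous functions *)

Section Cancellation.
Context {R : realType} {n : nat}.
Hypothesis n0 : (0 < n)%N.
Local Notation V := 'rV[R]_n.
Local Notation E := (Rn R n).
Local Notation mu := (@lebn R n).
Local Open Scope ereal_scope.

Lemma hom_shell_integral (G : E -> \bar R) (r t : R) : (0 < r)%R -> (r <= t)%R ->
  measurable_fun setT G -> (forall x, 0 <= G x) ->
  (forall (s : R) (x : V), (0 < s)%R -> x != 0%R -> G (s *: x)%R = G x) ->
  \int[mu]_(x in shell 0 1) G x < +oo ->
  \int[mu]_(x in shell r t) G x = (t ^+ n - r ^+ n)%:E * \int[mu]_(x in shell 0 1) G x.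
Proof.
move=> r0 rt mG G0 hG Gfin.
have t0 : (0 < t)%R by exact: lt_le_trans rt.
have D : shell (R := R) (n := n) 0 t = shell 0 r `|` shell r t.
  apply/seteqP; split => x.
    move=> /andP[h1 h2]; case: (leP (enorm x) r) => xr; [left|right]; apply/andP; split => //.
  case => /andP[h1 h2]; apply/andP; split => //.
    exact: le_trans rt.
  exact: lt_trans h1.
have := hom_ball_integral t0 mG G0 hG.
rewrite D ge0_integral_setU//; first last.
- apply/eqP; apply/seteqP; split => x // [/andP[_ h1] /andP[h2 _]].
  by have := lt_le_trans h2 h1; rewrite ltxx.
- exact: measurable_funTS.
- exact: measurable_shell.
- exact: measurable_shell.
rewrite (hom_ball_integral r0 mG G0 hG).
have : \int[mu]_(x in shell 0 1) G x \is a fin_num.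
  by rewrite ge0_fin_numE// integral_ge0.
move: (\int[mu]_(x in shell 0 1) G x) => m /fineK <- h.
by rewrite EFinB muleBl// -h addeC addeK.
Qed.

(* Layer cake in the radial variable: [|x|^-n] is the length of the set of
   [l > 0] such that [l |x|^n <= 1]. *)
Lemma hom_radial_integral (G1 G2 : V -> R) (r s : R) : (0 < r)%R -> (r <= s)%R ->
  measurable_fun [set: E] (G1 : E -> R) -> measurable_fun [set: E] (G2 : E -> R) ->
  (forall x, 0 <= G1 x)%R -> (forall x, 0 <= G2 x)%R ->
  homogeneous0 G1 -> homogeneous0 G2 ->
  \int[mu]_(x in shell 0 1) (G1 x)%:E < +oo ->
  \int[mu]_(x in shell 0 1) (G1 x)%:E = \int[mu]_(x in shell 0 1) (G2 x)%:E ->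
  \int[mu]_(x in shell r s) (G1 x / enorm x ^+ n)%:E =
  \int[mu]_(x in shell r s) (G2 x / enorm x ^+ n)%:E.
Proof.
move=> r0 rs mG1 mG2 G10 G20 h1 h2 Gfin GE.
(* Outer radius of the part of the shell where l |x|^n <= 1: the number l^(-1/n) clamped to
   [r, s]. *)
pose rad (l : R) : R := (Num.max r (Num.min s (l^-1 `^ n%:R^-1)))%R.
have nn : (0 < n%:R :> R)%R by rewrite ltr0n.
have key (G : V -> R) : measurable_fun [set: E] (G : E -> R) -> (forall x, 0 <= G x)%R ->
    homogeneous0 G -> \int[mu]_(x in shell 0 1) (G x)%:E < +oo ->
    \int[mu]_(x in shell r s) (G x / enorm x ^+ n)%:E =
    \int[lebesgue_measure]_(l in `]0%R, +oo[)
       ((rad l ^+ n - r ^+ n)%:E * \int[mu]_(x in shell 0 1) (G x)%:E).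
  move=> mG G0 hG Gf.
  pose c (p : E * R) : bool := (0 < p.2)%R && (p.2 * enorm p.1 ^+ n <= 1)%R &&
    ((r < enorm p.1)%R && (enorm p.1 <= s)%R).
  pose H (p : E * measurableTypeR R) := (G p.1 * (c p)%:R)%:E.
  have me : measurable_fun [set: E * measurableTypeR R] (fun p => enorm p.1).
    by apply: measurable_enorm; exact: coordm_fst_id.
  have mc : measurable_fun [set: E * measurableTypeR R] (c : E * measurableTypeR R -> bool).
    apply: measurable_and; apply: measurable_and.
    - by apply: measurable_fun_ltr; [exact: measurable_cst|exact: measurable_snd].
    - apply: measurable_fun_ler; last exact: measurable_cst.
      exact: (measurable_funM measurable_snd (measurable_funX _ me)).
    - by apply: measurable_fun_ltr => //; exact: measurable_cst.
    - by apply: measurable_fun_ler => //; exact: measurable_cst.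
  have mH : measurable_fun setT H.
    apply/measurable_EFinP; apply: measurable_funM; last exact: measurable_natr.
    exact: (measurableT_comp mG measurable_fst).
  have H0 p : 0 <= H p by rewrite lee_fin mulr_ge0.
  have : \int[mu]_x \int[@lebesgue_measure R]_l H (x, l) =
      \int[@lebesgue_measure R]_l \int[mu]_x H (x, l) by exact: fubini_tonelli.
  have -> : \int[mu]_x \int[lebesgue_measure]_l H (x, l) =
     \int[mu]_(x in shell r s) (G x / enorm x ^+ n)%:E.
    rewrite [RHS]integral_mkcond; apply: eq_integral => x _; rewrite patchE.
    case: ifPn => [|xS].
      rewrite inE => xS; case/andP: (xS) => rx xs.
      have x0 : (0 < enorm x ^+ n)%R by rewrite exprn_gt0// (lt_trans r0).
      transitivity (\int[lebesgue_measure]_(l in `]0%R, (enorm x ^+ n)^-1%R]) (cst (G x)%:E l)).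
        rewrite [RHS]integral_mkcond; apply: eq_integral => l _; rewrite patchE /H /c /= rx xs andbT.
        rewrite mem_setE in_itv/= -[(enorm x ^+ n)^-1%R]div1r ler_pdivlMr//.
        by case: ifP => _; rewrite ?mulr1 ?mulr0.
      rewrite integral_cst; last exact: measurable_itv.
      transitivity ((G x)%:E * ((enorm x ^+ n)^-1)%:E); last by rewrite -EFinM.
      congr (_ * _); have := @lebesgue_measure_itv R `]0%R, (enorm x ^+ n)^-1%R].
      by rewrite /= lte_fin invr_gt0 x0 oppr0 adde0.
    rewrite integral0_eq// => l _; rewrite /H /c /=.
    by move: xS; rewrite notin_setE => /negP/negPf; rewrite /shell /= => ->; rewrite andbF mulr0.
  move=> ->; rewrite [RHS]integral_mkcond; apply: eq_integral => l _; rewrite patchE.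
  rewrite mem_setE in_itv/= andbT; case: ifPn => l0; last first.
    by rewrite integral0_eq// => x _; rewrite /H /c /= (negPf l0) mulr0.
  rewrite -(@hom_shell_integral (fun x => (G x)%:E) r (rad l))//; first last.
  - by move=> t x t0 x0; rewrite hG.
  - exact/measurable_EFinP.
  - by rewrite /rad le_max lexx.
  rewrite [RHS]integral_mkcond; apply: eq_integral => x _; rewrite patchE.
  have -> : (x \in shell r (rad l)) = (r < enorm x <= rad l)%R.
    by apply/idP/idP; rewrite inE.
  rewrite /H /c /= l0/=.
  suff -> : (l * enorm x ^+ n <= 1)%R && ((r < enorm x)%R && (enorm x <= s)%R) =
      ((r < enorm x) && (enorm x <= rad l))%R.
    by case: ifP => _; rewrite ?mulr1 ?mulr0.
  have [rx|] /= := ltP r (enorm x); last by rewrite andbF.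
  rewrite /rad le_max leNgt rx/= le_min andbC; congr (_ && _).
  rewrite mulrC -ler_pdivlMr// div1r.
  have x0 : (0 <= enorm x)%R by rewrite enorm_ge0.
  have li : (0 <= l^-1)%R by rewrite invr_ge0 ltW.
  rewrite -powR_mulrn//; apply/idP/idP => h.
    have := @ge0_ler_powR R n%:R^-1 _ (enorm x `^ n%:R)%R (l^-1)%R.
    rewrite invr_ge0 ler0n !nnegrE powR_ge0 => /(_ isT isT li h).
    by rewrite -powRrM mulfV ?gt_eqF// powRr1.
  have := @ge0_ler_powR R n%:R _ (enorm x) (l^-1 `^ n%:R^-1)%R.
  rewrite ler0n !nnegrE => /(_ isT x0 (powR_ge0 _ _) h).
  by rewrite -powRrM mulVf ?gt_eqF// powRr1.
rewrite !key//; last by rewrite -GE.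
by rewrite GE.
Qed.

End Cancellation.

Lemma geometric_sum_lty {R : realType} (a : R) : 0 < a < 1 ->
  (\sum_(k <oo) (a ^+ k.+1)%:E < +oo)%E.
Proof.
move=> a01; have a0 : 0 < a by case/andP: a01.
pose v t := (Num.max t 0)%R%:E : \bar R.
have v0 t : (0 <= v t)%E by rewrite lee_fin le_max lexx orbT.
have -> : (\sum_(k <oo) (a ^+ k.+1)%:E = \sum_(k <oo) v (a ^+ k.+1)%R)%E.
  by apply: eq_eseriesr => k _; rewrite /v max_l// exprn_ge0// ltW.
apply: (@dini_sum_lty R v _ a01 v0).
- by move=> s t st; rewrite lee_fin ge_max !le_max st lexx orbT.
- apply: (@le_lt_trans _ _ (\int[lebesgue_measure]_(t in `]0%R, 1%R]) (cst 1 t))%E).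
    apply: ge0_le_lower_integral => t; rewrite /= in_itv/= => /andP[t0 _].
      by rewrite /v -EFinM lee_fin max_l ?(ltW t0)// mulfV// gt_eqF.
    by rewrite /v -EFinM lee_fin max_l ?(ltW t0)// mulfV// gt_eqF.
  by rewrite integral_cst//= lebesgue_measure_itv/= lte_fin ltr01 oppr0 adde0 mul1e ltry.
Qed.

(** What the later arguments use of the kernel. It is stated for any Borel function, so that the
    representative [K0], which is homogeneous only almost everywhere, can take the place of K. *)
Record good_kernel {R : realType} {n : nat} (q : R) (K : 'rV[R]_n -> R) : Prop := {
  gk_borel : borel_fun K;
  gk_smooth : forall e : R, 0 < e -> exists M : R, 2 <= M /\
    forall (rho : R) (y : 'rV[R]_n), 0 < rho -> M * enorm y <= rho ->
    (\int[@lebn R n]_(x in outside rho) (`|K ((x : 'rV[R]_n) - y) - K x| `^ q)%:E <= e%:E)%E;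
  gk_size : exists L : R, 0 <= L /\ forall r s, 0 < r -> r <= s ->
    (\int[@lebn R n]_(x in shell r s) (`|K x| `^ q)%:E <= ((s / r) ^+ n * L)%:E)%E }.

(** * The Borel representative of the kernel *)

Section KernelBorel.
Context {R : realType} {n : nat} {alpha : R}.
Hypothesis n0 : (0 < n)%N.
Hypothesis alpha0 : 0 <= alpha.
Hypothesis alphan : alpha < n%:R.
Local Notation V := 'rV[R]_n.
Local Notation E := (Rn R n).
Local Notation mu := (@lebn R n).
Local Notation beta := (n%:R - alpha).
Local Notation q := (n%:R / (n%:R - alpha)).
Variable Omega : V -> R.
Hypothesis hom : homogeneous0 Omega.
Hypothesis dini : Lq_Dini q Omega.
Local Notation K := (omega_kernel alpha Omega).
Local Notation LqB := (@LqB R n alpha Omega).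
Local Open Scope ereal_scope.

Lemma kernel0 : K 0 = 0%R.
Proof.
by rewrite /omega_kernel enorm0 powR0 ?invr0 ?mulr0// gt_eqF// subr_gt0.
Qed.

Lemma le1_powR (t : R) : (0 <= t)%R -> (t <= 1 + t `^ q)%R.
Proof.
move=> t0; have [t1|t1] := leP t 1%R.
  by apply: (le_trans t1); rewrite lerDl powR_ge0.
apply: (@le_trans _ _ (t `^ q)%R); last by rewrite lerDr.
by rewrite -{1}[t]powRr1//; apply: ler_powR; [exact: ltW|exact: (q_ge1 alpha0 alphan)].
Qed.

Lemma shell01_fin : mu (shell 0 1) < +oo.
Proof.
by apply: le_lt_trans (lebn_cball_lty 1); apply: le_lebn => x /andP[].
Qed.

Lemma integral_1DOmega : \int[mu]_(x in shell 0 1) (1 + `|Omega x| `^ q)%:E < +oo.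
Proof.
under eq_integral do rewrite EFinD.
rewrite (lebn_integralD (measurable_shell _ _) (measurable_cst _)
  (measurable_Omega_powR dini)) => [|x|x]; [|by []|by rewrite lee_fin powR_ge0].
rewrite integral_cst; last exact: measurable_shell.
rewrite mul1e; apply: lte_add_pinfty; first exact: shell01_fin.
exact: (LqB_lty n0 hom dini).
Qed.

(** On the shell of radius about 2^-k the kernel is at most 2^((k + 1) beta) |Omega| and the volume
    scales as 2^(-k n), so the shell contributes a multiple of 2^(-alpha (k + 1)); the series
    converges because alpha > 0. *)
Lemma kernel_L1loc : (0 < alpha)%R -> \int[mu]_(x in cball 1) (`|K x|)%:E < +oo.
Proof.
move=> al0.
have -> : \int[mu]_(x in cball 1) (`|K x|)%:E = \int[mu]_(x in shell 0 1) (`|K x|)%:E.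
  rewrite [LHS]integral_mkcond [RHS]integral_mkcond; apply: eq_integral => x _.
  rewrite !patchE; have [->|x0] := eqVneq (x : V) 0%R.
    by rewrite kernel0 normr0; case: ifP => _; case: ifP.
  suff -> : (x \in cball 1) = (x \in shell 0 1) by [].
  by apply/idP/idP; rewrite !inE /cball /shell /= enorm_gt0 x0.
have c1 : (1 < 2 :> R)%R by rewrite ltr1n.
rewrite (unit_shells c1).
have mK : measurable_fun [set: E] (fun x : E => (`|K x|)%:E).
  apply/measurable_EFinP; apply: (measurableT_comp (@normr_measurable R setT)).
  exact: kernel_measurable dini.
rewrite ge0_integral_bigcup; first last.
- apply/trivIsetP => i j _ _ ij; apply/seteqP; split => x // [/andP[h1 h2] /andP[h3 h4]].
  have key (a b : nat) : (a < b)%N -> (enorm x <= (2 ^+ b)^-1)%R -> ((2 ^+ a.+1)^-1 < enorm x)%R -> False.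
    move=> ab u v; have := lt_le_trans v u.
    rewrite ltf_pV2 ?posrE ?exprn_gt0// ltNge => /negP; apply.
    by rewrite ler_weXn2l// ler1n.
  by have [h|h|h] := ltngtP i j; [exact: (key i j)|exact: (key j i)|rewrite h eqxx in ij].
- by [].
- exact: measurable_funTS.
- by move=> k; exact: measurable_shell.
pose G (x : E) := (1 + `|Omega x| `^ q)%:E.
have mG : measurable_fun setT G.
  apply/measurable_EFinP; apply: measurable_funD; first exact: measurable_cst.
  by have /measurable_EFinP := measurable_Omega_powR dini.
have G0 x : 0 <= G x by rewrite lee_fin addr_ge0// powR_ge0.
have hG (s : R) (x : V) : (0 < s)%R -> x != 0%R -> G (s *: x)%R = G x.
  by move=> s0 x0; rewrite /G hom.
set m := \int[mu]_(x in shell 0 1) G x.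
have mfin : m < +oo by exact: integral_1DOmega.
have m0 : 0 <= m by exact: integral_ge0.
have mE : m = (fine m)%:E by rewrite fineK// ge0_fin_numE.
pose a : R := (2 `^ (- alpha))%R.
have a01 : (0 < a < 1)%R.
  rewrite powR_gt0//= /a powRN invf_lt1 ?powR_gt0//.
  by rewrite /powR pnatr_eq0/= expR_gt1 mulr_gt0// ln_gt0.
have a0 : (0 < a)%R by case/andP: a01.
pose b : R := (2 `^ beta)%R.
have b0 : (0 < b)%R by rewrite powR_gt0.
have bE : b = (2 ^+ n * a)%R.
  by rewrite /b /a powRD ?powR_mulrn// pnatr_eq0 implybT.
have bk k : ((2 ^+ k) `^ beta = b ^+ k)%R.
  by rewrite -[(2 ^+ k)%R]powR_mulrn// powRAC powR_mulrn ?powR_ge0.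
have M0 : (0 <= fine m)%R by rewrite fine_ge0.
apply: (@le_lt_trans _ _ ((2 ^+ n * fine m)%:E * \sum_(k <oo) (a ^+ k.+1)%:E)).
  rewrite -nneseriesZl; last by move=> k _; rewrite lee_fin exprn_ge0// ltW.
  apply: lee_nneseries => [*|k _]; first by apply: integral_ge0 => x _; rewrite lee_fin.
  have p0 j : (0 < 2 ^+ j :> R)%R by rewrite exprn_gt0.
  apply: (@le_trans _ _ (\int[mu]_(x in shell (2 ^+ k.+1)^-1 (2 ^+ k)^-1) ((b ^+ k.+1)%:E * G x))).
    apply: ge0_le_lower_integral => x /andP[x1 x2]; first by rewrite lee_fin.
    have x0 : (0 < enorm x)%R by apply: lt_trans x1; rewrite invr_gt0.
    have xb : (0 < enorm x `^ beta)%R by rewrite powR_gt0.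
    rewrite /G -EFinM lee_fin normrM normfV (gtr0_norm xb) mulrC; apply: ler_pM => //.
    - by rewrite invr_ge0 ltW.
    - rewrite -bk -[leRHS]invrK lef_pV2 ?posrE ?invr_gt0 ?powR_gt0//.
      rewrite -powR_inv1 ?powR_ge0// powRAC powR_inv1 ?(ltW (p0 _))//.
      apply: ge0_ler_powR; rewrite ?nnegrE ?invr_ge0 ?(ltW x0) ?(ltW x1) ?(ltW (p0 _))//.
      by rewrite subr_ge0 ltW.
    - exact: le1_powR.
  rewrite (lebn_integralZl (measurable_shell _ _) mG G0); last by rewrite exprn_ge0// ltW.
  apply: (@le_trans _ _ ((b ^+ k.+1)%:E * (((2 ^+ k)^-1 ^+ n)%:E * m))).
    apply: lee_wpmul2l; first by rewrite lee_fin exprn_ge0// ltW.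
    rewrite -(hom_ball_integral _ mG G0 hG) ?invr_gt0//.
    apply: ge0_subset_lower_integral => // x /andP[x1 x2]; apply/andP; split => //.
    by apply: lt_trans x1; rewrite invr_gt0.
  rewrite mE -!EFinM lee_fin le_eqVlt; apply/orP; left; apply/eqP.
  rewrite bE exprVn -exprM mulnC exprM exprMn (exprS (2 ^+ n)%R).
  by move: (p0 n); move: (2 ^+ n)%R => d d0; field; rewrite expf_neq0// gt_eqF.
rewrite lte_mul_pinfty// ?lee_fin ?mulr_ge0//.
  by rewrite geometric_sum_lty.
Qed.

(** The positive and negative parts of Omega have equal finite integrals over the unit ball;
    [hom_radial_integral] carries this equality over to the parts of K on a shell. *)
Lemma kernel_cancel (r s : R) : alpha = 0%R ->
  sphere_integral (fun x => (Omega x)%:E) = 0 -> (0 < r)%R -> (r <= s)%R ->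
  \int[mu]_(x in shell r s) (K x)%:E = 0.
Proof.
move=> al0 sph r0 rs.
have mO := Omega_measurable dini.
pose P (x : V) := Num.max (Omega x) 0%R; pose N (x : V) := Num.max (- Omega x)%R 0%R.
have mP : measurable_fun [set: E] (P : E -> R).
  by apply: measurable_maxr => //; exact: measurable_cst.
have mN : measurable_fun [set: E] (N : E -> R).
  by apply: measurable_maxr; [exact: measurable_funN|exact: measurable_cst].
have P0 x : (0 <= P x)%R by rewrite le_max lexx orbT.
have N0 x : (0 <= N x)%R by rewrite le_max lexx orbT.
have hP : homogeneous0 P by move=> t x t0 x0; rewrite /P hom.
have hN : homogeneous0 N by move=> t x t0 x0; rewrite /N hom.
have fin (F : V -> R) : (forall x, 0 <= F x)%R -> (forall x, F x <= `|Omega x|)%R ->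
    \int[mu]_(x in shell 0 1) (F x)%:E < +oo.
  move=> F0 FO; apply: le_lt_trans integral_1DOmega.
  apply: ge0_le_lower_integral => x _; first by rewrite lee_fin.
  by rewrite lee_fin (le_trans (FO x))// le1_powR.
have fP : \int[mu]_(x in shell 0 1) (P x)%:E < +oo.
  by apply: fin => // x; rewrite /P ge_max ler_norm normr_ge0.
have fN : \int[mu]_(x in shell 0 1) (N x)%:E < +oo.
  by apply: fin => // x; rewrite /N ge_max normr_ge0 andbT -normrN ler_norm.
have PN : \int[mu]_(x in shell 0 1) (P x)%:E = \int[mu]_(x in shell 0 1) (N x)%:E.
  move: sph; rewrite (sphere_integral_hom EFin hom) integralE.
  have -> : \int[mu]_(x in shell 0 1) ((EFin \o Omega)^\+ x) = \int[mu]_(x in shell 0 1) (P x)%:E.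
    by apply: eq_integral => x _; rewrite funeposE /P /= EFin_max.
  have -> : \int[mu]_(x in shell 0 1) ((EFin \o Omega)^\- x) = \int[mu]_(x in shell 0 1) (N x)%:E.
    by apply: eq_integral => x _; rewrite funenegE /N /= EFin_max.
  have pf : \int[mu]_(x in shell 0 1) (P x)%:E \is a fin_num.
    by rewrite ge0_fin_numE// integral_ge0// => x _; rewrite lee_fin.
  have nf : \int[mu]_(x in shell 0 1) (N x)%:E \is a fin_num.
    by rewrite ge0_fin_numE// integral_ge0// => x _; rewrite lee_fin.
  move/eqP; rewrite mule_eq0 eqe pnatr_eq0 gtn_eqF//=.
  rewrite -(fineK pf) -(fineK nf) -EFinB eqe subr_eq0 => /eqP e.
  by rewrite e.
rewrite integralE.
have E1 : \int[mu]_(x in shell r s) ((fun x => (K x)%:E)^\+ x) =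
    \int[mu]_(x in shell r s) (P x / enorm x ^+ n)%:E.
  apply: eq_integral => x; rewrite inE => /andP[x1 _].
  have x0 : (0 < enorm x)%R by exact: lt_trans x1.
  have i0 : (0 <= (enorm x ^+ n)^-1)%R by rewrite invr_ge0 exprn_ge0// ltW.
  rewrite funeposE /omega_kernel al0 subr0 powR_mulrn ?(ltW x0)// /P.
  by rewrite -EFin_max maxr_pMl// mul0r.
have E2 : \int[mu]_(x in shell r s) ((fun x => (K x)%:E)^\- x) =
    \int[mu]_(x in shell r s) (N x / enorm x ^+ n)%:E.
  apply: eq_integral => x; rewrite inE => /andP[x1 _].
  have x0 : (0 < enorm x)%R by exact: lt_trans x1.
  have i0 : (0 <= (enorm x ^+ n)^-1)%R by rewrite invr_ge0 exprn_ge0// ltW.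
  rewrite funenegE /omega_kernel al0 subr0 powR_mulrn ?(ltW x0)// /N.
  by rewrite -EFinN -EFin_max maxr_pMl// mul0r mulNr.
rewrite E1 E2 (hom_radial_integral n0 r0 rs mP mN P0 N0 hP hN fP PN) subee//.
rewrite ge0_fin_numE; last by apply: integral_ge0 => x _; rewrite lee_fin divr_ge0// exprn_ge0// enorm_ge0.
apply: (@le_lt_trans _ _ (((r ^+ n)^-1)%:E * \int[mu]_(x in shell 0 s) (N x)%:E)); last first.
  have mN' : measurable_fun setT (fun x : E => (N x)%:E) by exact/measurable_EFinP.
  rewrite (hom_ball_integral _ mN')//; last 2 first.
  - by rewrite (lt_le_trans r0).
  - by move=> t x t0 x0; rewrite hN.
  have i0 : 0 <= \int[mu]_(x in shell 0 1) (N x)%:E.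
    by apply: integral_ge0 => x _; rewrite lee_fin.
  by rewrite muleA -EFinM lte_mul_pinfty// lee_fin mulr_ge0 ?invr_ge0 ?exprn_ge0// ltW// (lt_le_trans r0).
have mN' : measurable_fun setT (fun x : E => (N x)%:E) by exact/measurable_EFinP.
have ri : (0 <= (r ^+ n)^-1)%R by rewrite invr_ge0 exprn_ge0// ltW.
rewrite -(lebn_integralZl (measurable_shell _ _) mN')//.
apply: (@le_trans _ _ (\int[mu]_(x in shell r s) (((r ^+ n)^-1)%:E * (N x)%:E))).
  apply: ge0_le_lower_integral => x /andP[x1 x2].
    by rewrite lee_fin divr_ge0// exprn_ge0// enorm_ge0.
  rewrite -EFinM lee_fin mulrC; apply: ler_wpM2r => //.
  have x0 : (0 < enorm x)%R by exact: lt_trans x1.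
  rewrite lef_pV2 ?posrE ?exprn_gt0//; apply: lerXn2r; rewrite ?nnegrE ?(ltW r0) ?(ltW x0)//.
  exact: ltW.
apply: ge0_subset_lower_integral => [x|x /andP[x1 x2]].
  by rewrite mule_ge0// lee_fin.
by apply/andP; split => //; exact: lt_trans x1.
Qed.

Lemma kernel_borel_repr : exists K0 : V -> R, [/\ good_kernel q K0,
  mu [set x | K0 x <> K x] = 0,
  ((0 < alpha)%R -> \int[mu]_(x in cball 1) (`|K0 x|)%:E < +oo) &
  (alpha = 0%R -> sphere_integral (fun x => (Omega x)%:E) = 0 ->
   forall r s, (0 < r)%R -> (r <= s)%R -> \int[mu]_(x in shell r s) (K0 x)%:E = 0)].
Proof.
have mK := kernel_measurable dini.
have [N [bN N0 bK0]] := borel_repr mK.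
set K0 := (fun x => _) in bK0; exists K0.
have K0E : mu [set x | K0 x <> K x] = 0.
  by apply: sub_lebn0 N0 => x /=; rewrite /K0; case: asboolP.
have mK0 := borel_fun_measurable bK0.
have mabs (G : V -> R) : measurable_fun [set: E] (G : E -> R) ->
    measurable_fun [set: E] (fun x : E => (`|G x|)%:E).
  move=> mG; apply/measurable_EFinP; apply: (measurableT_comp (@normr_measurable R setT)).
  exact: mG.
have mpow (G : V -> R) : measurable_fun [set: E] (G : E -> R) ->
    measurable_fun [set: E] (fun x : E => (`|G x| `^ q)%:E).
  move=> mG; apply/measurable_EFinP; apply: (measurableT_comp (measurable_powR _)).
  apply: (measurableT_comp (@normr_measurable R setT)); exact: mG.
split => //.
- split => //.
  + move=> e e0; have [M [M2 hM]] := kernel_smooth n0 alpha0 alphan hom dini e0.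
    exists M; split => // rho y r0 yM.
    rewrite (@integral_eq_off_null R n _ _ (fun x : E => (`|K ((x : V) - y) - K x| `^ q)%:E)).
    * exact: hM.
    * exact: measurable_outside.
    * by apply/measurable_EFinP; exact: measurable_diff_powR.
    * by apply/measurable_EFinP; exact: measurable_diff_powR.
    apply: (@sub_lebn0 _ _ _ ([set x | K0 x <> K x] `|` affine 1 (- y) @^-1` [set x | K0 x <> K x])).
      move=> x /= h; apply: contrapT => /not_orP[/contrapT h1 /contrapT].
      by rewrite /affine scale1r => h2; apply: h; rewrite h1 h2.
    apply/eqP; rewrite eq_le lebn_ge0 andbT; apply: (le_trans (lebn_setU_le _ _)).
    by rewrite lebn_affine ?oner_neq0// K0E mule0 adde0.
  + exists (fine LqB); split; first by rewrite fine_ge0// LqB_ge0.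
    move=> r s r0 rs; rewrite EFinM -(LqB_fin n0 hom dini).
    apply: le_trans (kernel_size alphan hom dini r0 rs).
    rewrite (@integral_eq_off_null R n _ _ (fun x : E => (`|K x| `^ q)%:E)).
    * by [].
    * exact: measurable_shell.
    * exact: mpow.
    * exact: mpow.
    * by apply: sub_lebn0 K0E => x /= h e; apply: h; rewrite e.
- move=> al0; rewrite (@integral_eq_off_null R n _ _ (fun x : E => (`|K x|)%:E)).
  + exact: kernel_L1loc.
  + exact: measurable_cball.
  + exact: mabs.
  + exact: mabs.
  + by apply: sub_lebn0 K0E => x /= h e; apply: h; rewrite e.
- move=> al0 sph r s r0 rs.
  rewrite (@integral_eq_off_null R n _ _ (fun x : E => (K x)%:E)).
  + exact: kernel_cancel.
  + exact: measurable_shell.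
  + exact/measurable_EFinP.
  + exact/measurable_EFinP.
  + by apply: sub_lebn0 K0E => x /= h e; apply: h; rewrite e.
Qed.

End KernelBorel.

(** * Convolution with truncated kernels *)

Section Convolution.
Context {R : realType} {n : nat}.
Local Notation V := 'rV[R]_n.
Local Notation E := (Rn R n).
Local Notation mu := (@lebn R n).
Local Open Scope ereal_scope.

Definition kcut (K : V -> R) (e : R) (w : V) : R := (K w * (e < enorm w)%R%:R)%R.

Definition conv (k : V -> R) (f : V -> R) (x : V) : R :=
  Defs.Rint mu setT (fun y : E => k (x - (y : V)) * f y)%R.

(** Uniformity in the translate y is what Tonelli's theorem needs to make the convolution with any
    integrable function absolutely convergent almost everywhere. *)
Definition loc_unif_integrable (k : V -> R) : Prop := forall r : R, (0 < r)%R ->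
  exists C : R, (0 <= C)%R /\ forall y : V,
    \int[mu]_(x in cball r) (`|k ((x : V) - y)|)%:E <= C%:E.

Lemma coordm_sub : coord_measurable (fun p : E * E => (p.1 : V) - (p.2 : V))%R.
Proof. by apply: coordmB; [exact: coordm_fst_id|exact: coordm_snd_id]. Qed.

Lemma coordm_subl (c : V) : coord_measurable (fun x : E => (x : V) - c)%R.
Proof. by apply: coordmB; [exact: coordm_id|exact: coordm_cst]. Qed.

Lemma coordm_subr (c : V) : coord_measurable (fun y : E => c - (y : V))%R.
Proof. by apply: coordmB; [exact: coordm_cst|exact: coordm_id]. Qed.

Lemma coordm_enorm_lt d (T : measurableType d) (m : T -> V) (e : R) :
  coord_measurable m -> measurable_fun setT (fun p => e < enorm (m p))%R.
Proof.
by move=> cm; apply: measurable_fun_ltr; [exact: measurable_cst|exact: measurable_enorm].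
Qed.

Lemma measurable_kcut d (T : measurableType d) (m : T -> V) (K : V -> R) (e : R) :
  borel_fun K -> coord_measurable m -> measurable_fun setT (fun p => kcut K e (m p)).
Proof.
move=> bK cm; apply: measurable_funM; first exact: (borel_fun_comp bK).
by apply: measurable_natr; exact: coordm_enorm_lt.
Qed.

Lemma borel_coord i : borel_fun (fun x : V => x ord0 i).
Proof.
apply: borel_funP => q0.
have -> : [set x : V | x ord0 i < ratr q0]%R = \bigcup_(N : nat)
    box (const_mx (- N%:R)%R) (\row_j (if j == i then ratr q0 else N%:R)%R).
  apply/seteqP; split => x /=; last first.
    by move=> [N _ /(_ i)]; rewrite !mxE eqxx => /andP[].
  move=> xq; have [N hN] := cst_le_coord x; exists N => // j; rewrite !mxE.
  have := hN j; rewrite ltr_norml => /andP[/ltW -> h].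
  by case: eqP => [->|_].
by apply: borel_bigcup => N; exact: borel_box.
Qed.

Lemma borel_kcut (K : V -> R) (e : R) : borel_fun K -> borel_fun (kcut K e).
Proof.
move=> bK; apply: measurable_kcut => //.
by move=> i; exact: borel_coord.
Qed.

Lemma measurable_abs d (T : measurableType d) (f : T -> R) : measurable_fun setT f ->
  measurable_fun setT (fun x => `|f x|%:E).
Proof.
move=> mf; apply/measurable_EFinP; exact: (measurableT_comp (@normr_measurable R setT)).
Qed.

Lemma translation_integral (F : E -> \bar R) (D : set E) (c : V) :
  measurable D -> measurable_fun setT F -> (forall x, 0 <= F x) ->
  \int[mu]_(x in (affine 1 (- c)%R : E -> E) @^-1` D) F ((x : V) - c)%R =
  \int[mu]_(x in D) F x.
Proof.
move=> mD mF F0; have := @ge0_integral_affine R n 1 (- c)%R D F (oner_neq0 _) mD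
  (measurable_funTS mF) F0.
rewrite normr1 expr1n invr1 mul1e => <-.
by apply: eq_integral => x _; rewrite /affine scale1r.
Qed.

Lemma reflection_integral (F : E -> \bar R) (D : set E) (c : V) :
  measurable D -> measurable_fun setT F -> (forall x, 0 <= F x) ->
  \int[mu]_(x in (affine (-1) c : E -> E) @^-1` D) F (c - (x : V))%R =
  \int[mu]_(x in D) F x.
Proof.
move=> mD mF F0; have := @ge0_integral_affine R n (-1)%R c D F _ mD
  (measurable_funTS mF) F0.
rewrite oppr_eq0 oner_eq0 normrN1 expr1n invr1 mul1e => /(_ isT) <-.
by apply: eq_integral => x _; rewrite /affine scaleN1r addrC.
Qed.

Lemma conv_tonelli (k : V -> R) (f : V -> R) (r C : R) : borel_fun k ->
  measurable_fun [set: E] (f : E -> R) -> (0 <= C)%R ->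
  (forall y : V, \int[mu]_(x in cball r) (`|k ((x : V) - y)|)%:E <= C%:E) ->
  \int[mu]_(x in cball r) \int[mu]_y (`|k ((x : V) - (y : V)) * f y|)%:E
    <= C%:E * \int[mu]_y (`|f y|)%:E.
Proof.
move=> bk mf C0 hC.
have mF : measurable_fun setT (fun p : E * E => (`|k ((p.1 : V) - (p.2 : V)) * f p.2|)%:E).
  apply: measurable_abs; apply: measurable_funM.
    exact: (borel_fun_comp bk coordm_sub).
  exact: (measurableT_comp mf measurable_snd).
rewrite (tonelli (measurable_cball r) measurableT mF) => [|p]; last by rewrite lee_fin.
rewrite -(lebn_integralZl measurableT (measurable_abs mf))//.
apply: ge0_le_lower_integral => y _.
  by apply: integral_ge0 => x _; rewrite lee_fin.
rewrite (_ : \int[mu]_(x in cball r) _ =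
    \int[mu]_(x in cball r) ((`|f y|)%:E * (`|k ((x : V) - (y : V))|)%:E)); last first.
  by apply: eq_integral => x _; rewrite normrM mulrC EFinM.
have mk : measurable_fun setT (fun x : E => (`|k ((x : V) - (y : V))|)%:E).
  by apply: measurable_abs; exact: (borel_fun_comp bk (coordm_subl _)).
rewrite (lebn_integralZl (measurable_cball r) mk)// muleC.
by apply: lee_wpmul2r; [rewrite lee_fin|exact: hC].
Qed.

Lemma measurable_conv_integrand (k : V -> R) (f : V -> R) (x : V) : borel_fun k ->
  measurable_fun [set: E] (f : E -> R) ->
  measurable_fun [set: E] (fun y : E => k (x - (y : V)) * f y)%R.
Proof.
move=> bk mf; exact: (measurable_funM (borel_fun_comp bk (coordm_subr _)) mf).
Qed.

Definition conv_integrable (k f : V -> R) (x : V) : Prop :=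
  mu.-integrable setT (fun y : E => (k (x - (y : V)) * f y)%:E).

Lemma conv_integrableP (k f : V -> R) (x : V) : borel_fun k ->
  measurable_fun [set: E] (f : E -> R) ->
  \int[mu]_y (`|k (x - (y : V)) * f y|)%:E < +oo -> conv_integrable k f x.
Proof.
move=> bk mf h; apply/integrableP; split; last exact: h.
by apply/measurable_EFinP; exact: measurable_conv_integrand.
Qed.

Lemma lebn0_infty (D : set E) (F : E -> \bar R) : measurable D ->
  measurable_fun setT F -> (forall x, 0 <= F x) ->
  \int[mu]_(x in D) F x < +oo -> mu [set x | D x /\ ~ (F x < +oo)] = 0.
Proof.
move=> mD mF F0 Ffin.
have : mu.-integrable D F.
  apply/integrableP; split; first exact: measurable_funTS.
  rewrite (_ : (fun _ => _) = F)//; apply/funext => x; exact: gee0_abs.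
move/(integrable_ae mD) => [N [mN N0 hN]].
apply: sub_lebn0 N0 => x [Dx Fx]; apply: hN => /= h; apply: Fx.
by have := h Dx; rewrite ge0_fin_numE.
Qed.

Lemma conv_integrable_ae (k : V -> R) (f : V -> R) : borel_fun k ->
  loc_unif_integrable k -> mu.-integrable setT (fun y : E => (f y)%:E) ->
  mu [set x | ~ conv_integrable k f x] = 0.
Proof.
move=> bk hk fi; have /integrableP[/measurable_EFinP mf ffin] := fi.
apply: (@sub_lebn0 _ _ _ (\bigcup_N [set x | cball N.+1%:R x /\
   ~ (\int[mu]_y (`|k (x - (y : V)) * f y|)%:E < +oo)])).
  move=> x h; exists (Num.trunc (enorm x)) => //; split.
    by rewrite /cball /= ltW// truncnS_gt.
  by move=> h'; apply: h; exact: conv_integrableP.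
apply: lebn_null_bigcup => N.
have [C [C0 hC]] := hk N.+1%:R (ltr0Sn _ _).
apply: lebn0_infty.
- exact: measurable_cball.
- apply: (@tonelli_measurable R n setT (fun p : E * E =>
     (`|k ((p.1 : V) - (p.2 : V)) * f p.2|)%:E)) => //.
  apply: measurable_abs; apply: measurable_funM.
    exact: (borel_fun_comp bk coordm_sub).
  exact: (measurableT_comp mf measurable_snd).
- by move=> x; apply: integral_ge0 => y _; rewrite lee_fin.
apply: le_lt_trans (conv_tonelli bk mf C0 hC) _.
by rewrite lte_mul_pinfty// lee_fin.
Qed.

Variables (q : R) (q1 : (1 <= q)%R) (K : V -> R) (gK : good_kernel q K).

Let bK := gk_borel gK.

Lemma le1_powRq (t : R) : (0 <= t)%R -> (t <= 1 + t `^ q)%R.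
Proof.
move=> t0; have [t1|t1] := leP t 1%R.
  by apply: (le_trans t1); rewrite lerDl powR_ge0.
apply: (@le_trans _ _ (t `^ q)%R); last by rewrite lerDr.
by rewrite -{1}[t]powRr1//; apply: ler_powR => //; exact: ltW.
Qed.

(** By t <= 1 + t^q only |K|^q matters. For |y| <= 2 r the arguments x - y kept by the truncation
    lie between e and 3 r + e; for larger |y| they lie between |y| / 2 and 2 |y|, where [gk_size]
    gives 4^n L whatever y is. *)
Lemma kcut_unif (e : R) : (0 < e)%R -> loc_unif_integrable (kcut K e).
Proof.
move=> e0 r r0; have [L [L0 hL]] := gk_size gK.
pose v : R := fine (mu (cball r)).
have vE : mu (cball r) = v%:E by rewrite fineK// ge0_fin_numE ?lebn_ge0// lebn_cball_lty.
have v0 : (0 <= v)%R by rewrite fine_ge0// lebn_ge0.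
exists (v + (((3 * r + e) / e) ^+ n * L + 4 ^+ n * L))%R; split.
  by rewrite !addr_ge0// mulr_ge0// exprn_ge0// divr_ge0 ?ltW// addr_gt0// mulr_gt0.
move=> y.
pose G (w : E) := (`|kcut K e w| `^ q)%:E.
have mG : measurable_fun setT G.
  apply/measurable_EFinP; apply: (measurableT_comp (measurable_powR _)).
  by have /measurable_EFinP := measurable_abs (measurable_kcut e bK coordm_id).
have G0 w : 0 <= G w by rewrite lee_fin powR_ge0.
have mGy : measurable_fun setT (fun x : E => G ((x : V) - y)%R).
  apply/measurable_EFinP; apply: (measurableT_comp (measurable_powR _)).
  by have /measurable_EFinP := measurable_abs (measurable_kcut e bK (coordm_subl y)).
apply: (@le_trans _ _ (\int[mu]_(x in cball r) (cst 1 x + G ((x : V) - y)%R))).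
  apply: ge0_le_lower_integral => x _; first by rewrite lee_fin.
  by rewrite -EFinD lee_fin le1_powRq.
rewrite (lebn_integralD (measurable_cball r) (measurable_cst _) mGy)//.
have -> : \int[mu]_(x in cball r) cst 1 x = v%:E.
  by rewrite integral_cst; [rewrite mul1e; exact: vE|exact: measurable_cball].
rewrite EFinD; apply: leeD => //.
pose D : set E := [set w | cball r ((w : V) + y)%R /\ (e < enorm w)%R].
have -> : \int[mu]_(x in cball r) G ((x : V) - y)%R =
    \int[mu]_(w in D) G w.
  pose D0 : set E := [set w | cball r ((w : V) + y)%R].
  have D0E : D0 = (affine 1 y : E -> E) @^-1` cball r.
    by apply/seteqP; split => w; rewrite /D0 /affine /= scale1r.
  have mD0 : measurable D0.
    rewrite D0E -[X in measurable X]setTI.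
    exact: (measurable_affine y (oner_neq0 _) measurableT (measurable_cball r)).
  have -> : cball r = (affine 1 (- y)%R : E -> E) @^-1` D0.
    by apply/seteqP; split => w; rewrite /D0 /affine /cball /= scale1r subrK.
  rewrite translation_integral// [LHS]integral_mkcond [RHS]integral_mkcond.
  apply: eq_integral => w _; rewrite !patchE.
  case: (boolP (w \in D)) => [|nD].
    by rewrite inE => -[h _]; rewrite mem_set.
  case: ifP => // /set_mem wD0; rewrite /G /kcut.
  case: (ltP e (enorm w)) => [ew|_]; last by rewrite mulr0 normr0 powR0// gt_eqF// (lt_le_trans ltr01).
  by move: nD; rewrite notin_setE => -[].
have bound (a b : R) : (0 < a)%R -> (a <= b)%R -> (forall w, D w -> a < enorm w <= b)%R ->
    \int[mu]_(w in D) G w <= ((b / a) ^+ n * L)%:E.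
  move=> a0 ab Dab; apply: le_trans (hL a b a0 ab).
  apply: (@le_trans _ _ (\int[mu]_(w in shell a b) G w)).
    by apply: ge0_subset_lower_integral => // w /Dab.
  apply: ge0_le_lower_integral => // w _; rewrite lee_fin.
  apply: ge0_ler_powR; rewrite ?nnegrE//; first by rewrite (le_trans _ q1).
  by rewrite /kcut; case: (e < enorm w)%R; rewrite ?mulr1 ?mulr0 ?normr0.
have [y2|y2] := leP (enorm y) (2 * r)%R.
  apply: (@le_trans _ _ (((3 * r + e) / e) ^+ n * L)%:E).
    apply: bound => //; first by rewrite lerDr mulr_ge0// ltW.
    move=> w [wr ew]; rewrite ew/=; rewrite /cball /= in wr.
    have := ler_enormB (w + y) y; rewrite addrK; lra.
  by rewrite lee_fin lerDl mulr_ge0// exprn_ge0.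
apply: (@le_trans _ _ ((((2 * enorm y) / (2^-1 * enorm y)) ^+ n * L)%:E)).
  have y0 : (0 < enorm y)%R by apply: lt_trans y2; rewrite mulr_gt0.
  apply: bound; first by rewrite mulr_gt0.
    by apply: ler_wpM2r; [exact: ltW|lra].
  move=> w [wr ew]; rewrite /cball /= in wr.
  have h1 := ler_enormB (w + y) y; rewrite addrK in h1.
  have h2 := lerB_enorm y (w + y); rewrite opprD addrCA subrr addr0 enormN in h2.
  apply/andP; split; lra.
have y0 : enorm y != 0%R by rewrite gt_eqF// (lt_trans _ y2)// mulr_gt0.
have -> : ((2 * enorm y) / (2^-1 * enorm y) = 4 :> R)%R by field.
rewrite lee_fin lerDr mulr_ge0// exprn_ge0// divr_ge0 ?ltW// addr_gt0// mulr_gt0//.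
Qed.

Lemma unif_of_L1loc : \int[mu]_(x in cball 1) (`|K x|)%:E < +oo -> loc_unif_integrable K.
Proof.
move=> Kfin r r0; have [C [C0 hC]] := kcut_unif ltr01 r0.
set m := \int[mu]_(x in cball 1) _ in Kfin.
have m0 : 0 <= m by apply: integral_ge0 => x _; rewrite lee_fin.
exists (C + fine m)%R; split; first by rewrite addr_ge0// fine_ge0.
move=> y.
pose H (w : E) := (`|K w| * (enorm w <= 1)%R%:R)%:E.
have mK1 : measurable_fun setT (fun x : E => (`|kcut K 1 ((x : V) - y)|)%:E).
  by apply: measurable_abs; exact: (measurable_kcut 1 bK (coordm_subl y)).
have mH d (T : measurableType d) (c : T -> V) : coord_measurable c -> measurable_fun setT (fun x => H (c x)).
  move=> cm; apply/measurable_EFinP; apply: measurable_funM.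
    by have /measurable_EFinP := measurable_abs (borel_fun_comp bK cm).
  by apply: measurable_natr; apply: measurable_fun_ler; [exact: measurable_enorm|exact: measurable_cst].
have H0 w : 0 <= H w by rewrite lee_fin mulr_ge0.
apply: (@le_trans _ _ (\int[mu]_(x in cball r) ((`|kcut K 1 ((x : V) - y)|)%:E + H ((x : V) - y)%R))).
  apply: ge0_le_lower_integral => x _; first by rewrite lee_fin.
  rewrite -EFinD lee_fin /kcut; case: (leP (enorm ((x : V) - y)%R) 1%R) => _.
    by rewrite mulr0 normr0 add0r mulr1.
  by rewrite mulr1 mulr0 addr0.
rewrite (lebn_integralD (measurable_cball r) mK1 (mH _ _ _ (coordm_subl y)))//.
rewrite EFinD; apply: leeD; first exact: hC.
rewrite fineK ?ge0_fin_numE//.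
apply: (@le_trans _ _ (\int[mu]_x H ((x : V) - y)%R)).
  exact: ge0_subset_lower_integral.
rewrite -[X in \int[mu]_(x in X) _](preimage_setT (affine 1 (- y)%R : E -> E)).
rewrite translation_integral//; last exact: (mH _ _ _ coordm_id).
rewrite /m [leRHS]integral_mkcond; apply: ge0_le_lower_integral => // x _.
rewrite patchE /H; case: (leP (enorm x) 1%R) => x1.
  by rewrite mulr1 mem_set.
by rewrite mulr0 memNset// /cball /=; apply/negP; rewrite -ltNge.
Qed.

End Convolution.

(** * Convolution compared with a multiple of the kernel *)

Section NearEstimate.
Context {R : realType} {n : nat}.
Local Notation V := 'rV[R]_n.
Local Notation E := (Rn R n).
Local Notation mu := (@lebn R n).
Local Open Scope ereal_scope.

Lemma chebyshev (D : set E) (F : E -> \bar R) (t : R) : measurable D ->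
  measurable_fun setT F -> (forall x, 0 <= F x) -> (0 < t)%R ->
  mu [set x | D x /\ t%:E < F x] <= (t^-1)%:E * \int[mu]_(x in D) F x.
Proof.
move=> mD mF F0 t0; rewrite -lee_pdivrMl ?invr_gt0// invrK.
set S := [set x | _].
have mS : measurable (S : set E).
  rewrite (_ : S = D `&` (setT `&` [set x | t%:E < F x])).
    by apply: measurableI => //; exact: emeasurable_fun_o_infty.
  by rewrite setTI.
have -> : t%:E * mu S = \int[mu]_(x in S) cst t%:E x by rewrite integral_cst.
apply: (@le_trans _ _ (\int[mu]_(x in S) F x)).
  by apply: ge0_le_lower_integral => x [_ /ltW h] //=; rewrite lee_fin ltW.
by apply: ge0_subset_lower_integral => // x [].
Qed.

Lemma RintE (D : set E) (f : E -> R) : Defs.Rint mu D f = Rintegral mu D f.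
Proof. by []. Qed.

Lemma conv_add (k f g : V -> R) (x : V) : conv_integrable k f x ->
  conv_integrable k g x -> conv k (f \+ g)%R x = (conv k f x + conv k g x)%R.
Proof.
move=> fi gi; rewrite /conv !RintE -RintegralD//.
by apply: eq_Rintegral => y _ /=; rewrite mulrDr.
Qed.

Lemma conv_sub (k f g : V -> R) (x : V) : conv_integrable k f x ->
  conv_integrable k g x -> conv k (f \- g)%R x = (conv k f x - conv k g x)%R.
Proof.
move=> fi gi; rewrite /conv !RintE -RintegralB//.
by apply: eq_Rintegral => y _ /=; rewrite mulrBr.
Qed.

Lemma conv_integrable_sub (k f g : V -> R) (x : V) : conv_integrable k f x ->
  conv_integrable k g x -> conv_integrable k (f \- g)%R x.
Proof.
move=> fi gi; rewrite /conv_integrable.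
under eq_fun do rewrite /= mulrBr EFinB.
exact: integrableB.
Qed.

Variables (q : R) (q1 : (1 <= q)%R) (K : V -> R) (gK : good_kernel q K).

Let bK := gk_borel gK.
Let q0 : (0 < q)%R. Proof. exact: lt_le_trans ltr01 q1. Qed.

Definition near_good (f : V -> R) (l : R) (x : V) : Prop :=
  conv_integrable K f x /\ (`|conv K f x - K x * Defs.Rint mu setT f| <= l)%R.

(* With [d := l / 2A], the elementary bound [z <= d + d (z/d)^q] replaces
   Minkowski's inequality. *)
Lemma near_good_of_small (f : V -> R) (A l : R) (x : V) : (0 < A)%R -> (0 < l)%R ->
  mu.-integrable setT (fun y : E => (f y)%:E) ->
  \int[mu]_y (`|f y|)%:E <= A%:E ->
  \int[mu]_y (`|K (x - (y : V)) - K x| `^ q * `|f y|)%:E <= (A * (l / (2 * A)) `^ q)%:E ->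
  near_good f l x.
Proof.
move=> A0 l0 fi fA Dx; have /integrableP[/measurable_EFinP mf _] := fi.
set d := (l / (2 * A))%R in Dx.
have d0 : (0 < d)%R by rewrite divr_gt0// mulr_gt0.
have dq : (0 < d `^ q)%R by rewrite powR_gt0.
pose g (y : E) := ((K (x - (y : V)) - K x) * f y)%R.
have mdK : measurable_fun setT (fun y : E => K (x - (y : V)) - K x)%R.
  exact: (measurable_funB (borel_fun_comp bK (coordm_subr x)) (measurable_cst _)).
have mg : measurable_fun setT g by exact: (measurable_funM mdK mf).
have maf : measurable_fun setT (fun y : E => (`|f y|)%:E) by exact: measurable_abs.
have mD : measurable_fun setT (fun y : E => (`|K (x - (y : V)) - K x| `^ q * `|f y|)%:E).
  apply/measurable_EFinP; apply: measurable_funM.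
    apply: (measurableT_comp (measurable_powR _)).
    by have /measurable_EFinP := measurable_abs mdK.
  by have /measurable_EFinP := maf.
have gl : \int[mu]_y (`|g y|)%:E <= l%:E.
  apply: (@le_trans _ _ (\int[mu]_y (d%:E * (`|f y|)%:E +
      (d * (d `^ q)^-1)%:E * (`|K (x - (y : V)) - K x| `^ q * `|f y|)%:E))).
    apply: ge0_le_lower_integral => y _; first by rewrite lee_fin.
    rewrite -!EFinM -EFinD lee_fin /g normrM mulrA -mulrDl; apply: ler_wpM2r => //.
    set z := `|_ - _|%R; have z0 : (0 <= z)%R by exact: normr_ge0.
    have := le1_powRq q1 (divr_ge0 (normr_ge0 (K (x - y) - K x)%R) (ltW d0)).
    rewrite -/z powRM ?invr_ge0 ?(ltW d0)// => /(ler_wpM2l (ltW d0)).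
    rewrite mulrCA mulfV ?gt_eqF// mulr1 mulrDr mulr1 => /le_trans; apply.
    rewrite lerD2l (mulrC (z `^ q)%R) mulrA.
    by rewrite -[X in (X `^ q)%R](powR_inv1 (ltW d0)) powRAC powR_inv1 ?powR_ge0.
  have c1 : (0 <= d)%R by exact: ltW.
  have c2 : (0 <= d * (d `^ q)^-1)%R by rewrite mulr_ge0// invr_ge0 ltW.
  rewrite (lebn_integralD measurableT (measurable_funeM _ maf) (measurable_funeM _ mD)); last 2 first.
  - by move=> y; rewrite mule_ge0// lee_fin.
  - by move=> y; rewrite mule_ge0 ?lee_fin// mulr_ge0// powR_ge0.
  rewrite (lebn_integralZl measurableT maf)//.
  rewrite (lebn_integralZl measurableT mD) => [|y|//]; last first.
    by rewrite lee_fin mulr_ge0// powR_ge0.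
  apply: (@le_trans _ _ (d%:E * A%:E + (d * (d `^ q)^-1)%:E * (A * d `^ q)%:E)).
    by apply: leeD; apply: lee_wpmul2l.
  rewrite -!EFinM -EFinD lee_fin.
  have -> : (d / d `^ q * (A * d `^ q) = d * A)%R by field; rewrite gt_eqF.
  by rewrite /d le_eqVlt; apply/orP; left; apply/eqP; field; rewrite gt_eqF.
have gi : mu.-integrable setT (fun y => (g y)%:E).
  apply/integrableP; split; first exact/measurable_EFinP.
  by apply: le_lt_trans gl _; exact: ltry.
have Kxf : mu.-integrable setT (fun y : E => (K x * f y)%:E).
  have := integrableZl measurableT (K x) fi.
  by apply: eq_integrable => // y _; rewrite EFinM.
have ci : conv_integrable K f x.
  rewrite /conv_integrable (_ : (fun y : E => _) = (fun y => (g y)%:E) \+ (fun y : E => (K x * f y)%:E)).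
    exact: integrableD.
  by apply/funext => y; rewrite /g /= -EFinD; congr (_%:E); ring.
split => //; rewrite /conv !RintE.
have -> : (K x * Rintegral mu setT f = Rintegral mu setT (fun y => K x * f y))%R.
  by rewrite RintegralZl.
rewrite -RintegralB//.
rewrite (@eq_Rintegral _ _ _ _ _ g); last by move=> y _; rewrite /g mulrBl.
have h := le_normr_Rintegral measurableT gi.
apply: (le_trans h); rewrite -lee_fin /Rintegral fineK// ge0_fin_numE.
  by apply: le_lt_trans gl _; exact: ltry.
by apply: integral_ge0 => y _; rewrite lee_fin.
Qed.

(** Chebyshev's inequality for D, the integral in [near_good_of_small]. By Tonelli and smoothness D
    has integral at most e A outside the ball of radius M N, and the threshold A (l / 2A)^q turns
    this into (2A / l)^q e. *)
Lemma near_weak (e : R) : (0 < e)%R -> exists M : R, (2 <= M)%R /\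
  forall (N A l : R) (f : V -> R), (0 < N)%R -> (0 < A)%R -> (0 < l)%R ->
  mu.-integrable setT (fun y : E => (f y)%:E) ->
  \int[mu]_y (`|f y|)%:E <= A%:E ->
  (forall y, N < enorm y -> f y = 0)%R ->
  mu [set x | (M * N < enorm x)%R /\ ~ near_good f l x] <= ((2 * A / l) `^ q * e)%:E.
Proof.
move=> e0; have [M [M2 hM]] := gk_smooth gK e0; exists M; split => //.
move=> N A l f N0 A0 l0 fi fA fN; have /integrableP[/measurable_EFinP mf _] := fi.
pose F (p : E * E) := (`|K ((p.1 : V) - (p.2 : V)) - K p.1| `^ q * `|f p.2|)%:E.
have mF : measurable_fun setT F.
  apply/measurable_EFinP; apply: measurable_funM.
    apply: (measurableT_comp (measurable_powR _)).
    have cf : coord_measurable (fun p : E * E => p.1 : V) by exact: coordm_fst_id.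
    have mdK : measurable_fun setT (fun p : E * E => K ((p.1 : V) - (p.2 : V)) - K p.1)%R.
      exact: (measurable_funB (borel_fun_comp bK coordm_sub) (borel_fun_comp bK cf)).
    by have /measurable_EFinP := measurable_abs mdK.
  have /measurable_EFinP maf := measurable_abs mf.
  exact: (measurableT_comp maf measurable_snd).
have F0 p : 0 <= F p by rewrite lee_fin mulr_ge0// powR_ge0.
pose D (x : E) := \int[mu]_y F (x, y).
have mDx : measurable_fun setT D by exact: (tonelli_measurable measurableT mF F0).
have D0 x : 0 <= D x by exact: integral_ge0.
pose t := (A * (l / (2 * A)) `^ q)%R.
have t0 : (0 < t)%R by rewrite mulr_gt0// powR_gt0// divr_gt0// mulr_gt0.
apply: (@le_trans _ _ (mu [set x | outside (M * N) x /\ t%:E < D x])).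
  apply: le_lebn => x /= [xMN nx]; split => //.
  rewrite ltNge; apply/negP => Dx; apply: nx.
  exact: (@near_good_of_small f A l x).
have mO : measurable (outside (M * N) : set E) by exact: measurable_outside.
apply: (le_trans (chebyshev mO mDx D0 t0)).
have MN : (0 < M * N)%R by rewrite mulr_gt0// (lt_le_trans _ M2).
have DA : \int[mu]_(x in outside (M * N)) D x <= e%:E * A%:E.
  rewrite /D (tonelli mO measurableT mF F0).
  apply: (@le_trans _ _ (e%:E * \int[mu]_y (`|f y|)%:E)); last first.
    by apply: lee_wpmul2l => //; rewrite lee_fin ltW.
  have maf : measurable_fun setT (fun y : E => (`|f y|)%:E) by exact: measurable_abs.
  rewrite -(lebn_integralZl measurableT maf) => [|y|]; [|by rewrite lee_fin|exact: ltW].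
  apply: ge0_le_lower_integral => y _; first exact: integral_ge0.
  have [yN|Ny] := leP (enorm y) N; last first.
    rewrite integral0_eq => [|x _]; first by rewrite -EFinM lee_fin mulr_ge0// ltW.
    by rewrite /F /= fN// normr0 mulr0.
  pose F1 (x : E) := (`|K ((x : V) - (y : V)) - K x| `^ q)%:E.
  have mF1 : measurable_fun setT F1.
    have md : measurable_fun setT (fun x : E => K ((x : V) - (y : V)) - K x)%R.
      exact: (measurable_funB (borel_fun_comp bK (coordm_subl y)) (borel_fun_measurable bK)).
    apply/measurable_EFinP; apply: (measurableT_comp (measurable_powR _)).
    by have /measurable_EFinP := measurable_abs md.
  rewrite (_ : \int[mu]_(x in _) _ = \int[mu]_(x in outside (M * N)) ((`|f y|)%:E * F1 x)); last first.
    by apply: eq_integral => x _; rewrite /F /F1 /= mulrC EFinM.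
  rewrite (lebn_integralZl mO mF1) => [|x|//]; last by rewrite lee_fin powR_ge0.
  rewrite muleC; apply: lee_wpmul2r; first by rewrite lee_fin.
  apply: hM => //; apply: ler_wpM2l => //.
  by rewrite (le_trans _ M2).
apply: (@le_trans _ _ ((t^-1)%:E * (e%:E * A%:E))).
  by apply: lee_wpmul2l => //; rewrite lee_fin invr_ge0 ltW.
rewrite -!EFinM lee_fin le_eqVlt; apply/orP; left; apply/eqP.
have -> : (2 * A / l = (l / (2 * A))^-1)%R by rewrite invf_div.
have lA : (0 < l / (2 * A))%R by rewrite divr_gt0// mulr_gt0.
rewrite -[X in (X `^ q)%R](powR_inv1 (ltW lA)) powRAC powR_inv1 ?powR_ge0//.
have : (0 < (l / (2 * A)) `^ q)%R by rewrite powR_gt0.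
rewrite /t; move: ((l / (2 * A)) `^ q)%R => u u0; field.
by rewrite !gt_eqF.
Qed.

End NearEstimate.

(** * Dyadic cells and stopping times *)

Section DyadicCells.
Context {R : realType} {n : nat}.
Local Notation V := 'rV[R]_n.
Local Notation E := (Rn R n).
Local Notation mu := (@lebn R n).
Local Open Scope ereal_scope.

(** Only dyadic cells of side at most 1 occur: the Calderon-Zygmund stopping time starts at side 1
    thanks to a smallness condition on the integral, and the maximal function only takes truncations
    at e <= 1. *)
Definition cell_index (k : nat) (x : V) : 'rV[int]_n :=
  \row_i Num.floor (2 ^+ k * x ord0 i)%R.

Definition cellset (k : nat) (m : 'rV[int]_n) : set E :=
  [set x : E | cell_index k x = m].

Definition cell (k : nat) (x : V) : set E := cellset k (cell_index k x).

Definition corner (k : nat) (x : V) : V :=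
  (\row_i ((2 ^+ k)^-1 * (cell_index k x ord0 i)%:~R))%R.

Lemma pow2_gt0 (k : nat) : (0 < 2 ^+ k :> R)%R.
Proof. by rewrite exprn_gt0. Qed.

Lemma cell_refl k x : cell k x x. Proof. by []. Qed.

(** Nesting of dyadic cells: the integer part of s / 2 is determined by that of s. *)
Lemma floor_half (s t : R) : Num.floor s = Num.floor t ->
  Num.floor (2^-1 * s)%R = Num.floor (2^-1 * t)%R.
Proof.
have key (u w : R) : Num.floor u = Num.floor w ->
    (Num.floor (2^-1 * u)%R <= Num.floor (2^-1 * w)%R)%R.
  move=> uw; rewrite floor_ge_int.
  have h : ((Num.floor (2^-1 * u)%R)%:~R <= 2^-1 * u)%R by exact: floor_le_tmp.
  have : ((2 * Num.floor (2^-1 * u)%R)%R <= Num.floor u)%R.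
    rewrite floor_ge_int intrM; lra.
  rewrite uw floor_ge_int intrM; lra.
by move=> st; apply/eqP; rewrite eq_le !key.
Qed.

Lemma cell_index_le (j k : nat) (x y : V) : (j <= k)%N ->
  cell_index k x = cell_index k y -> cell_index j x = cell_index j y.
Proof.
move=> /subnK <-; elim: (k - j)%N => [//|i IH] h; apply: IH.
apply/rowP => l; move/rowP: h => /(_ l); rewrite !mxE addSn exprS => /floor_half.
by rewrite !mulrA mulVf// !mul1r.
Qed.

Lemma cell_le (j k : nat) (x : V) : (j <= k)%N -> cell k x `<=` cell j x.
Proof. by move=> jk y; exact: cell_index_le. Qed.

Lemma cell_dist (k : nat) (x y : V) : cell_index k x = cell_index k y ->
  (enorm (x - y) <= n%:R / 2 ^+ k)%R.
Proof.
move=> xy; apply: enorm_le_coord => i; rewrite !mxE.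
have /rowP/(_ i) := xy; rewrite !mxE => h.
have p0 := pow2_gt0 k.
have h1 := floor_le_tmp (2 ^+ k * x ord0 i)%R; have h2 := floor_le_tmp (2 ^+ k * y ord0 i)%R.
have h3 := floorD1_gt (2 ^+ k * x ord0 i)%R; have h4 := floorD1_gt (2 ^+ k * y ord0 i)%R.
rewrite -h intrD in h4; rewrite -h in h2; rewrite intrD in h3.
rewrite -div1r ler_pdivlMr// -{1}(gtr0_norm p0) -normrM mulrBl ler_norml.
apply/andP; split; lra.
Qed.

Lemma corner_dist (k : nat) (x : V) : (enorm (x - corner k x) <= n%:R / 2 ^+ k)%R.
Proof.
apply: enorm_le_coord => i; rewrite !mxE.
have p0 := pow2_gt0 k.
have h1 := floor_le_tmp (2 ^+ k * x ord0 i)%R.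
have h3 := floorD1_gt (2 ^+ k * x ord0 i)%R; rewrite intrD in h3.
set m := (Num.floor _)%:~R in h1 h3 *.
have -> : (x ord0 i - 2 ^- k * m = 2 ^- k * (2 ^+ k * x ord0 i - m))%R.
  by rewrite mulrBr mulrA mulVf ?mul1r// gt_eqF.
have p1 : (0 < 2 ^- k :> R)%R by rewrite invr_gt0.
rewrite normrM (gtr0_norm p1); apply: ler_piMr; first exact: ltW.
rewrite ler_norml; apply/andP; split; lra.
Qed.

Definition unit_cell : set V := cellset 0 0%R.
(* The value [v1 = 1] is never needed: if [v1 = 0] then every set is null. *)
Definition v1 : R := fine (mu unit_cell).

Lemma cellsetE k m : cellset k m =
  affine (2 ^+ k)%R (- map_mx intr m)%R @^-1` unit_cell.
Proof.
have fl (t : R) (i : int) : (Num.floor t = i) <-> (Num.floor (1 * (t - i%:~R)) = 0)%R.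
  rewrite mul1r -intrN floorDrz ?intr_int// intrKfloor.
  by split => [->|/eqP]; [rewrite subrr|rewrite subr_eq0 => /eqP].
apply/seteqP; split => x; rewrite /cellset /unit_cell /affine /cellset /=.
  move=> /rowP h; apply/rowP => i; move: (h i); rewrite !mxE expr0; exact: (proj1 (fl _ _)).
move=> /rowP h; apply/rowP => i; move: (h i); rewrite !mxE expr0; exact: (proj2 (fl _ _)).
Qed.

Lemma unit_cellE : unit_cell = box 0%R (const_mx 1%R).
Proof.
apply/seteqP; split => x.
  move=> /rowP h i; move: (h i); rewrite !mxE expr0 mul1r => hi.
  have := floor_le_tmp (x ord0 i); have := floorD1_gt (x ord0 i).
  by rewrite hi add0r => -> ->.
move=> h; apply/rowP => i; move: (h i); rewrite !mxE expr0 mul1r => hi.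
by apply/eqP; rewrite floor_eq add0r.
Qed.

Lemma measurable_cellset k m : measurable (cellset k m).
Proof.
have mu1 : measurable (unit_cell : set E) by rewrite unit_cellE; exact: measurable_box.
rewrite cellsetE -[X in measurable X]setTI.
exact: (measurable_affine _ (lt0r_neq0 (pow2_gt0 k)) measurableT mu1).
Qed.

Lemma v1E : mu unit_cell = v1%:E.
Proof.
rewrite fineK// ge0_fin_numE ?lebn_ge0// unit_cellE.
apply: le_lt_trans (lebn_box_le _) (ltry _) => i; rewrite !mxE ler01//.
Qed.

Lemma v1_ge0 : (0 <= v1)%R.
Proof. by rewrite fine_ge0// lebn_ge0. Qed.

Definition cvol (k : nat) : R := ((2 ^+ k) ^- n * v1)%R.

Lemma lebn_cellset k m : mu (cellset k m) = (cvol k)%:E.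
Proof.
rewrite cellsetE lebn_affine ?gt_eqF ?pow2_gt0// v1E -EFinM.
by rewrite gtr0_norm ?pow2_gt0.
Qed.

Lemma lebn_cell k x : mu (cell k x) = (cvol k)%:E.
Proof. exact: lebn_cellset. Qed.

Lemma measurable_cell k x : measurable (cell k x).
Proof. exact: measurable_cellset. Qed.

Lemma lebn_null_of_v1 : v1 = 0%R -> forall A : set V, mu A = 0.
Proof.
move=> v0 A; apply: (@sub_lebn0 _ _ _ [set x | exists m, cellset 0 m x]).
  by move=> x _; exists (cell_index 0 x).
by apply: lebn_null_exists => m; rewrite lebn_cellset /cvol v0 mulr0.
Qed.

Definition cellwise (T : Type) (k : nat) (f : V -> T) : Prop :=
  forall x y, cell_index k x = cell_index k y -> f x = f y.

(** There are countably many cells, so a function constant on them is measurable whatever its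
    values; functions of the stopping time need no further inspection. *)
Lemma measurable_cellwise d (T : measurableType d) (k : nat) (f : V -> T) :
  cellwise k f -> measurable_fun [set: E] (f : E -> T).
Proof.
move=> cf _ A mA; rewrite setTI.
pose F (m : 'rV[int]_n) : set V := [set x | cell_index k x = m /\ A (f x)].
pose G (i : nat) : set E := if unpickle i is Some m then F m else set0.
have -> : f @^-1` A = \bigcup_i G i.
  apply/seteqP; split => [x Ax|x [i _]].
    by exists (pickle (cell_index k x)) => //; rewrite /G pickleK.
  by rewrite /G; case: unpickle => // m [].
apply: bigcupT_measurable => i; rewrite /G; case: unpickle => [m|]; last exact: measurable0.
have [[x xm]|nx] := pselect (exists x, F m x); last first.
  rewrite (_ : F m = set0); first exact: measurable0.
  by apply/seteqP; split => x // Fx; apply: nx; exists x.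
rewrite (_ : F m = cellset k m); first exact: measurable_cellset.
apply/seteqP; split => y; first by case.
by move=> ym; split => //; case: xm => xm; rewrite (cf y x)// ym.
Qed.

Lemma coordm_cellwise k (f : V -> V) : cellwise k f -> coord_measurable (f : E -> V).
Proof.
by move=> cf i; apply: (@measurable_cellwise _ _ k) => x y xy; rewrite (cf x y xy).
Qed.

Definition interior_pt (k : nat) (x : V) : Prop :=
  exists d : R, (0 < d)%R /\ forall y, (enorm (x - y) <= d)%R -> cell_index k y = cell_index k x.

(** Off the countably many hyperplanes x_i = m / 2^k, each coordinate is at a positive distance from
    the faces of its cell. *)
Lemma interior_ae k : mu [set x | ~ interior_pt k x] = 0.
Proof.
apply: (@sub_lebn0 _ _ _ [set x | exists im : 'I_n * int,
    x ord0 im.1 = ((2 ^+ k)^-1 * im.2%:~R)%R]); last first.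
  by apply: lebn_null_exists => im; exact: lebn_hyperplane.
move=> x nx; apply: contrapT => /forallNP h; apply: nx.
have p0 := pow2_gt0 k.
pose fl i := (Num.floor (2 ^+ k * x ord0 i)%R)%:~R : R.
have h1 i : (fl i < 2 ^+ k * x ord0 i)%R.
  rewrite lt_neqAle floor_le_tmp andbT; apply/eqP => e.
  by apply: (h (i, Num.floor (2 ^+ k * x ord0 i)%R)); rewrite /= -/(fl i) e mulrA mulVf ?mul1r// gt_eqF.
have h2 i : (2 ^+ k * x ord0 i < fl i + 1)%R.
  by have := floorD1_gt (2 ^+ k * x ord0 i)%R; rewrite intrD.
pose di i := (Num.min (2 ^+ k * x ord0 i - fl i) (fl i + 1 - 2 ^+ k * x ord0 i))%R.
have di0 i : (0 < di i)%R by rewrite lt_min !subr_gt0 h1 h2.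
pose dd : R := (\big[Num.min/1]_(i < n) di i)%R.
have dd0 : (0 < dd)%R.
  by rewrite /dd; elim/big_ind: _ => // a b a0 b0; rewrite lt_min a0.
exists (dd / 2 / 2 ^+ k)%R; split; first by rewrite !divr_gt0.
move=> y xy; apply/rowP => i; rewrite !mxE.
apply/eqP; rewrite floor_eq.
have ddi : (dd <= di i)%R by exact: bigmin_le_cond.
have := le_trans (coord_le_enorm (x - y)%R i) xy; rewrite !mxE.
rewrite ler_pdivlMr// -{1}(gtr0_norm p0) -normrM mulrBl => /ler_normlP[].
move: ddi; rewrite /di le_min => /andP[]; rewrite intrD -/(fl i).
move: (h1 i) (h2 i) dd0; rewrite !(mulrC _ (2 ^+ k)%R) => *; apply/andP; split; lra.
Qed.

End DyadicCells.

(** * Stopping times on dyadic cells *)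

Section Stopping.
Context {R : realType} {n : nat}.
Local Notation V := 'rV[R]_n.
Local Notation E := (Rn R n).
Local Notation mu := (@lebn R n).
Local Open Scope ereal_scope.

Variables (P : nat -> V -> Prop) (cP : forall k, cellwise k (P k)).

Definition first_level (k : nat) (x : V) : Prop :=
  P k x /\ forall j, (j < k)%N -> ~ P j x.

Definition stopped (x : V) : Prop := exists k, P k x.

Lemma stoppedP x : stopped x <-> exists k, first_level k x.
Proof.
split => [[k Pk]|[k []]]; last by exists k.
have ex : exists k, `[< P k x >] by exists k; apply/asboolP.
have := ex_minnP ex => -[m /asboolP Pm mmin]; exists m; split => // j jm Pj.
have : (m <= j)%N by apply: mmin; apply/asboolP.
by rewrite leqNgt jm.
Qed.

Lemma first_level_uniq x j k : first_level j x -> first_level k x -> j = k.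
Proof.
move=> [Pj nj] [Pk nk]; case: (ltngtP j k) => // h.
  by case: (nk _ h).
by case: (nj _ h).
Qed.

Lemma first_level_cell k x y : cell_index k x = cell_index k y ->
  first_level k x -> first_level k y.
Proof.
move=> xy [Pk nk]; split; first by rewrite -(cP xy).
by move=> j jk; rewrite -(cP (cell_index_le (ltnW jk) xy)); exact: nk.
Qed.

(** The maximal cells as a sequence indexed by codes of pairs (level, index), empty where the code
    is void or the cell is not maximal. [pickle_inv] is injective where it is defined, which gives
    disjointness. *)
Definition stopfam (i : nat) : set E :=
  if pickle_inv i is Some km then
    [set x : E | @cell_index R n (km : nat * 'rV[int]_n).1 x = km.2 /\ first_level km.1 x]
  else set0.

Lemma stopfamP i : stopfam i = set0 \/
  exists k x, first_level k x /\ stopfam i = cell k x.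
Proof.
rewrite /stopfam; case: pickle_inv => [[k m]|]; last by left.
have [[x [xm Px]]|nx] := pselect (exists x : V, cell_index k x = m /\ first_level k x).
  right; exists k, x; split => //=; apply/seteqP; split => y /=.
    by move=> [ym _]; rewrite /cell /cellset /= ym.
  rewrite /cell /cellset /= => yx; split; first by rewrite yx.
  by apply: (first_level_cell _ Px); rewrite yx.
by left; apply/seteqP; split => x //= h; apply: nx; exists x.
Qed.

Lemma stopfam_measurable i : measurable (stopfam i).
Proof.
case: (stopfamP i) => [->|[k [x [_ ->]]]]; first exact: measurable0.
exact: measurable_cell.
Qed.

Lemma stopfam_trivIset : trivIset setT stopfam.
Proof.
apply/trivIsetP => i j _ _ ij; apply/seteqP; split => // x [].
rewrite /stopfam; case Ei : (pickle_inv i) => [[k m]|//] /= [xm fk].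
case Ej : (pickle_inv j) => [[k' m']|//] /= [xm' fk'].
have kk := first_level_uniq fk fk'; subst k'; subst m; subst m'.
move/eqP: ij; apply.
have := @pickle_invK (nat * 'rV[int]_n)%type i.
have := @pickle_invK (nat * 'rV[int]_n)%type j.
by rewrite Ei Ej /= => <- <-.
Qed.

Lemma bigcup_stopfam : \bigcup_i stopfam i = [set x | stopped x].
Proof.
apply/seteqP; split => x.
  move=> [i _]; rewrite /stopfam; case: pickle_inv => // -[k m] /= [_ fk].
  by apply/stoppedP; exists k.
move=> /stoppedP[k fk]; exists (pickle (k, cell_index k x)) => //.
by rewrite /stopfam pickleK_inv.
Qed.

Lemma stopped_measurable : measurable ([set x | stopped x] : set E).
Proof. by rewrite -bigcup_stopfam; apply: bigcupT_measurable; exact: stopfam_measurable. Qed.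

End Stopping.

Section Covering.
Context {R : realType} {n : nat}.
Local Notation V := 'rV[R]_n.
Local Notation E := (Rn R n).
Local Notation mu := (@lebn R n).
Local Open Scope ereal_scope.

Lemma cell_eq (k : nat) (x y : V) : cell_index k x = cell_index k y -> cell k x = cell k y.
Proof. by rewrite /cell => ->. Qed.

Lemma lebn_sum_setI_le (S : set V) (A : nat -> set E) : (forall i, measurable (A i)) ->
  trivIset setT A -> \sum_(i <oo) mu (S `&` A i) <= mu S.
Proof.
move=> mA tA; apply: le_trans (@caratheodory_lime_le R V (@lebesgue_outer R n) A mA tA S).
by rewrite leeDl// outer_measure_ge0.
Qed.

(** The largest cells in which S has density at least 1/2 are disjoint and cover X. *)
Lemma dyadic_covering (X S : set V) :
  (forall x, X x -> exists k, mu (cell k x) <= 2%:E * mu (S `&` cell k x)) ->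
  mu X <= 2%:E * mu S.
Proof.
move=> hX.
pose P (k : nat) (x : V) : Prop := mu (cell k x) <= 2%:E * mu (S `&` cell k x).
have cP k : cellwise k (P k) by move=> x y /cell_eq e; rewrite /P e.
apply: (@le_trans _ _ (mu (\bigcup_i stopfam P i))).
  by apply: le_lebn => x /hX; rewrite bigcup_stopfam.
apply: (le_trans (lebn_bigcup_le _)).
apply: (@le_trans _ _ (2%:E * \sum_(i <oo) mu (S `&` stopfam P i))).
  rewrite -nneseriesZl; last by move=> *; exact: lebn_ge0.
  apply: lee_nneseries => [*|i _]; first exact: lebn_ge0.
  case: (stopfamP cP i) => [->|[k [x [[Pk _] ->]]]]; last exact: Pk.
  by rewrite lebn_set0 mule_ge0// lebn_ge0.
apply: lee_wpmul2l => //; apply: lebn_sum_setI_le.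
  exact: stopfam_measurable.
exact: stopfam_trivIset.
Qed.

End Covering.

(** * Maximal truncations of step functions *)

Section PrincipalValue.
Context {R : realType} {n : nat}.
Local Notation V := 'rV[R]_n.
Local Notation E := (Rn R n).
Local Notation mu := (@lebn R n).
Local Open Scope ereal_scope.

(** Bounded functions supported in a ball: all their truncated convolutions converge absolutely, at
    every point. *)
Definition bcs (f : V -> R) : Prop := [/\ measurable_fun [set: E] (f : E -> R),
  exists B, forall x, (`|f x| <= B)%R & exists N, forall x, (N < enorm x)%R -> f x = 0%R].

Definition loc_const (f : V -> R) (x : V) : Prop :=
  exists d : R, (0 < d)%R /\ forall y, (enorm (x - y) <= d)%R -> f y = f x.

Lemma bcs_integrable f : bcs f -> mu.-integrable setT (fun y : E => (f y)%:E).
Proof.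
move=> [mf [B fB] [N fN]]; apply/integrableP; split; first exact/measurable_EFinP.
have B0 : (0 <= B)%R by exact: le_trans (normr_ge0 _) (fB 0%R).
apply: (@le_lt_trans _ _ (\int[mu]_(x in cball N) cst B%:E x)).
  rewrite [leRHS]integral_mkcond; apply: ge0_le_lower_integral => x _; first exact: abse_ge0.
  rewrite patchE; case: ifPn => [_|]; first by rewrite lee_fin.
  rewrite notin_setE /cball /= => /negP; rewrite -ltNge => /fN ->.
  by rewrite normr0.
rewrite integral_cst; last exact: measurable_cball.
by rewrite lte_mul_pinfty// lebn_cball_lty.
Qed.

End PrincipalValue.

(** * Truncations of a kernel with cancellation (the case q = 1) *)

Section TruncatedOperators.
Context {R : realType} {n : nat}.
Local Notation V := 'rV[R]_n.
Local Notation E := (Rn R n).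
Local Notation mu := (@lebn R n).
Local Open Scope ereal_scope.

Variables (K : V -> R) (M L : R).
Hypothesis bK : borel_fun K.
Hypothesis M3 : (3 <= M)%R.
Hypothesis hsm : forall (rho : R) (y : V), (0 < rho)%R -> (M * enorm y <= rho)%R ->
  \int[mu]_(x in outside rho) (`|K ((x : V) - y) - K x|)%:E <= 1.
Hypothesis L0 : (0 <= L)%R.
Hypothesis hsz : forall r s, (0 < r)%R -> (r <= s)%R ->
  \int[mu]_(x in shell r s) (`|K x|)%:E <= ((s / r) ^+ n * L)%:E.
Hypothesis hcanc : forall r s, (0 < r)%R -> (r <= s)%R ->
  \int[mu]_(x in shell r s) (K x)%:E = 0.

Definition Tj (f : V -> R) (x : V) : R := lim (conv (kcut K e) f x @[e --> 0^'+]).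

Lemma measurable_absK d (T : measurableType d) (m : T -> V) : coord_measurable m ->
  measurable_fun setT (fun p => (`|K (m p)|)%:E).
Proof. by move=> cm; apply: measurable_abs; exact: (borel_fun_comp bK cm). Qed.

Definition reflect_set (D : set E) (x : V) : set E := [set y : E | D (x - (y : V))%R].

Lemma reflect_setE D x : reflect_set D x = (affine (-1) x : E -> E) @^-1` D.
Proof. by apply/seteqP; split => y; rewrite /reflect_set /affine /= scaleN1r addrC. Qed.

Lemma measurable_reflect_set D x : measurable D -> measurable (reflect_set D x).
Proof.
move=> mD; rewrite reflect_setE -[X in measurable X]setTI.
by apply: (measurable_affine x _ measurableT mD); rewrite oppr_eq0 oner_neq0.
Qed.

Lemma reflect_shell_absK r s x : (0 < r)%R -> (r <= s)%R ->
  \int[mu]_(y in reflect_set (shell r s) x) (`|K (x - (y : V))|)%:E <= ((s / r) ^+ n * L)%:E.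
Proof.
move=> r0 rs; rewrite reflect_setE.
rewrite (reflection_integral x (measurable_shell r s) (measurable_absK coordm_id)).
  exact: hsz.
by move=> y; rewrite lee_fin.
Qed.

Lemma reflect_shell_cancel r s x : (0 < r)%R -> (r <= s)%R ->
  \int[mu]_(y in reflect_set (shell r s) x) (K (x - (y : V)))%:E = 0.
Proof.
move=> r0 rs; rewrite -(hcanc r0 rs) reflect_setE integralE [RHS]integralE.
have mK : measurable_fun setT (fun w : E => (K w)%:E).
  by apply/measurable_EFinP; exact: borel_fun_measurable.
congr (_ - _).
  rewrite -(reflection_integral x (measurable_shell r s) (measurable_funepos mK)) => [|y].
    by apply: eq_integral => y _; rewrite !funeposE.
  exact: funepos_ge0.
rewrite -(reflection_integral x (measurable_shell r s) (measurable_funeneg mK)) => [|y].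
  by apply: eq_integral => y _; rewrite !funenegE.
exact: funeneg_ge0.
Qed.

Lemma kcut_le (e : R) (w : V) : (`|kcut K e w| <= `|K w|)%R.
Proof. by rewrite /kcut; case: (e < enorm w)%R; rewrite ?mulr1 ?mulr0 ?normr0. Qed.

Lemma bcs_conv_integrable (f : V -> R) (e : R) (x : V) : bcs f -> (0 < e)%R ->
  conv_integrable (kcut K e) f x.
Proof.
move=> [mf [B fB] [N fN]] e0.
have B0 : (0 <= B)%R by exact: le_trans (normr_ge0 _) (fB 0%R).
apply: conv_integrableP => //; first exact: borel_kcut.
pose b := (enorm x + `|N| + e)%R.
have mS := measurable_reflect_set x (measurable_shell e b).
have maK : measurable_fun setT (fun y : E => (`|K (x - (y : V))|)%:E).
  exact: (measurable_absK (coordm_subr x)).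
apply: (@le_lt_trans _ _ (\int[mu]_(y in reflect_set (shell e b) x)
   (B%:E * (`|K (x - (y : V))|)%:E))).
  rewrite [leRHS]integral_mkcond; apply: ge0_le_lower_integral => y _; first by rewrite lee_fin.
  rewrite patchE; case: ifPn => [_|].
    by rewrite -EFinM lee_fin normrM mulrC; apply: ler_pM => //; exact: kcut_le.
  rewrite notin_setE /reflect_set /shell /= => ny.
  suff -> : (kcut K e (x - (y : V)) * f y = 0)%R by rewrite normr0.
  rewrite /kcut; case: (ltP e (enorm (x - (y : V))%R)) => h; last by rewrite mulr0 mul0r.
  rewrite fN ?mulr0//; rewrite ltNge; apply/negP => yN; apply: ny; rewrite h/=.
  apply: (le_trans (ler_enormB _ _)); rewrite /b; have := ler_norm N; lra.
rewrite (lebn_integralZl mS maK) => [|y|//]; last by rewrite lee_fin.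
rewrite lte_mul_pinfty// ?lee_fin//.
apply: le_lt_trans (reflect_shell_absK _ _ _) (ltry _) => //.
by rewrite /b lerDr addr_ge0// enorm_ge0.
Qed.

(** The two truncations differ by the shell e < |x - y| <= d, where f is constant and K has integral
    zero. *)
Lemma conv_kcut_loc_const (f : V -> R) (x : V) (d e : R) : bcs f -> (0 < e)%R -> (e <= d)%R ->
  (forall y, (enorm (x - y) <= d)%R -> f y = f x) ->
  conv (kcut K e) f x = conv (kcut K d) f x.
Proof.
move=> bf e0 ed fx; have d0 : (0 < d)%R by exact: lt_le_trans ed.
have ie := bcs_conv_integrable x bf e0; have id := bcs_conv_integrable x bf d0.
apply/eqP; rewrite -subr_eq0; apply/eqP.
rewrite /conv !RintE -RintegralB//.
pose S := reflect_set (shell e d) x.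
have mS : measurable S by apply: measurable_reflect_set; exact: measurable_shell.
transitivity (Rintegral mu setT ((fun y : E => K (x - (y : V)) * f x)%R \_ S)).
  apply: eq_Rintegral => y _.
  rewrite -mulrBl /kcut -mulrBr.
  have -> : (y \in S) = (e < enorm (x - (y : V)))%R && (enorm (x - (y : V)) <= d)%R.
    by apply/idP/idP; rewrite inE.
  case: (leP (enorm (x - (y : V))%R) d) => h1; case: (ltP e (enorm (x - (y : V))%R)) => h2 /=.
  - by rewrite subr0 mulr1 fx.
  - by rewrite subrr mulr0 mul0r.
  - by rewrite subrr mulr0 mul0r.
  - by rewrite ltNge (le_trans h2 ed) in h1.
rewrite -Rintegral_mkcond RintegralZr//; last first.
  apply/integrableP; split.
    apply: measurable_funTS; apply/measurable_EFinP.
    exact: (borel_fun_comp bK (coordm_subr x)).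
  by apply: le_lt_trans (reflect_shell_absK x e0 ed) (ltry _).
by rewrite /Rintegral reflect_shell_cancel//= mul0r.
Qed.

Lemma conv_kcut_cvg (f : V -> R) (x : V) (d : R) : bcs f -> (0 < d)%R ->
  (forall y, (enorm (x - y) <= d)%R -> f y = f x) ->
  conv (kcut K e) f x @[e --> 0^'+] --> conv (kcut K d) f x.
Proof.
move=> bf d0 fx; apply: cvg_near_cst; near=> e; apply: conv_kcut_loc_const => //.
by near: e; exact: nbhs_right_le.
Unshelve. all: by end_near. Qed.

Lemma Tj_loc_const (f : V -> R) (x : V) (d : R) : bcs f -> (0 < d)%R ->
  (forall y, (enorm (x - y) <= d)%R -> f y = f x) -> Tj f x = conv (kcut K d) f x.
Proof. by move=> bf d0 fx; apply/cvg_lim => //; exact: conv_kcut_cvg. Qed.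

End TruncatedOperators.

(** * Cotlar's argument for the good part *)

Section GoodPart.
Context {R : realType} {n : nat}.
Local Notation V := 'rV[R]_n.
Local Notation E := (Rn R n).
Local Notation mu := (@lebn R n).
Local Notation v1 := (@v1 R n).
Local Notation vB := (@vB R n).
Local Open Scope ereal_scope.

Variables (K : V -> R) (M L c : R).
Hypothesis n0 : (0 < n)%N.
Hypothesis v10 : (0 < v1)%R.
Hypothesis bK : borel_fun K.
Hypothesis M3 : (3 <= M)%R.
Hypothesis hsm : forall (rho : R) (y : V), (0 < rho)%R -> (M * enorm y <= rho)%R ->
  \int[mu]_(x in outside rho) (`|K ((x : V) - y) - K x|)%:E <= 1.
Hypothesis L0 : (0 <= L)%R.
Hypothesis hsz : forall r s, (0 < r)%R -> (r <= s)%R ->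
  \int[mu]_(x in shell r s) (`|K x|)%:E <= ((s / r) ^+ n * L)%:E.
Hypothesis hcanc : forall r s, (0 < r)%R -> (r <= s)%R ->
  \int[mu]_(x in shell r s) (K x)%:E = 0.
Hypothesis c0 : (0 <= c)%R.
Hypothesis weak : forall (f : V -> R) (l : R), bcs f -> (0 < l)%R ->
  mu [set x | l < `|Tj K f x|]%R <= (c / l)%:E * \int[mu]_y (`|f y|)%:E.

Local Notation T := (fun e f x => conv (kcut K e) f x).

(** The bound 1/4 serves the comparison of three terms in [good_part]. The other one makes twice the
    measure given by the weak bound at level A / 4, namely 8 c vB gam e^n, at most the volume of a
    cell with 2^k e <= 2 n M. *)
Definition gam : R := (Num.min (1 / 4) (v1 / (8 * (c + 1) * (2 * n%:R * M) ^+ n * (vB + 1))))%R.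

Let nM0 : (0 < 2 * n%:R * M)%R.
Proof. by rewrite !mulr_gt0 ?ltr0n//; have := M3; lra. Qed.

Lemma gam_gt0 : (0 < gam)%R.
Proof.
rewrite /gam lt_min; apply/andP; split; first lra.
by rewrite divr_gt0// !mulr_gt0 ?exprn_gt0// ltr_wpDl// vB_ge0.
Qed.

Lemma measurable_cut (f : V -> R) (b : V -> bool) : measurable_fun [set: E] (f : E -> R) ->
  measurable_fun [set: E] (b : E -> bool) ->
  measurable_fun [set: E] (fun y : E => f y * (b y)%:R)%R.
Proof. by move=> mf mb; exact: (measurable_funM mf (measurable_natr mb)). Qed.

Lemma bcs_cut (f : V -> R) (b : V -> bool) : bcs f ->
  measurable_fun [set: E] (b : E -> bool) -> bcs (fun y => f y * (b y)%:R)%R.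
Proof.
move=> [mf [B fB] [N fN]] mb; split; first exact: measurable_cut.
  exists B => x; case: (b x); rewrite ?mulr1 ?mulr0 ?normr0//.
  exact: le_trans (normr_ge0 _) (fB x).
by exists N => x /fN ->; rewrite mul0r.
Qed.

Lemma measurable_in_ball (x : V) (e : R) : measurable_fun [set: E] (fun y : E => enorm (x - (y : V)) <= e)%R.
Proof.
exact: (measurable_fun_ler (measurable_enorm (coordm_subr x)) (measurable_cst _)).
Qed.

Lemma measurable_off_ball (x : V) (e : R) : measurable_fun [set: E] (fun y : E => e < enorm (x - (y : V)))%R.
Proof. exact: (coordm_enorm_lt e (coordm_subr x)). Qed.

(** As |x - z| <= e / 3, any y with |x - y| > e has |z - y| > e / 2 >= d, so the truncation at d is
    inactive and the difference is an integral of K (x - y) - K (z - y) over |x - y| > e. Smoothness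
    with shift x - z bounds it by the supremum of |f|. *)
Lemma off_ball_diff (f : V -> R) (A e d : R) (x z : V) : bcs f -> (0 < d)%R -> (0 < e)%R ->
  (0 <= A)%R -> (forall y, `|f y| <= A)%R -> (M * enorm (x - z) <= e)%R -> (d <= e / 2)%R ->
  (`|T e f x - T d (fun y => f y * (e < enorm (x - y))%R%:R) z| <= A)%R.
Proof.
move=> bf d0 e0 A0 fA xz de.
pose f2 (y : V) := (f y * (e < enorm (x - y))%R%:R)%R; rewrite -/f2.
have bf2 : bcs f2 by exact: (bcs_cut bf (measurable_off_ball x e)).
have i1 := bcs_conv_integrable bK hsz x bf e0.
have i2 := bcs_conv_integrable bK hsz z bf2 d0.
rewrite /conv !RintE -RintegralB//.
pose F (y : E) := (kcut K e (x - (y : V)) * f y - kcut K d (z - (y : V)) * f2 y)%R.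
change (`|Rintegral mu setT F| <= A)%R.
have iF : mu.-integrable setT (fun y => (F y)%:E).
  rewrite (_ : (fun y => (F y)%:E) = (fun y : E => (kcut K e (x - (y : V)) * f y)%:E) \-
    (fun y : E => (kcut K d (z - (y : V)) * f2 y)%:E))//.
  exact: integrableB.
have Fint : \int[mu]_y (`|F y|)%:E <= A%:E.
  pose H (w : E) := (`|K ((w : V) - (x - z)) - K w|)%:E.
  have mH : measurable_fun setT H.
    apply: measurable_abs.
    exact: (measurable_funB (borel_fun_comp bK (coordm_subl _)) (borel_fun_measurable bK)).
  have mHx : measurable_fun setT (fun y : E => H (x - (y : V))%R).
    apply: measurable_abs; apply: measurable_funB; last exact: (borel_fun_comp bK (coordm_subr x)).
    by apply: (borel_fun_comp bK); apply: coordmB; [exact: coordm_subr|exact: coordm_cst].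
  have H0 w : 0 <= H w by rewrite lee_fin.
  have mS := measurable_reflect_set x (measurable_outside (R := R) (n := n) e).
  apply: (@le_trans _ _ (\int[mu]_(y in reflect_set (outside e) x) (A%:E * H (x - (y : V))%R))).
    rewrite [leRHS]integral_mkcond; apply: ge0_le_lower_integral => y _; first by rewrite lee_fin.
    rewrite patchE; case: ifPn => [|].
      rewrite inE /reflect_set /outside /= => h.
      rewrite /H -EFinM lee_fin /F /kcut /f2 h !mulr1.
      have -> : (d < enorm (z - (y : V)))%R.
        have := ler_enormD (x - z) (z - y)%R; rewrite addrA subrK.
        have := enorm_ge0 (x - z)%R; move: M3 => M3'; nra.
      rewrite mulr1 -mulrBl normrM mulrC; apply: ler_pM => //.
      rewrite distrC; have -> // : (x - (y : V) - (x - z) = z - (y : V))%R.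
      by rewrite opprB addrC addrA subrK.
    rewrite notin_setE /reflect_set /outside /= => /negP/negPf h.
    by rewrite /F /kcut /f2 h !mulr0 mul0r subrr normr0.
  rewrite (lebn_integralZl mS mHx)//.
  rewrite -[leRHS]mule1; apply: lee_wpmul2l; first by rewrite lee_fin.
  rewrite reflect_setE (reflection_integral x (measurable_outside e) mH)//.
  exact: hsm.
apply: (le_trans (le_normr_Rintegral measurableT iF)).
rewrite -lee_fin /Rintegral fineK// ge0_fin_numE; first exact: le_lt_trans Fint (ltry _).
by apply: integral_ge0 => y _; rewrite lee_fin.
Qed.

Lemma lebn_reflect_cball (x : V) (e : R) : (0 < e)%R ->
  mu (reflect_set (cball e) x) = (e ^+ n * vB)%:E.
Proof.
move=> e0; rewrite reflect_setE lebn_affine ?oppr_eq0 ?oner_neq0//.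
by rewrite normrN1 expr1n invr1 mul1e lebn_cball.
Qed.

Lemma in_ball_weak (f : V -> R) (A e : R) (x : V) (k : nat) : bcs f -> (0 < A)%R -> (0 < e)%R ->
  (forall y, `|f y| <= gam * A)%R -> (2 ^+ k * e <= 2 * n%:R * M)%R ->
  2%:E * mu [set z | A / 4 < `|Tj K (fun y => f y * (enorm (x - y) <= e)%R%:R) z|]%R
    <= (cvol (R := R) (n := n) k)%:E.
Proof.
move=> bf A0 e0 fA ke; pose f1 (y : V) := (f y * (enorm (x - y) <= e)%R%:R)%R; rewrite -/f1.
have bf1 : bcs f1 by exact: (bcs_cut bf (measurable_in_ball x e)).
have A4 : (0 < A / 4)%R by rewrite divr_gt0.
have g0 := gam_gt0.
have f1A : \int[mu]_y (`|f1 y|)%:E <= (gam * A * (e ^+ n * vB))%:E.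
  have mS := measurable_reflect_set x (measurable_cball (R := R) (n := n) e).
  apply: (@le_trans _ _ (\int[mu]_(y in reflect_set (cball e) x) cst (gam * A)%:E y)).
    rewrite [leRHS]integral_mkcond; apply: ge0_le_lower_integral => y _; first by rewrite lee_fin.
    rewrite patchE; case: ifPn => [|].
      rewrite inE /reflect_set /cball /= => h; rewrite lee_fin /f1 h mulr1; exact: fA.
    rewrite notin_setE /reflect_set /cball /= => /negP/negPf h.
    by rewrite /f1 h mulr0 normr0.
  rewrite integral_cst// (_ : (_ * _) = (gam * A)%:E * mu (reflect_set (cball e) x))//.
  by rewrite lebn_reflect_cball// -EFinM.
apply: (@le_trans _ _ (2%:E * ((c / (A / 4))%:E * (gam * A * (e ^+ n * vB))%:E))).
  apply: lee_wpmul2l => //; apply: (le_trans (weak bf1 A4)).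
  by apply: lee_wpmul2l => //; rewrite lee_fin divr_ge0// ltW.
rewrite -!EFinM lee_fin.
have -> : (2 * (c / (A / 4) * (gam * A * (e ^+ n * vB))) = 8 * c * vB * gam * e ^+ n)%R.
  by field; rewrite gt_eqF.
have vB0 : (0 <= vB)%R by exact: vB_ge0.
have p0 := pow2_gt0 (R := R) k.
rewrite /cvol [leRHS]mulrC ler_pdivlMr ?exprn_gt0//.
have D0 : (0 < 8 * (c + 1) * (2 * n%:R * M) ^+ n * (vB + 1))%R.
  by rewrite !mulr_gt0 ?exprn_gt0// ltr_wpDl.
have gv : (gam * (8 * (c + 1) * (2 * n%:R * M) ^+ n * (vB + 1)) <= v1)%R.
  by rewrite -ler_pdivlMr// /gam ge_min lexx orbT.
apply: le_trans gv.
rewrite -[leLHS]mulrA (_ : (e ^+ n * (2 ^+ k) ^+ n = (2 ^+ k * e) ^+ n)%R); last by rewrite exprMn mulrC.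
rewrite [leRHS](_ : _ = (8 * (c + 1) * (vB + 1) * gam * (2 * n%:R * M) ^+ n)%R); last by ring.
apply: ler_pM.
- by rewrite !mulr_ge0// ltW.
- by rewrite exprn_ge0// mulr_ge0// ltW.
- apply: ler_wpM2r; first exact: ltW.
  by apply: ler_pM; rewrite ?mulr_ge0 ?ler_pM2l ?lerDl.
- by apply: lerXn2r; rewrite ?nnegrE ?(ltW nM0)// mulr_ge0// ltW.
Qed.

Lemma half_absorb (x : R) (a b : \bar R) : (0 <= x)%R -> 0 <= a -> 0 <= b ->
  x%:E <= a + b -> 2%:E * b <= x%:E -> x%:E <= 2%:E * a.
Proof.
move=> x0; case: a => [a| |]//=; last by move=> *; rewrite gt0_muley ?leey// lte_fin.
case: b => [b| |]//=; last by move=> _ _ _; rewrite gt0_muley ?lte_fin.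
by rewrite -EFinD -!EFinM !lee_fin; lra.
Qed.

(* Cotlar's argument: on the cell of [x] of size about [e], the truncation of
   [g] at [x] is within [A] of [Tj g - Tj (g 1_B(x, e))], so one of these two
   exceeds [A / 4] there; the second one does so on at most half of the cell. *)
Lemma good_part (g : V -> R) (A : R) : bcs g -> (0 < A)%R ->
  (forall y, `|g y| <= gam * A)%R -> mu [set x | ~ loc_const g x] = 0 ->
  mu [set x | exists e, (0 < e <= 1)%R /\ (A < `|T e g x|)%R] <=
  (8 * c / A)%:E * \int[mu]_y (`|g y|)%:E.
Proof.
move=> bg A0 gA lc.
have A4 : (0 < A / 4)%R by rewrite divr_gt0.
have g0 := gam_gt0.
have gam4 : (gam <= 1 / 4)%R by rewrite /gam ge_min lexx.
pose S : set V := [set z | A / 4 < `|Tj K g z|]%R.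
apply: (@le_trans _ _ (2%:E * mu S)); last first.
  apply: (@le_trans _ _ (2%:E * ((c / (A / 4))%:E * \int[mu]_y (`|g y|)%:E))).
    by apply: lee_wpmul2l => //; exact: weak.
  rewrite muleA -EFinM; apply: lee_wpmul2r.
    by apply: integral_ge0 => y _; rewrite lee_fin.
  by rewrite lee_fin le_eqVlt; apply/orP; left; apply/eqP; field; rewrite gt_eqF.
apply: dyadic_covering => x [e [/andP[e0 e1] hx]].
have n1 : (1 <= n%:R :> R)%R by rewrite ler1n.
have t1 : (1 <= n%:R * M / e)%R.
  by rewrite ler_pdivlMr// mul1r; move: M3 => M3'; nra.
(* Level j + 1 is the coarsest with n M / 2^(j + 1) < e: the cell is small enough for
   [off_ball_diff], and its volume is still comparable to e^n. Since e <= 1, such a level exists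
   among the nonnegative ones. *)
have [j /andP[j1 j2]] := @geometric_bracket_co R 2 _ (ltr1n _ 2) t1.
exists j.+1.
have p0 := pow2_gt0 (R := R) j.+1.
have nk : (n%:R / 2 ^+ j.+1 * M <= e)%R.
  rewrite mulrAC ler_pdivrMr//; move: j2; rewrite ltr_pdivrMr// => /ltW.
  by rewrite mulrC (mulrC e).
have ke : (2 ^+ j.+1 * e <= 2 * n%:R * M)%R.
  rewrite exprS -!mulrA ler_pM2l//; move: j1; rewrite ler_pdivlMr//.
pose f1 (y : V) := (g y * (enorm (x - y) <= e)%R%:R)%R.
pose f2 (y : V) := (g y * (e < enorm (x - y))%R%:R)%R.
have bf1 : bcs f1 by exact: (bcs_cut bg (measurable_in_ball x e)).
have bf2 : bcs f2 by exact: (bcs_cut bg (measurable_off_ball x e)).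
pose S1 : set V := [set z | A / 4 < `|Tj K f1 z|]%R.
have sub : cell j.+1 x `<=` (S `&` cell j.+1 x) `|` (S1 `|` [set z | ~ loc_const g z]).
  move=> z zx; have [[d0 [d00 gd]]|nl] := pselect (loc_const g z); last by right; right.
  have [zS|zS] := leP `|Tj K g z|%R (A / 4)%R; last by left.
  have [zS1|zS1] := leP `|Tj K f1 z|%R (A / 4)%R; last by right; left.
  exfalso.
  have xz : (M * enorm (x - z) <= e)%R.
    apply: le_trans nk; rewrite mulrC; apply: ler_wpM2r; first by move: M3 => ?; lra.
    by apply: cell_dist; rewrite zx.
  have xze : (enorm (x - z) <= e / 3)%R.
    have := enorm_ge0 (x - z)%R; move: M3 => ?; nra.
  (* In the ball of radius d about z both g and its restriction to B(x, e) are constant, so that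
     both principal values at z are the truncations at d. *)
  pose d := Num.min d0 (e / 2)%R.
  have d0' : (0 < d)%R by rewrite lt_min d00 divr_gt0.
  have de : (d <= e / 2)%R by rewrite ge_min lexx orbT.
  have dd : (d <= d0)%R by rewrite ge_min lexx.
  have xy (y : V) : (enorm (z - y) <= d)%R -> (enorm (x - y) <= e)%R.
    move=> zy; have := ler_enormD (x - z) (z - y)%R; rewrite addrA subrK; lra.
  have gz y : (enorm (z - y) <= d)%R -> g y = g z by move=> zy; apply: gd; exact: le_trans dd.
  have f1z y : (enorm (z - y) <= d)%R -> f1 y = f1 z.
    move=> zy; rewrite /f1 gz// xy//.
    by rewrite (_ : (enorm (x - z) <= e)%R)//; lra.
  have e1' : Tj K g z = T d g z by exact: (Tj_loc_const bK hsz hcanc bg d0' gz).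
  have e2 : Tj K f1 z = T d f1 z by exact: (Tj_loc_const bK hsz hcanc bf1 d0' f1z).
  have gE : g = (f1 \+ f2)%R.
    apply/funext => y; rewrite /f1 /f2 /= -mulrDr.
    by case: leP => _; rewrite ?addr0 ?add0r mulr1.
  have e3 : (T d g z = T d f1 z + T d f2 z)%R.
    rewrite {1}gE; apply: conv_add; exact: (bcs_conv_integrable bK hsz).
  have gA0 : (0 <= gam * A)%R by rewrite mulr_ge0 ?ltW.
  have e4 := off_ball_diff bg d0' e0 gA0 gA xz de.
  rewrite -/f2 in e4; move: hx e4 zS zS1 => /=; rewrite e1' e2 e3.
  move: (T d f1 z) (T d f2 z) (T e g x) => a b t ht.
  rewrite !ler_norml => /andP[h1 h2] /andP[h3 h4] /andP[h5 h6].
  move: ht; rewrite ltNge => /negP; apply; rewrite ler_norml; apply/andP; split; nra.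
have cv0 : (0 <= cvol (R := R) (n := n) j.+1)%R.
  by rewrite /cvol mulr_ge0 ?v1_ge0// invr_ge0 exprn_ge0// ltW.
rewrite lebn_cell; apply: (@half_absorb _ _ (mu S1)); rewrite ?lebn_ge0//.
  rewrite -(lebn_cell j.+1 x); apply: (le_trans (le_lebn sub)).
  apply: (le_trans (lebn_setU_le _ _)); apply: leeD => //.
  by apply: (le_trans (lebn_setU_le _ _)); rewrite lc adde0.
exact: in_ball_weak.
Qed.

End GoodPart.

(** * The Calderon-Zygmund decomposition of a dyadic step function *)

Section CalderonZygmund.
Context {R : realType} {n : nat}.
Local Notation V := 'rV[R]_n.
Local Notation E := (Rn R n).
Local Notation mu := (@lebn R n).
Local Notation v1 := (@v1 R n).
Local Notation cvl := (@cvol R n).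
Local Open Scope ereal_scope.

Lemma cvolS k : cvl k = (2 ^+ n * cvl k.+1)%R.
Proof.
have p0 := pow2_gt0 (R := R) k.
rewrite /cvol exprS exprMn invfM !mulrA divff ?mul1r// gt_eqF// exprn_gt0//.
Qed.

Lemma cvol_gt0 k : (0 < v1)%R -> (0 < cvl k)%R.
Proof. by move=> v10; rewrite mulr_gt0// invr_gt0 !exprn_gt0. Qed.

Lemma cell_int_cst k (x : V) (a : \bar R) : \int[mu]_(y in cell k x) cst a y = a * (cvl k)%:E.
Proof. by rewrite -(lebn_cell k x) integral_cst//; exact: measurable_cell. Qed.

Variables (h : V -> R) (J : nat) (A : R).
Hypothesis v10 : (0 < v1)%R.
Hypothesis ch : cellwise J h.
Hypothesis bh : bcs h.
Hypothesis A0 : (0 < A)%R.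
Hypothesis hA : \int[mu]_y (`|h y|)%:E <= (A * v1)%:E.

(** Levels are capped at J, where h is constant on cells. Hence an unstopped point has |h| <= A
    without any differentiation theorem, and everything built from the stopping time is constant on
    cells of level J, so measurable. *)
Definition heavy (k : nat) (x : V) : Prop :=
  (k <= J)%N /\ (A * cvl k)%:E < \int[mu]_(y in cell k x) (`|h y|)%:E.

Lemma cellwise_heavy k : cellwise k (heavy k).
Proof. by move=> x y /cell_eq e; rewrite /heavy e. Qed.

Lemma heavy0 x : ~ heavy 0 x.
Proof.
move=> [_]; apply/negP; rewrite -leNgt.
rewrite /cvol expr0 expr1n invr1 mul1r; apply: le_trans hA.
by apply: ge0_subset_lower_integral => // y; rewrite lee_fin.
Qed.

Local Notation U := (stopped heavy).
Local Notation fam := (stopfam heavy).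

(** No cell of level 0 is heavy, so a maximal heavy cell has a parent, which is light and 2^n times
    as large. *)
Lemma first_heavy_le k x : first_level heavy k x ->
  \int[mu]_(y in cell k x) (`|h y|)%:E <= (2 ^+ n * A * cvl k)%:E.
Proof.
case: k => [[/heavy0//]|k] [[kJ _] /(_ k (ltnSn _)) nk].
apply: (@le_trans _ _ (\int[mu]_(y in cell k x) (`|h y|)%:E)).
  apply: ge0_subset_lower_integral; first by move=> y; rewrite lee_fin.
  exact: cell_le.
rewrite leNgt; apply/negP => lt; apply: nk; split; first exact: ltnW.
by apply: le_lt_trans lt; rewrite lee_fin (cvolS k) mulrCA mulrA.
Qed.

(* On unstopped points the level is the junk value [0]. *)
Definition stop_level (x : V) : nat := xget 0%N [set k | first_level heavy k x].

Lemma stop_levelE k x : first_level heavy k x -> stop_level x = k.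
Proof.
by move=> fk; apply: xget_unique => // j fj; exact: first_level_uniq fj fk.
Qed.

Lemma stop_level_first x : U x -> first_level heavy (stop_level x) x.
Proof. by move=> /stoppedP[k fk]; rewrite (stop_levelE fk). Qed.

Lemma stop_level_le x : (stop_level x <= J)%N.
Proof.
have [Ux|nU] := pselect (U x); first by case: (stop_level_first Ux) => -[].
rewrite /stop_level xgetPN// => k fk; apply: nU.
by apply/stoppedP; exists k.
Qed.

Lemma cellwise_first_level k : cellwise J (first_level heavy k).
Proof.
have key j x y : cell_index J x = cell_index J y -> heavy j x -> heavy j y.
  move=> xy [jJ]; have jxy := cell_index_le jJ xy.
  by rewrite /heavy -(cell_eq jxy).
move=> x y xy; apply/propext; split => -[h1 h2]; split.
- exact: key h1.
- by move=> j /h2 nj hj; apply: nj; exact: key hj.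
- exact: key h1.
- by move=> j /h2 nj hj; apply: nj; exact: key hj.
Qed.

Lemma cellwise_stop_level : cellwise J stop_level.
Proof.
move=> x y xy; rewrite /stop_level; congr xget.
by apply/funext => k /=; exact: cellwise_first_level.
Qed.

Lemma cellwise_stopped : cellwise J (fun x => `[< U x >]).
Proof.
move=> x y xy; congr asbool; apply/propext; rewrite !stoppedP; split=> -[k fk]; exists k.
  by rewrite -(cellwise_first_level k xy).
by rewrite (cellwise_first_level k xy).
Qed.

(** The corner plays the role of the center of the stopped cell: it is common to all points of the
    cell and within [stop_diam] of each. *)
Definition stop_corner (x : V) : V := corner (stop_level x) x.
Definition stop_diam (x : V) : R := (n%:R / 2 ^+ stop_level x)%R.
Definition stop_avg (x : V) : R :=
  (Rintegral mu (cell (stop_level x) x) h / cvl (stop_level x))%R.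

Lemma cellwise_stop_diam : cellwise J stop_diam.
Proof. by move=> x y xy; rewrite /stop_diam (cellwise_stop_level xy). Qed.

Lemma cellwise_stop_corner : cellwise J stop_corner.
Proof.
move=> x y xy; rewrite /stop_corner (cellwise_stop_level xy) /corner.
by rewrite (cell_index_le (stop_level_le y) xy).
Qed.

Lemma cellwise_stop_avg : cellwise J stop_avg.
Proof.
move=> x y xy; rewrite /stop_avg (cellwise_stop_level xy).
by rewrite (cell_eq (cell_index_le (stop_level_le y) xy)).
Qed.

Lemma stop_corner_dist x : (enorm (x - stop_corner x) <= stop_diam x)%R.
Proof. exact: corner_dist. Qed.

Definition bad_part (x : V) : R := ((h x - stop_avg x) * `[< U x >]%:R)%R.

Lemma cellwise_bad : cellwise J bad_part.
Proof.
by move=> x y xy; rewrite /bad_part (cellwise_stopped xy) (ch xy) (cellwise_stop_avg xy).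
Qed.

Lemma measurable_bad : measurable_fun [set: E] (bad_part : E -> R).
Proof. exact: measurable_cellwise cellwise_bad. Qed.

Lemma h_integrable_cell k x : mu.-integrable (cell k x) (fun y : E => (h y)%:E).
Proof.
apply: (integrableS measurableT (measurable_cell k x)) => //.
exact: bcs_integrable.
Qed.

Lemma stop_avg_le x : U x ->
  (`|stop_avg x|)%:E * (cvl (stop_level x))%:E <=
    \int[mu]_(y in cell (stop_level x) x) (`|h y|)%:E.
Proof.
move=> Ux; have c0 := cvol_gt0 (stop_level x) v10.
rewrite -EFinM /stop_avg normrM normfV (gtr0_norm c0) mulfVK ?gt_eqF//.
apply: (@le_trans _ _ (Rintegral mu (cell (stop_level x) x) (fun y => `|h y|%R))%:E).
  rewrite lee_fin; apply: le_normr_Rintegral; first exact: measurable_cell.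
  exact: h_integrable_cell.
rewrite /Rintegral fineK// ge0_fin_numE; last by apply: integral_ge0 => y _; rewrite lee_fin.
by have /integrableP[_] := h_integrable_cell (stop_level x) x.
Qed.

Lemma good_le x : (`|h x - bad_part x| <= 2 ^+ n * A)%R.
Proof.
rewrite /bad_part; case: asboolP => Ux.
  have c0 := cvol_gt0 (stop_level x) v10.
  rewrite mulr1 opprB addrC subrK -(ler_pM2r c0) -lee_fin EFinM.
  exact: (le_trans (stop_avg_le Ux) (first_heavy_le (stop_level_first Ux))).
rewrite mulr0 subr0; have c0 := cvol_gt0 J v10.
apply: (@le_trans _ _ A); last by rewrite ler_peMl ?(ltW A0)// exprn_ege1// ler1n.
have nJ : ~ heavy J x by move=> hJ; apply: Ux; exists J.
rewrite -(ler_pM2r c0) -lee_fin leNgt; apply/negP => lt; apply: nJ; split => //.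
apply: (lt_le_trans lt).
have -> : \int[mu]_(y in cell J x) (`|h y|)%:E = \int[mu]_(y in cell J x) cst (`|h x|)%:E y.
  by apply: eq_integral => y; rewrite inE /cell /cellset /= => /ch ->.
by rewrite cell_int_cst EFinM.
Qed.

Section OneCell.
Variables (k : nat) (x : V).
Hypothesis fk : first_level heavy k x.

Lemma stop_cell_first y : cell k x y -> first_level heavy k y.
Proof. by move=> xy; exact: (first_level_cell cellwise_heavy (esym xy) fk). Qed.

Lemma stop_cell_level y : cell k x y -> stop_level y = k.
Proof. by move=> xy; exact: stop_levelE (stop_cell_first xy). Qed.

Lemma stop_cell_corner y : cell k x y -> stop_corner y = corner k x.
Proof. by move=> xy; rewrite /stop_corner (stop_cell_level xy) /corner xy. Qed.

Lemma stop_cell_avg y : cell k x y -> stop_avg y = stop_avg x.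
Proof.
move=> xy; rewrite /stop_avg (stop_cell_level xy) (stop_levelE fk).
by rewrite (cell_eq xy).
Qed.

Lemma stop_cell_bad y : cell k x y -> bad_part y = (h y - stop_avg x)%R.
Proof.
move=> xy; rewrite /bad_part asboolT ?mulr1 ?(stop_cell_avg xy)//.
by apply/stoppedP; exists k; exact: stop_cell_first.
Qed.

Lemma cell_int_bad : \int[mu]_(y in cell k x) (bad_part y)%:E = 0.
Proof.
have c0 := cvol_gt0 k v10; have mC := measurable_cell k x.
rewrite (eq_integral (fun y : E => (h y)%:E - cst (stop_avg x)%:E y)); last first.
  by move=> y; rewrite inE => xy; rewrite (stop_cell_bad xy).
have iC : mu.-integrable (cell k x) (cst (stop_avg x)%:E).
  apply/integrableP; split; first exact: measurable_cst.
  by rewrite (cell_int_cst k x `|stop_avg x|%:E) -EFinM ltry.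
rewrite integralB//; last exact: h_integrable_cell.
rewrite cell_int_cst -EFinM /stop_avg (stop_levelE fk) mulfVK ?gt_eqF//.
by rewrite /Rintegral fineK ?subee ?integrable_fin_num//; exact: h_integrable_cell.
Qed.

Lemma cell_int_abs_bad :
  \int[mu]_(y in cell k x) (`|bad_part y|)%:E <=
  2%:E * \int[mu]_(y in cell k x) (`|h y|)%:E.
Proof.
have mC := measurable_cell k x.
apply: (@le_trans _ _ (\int[mu]_(y in cell k x) ((`|h y|)%:E + cst (`|stop_avg x|)%:E y))).
  apply: ge0_le_lower_integral => y xy; first by rewrite lee_fin.
  by rewrite (stop_cell_bad xy) -EFinD lee_fin ler_normB.
have mh : measurable_fun [set: E] (fun y : E => (`|h y|)%:E).
  by apply: measurable_abs; case: bh.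
rewrite lebn_integralD; [|exact: mC|exact: mh|exact: measurable_cst|by move=> ?; rewrite lee_fin..].
rewrite (_ : 2%:E = 1 + 1)// ge0_muleDl// !mul1e; apply: leeD => //.
rewrite cell_int_cst -(stop_levelE fk); apply: stop_avg_le.
by apply/stoppedP; exists k.
Qed.

End OneCell.

Lemma stopped_integral_le (F G : E -> \bar R) : measurable_fun setT F ->
  measurable_fun setT G -> (forall x, 0 <= F x) -> (forall x, 0 <= G x) ->
  (forall k x, first_level heavy k x ->
     \int[mu]_(y in cell k x) F y <= \int[mu]_(y in cell k x) G y) ->
  \int[mu]_(y in [set y : E | U y]) F y <= \int[mu]_(y in [set y : E | U y]) G y.
Proof.
move=> mF mG F0 G0 FG; rewrite -bigcup_stopfam.
have mf := stopfam_measurable cellwise_heavy; have tf := @stopfam_trivIset _ _ heavy.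
rewrite !ge0_integral_bigcup//; try exact: measurable_funTS.
apply: lee_nneseries => [i _ _|i _]; first by apply: integral_ge0 => y _.
case: (stopfamP cellwise_heavy i) => [->|[k [x [fk ->]]]]; first by rewrite !integral_set0.
exact: FG.
Qed.

Lemma measurable_stopped_set : measurable ([set y : E | U y]).
Proof. exact: stopped_measurable cellwise_heavy. Qed.

Lemma measurable_absh : measurable_fun [set: E] (fun y : E => (`|h y|)%:E).
Proof. by apply: measurable_abs; case: bh. Qed.

Lemma int_stopped_le : \int[mu]_(y in [set y : E | U y]) (`|h y|)%:E <= \int[mu]_y (`|h y|)%:E.
Proof. by apply: ge0_subset_lower_integral => // y; rewrite lee_fin. Qed.

Lemma lebn_stopped : A%:E * mu [set y : E | U y] <= \int[mu]_y (`|h y|)%:E.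
Proof.
have mU := measurable_stopped_set.
apply: le_trans int_stopped_le.
have -> : A%:E * mu [set y : E | U y] = \int[mu]_(y in [set y : E | U y]) cst A%:E y.
  by rewrite integral_cst.
apply: stopped_integral_le; first exact: measurable_cst.
- exact: measurable_absh.
- by move=> x; rewrite lee_fin ltW.
- by move=> x; rewrite lee_fin.
- move=> k x [[_ /ltW fk] _]; by rewrite cell_int_cst -EFinM.
Qed.

Lemma bad_off x : ~ U x -> bad_part x = 0%R.
Proof. by move=> Ux; rewrite /bad_part asboolF ?mulr0. Qed.

Lemma int_bad_le : \int[mu]_y (`|bad_part y|)%:E <= 2%:E * \int[mu]_y (`|h y|)%:E.
Proof.
have mU := measurable_stopped_set.
apply: (@le_trans _ _ (\int[mu]_(y in [set y : E | U y]) (`|bad_part y|)%:E)).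
  rewrite [leRHS]integral_mkcond; apply: ge0_le_lower_integral => y _; first by rewrite lee_fin.
  rewrite patchE; case: ifPn => //; rewrite notin_setE /= => /bad_off ->.
  by rewrite normr0.
apply: (@le_trans _ _ (\int[mu]_(y in [set y : E | U y]) (2%:E * (`|h y|)%:E))).
  apply: stopped_integral_le.
  - by apply: measurable_abs; exact: measurable_bad.
  - exact: (measurable_funeM _ measurable_absh).
  - by move=> x; rewrite lee_fin.
  - by move=> x; rewrite -EFinM lee_fin mulr_ge0.
  - move=> k x fk; apply: (le_trans (cell_int_abs_bad fk)).
    by rewrite lebn_integralZl; [|exact: measurable_cell|exact: measurable_absh|move=> y; rewrite lee_fin|].
rewrite lebn_integralZl; [|exact: mU|exact: measurable_absh|by move=> y; rewrite lee_fin|by []].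
by apply: lee_wpmul2l => //; exact: int_stopped_le.
Qed.

Lemma bcs_good : bcs (fun x => h x - bad_part x)%R.
Proof.
have [mh _ [N hN]] := bh; split.
- exact: (measurable_funB mh measurable_bad).
- by exists (2 ^+ n * A)%R; exact: good_le.
- exists (N + n%:R)%R => x xN.
  have hx : h x = 0%R by apply: hN; apply: le_lt_trans xN; rewrite lerDl.
  have -> : bad_part x = 0%R; last by rewrite hx subrr.
  apply: bad_off => Ux; have [[_ hv] _] := stop_level_first Ux.
  move: hv; rewrite (eq_integral (cst 0)).
    rewrite integral0; apply/negP; rewrite -leNgt lee_fin.
    by rewrite mulr_ge0 ?(ltW A0)//; exact/ltW/cvol_gt0.
  move=> y; rewrite inE => xy /=; rewrite hN ?normr0//.
  have := cell_dist (esym xy : cell_index (stop_level x) x = _).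
  have := ler_enormD y (x - y)%R; rewrite addrC subrK => h1 h2.
  have p1 : (n%:R / 2 ^+ stop_level x <= n%:R :> R)%R.
    by rewrite ler_pdivrMr ?pow2_gt0// ler_peMr// exprn_ege1// ler1n.
  rewrite -(ltrD2r n%:R); apply: (lt_le_trans xN); apply: (le_trans h1).
  by rewrite lerD2l; exact: le_trans p1.
Qed.

Lemma bcs_bad : bcs bad_part.
Proof.
have [mg [Bg gB] [N gN]] := bcs_good; have [mh [Bh hB] [N' hN]] := bh.
split; first exact: measurable_bad.
  exists (Bg + Bh)%R => x.
  rewrite (_ : bad_part x = h x - (h x - bad_part x))%R; last by rewrite opprB addrC subrK.
  by apply: (le_trans (ler_normB _ _)); rewrite addrC lerD.
exists (`|N| + `|N'|)%R => x xN.
have := gN x; have := hN x; have := ler_norm N; have := ler_norm N'.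
have := normr_ge0 N; have := normr_ge0 N' => h1 h2 h3 h4 h5 h6.
have : h x = 0%R by apply: h5; lra.
have : (h x - bad_part x = 0)%R by apply: h6; lra.
lra.
Qed.

End CalderonZygmund.

(** * Truncations of the bad part *)

Section BadPart.
Context {R : realType} {n : nat}.
Local Notation V := 'rV[R]_n.
Local Notation E := (Rn R n).
Local Notation mu := (@lebn R n).
Local Notation v1 := (@v1 R n).
Local Notation vB := (@vB R n).
Local Notation cvl := (@cvol R n).
Local Open Scope ereal_scope.

Variables (K : V -> R) (M L : R).
Hypothesis n0 : (0 < n)%N.
Hypothesis v10 : (0 < v1)%R.
Hypothesis bK : borel_fun K.
Hypothesis M3 : (3 <= M)%R.
Hypothesis hsm : forall (rho : R) (y : V), (0 < rho)%R -> (M * enorm y <= rho)%R ->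
  \int[mu]_(x in outside rho) (`|K ((x : V) - y) - K x|)%:E <= 1.
Hypothesis L0 : (0 <= L)%R.
Hypothesis hsz : forall r s, (0 < r)%R -> (r <= s)%R ->
  \int[mu]_(x in shell r s) (`|K x|)%:E <= ((s / r) ^+ n * L)%:E.

Variables (h : V -> R) (J : nat) (A : R).
Hypothesis ch : cellwise J h.
Hypothesis bh : bcs h.
Hypothesis A0 : (0 < A)%R.
Hypothesis hA : \int[mu]_y (`|h y|)%:E <= (A * v1)%:E.

Local Notation U := (stopped (heavy h J A)).
Local Notation bad := (bad_part h J A).
Local Notation cr := (stop_corner h J A).
Local Notation dm := (stop_diam h J A).

(** Bound for the mean of |bad| over a stopped cell: twice the mean of |h|, itself at most 2^n A. *)
Let B : R := (2 ^+ n.+1 * A)%R.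
Let B0 : (0 <= B)%R. Proof. by rewrite mulr_ge0 ?exprn_ge0// ltW. Qed.

(** The oscillation of K is integrated once against |bad| and once more, after |bad| has been
    replaced by its mean bound B near the edge of the truncation, against B on the stopped set. *)
Definition bad_weight (y : V) : R := (`|bad y| + B * `[< U y >]%:R)%R.

Lemma bad_weight_ge0 y : (0 <= bad_weight y)%R.
Proof. by rewrite addr_ge0// mulr_ge0. Qed.

(** The cut-off is the region where the smoothness hypothesis applies to the shift y - cr y, so that
    the integral in x is at most 1 for every y. *)
Definition bad_osc (x y : V) : R :=
  ((M * dm y < enorm (x - cr y))%R%:R * `|K (x - y) - K (x - cr y)|)%R.

Lemma bad_osc_ge0 x y : (0 <= bad_osc x y)%R.
Proof. by rewrite mulr_ge0. Qed.

(** It does not involve e, so it controls the oscillation for all truncations at once, and its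
    integral is bounded by that of [bad_weight]. *)
Definition bad_majorant (x : V) : \bar R := \int[mu]_y (bad_osc x y * bad_weight y)%:E.

Lemma coordm_cr : coord_measurable (cr : E -> V).
Proof. exact: coordm_cellwise (cellwise_stop_corner h A). Qed.

Lemma coordm_cr2 : coord_measurable (fun p : E * E => (p.1 : V) - cr p.2)%R.
Proof.
apply: coordmB; first exact: coordm_fst_id.
by move=> i; apply: (measurableT_comp (coordm_cr i)); exact: measurable_snd.
Qed.

Lemma cellwise_weight : cellwise J bad_weight.
Proof.
by move=> x y xy; rewrite /bad_weight (cellwise_bad A ch xy) (cellwise_stopped h A xy).
Qed.

Lemma measurable_weight : measurable_fun [set: E] (bad_weight : E -> R).
Proof. exact: measurable_cellwise cellwise_weight. Qed.

Lemma measurable_osc : measurable_fun [set: E * E] (fun p : E * E => bad_osc p.1 p.2).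
Proof.
apply: measurable_funM.
  apply: measurable_natr; apply: measurable_fun_ltr; last exact: measurable_enorm coordm_cr2.
  apply: measurable_funM; first exact: measurable_cst.
  apply: (measurableT_comp _ (@measurable_snd _ _ E E)).
  exact: measurable_cellwise (cellwise_stop_diam h A).
apply: (measurableT_comp (@normr_measurable R setT)).
exact: (measurable_funB (borel_fun_comp bK coordm_sub) (borel_fun_comp bK coordm_cr2)).
Qed.

Lemma measurable_majorant_integrand : measurable_fun [set: E * E]
  (fun p : E * E => (bad_osc p.1 p.2 * bad_weight p.2)%:E).
Proof.
apply/measurable_EFinP; apply: (measurable_funM measurable_osc).
exact: (measurableT_comp measurable_weight (@measurable_snd _ _ E E)).
Qed.

Lemma measurable_majorant : measurable_fun [set: E] (bad_majorant : E -> \bar R).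
Proof.
apply: (tonelli_measurable measurableT measurable_majorant_integrand) => p.
by rewrite lee_fin mulr_ge0 ?bad_osc_ge0 ?bad_weight_ge0.
Qed.

Lemma stop_diam_gt0 y : (0 < dm y)%R.
Proof. by rewrite divr_gt0 ?ltr0n// pow2_gt0. Qed.

Lemma int_osc_le y : \int[mu]_x (bad_osc (x : V) y)%:E <= 1.
Proof.
have rho0 : (0 < M * dm y)%R by rewrite mulr_gt0 ?stop_diam_gt0//; move: M3 => M3'; lra.
have ycr : (M * enorm (y - cr y) <= M * dm y)%R.
  by apply: ler_wpM2l; [move: M3 => M3'; lra|exact: stop_corner_dist].
apply: le_trans (hsm rho0 ycr).
pose F (u : E) := (`|K ((u : V) - (y - cr y)) - K u|)%:E.
have mF : measurable_fun setT F.
  apply: measurable_abs.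
  exact: (measurable_funB (borel_fun_comp bK (coordm_subl _)) (borel_fun_measurable bK)).
have F0 w : 0 <= F w by rewrite lee_fin.
rewrite -(@translation_integral R n F (outside (M * dm y)) (cr y) (measurable_outside _) mF F0).
rewrite [leRHS]integral_mkcond; apply: ge0_le_lower_integral => x _.
  by rewrite lee_fin bad_osc_ge0.
rewrite patchE; case: ifPn => [|].
  rewrite inE /affine /outside /= scale1r => hx.
  rewrite /F lee_fin /bad_osc hx mul1r.
  by rewrite (_ : (x : V) - cr y - (y - cr y) = (x : V) - y)%R// opprB addrA subrK.
rewrite notin_setE /affine /outside /= scale1r => /negP/negPf hx.
by rewrite /bad_osc hx mul0r.
Qed.

Lemma int_majorant : \int[mu]_x bad_majorant x <= \int[mu]_y (bad_weight y)%:E.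
Proof.
rewrite /bad_majorant.
rewrite (tonelli measurableT measurableT measurable_majorant_integrand); last first.
  by move=> p; rewrite lee_fin mulr_ge0 ?bad_osc_ge0 ?bad_weight_ge0.
apply: ge0_le_lower_integral => y _.
  by apply: integral_ge0 => x _; rewrite lee_fin mulr_ge0 ?bad_osc_ge0 ?bad_weight_ge0.
have mo : measurable_fun setT (fun x : E => (bad_osc (x : V) y)%:E).
  by apply/measurable_EFinP; exact: (measurable_fun_pair1 y measurable_osc).
rewrite (_ : (fun x : E => _) = (fun x : E => (bad_weight y)%:E * (bad_osc (x : V) y)%:E)).
  rewrite (lebn_integralZl measurableT mo); last exact: bad_weight_ge0.
    by rewrite -[leRHS]mule1; apply: lee_wpmul2l (int_osc_le y); rewrite lee_fin bad_weight_ge0.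
  by move=> x; rewrite lee_fin bad_osc_ge0.
by apply/funext => x; rewrite -EFinM mulrC.
Qed.

Lemma int_weight : \int[mu]_y (bad_weight y)%:E <=
  (2 + 2 ^+ n.+1)%:E * \int[mu]_y (`|h y|)%:E.
Proof.
have mU := measurable_stopped_set h J A.
have I0 : 0 <= \int[mu]_y (`|h y|)%:E by apply: integral_ge0 => y _; rewrite lee_fin.
rewrite (_ : (fun y : E => (bad_weight y)%:E) =
   (fun y : E => (`|bad y|)%:E + (B * `[< U y >]%:R)%:E))//.
have mu2 : measurable_fun [set: E] (fun y : E => (B * `[< U y >]%:R)%:E).
  by apply: (@measurable_cellwise _ _ _ _ J) => x y xy; rewrite (cellwise_stopped h A xy).
rewrite lebn_integralD; [|exact: measurableT|by apply: measurable_abs; exact: (measurable_bad A ch)|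
  exact: mu2|by move=> y; rewrite lee_fin|by move=> y; rewrite lee_fin mulr_ge0].
rewrite EFinD ge0_muleDl//; apply: leeD; first exact: (int_bad_le A v10 ch bh).
apply: (@le_trans _ _ (\int[mu]_(y in [set y : E | U y]) cst B%:E y)).
  rewrite [leRHS]integral_mkcond; apply: ge0_le_lower_integral => y _.
    by rewrite lee_fin mulr_ge0.
  rewrite patchE; case: asboolP => Uy; first by rewrite mem_set// mulr1.
  by rewrite memNset// mulr0.
have -> : \int[mu]_(y in [set y : E | U y]) cst B%:E y = B%:E * mu [set y : E | U y].
  by rewrite integral_cst.
rewrite /B EFinM -muleA; apply: lee_wpmul2l; first by rewrite lee_fin exprn_ge0.
exact: (lebn_stopped J bh A0).
Qed.

Definition bad_nbhd : set V := [set x | exists y, U y /\ (enorm (x - cr y) <= M * dm y)%R].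

(** All points of a stopped cell share corner and diameter bound, hence one ball per cell. Its
    volume is (M n)^n vB / v1 times that of the cell, and the stopped set has measure at most the
    integral of |h| over A. *)
Lemma lebn_bad_nbhd :
  mu bad_nbhd <= ((M * n%:R) ^+ n * vB / v1 / A)%:E * \int[mu]_y (`|h y|)%:E.
Proof.
pose ball (i : nat) : set V :=
  [set x | exists y, stopfam (heavy h J A) i y /\ (enorm (x - cr y) <= M * dm y)%R].
pose Q : R := ((M * n%:R) ^+ n * vB / v1)%R.
have Mn0 : (0 < M * n%:R)%R by rewrite mulr_gt0 ?ltr0n//; move: M3 => M3'; lra.
have Q0 : (0 <= Q)%R by rewrite !mulr_ge0 ?vB_ge0 ?invr_ge0 ?exprn_ge0// ltW.
apply: (@le_trans _ _ (mu (\bigcup_i ball i))).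
  apply: le_lebn => x [y [Uy xy]].
  have : (\bigcup_i stopfam (heavy h J A) i) y by rewrite bigcup_stopfam.
  by move=> [i _ iy]; exists i => //; exists y.
apply: (le_trans (lebn_bigcup_le _)).
apply: (@le_trans _ _ (Q%:E * \sum_(i <oo) mu ([set y : E | U y] `&` stopfam (heavy h J A) i))).
  rewrite -nneseriesZl; last by move=> *; exact: lebn_ge0.
  apply: lee_nneseries => [*|i _]; first exact: lebn_ge0.
  case: (stopfamP (cellwise_heavy h J A) i) => [e|[k [y0 [fk e]]]].
    rewrite (_ : ball i = set0); first by rewrite lebn_set0 mule_ge0 ?lee_fin ?lebn_ge0.
    by apply/seteqP; split => // x [y []]; rewrite e.
  rewrite e (_ : _ `&` _ = cell k y0); last first.
    apply/seteqP; split => [y []//|y yc]; split => //.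
    by apply/stoppedP; exists k; exact: (stop_cell_first fk).
  have r0 : (0 < M * (n%:R / 2 ^+ k))%R by rewrite mulrA divr_gt0// pow2_gt0.
  apply: (@le_trans _ _ (mu (reflect_set (cball (M * (n%:R / 2 ^+ k))) (corner k y0)))).
    apply: le_lebn => x [y []]; rewrite e => yc.
    rewrite /reflect_set /cball /= (stop_cell_corner fk yc) /stop_diam (stop_cell_level fk yc).
    by rewrite -[(corner k y0 - x)%R]opprB enormN.
  rewrite lebn_reflect_cball// lebn_cell -EFinM lee_fin /Q /cvol.
  rewrite mulrA exprMn exprVn [leLHS](_ : _ = (M * n%:R) ^+ n * vB / v1 * ((2 ^+ k) ^- n * v1))%R//.
  by field; rewrite !gt_eqF// ?exprn_gt0// pow2_gt0.
rewrite -/Q [(Q / A)%:E]EFinM -muleA; apply: lee_wpmul2l; first by rewrite lee_fin.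
apply: (@le_trans _ _ (mu [set y : E | U y])).
  apply: lebn_sum_setI_le; first by move=> i; exact: stopfam_measurable (cellwise_heavy h J A) i.
  exact: stopfam_trivIset.
rewrite -[leLHS]mul1e (_ : 1%R%:E = (A^-1)%:E * A%:E); last by rewrite -EFinM mulVf ?gt_eqF.
rewrite -muleA; apply: lee_wpmul2l; first by rewrite lee_fin invr_ge0 ltW.
exact: (lebn_stopped J bh A0).
Qed.

Lemma stopped_integral_leT (F G : E -> \bar R) : measurable_fun setT F ->
  measurable_fun setT G -> (forall x, 0 <= F x) -> (forall x, 0 <= G x) ->
  (forall x, ~ U x -> F x = 0) ->
  (forall k x, first_level (heavy h J A) k x ->
     \int[mu]_(y in cell k x) F y <= \int[mu]_(y in cell k x) G y) ->
  \int[mu]_y F y <= \int[mu]_y G y.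
Proof.
move=> mF mG F0 G0 offF FG.
apply: (@le_trans _ _ (\int[mu]_(y in [set y : E | U y]) F y)).
  rewrite [leRHS]integral_mkcond; apply: ge0_le_lower_integral => y _ //.
  by rewrite patchE; case: ifPn => //; rewrite notin_setE /= => /offF ->.
apply: (le_trans (stopped_integral_le mF mG F0 G0 FG)).
exact: ge0_subset_lower_integral.
Qed.

Section Pointwise.
Variables (x : V) (e : R).
Hypothesis xU : ~ bad_nbhd x.
Hypothesis e0 : (0 < e)%R.

Let ct (y : V) : R := kcut K e (x - cr y).
Let a (y : E) : R := (kcut K e (x - (y : V)) * bad y)%R.
Let a3 (y : E) : R := (ct y * bad y)%R.
(** Localizes the cells on which the cut-offs at y and at cr y can disagree. For x outside
    [bad_nbhd] and M >= 3, |y - cr y| < |x - cr y| / 3, so |x - y| is between 2/3 and 4/3 of |x - cr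
    y|; if e separates the two, then |x - cr y| is between 3 e / 4 and 3 e / 2. *)
Let phi (y : V) : R :=
  ((3 * e / 4 <= enorm (x - cr y) <= 3 * e / 2)%R%:R * `|K (x - cr y)|)%R.

Let far y : U y -> (3 * enorm (y - cr y) < enorm (x - cr y))%R /\ (M * dm y < enorm (x - cr y))%R.
Proof.
move=> Uy; have h1 : (M * dm y < enorm (x - cr y))%R.
  by rewrite ltNge; apply/negP => h1; apply: xU; exists y.
split => //; apply: le_lt_trans h1; apply: ler_pM => //; [exact: enorm_ge0|exact: stop_corner_dist].
Qed.

Let near_edge y : (enorm (x - cr y) - enorm (y - cr y) <= enorm (x - y) <=
  enorm (x - cr y) + enorm (y - cr y))%R.
Proof.
have h1 := ler_enormD (x - y) (y - cr y)%R; rewrite addrA subrK in h1.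
have h2 := ler_enormB (x - cr y) (y - cr y)%R; rewrite opprB addrA subrK in h2.
by rewrite h2 andbT lerBlDr.
Qed.

(* [a3] replaces [x - y] by [x - cr y] both in the kernel and in the cut-off: it
   is a function constant on cells times [bad], hence has integral zero. *)
Lemma bad_pointwise1 y :
  (`|a y - a3 y| <= bad_osc x y * `|bad y| + phi y * `|bad y|)%R.
Proof.
have [Uy|nU] := pselect (U y); last first.
  by rewrite /a /a3 bad_off// !mulr0 subrr normr0 !mulr0 addr0.
have [f1 f2] := far Uy; have /andP[n1 n2] := near_edge y; have d0 := enorm_ge0 (y - cr y)%R.
rewrite /a /a3 -mulrBl normrM -mulrDl; apply: ler_wpM2r => //.
rewrite /bad_osc f2 mul1r /ct /kcut /phi.
have e0' := e0.
case: (ltP e (enorm (x - y))) => h1; case: (ltP e (enorm (x - cr y))) => h2.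
- by rewrite !mulr1 lerDl mulr_ge0.
- have -> : (3 * e / 4 <= enorm (x - cr y) <= 3 * e / 2)%R by apply/andP; split; lra.
  by rewrite !mulr1 mul1r mulr0 subr0 -{1}(subrK (K (x - cr y)) (K (x - y))) ler_normD.
- have -> : (3 * e / 4 <= enorm (x - cr y) <= 3 * e / 2)%R by apply/andP; split; lra.
  by rewrite !mulr1 mul1r mulr0 sub0r normrN lerDr.
- by rewrite !mulr0 subrr normr0 addr_ge0// mulr_ge0.
Qed.

(** On the support of phi, |x - y| lies between e / 2 and 2 e. Going back from cr y to y costs one
    more oscillation term and leaves K on a fixed shell, where its size is known. *)
Lemma bad_pointwise2 y : (phi y * (B * `[< U y >]%:R) <= bad_osc x y * (B * `[< U y >]%:R) +
  B * (`|K (x - y)| * ((e / 4 < enorm (x - y))%R && (enorm (x - y) <= 2 * e)%R)%:R))%R.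
Proof.
case: asboolP => Uy; last by rewrite !mulr0 add0r mulr_ge0// mulr_ge0.
have [f1 f2] := far Uy; have /andP[n1 n2] := near_edge y; have d0 := enorm_ge0 (y - cr y)%R.
rewrite mulr1 ![(_ * B)%R]mulrC -mulrDr; apply: ler_wpM2l => //.
rewrite /bad_osc f2 mul1r /phi; have e0' := e0.
case: (boolP (_ <= _ <= _)%R) => [/andP[h1 h2]|_]; last first.
  by rewrite mul0r addr_ge0// mulr_ge0.
have -> : (e / 4 < enorm (x - y))%R by lra.
have -> : (enorm (x - y) <= 2 * e)%R by lra.
rewrite mul1r mulr1 distrC -{1}(subrK (K (x - y)) (K (x - cr y))); exact: ler_normD.
Qed.

Lemma cellwise_phi : cellwise J phi.
Proof. by move=> y z yz; rewrite /phi (cellwise_stop_corner h A yz). Qed.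

Lemma cellwise_a3 : cellwise J a3.
Proof.
by move=> y z yz; rewrite /a3 /ct (cellwise_stop_corner h A yz) (cellwise_bad A ch yz).
Qed.

Lemma int_a3 : mu.-integrable setT (fun y : E => (a3 y)%:E) -> \int[mu]_y (a3 y)%:E = 0.
Proof.
move=> i3; have mU := measurable_stopped_set h J A.
have -> : \int[mu]_y (a3 y)%:E = \int[mu]_(y in \bigcup_i stopfam (heavy h J A) i) (a3 y)%:E.
  rewrite [RHS]integral_mkcond; apply: eq_integral => y _; rewrite patchE bigcup_stopfam.
  by case: ifPn => //; rewrite notin_setE /= => nU; rewrite /a3 bad_off// mulr0.
have mf := stopfam_measurable (cellwise_heavy h J A).
rewrite integral_bigcup//; [|exact: stopfam_trivIset|]; last first.
  by apply: (integrableS measurableT _ _ i3) => //; exact: bigcupT_measurable.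
apply: eseries0 => i _ _.
case: (stopfamP (cellwise_heavy h J A) i) => [->|[k [z [fk ->]]]].
  by rewrite integral_set0.
rewrite (eq_integral (fun y : E => (ct z)%:E * (bad y)%:E)); last first.
  move=> y; rewrite inE => yz.
  by rewrite /a3 /ct (stop_cell_corner fk yz) (stop_cell_corner fk (cell_refl k z)) EFinM.
rewrite integralZl; [|exact: measurable_cell|]; last first.
  apply: (integrableS measurableT (measurable_cell k z)) => //.
  by apply: bcs_integrable; exact: bcs_bad.
by rewrite cell_int_bad// mule0.
Qed.

(** The edge term phi |bad| has no cancellation, but phi is constant on stopped cells, so |bad| may
    be replaced there by its mean bound B. What remains is B times the integral of |K| over a shell
    of ratio 2 e / (e / 4) = 8. *)
Lemma bad_pointwise : (`|conv (kcut K e) bad x|)%:E <= bad_majorant x + (B * (8 ^+ n * L))%:E.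
Proof.
have bb := bcs_bad v10 ch bh A0 hA.
have ia : conv_integrable (kcut K e) bad x := bcs_conv_integrable bK hsz x bb e0.
have mb := measurable_bad A ch.
pose osc y := (bad_osc x y * `|bad y|)%R.
have mosc : measurable_fun [set: E] (fun y : E => bad_osc x y).
  exact: (measurableT_comp measurable_osc (@pair1_measurable _ _ E E x)).
have mabs : measurable_fun [set: E] (fun y : E => `|bad y|%R).
  exact: (measurableT_comp (@normr_measurable R setT) mb).
have mo : measurable_fun [set: E] (fun y : E => (osc y)%:E).
  by apply/measurable_EFinP; exact: (measurable_funM mosc mabs).
pose F (y : E) := (phi y * `|bad y|)%:E.
pose G (y : E) := (phi y * (B * `[< U y >]%:R))%:E.
have phi0 y : (0 <= phi y)%R by rewrite mulr_ge0.
have mF : measurable_fun setT F.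
  by apply: (@measurable_cellwise _ _ _ _ J) => y z yz; rewrite /F (cellwise_phi yz) (cellwise_bad A ch yz).
have mG : measurable_fun setT G.
  by apply: (@measurable_cellwise _ _ _ _ J) => y z yz; rewrite /G (cellwise_phi yz) (cellwise_stopped h A yz).
have F0 y : 0 <= F y by rewrite lee_fin mulr_ge0.
have G0 y : 0 <= G y by rewrite lee_fin; apply: mulr_ge0 => //; exact: mulr_ge0.
have o0 y : 0 <= (osc y)%:E by rewrite lee_fin mulr_ge0 ?bad_osc_ge0.
have FG : \int[mu]_y F y <= \int[mu]_y G y.
  apply: (stopped_integral_leT mF mG F0 G0) => [y nU|k y fk].
    by rewrite /F bad_off// normr0 mulr0.
  rewrite (eq_integral (fun z : E => (phi y)%:E * (`|bad z|)%:E)); last first.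
    move=> z; rewrite inE => yz; rewrite /F /phi (stop_cell_corner fk yz).
    by rewrite (stop_cell_corner fk (cell_refl k y)) EFinM.
  rewrite [leRHS](eq_integral (cst (phi y * B)%:E)); last first.
    move=> z; rewrite inE => yz; rewrite /G /phi (stop_cell_corner fk yz).
    rewrite (stop_cell_corner fk (cell_refl k y)) asboolT ?mulr1//.
    by apply/stoppedP; exists k; exact: (stop_cell_first fk).
  rewrite cell_int_cst lebn_integralZl; [|exact: measurable_cell|by apply: measurable_abs|
    by move=> z; rewrite lee_fin|exact: phi0].
  rewrite [(phi y * B)%:E]EFinM -muleA; apply: lee_wpmul2l; first by rewrite lee_fin.
  apply: (le_trans (cell_int_abs_bad v10 bh fk)).
  apply: (@le_trans _ _ (2%:E * (2 ^+ n * A * cvl k)%:E)).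
    by apply: lee_wpmul2l => //; exact: (first_heavy_le hA fk).
  by rewrite -!EFinM lee_fin /B exprS !mulrA.
pose S := reflect_set (shell (e / 4) (2 * e)) x.
have mS : measurable S by apply: measurable_reflect_set; exact: measurable_shell.
pose kS (y : E) := (B * (`|K (x - (y : V))| *
  ((e / 4 < enorm (x - (y : V)))%R && (enorm (x - (y : V)) <= 2 * e)%R)%:R))%:E.
have maK : measurable_fun setT (fun y : E => (`|K (x - (y : V))|)%:E).
  exact: (measurable_absK bK (coordm_subr x)).
have kSle : \int[mu]_y kS y <= (B * (8 ^+ n * L))%:E.
  apply: (@le_trans _ _ (\int[mu]_(y in S) (B%:E * (`|K (x - (y : V))|)%:E))).
    rewrite [leRHS]integral_mkcond; apply: ge0_le_lower_integral => y _.
      rewrite lee_fin; apply: mulr_ge0 => //; exact: mulr_ge0.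
    rewrite patchE; case: ifPn => [_|].
      by rewrite /kS -EFinM lee_fin; apply: ler_wpM2l => //; apply: ler_piMr => //; case: (_ && _).
    rewrite notin_setE /S /reflect_set /shell /= => ny.
    rewrite /kS; case: (boolP (_ && _)) => [/andP[h1 h2]|_]; last by rewrite !mulr0.
    by case: ny; rewrite h1.
  rewrite (lebn_integralZl mS maK) => [|y|//]; last by rewrite lee_fin.
  rewrite [(B * _)%:E]EFinM; apply: lee_wpmul2l; first by rewrite lee_fin.
  have e4 : (0 < e / 4)%R by rewrite divr_gt0.
  have e42 : (e / 4 <= 2 * e)%R by move: e0 => e0'; lra.
  apply: (le_trans (reflect_shell_absK bK hsz x e4 e42)).
  rewrite lee_fin (_ : (2 * e / (e / 4) = 8)%R)//.
  by field; rewrite gt_eqF.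
have mkS : measurable_fun setT kS.
  apply/measurable_EFinP; apply: measurable_funM; first exact: measurable_cst.
  apply: measurable_funM; first by exact/measurable_EFinP.
  apply: measurable_natr; apply: measurable_and; first exact: coordm_enorm_lt (coordm_subr x).
  exact: measurable_in_ball.
have mw : measurable_fun setT (fun y : E => (bad_osc x y * bad_weight y)%:E).
  by apply/measurable_EFinP; exact: (measurable_funM mosc measurable_weight).
have bound : \int[mu]_y (`|a y - a3 y|)%:E <= bad_majorant x + (B * (8 ^+ n * L))%:E.
  apply: (@le_trans _ _ (\int[mu]_y ((osc y)%:E + F y))).
    apply: ge0_le_lower_integral => y _; first by rewrite lee_fin.
    by rewrite -EFinD lee_fin; exact: bad_pointwise1.
  rewrite (lebn_integralD measurableT mo mF o0 F0).
  apply: (@le_trans _ _ (\int[mu]_y (osc y)%:E + \int[mu]_y G y)); first by apply: leeD.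
  rewrite -(lebn_integralD measurableT mo mG o0 G0).
  apply: (@le_trans _ _ (\int[mu]_y ((bad_osc x y * bad_weight y)%:E + kS y))).
    apply: ge0_le_lower_integral => y _; first by rewrite adde_ge0.
    rewrite -!EFinD lee_fin /osc /bad_weight [(_ * (_ + _))%R]mulrDr -addrA lerD2l.
    exact: bad_pointwise2.
  rewrite (lebn_integralD measurableT mw mkS); [by apply: leeD| |].
    by move=> y; rewrite lee_fin mulr_ge0 ?bad_osc_ge0 ?bad_weight_ge0.
  by move=> y; rewrite lee_fin mulr_ge0// mulr_ge0.
(* A finite majorant makes a - a3 integrable, hence also a3, whose integral can then be computed
   cell by cell. *)
have [fin|] := ltP (bad_majorant x) +oo; last first.
  by rewrite leye_eq => /eqP ->; rewrite addye// leey.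
have ma : measurable_fun setT (fun y : E => a y) := measurable_conv_integrand x (borel_kcut e bK) mb.
have m3 : measurable_fun setT (fun y : E => a3 y) by exact: measurable_cellwise cellwise_a3.
have i12 : mu.-integrable setT (fun y : E => (a y - a3 y)%:E).
  apply/integrableP; split; first by apply/measurable_EFinP; exact: measurable_funB.
  by apply: (le_lt_trans bound); rewrite lte_add_pinfty// ltry.
have i3 : mu.-integrable setT (fun y : E => (a3 y)%:E).
  rewrite (_ : (fun y : E => _) = (fun y : E => (a y)%:E) \- (fun y : E => (a y - a3 y)%:E)).
    exact: integrableB.
  by apply/funext => y /=; rewrite -EFinB opprB addrC subrK.
have -> : conv (kcut K e) bad x = Rintegral mu setT (fun y : E => a y - a3 y)%R.
  rewrite /conv RintE (RintegralB measurableT ia i3).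
  by rewrite [X in (_ - X)%R]/Rintegral int_a3// subr0.
apply: le_trans bound.
apply: (@le_trans _ _ (Rintegral mu setT (fun y : E => `|a y - a3 y|%R))%:E).
  by rewrite lee_fin; exact: le_normr_Rintegral.
rewrite /Rintegral fineK// ge0_fin_numE; last by apply: integral_ge0 => y _; rewrite lee_fin.
by have /integrableP[_] := i12.
Qed.

End Pointwise.

End BadPart.

(** * The weak bound for maximal truncations *)

Section MaximalWeak.
Context {R : realType} {n : nat}.
Local Notation V := 'rV[R]_n.
Local Notation E := (Rn R n).
Local Notation mu := (@lebn R n).
Local Notation v1 := (@v1 R n).
Local Notation vB := (@vB R n).
Local Open Scope ereal_scope.

Variables (K : V -> R) (M L c : R).
Hypothesis n0 : (0 < n)%N.
Hypothesis v10 : (0 < v1)%R.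
Hypothesis bK : borel_fun K.
Hypothesis M3 : (3 <= M)%R.
Hypothesis hsm : forall (rho : R) (y : V), (0 < rho)%R -> (M * enorm y <= rho)%R ->
  \int[mu]_(x in outside rho) (`|K ((x : V) - y) - K x|)%:E <= 1.
Hypothesis L0 : (0 <= L)%R.
Hypothesis hsz : forall r s, (0 < r)%R -> (r <= s)%R ->
  \int[mu]_(x in shell r s) (`|K x|)%:E <= ((s / r) ^+ n * L)%:E.
Hypothesis hcanc : forall r s, (0 < r)%R -> (r <= s)%R ->
  \int[mu]_(x in shell r s) (K x)%:E = 0.
Hypothesis c0 : (0 <= c)%R.
Hypothesis weak : forall (f : V -> R) (l : R), bcs f -> (0 < l)%R ->
  mu [set x | l < `|Tj K f x|]%R <= (c / l)%:E * \int[mu]_y (`|f y|)%:E.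

Lemma interior_loc_const (J : nat) (g : V -> R) (x : V) : cellwise J g ->
  interior_pt J x -> loc_const g x.
Proof. by move=> cg [d [d0 hd]]; exists d; split => // y /hd /cg. Qed.

Lemma maximal_weak : exists C0 C1 : R, (0 <= C0)%R /\ (0 <= C1)%R /\
  forall (h : V -> R) (J : nat) (A : R), cellwise J h -> bcs h -> (0 < A)%R ->
  \int[mu]_y (`|h y|)%:E <= (A * v1)%:E ->
  mu [set x | exists e, (0 < e <= 1)%R /\ (C0 * A < `|conv (kcut K e) h x|)%R] <=
  (C1 / A)%:E * \int[mu]_y (`|h y|)%:E.
Proof.
pose ga := gam (n := n) M c; have ga0 : (0 < ga)%R by exact: gam_gt0.
pose Q : R := ((M * n%:R) ^+ n * vB / v1)%R.
have Mn0 : (0 <= M * n%:R)%R by rewrite mulr_ge0//; move: M3 => M3'; lra.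
have Q0 : (0 <= Q)%R by rewrite !mulr_ge0 ?vB_ge0 ?invr_ge0 ?exprn_ge0// ltW.
have p2 : (0 < 2 ^+ n :> R)%R by rewrite exprn_gt0.
have p2S : (0 < 2 ^+ n.+1 :> R)%R by rewrite exprn_gt0.
have p8 : (0 < 8 ^+ n :> R)%R by rewrite exprn_gt0.
(* The threshold adds A' / A for the good part, 1 for a majorant below A and the edge term of
   [bad_pointwise]. The next constant adds the good part, whose integral is at most three times that
   of |h|, the measure of [bad_nbhd], and Chebyshev's inequality for the majorant. *)
exists (2 ^+ n / ga + (1 + 2 ^+ n.+1 * (8 ^+ n * L)))%R.
exists (24 * c * ga / 2 ^+ n + (Q + (2 + 2 ^+ n.+1)))%R.
have L8 : (0 <= 2 ^+ n.+1 * (8 ^+ n * L))%R by rewrite !mulr_ge0// ltW.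
split; first by rewrite addr_ge0 ?divr_ge0 ?addr_ge0// ltW.
have C10 : (0 <= 24 * c * ga / 2 ^+ n)%R.
  by rewrite divr_ge0 ?(ltW p2)// mulr_ge0 ?(ltW ga0)// mulr_ge0.
split; first by rewrite addr_ge0// addr_ge0// addr_ge0// ltW.
move=> h J A ch bh A0 hA.
pose bad := bad_part h J A.
pose g (x : V) := (h x - bad x)%R.
(* Chosen so that |g| <= 2^n A = ga A', as [good_part] asks. *)
pose A' : R := (2 ^+ n * A / ga)%R.
have A'0 : (0 < A')%R by rewrite divr_gt0// mulr_gt0.
have bg : bcs g by exact: bcs_good v10 ch bh A0 hA.
have bb : bcs bad by exact: bcs_bad v10 ch bh A0 hA.
have cg : cellwise J g by move=> x y xy; rewrite /g (ch _ _ xy) /bad (cellwise_bad A ch xy).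
have I0 : 0 <= \int[mu]_y (`|h y|)%:E by apply: integral_ge0 => y _; rewrite lee_fin.
have gI : \int[mu]_y (`|g y|)%:E <= 3%:E * \int[mu]_y (`|h y|)%:E.
  have mh : measurable_fun setT (fun y : E => (`|h y|)%:E) by apply: measurable_abs; case: bh.
  have mb : measurable_fun setT (fun y : E => (`|bad y|)%:E) by apply: measurable_abs; case: bb.
  apply: (@le_trans _ _ (\int[mu]_y ((`|h y|)%:E + (`|bad y|)%:E))).
    apply: ge0_le_lower_integral => y _; first by rewrite lee_fin.
    by rewrite -EFinD lee_fin /g ler_normB.
  rewrite (lebn_integralD measurableT mh mb); [|by move=> y; rewrite lee_fin..].
  rewrite (_ : 3%:E = 1%:E + 2%:E); last by rewrite -EFinD; congr EFin; lra.
  by rewrite ge0_muleDl// mul1e; apply: leeD => //; exact: (int_bad_le A v10 ch bh).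
have good := good_part n0 v10 bK M3 hsm hsz hcanc c0 weak bg A'0.
have {good} good : mu [set x | exists e, (0 < e <= 1)%R /\ (A' < `|conv (kcut K e) g x|)%R] <=
    (8 * c / A')%:E * \int[mu]_y (`|g y|)%:E.
  apply: good => [y|].
    apply: (le_trans (good_le v10 ch bh A0 hA y)).
    by rewrite /A' -/ga mulrCA mulfV ?mulr1// gt_eqF.
  apply: sub_lebn0 (interior_ae J) => x h1 h2; apply: h1; exact: interior_loc_const h2.
apply: (@le_trans _ _ (mu ([set x | exists e, (0 < e <= 1)%R /\ (A' < `|conv (kcut K e) g x|)%R] `|`
   (bad_nbhd M h J A `|` [set x : E | setT x /\ A%:E < bad_majorant K M h J A x])))).
  apply: le_lebn => x [e [/andP[e0 e1] hx]].
  have [gx|gx] := ltP A' `|conv (kcut K e) g x|%R; first by left; exists e; rewrite e0 e1.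
  have [Ux|nU] := pselect (bad_nbhd M h J A x); first by right; left.
  right; right; split => //.
  have := bad_pointwise v10 bK M3 hsz ch bh A0 hA nU e0 => bp.
  rewrite ltNge; apply/negP => Dle; move: hx; rewrite ltNge => /negP; apply.
  have hE : h = (g \+ bad)%R by apply/funext => y; rewrite /g /= subrK.
  have -> : conv (kcut K e) h x = (conv (kcut K e) g x + conv (kcut K e) bad x)%R.
    rewrite {1}hE; apply: conv_add; exact: (bcs_conv_integrable bK hsz).
  apply: (le_trans (ler_normD _ _)).
  rewrite mulrDl mulrDl; apply: lerD.
    by apply: (le_trans gx); rewrite /A' mulrAC.
  have : (`|conv (kcut K e) bad x|)%:E <= A%:E + (2 ^+ n.+1 * A * (8 ^+ n * L))%:E.
    by apply: (le_trans bp); apply: leeD.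
  by rewrite -EFinD lee_fin mul1r mulrAC.
apply: (le_trans (lebn_setU_le _ _)).
rewrite [leRHS](_ : _ = (24 * c * ga / 2 ^+ n / A)%:E * \int[mu]_y (`|h y|)%:E +
  ((Q / A)%:E * \int[mu]_y (`|h y|)%:E + (A^-1)%:E * ((2 + 2 ^+ n.+1)%:E * \int[mu]_y (`|h y|)%:E))); last first.
  have A1 : (0 <= A^-1)%R by rewrite invr_ge0 ltW.
  have D1 : (0 <= 24 * c * ga / 2 ^+ n / A)%R by exact: mulr_ge0.
  have D2 : (0 <= Q / A)%R by exact: mulr_ge0.
  have D3 : (0 <= A^-1 * (2 + 2 ^+ n.+1))%R by rewrite mulr_ge0// addr_ge0// ltW.
  rewrite muleA -EFinM -ge0_muleDl ?lee_fin// -ge0_muleDl ?lee_fin ?addr_ge0//.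
  by rewrite -!EFinD; congr (_%:E * _); ring.
apply: leeD.
  apply: (le_trans good); apply: (@le_trans _ _ ((8 * c / A')%:E * (3%:E * \int[mu]_y (`|h y|)%:E))).
    by apply: lee_wpmul2l => //; rewrite lee_fin divr_ge0 ?(ltW A'0)// mulr_ge0.
  rewrite muleA -EFinM (_ : (8 * c / A' * 3 = 24 * c * ga / 2 ^+ n / A)%R)//.
  by rewrite /A'; field; rewrite !gt_eqF.
apply: (le_trans (lebn_setU_le _ _)); apply: leeD.
  exact: (lebn_bad_nbhd n0 v10 M3 J bh A0).
apply: (le_trans (chebyshev measurableT (measurable_majorant M bK ch A0) _ A0)).
  by move=> x; apply: integral_ge0 => y _; rewrite lee_fin mulr_ge0 ?bad_osc_ge0 ?(bad_weight_ge0 _ _ A0).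
apply: lee_wpmul2l; first by rewrite lee_fin invr_ge0 ltW.
apply: (le_trans (int_majorant n0 bK M3 hsm ch A0)).
exact: (int_weight v10 ch bh A0).
Qed.

End MaximalWeak.

(** * Almost everywhere existence of principal values *)

Import HBSimple.

(** * Density of dyadic step functions in L^1 *)

Section DyadicApproximation.
Context {R : realType} {n : nat}.
Local Notation V := 'rV[R]_n.
Local Notation E := (Rn R n).
Local Notation mu := (@lebn R n).
Local Open Scope ereal_scope.

Lemma lebn_measurable_null (N : set V) : mu N = 0 -> measurable (N : set E).
Proof.
move=> N0; apply: (measure_is_complete_caratheodory (mu := @lebesgue_outer R n)).
have [B bB [NB B0]] := borel_null_hull N0.
by exists B; split => //; exact: borel_measurable.
Qed.

Lemma ae_of_null (P : E -> Prop) : mu [set x | ~ P x] = 0 -> {ae mu, forall x, P x}.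
Proof. by move=> h; exists [set x | ~ P x]; split => //; exact: lebn_measurable_null. Qed.

(** An intermediate class, stable under sums and products and containing indicators of boxes; local
    constancy almost everywhere lets its members be sampled at the corners of dyadic cells. *)
Definition tame (f : V -> R) : Prop := bcs f /\ mu [set x | ~ loc_const f x] = 0.

Lemma loc_const_comp (phi : R -> R -> R) (f g : V -> R) (x : V) :
  loc_const f x -> loc_const g x -> loc_const (fun y => phi (f y) (g y)) x.
Proof.
move=> [d [d0 fd]] [e [e0 ge]]; exists (Num.min d e); split; first by rewrite lt_min d0.
by move=> y; rewrite le_min => /andP[/fd -> /ge ->].
Qed.

Lemma tame_comp (phi : R -> R -> R) (f g : V -> R) (c : R -> R -> R) :
  tame f -> tame g -> phi 0%R 0%R = 0%R ->
  (forall a b s t, `|s| <= a -> `|t| <= b -> `|phi s t| <= c a b)%R ->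
  measurable_fun [set: E] (fun y : E => phi (f y) (g y)) ->
  tame (fun y => phi (f y) (g y)).
Proof.
move=> [[_ [Bf fB] [Nf fN]] lf] [[_ [Bg gB] [Ng gN]] lg] phi0 phic mphi; split; first split => //.
- by exists (c Bf Bg) => x; exact: phic.
- exists (Num.max Nf Ng) => x; rewrite gt_max => /andP[h1 h2].
  by rewrite fN// gN.
- apply: (@sub_lebn0 _ _ _ ([set x | ~ loc_const f x] `|` [set x | ~ loc_const g x])).
    move=> x /= h; have [lfx|] := pselect (loc_const f x); last by left.
    by right => lgx; apply: h; exact: loc_const_comp.
  apply/eqP; rewrite eq_le lebn_ge0 andbT; apply: (le_trans (lebn_setU_le _ _)).
  by rewrite lf lg adde0.
Qed.

Lemma tameD (f g : V -> R) : tame f -> tame g -> tame (fun y => f y + g y)%R.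
Proof.
move=> tf tg; apply: (@tame_comp (fun s t => s + t)%R f g (fun a b => a + b)%R).
- exact: tf.
- exact: tg.
- by rewrite addr0.
- by move=> a b s t sa tb; apply: (le_trans (ler_normD _ _)); exact: lerD.
- by apply: measurable_funD; [case: tf => -[]|case: tg => -[]].
Qed.

Lemma tameM (f g : V -> R) : tame f -> tame g -> tame (fun y => f y * g y)%R.
Proof.
move=> tf tg; apply: (@tame_comp (fun s t => s * t)%R f g (fun a b => a * b)%R).
- exact: tf.
- exact: tg.
- by rewrite mulr0.
- by move=> a b s t sa tb; rewrite normrM; exact: ler_pM.
- by apply: measurable_funM; [case: tf => -[]|case: tg => -[]].
Qed.

Lemma tameZ (k : R) (f : V -> R) : tame f -> tame (fun y => k * f y)%R.
Proof.
move=> tf; apply: (@tame_comp (fun s _ => k * s)%R f f (fun a _ => `|k| * a)%R).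
- exact: tf.
- exact: tf.
- by rewrite mulr0.
- by move=> a b s t sa _; rewrite normrM; exact: ler_wpM2l.
- by apply: measurable_funM; [exact: measurable_cst|case: tf => -[]].
Qed.

Lemma tame0 : tame (fun=> 0%R).
Proof.
split; first split.
- exact: measurable_cst.
- by exists 0%R => x; rewrite normr0.
- by exists 0%R.
- apply: (@sub_lebn0 _ _ _ set0); last exact: lebn_set0.
  by move=> x h; apply: h; exists 1%R.
Qed.

Lemma tame_indicU (A B : set V) : tame (\1_A : V -> R) -> tame (\1_B : V -> R) ->
  tame (\1_(A `|` B) : V -> R).
Proof.
move=> tA tB; rewrite (_ : \1_(A `|` B) =
    (fun y : V => \1_A y + (\1_B y + - 1 * (\1_A y * \1_B y)))%R); last first.
  apply/funext => y; rewrite !indicE in_setU.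
  by case: (y \in A); case: (y \in B); rewrite /= ?(mulr0, mulr1, addr0, add0r, mul0r) ?subrr ?addr0.
apply: tameD; first exact: tA.
by apply: tameD; [exact: tB|apply: tameZ; exact: (tameM tA tB)].
Qed.

Lemma box_loc_const (a b : V) (x : V) : (forall i, x ord0 i != a ord0 i) ->
  (forall i, x ord0 i != b ord0 i) -> loc_const (\1_(box a b) : V -> R) x.
Proof.
move=> xa xb; pose di i := (Num.min `|x ord0 i - a ord0 i| `|x ord0 i - b ord0 i|)%R.
have di0 i : (0 < di i)%R by rewrite lt_min !normr_gt0 !subr_eq0 xa xb.
pose dd : R := (\big[Num.min/1]_(i < n) di i)%R.
have dd0 : (0 < dd)%R.
  by rewrite /dd; elim/big_ind: _ => // s t s0 t0; rewrite lt_min s0.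
exists (dd / 2)%R; split; first by rewrite divr_gt0.
move=> y xy; rewrite !indicE; congr (_%:R); congr nat_of_bool.
have key i : (`|x ord0 i - y ord0 i| <= dd / 2)%R.
  by have := le_trans (coord_le_enorm (x - y)%R i) xy; rewrite !mxE.
have dle i : (dd <= `|x ord0 i - a ord0 i|)%R /\ (dd <= `|x ord0 i - b ord0 i|)%R.
  have : (dd <= di i)%R by exact: bigmin_le_cond.
  by rewrite le_min => /andP.
have side (s t u : R) : (`|s - t| <= dd / 2)%R -> (dd <= `|s - u|)%R ->
    ((u <= t) = (u <= s))%R /\ ((t < u) = (s < u))%R.
  move=> h1 h2; move: h1; rewrite ler_norml => /andP[h1 h1'].
  move: h2; have [su|su] := leP u s.
    rewrite ger0_norm ?subr_ge0// => h2; split; first by apply/idP; lra.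
    by apply/negbTE; rewrite -leNgt; lra.
  rewrite ltr0_norm ?subr_lt0// => h2; split; last by apply/idP; lra.
  by apply/negbTE; rewrite -ltNge; lra.
apply/idP/idP; rewrite !inE => h i; have /andP[h1 h2] := h i.
  have [e1 _] := side _ _ _ (key i) (proj1 (dle i)).
  have [_ e2] := side _ _ _ (key i) (proj2 (dle i)).
  by rewrite -e1 -e2 h1 h2.
have [e1 _] := side _ _ _ (key i) (proj1 (dle i)).
have [_ e2] := side _ _ _ (key i) (proj2 (dle i)).
by rewrite e1 e2 h1 h2.
Qed.

Lemma tame_box (a b : V) : tame (\1_(box a b) : V -> R).
Proof.
split; first split.
- by apply: measurable_indic; exact: measurable_box.
- by exists 1%R => x; rewrite indicE; case: (x \in _); rewrite ?normr1 ?normr0.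
- exists (n%:R * \sum_i (`|a ord0 i| + `|b ord0 i|))%R => x xN.
  rewrite indicE memNset// => xab; move: xN; apply/negP; rewrite -leNgt.
  apply: enorm_le_coord => i; rewrite (bigD1 i)//=.
  have /andP[h1 h2] := xab i.
  have s0 : (0 <= \sum_(j < n | j != i) (`|a ord0 j| + `|b ord0 j|))%R.
    by apply: sumr_ge0 => j _; rewrite addr_ge0.
  have := ler_norm (- a ord0 i)%R; have := ler_norm (b ord0 i); rewrite normrN => h3 h4.
  have := normr_ge0 (a ord0 i); have := normr_ge0 (b ord0 i) => h5 h6.
  by rewrite ler_norml; apply/andP; split; lra.
- apply: (@sub_lebn0 _ _ _ [set x | exists ij : 'I_n * bool,
     x ord0 ij.1 = (if ij.2 then a else b) ord0 ij.1]); last first.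
    by apply: lebn_null_exists => ij; exact: lebn_hyperplane.
  move=> x nl; apply: contrapT => /forallNP h; apply: nl; apply: box_loc_const => i; apply/eqP => e.
    by apply: (h (i, true)).
  by apply: (h (i, false)).
Qed.

Definition tame_approx (f : V -> R) : Prop := measurable_fun [set: E] (f : E -> R) /\
  forall e : R, (0 < e)%R -> exists g, tame g /\ \int[mu]_y (`|f y - g y|)%:E <= e%:E.

Lemma L1_triangle (f g k : V -> R) : measurable_fun [set: E] (f : E -> R) ->
  measurable_fun [set: E] (g : E -> R) -> measurable_fun [set: E] (k : E -> R) ->
  \int[mu]_y (`|f y - k y|)%:E <= \int[mu]_y (`|f y - g y|)%:E + \int[mu]_y (`|g y - k y|)%:E.
Proof.
move=> mf mg mk.
have m1 : measurable_fun setT (fun y : E => (`|f y - g y|)%:E).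
  by apply: measurable_abs; exact: measurable_funB.
have m2 : measurable_fun setT (fun y : E => (`|g y - k y|)%:E).
  by apply: measurable_abs; exact: measurable_funB.
rewrite -(lebn_integralD measurableT m1 m2); [|by move=> y; rewrite lee_fin..].
apply: ge0_le_lower_integral => y _; first by rewrite lee_fin.
by rewrite -EFinD lee_fin; exact: ler_distD.
Qed.

Lemma tame_measurable f : tame f -> measurable_fun [set: E] (f : E -> R).
Proof. by case=> -[]. Qed.

Lemma tame_approx_lim (f : V -> R) : measurable_fun [set: E] (f : E -> R) ->
  (forall e : R, (0 < e)%R -> exists g, tame_approx g /\ \int[mu]_y (`|f y - g y|)%:E <= e%:E) ->
  tame_approx f.
Proof.
move=> mf h; split => // e e0; have e2 : (0 < e / 2)%R by rewrite divr_gt0.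
have [g [[mg ag] fg]] := h _ e2; have [k [tk gk]] := ag _ e2.
exists k; split; first exact: tk.
apply: (le_trans (L1_triangle mf mg (tame_measurable tk))).
by rewrite (splitr e) EFinD; exact: leeD.
Qed.

Lemma tame_approxD f g : tame_approx f -> tame_approx g -> tame_approx (fun y => f y + g y)%R.
Proof.
move=> [mf af] [mg ag]; split; first exact: measurable_funD.
move=> e e0; have e2 : (0 < e / 2)%R by rewrite divr_gt0.
have [f' [tf ff]] := af _ e2; have [g' [tg gg]] := ag _ e2.
exists (fun y => f' y + g' y)%R; split; first exact: tameD.
have m1 : measurable_fun setT (fun y : E => (`|f y - f' y|)%:E).
  by apply: measurable_abs; exact: (measurable_funB mf (tame_measurable tf)).
have m2 : measurable_fun setT (fun y : E => (`|g y - g' y|)%:E).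
  by apply: measurable_abs; exact: (measurable_funB mg (tame_measurable tg)).
apply: (@le_trans _ _ (\int[mu]_y (`|f y - f' y|)%:E + \int[mu]_y (`|g y - g' y|)%:E)).
  rewrite -(lebn_integralD measurableT m1 m2); [|by move=> y; rewrite lee_fin..].
  apply: ge0_le_lower_integral => y _; first by rewrite lee_fin.
  by rewrite -EFinD lee_fin opprD addrACA; exact: ler_normD.
by rewrite (splitr e) EFinD; exact: leeD.
Qed.

Lemma tame_approxZ k f : tame_approx f -> tame_approx (fun y => k * f y)%R.
Proof.
move=> [mf af]; split; first exact: (measurable_funM (measurable_cst _) mf).
move=> e e0; have k1 : (0 < `|k| + 1)%R by rewrite ltr_wpDl.
have [f' [tf ff]] := af _ (divr_gt0 e0 k1).
exists (fun y => k * f' y)%R; split; first exact: tameZ.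
have m1 : measurable_fun setT (fun y : E => (`|f y - f' y|)%:E).
  by apply: measurable_abs; exact: (measurable_funB mf (tame_measurable tf)).
apply: (@le_trans _ _ (\int[mu]_y ((`|k| + 1)%:E * (`|f y - f' y|)%:E))).
  apply: ge0_le_lower_integral => y _; first by rewrite lee_fin.
  by rewrite -EFinM lee_fin -mulrBr normrM; apply: ler_wpM2r => //; rewrite lerDl.
rewrite (lebn_integralZl measurableT m1); [|by move=> y; rewrite lee_fin|exact: ltW].
apply: (@le_trans _ _ ((`|k| + 1)%:E * (e / (`|k| + 1))%:E)).
  by apply: lee_wpmul2l => //; rewrite lee_fin ltW.
by rewrite -EFinM mulrCA mulfV ?mulr1// gt_eqF.
Qed.

Lemma tame_approx0 : tame_approx (fun=> 0%R).
Proof.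
split; first exact: measurable_cst.
move=> e e0; exists (fun=> 0%R); split; first exact: tame0.
rewrite (eq_integral (cst 0)); first by rewrite integral0 lee_fin ltW.
by move=> y _; rewrite subrr normr0.
Qed.

(** A nearly optimal cover in the outer measure gives a countable union of boxes within e / 2 of A,
    and continuity from below a finite union within e / 2 of that one. *)
Lemma tame_approx_indic (A : set E) : measurable A -> mu A < +oo -> tame_approx (\1_A : V -> R).
Proof.
move=> mA Afin; split; first exact: measurable_indic.
move=> e e0; have e2 : (0 < e / 2)%R by rewrite divr_gt0.
have Afn : mu A \is a fin_num by rewrite ge0_fin_numE// lebn_ge0.
have [_ [F [_ AF] <-] Flt] := @lb_ereal_inf_adherent R
    [set \sum_(k <oo) box_vol (F k) | F in @measurable_cover _ (allsetsT R n) A]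
    (e / 2)%R e2 Afn.
have Fbox k : F k = set0 \/ exists a b, F k = box a b.
  have : box_vol (F k) < +oo.
    rewrite ltey; apply/eqP => Fk.
    suff : \sum_(k <oo) box_vol (F k) = +oo by move=> E0; rewrite E0 ltNge leey in Flt.
    apply/eqP; rewrite -leye_eq -Fk.
    rewrite (@nneseriesD1 _ _ k)//; last by move=> *; exact: box_vol_ge0.
    by rewrite leeDl//; apply: nneseries_ge0 => *; exact: box_vol_ge0.
  rewrite /box_vol; case: asboolP => [-> _|_]; first by left.
  by move=> /ereal_inf_lt[_ [[a b] /= [_ ->] _] _]; right; exists a, b.
have mF k : measurable (F k : set E).
  by case: (Fbox k) => [->|[a [b ->]]]; [exact: measurable0|exact: measurable_box].
pose O : set E := \bigcup_k F k.
have mO : measurable O by exact: bigcupT_measurable.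
have Ole : mu O <= mu A + (e / 2)%:E.
  apply: (le_trans _ (ltW Flt)); apply: (le_trans (lebn_bigcup_le _)).
  apply: lee_nneseries => [*|k _]; first exact: lebn_ge0.
  exact: lebn_le_box_vol.
have Ofin : mu O < +oo by apply: (le_lt_trans Ole); rewrite lte_add_pinfty// ltry.
have Ofn : mu O \is a fin_num by rewrite ge0_fin_numE// lebn_ge0.
pose S (m : nat) : set E := [set x | exists k, (k <= m)%N /\ F k x].
have SS m : S m.+1 = S m `|` F m.+1.
  apply/seteqP; split => x /=; last first.
    by move=> [[k [km Fk]]|Fm]; [exists k; split => //; exact: leqW|exists m.+1].
  move=> [k [km Fk]]; have [e'|ne] := eqVneq k m.+1; first by right; rewrite -e'.
  by left; exists k; split => //; rewrite -ltnS ltn_neqAle ne.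
have S0 : S 0%N = F 0%N.
  apply/seteqP; split => x /=; last by exists 0%N.
  by move=> [k []]; rewrite leqn0 => /eqP ->.
have mS m : measurable (S m).
  by elim: m => [|m IH]; rewrite ?S0 ?SS//; exact: measurableU.
have tF k : tame (\1_(F k) : V -> R).
  case: (Fbox k) => [->|[a [b ->]]]; last exact: tame_box.
  by rewrite indic0; exact: tame0.
have tS m : tame (\1_(S m) : V -> R).
  by elim: m => [|m IH]; rewrite ?S0 ?SS//; exact: tame_indicU.
have SO : \bigcup_m S m = O.
  apply/seteqP; split => x [k _] => [[j [_ Fj]]|Fk]; first by exists j.
  by exists k => //; exists k.
have Sub m : S m `<=` O by move=> x Sx; rewrite -SO; exists m.
have : mu (S m) @[m --> \oo] --> (fine (mu O))%:E.
  rewrite fineK// -SO; apply: nondecreasing_cvg_mu => //; first by rewrite SO.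
  apply/nondecreasing_seqP => m; apply/subsetPset => x; rewrite SS; by left.
move=> /fine_cvgP[_] /cvgrPdist_le /(_ _ e2)[m _ hm].
have Sfn : mu (S m) \is a fin_num.
  rewrite ge0_fin_numE ?lebn_ge0//; exact: le_lt_trans (le_lebn (Sub m)) Ofin.
exists (\1_(S m)); split; first exact: tS.
have AO : A `<=` O by [].
pose D1 : set E := O `\` A; pose D2 : set E := O `\` S m.
have mD1 : measurable D1 by exact: measurableD.
have mD2 : measurable D2 by exact: measurableD.
have i1 : measurable_fun setT (fun x : E => (\1_D1 x)%:E : \bar R).
  by apply/measurable_EFinP; exact: measurable_indic.
have i2 : measurable_fun setT (fun x : E => (\1_D2 x)%:E : \bar R).
  by apply/measurable_EFinP; exact: measurable_indic.
apply: (@le_trans _ _ (\int[mu]_x ((\1_D1 x)%:E + (\1_D2 x)%:E))).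
  apply: ge0_le_lower_integral => x _; first by rewrite lee_fin.
  rewrite -EFinD lee_fin !indicE !in_setD.
  have h1 : x \in A -> x \in O by rewrite !inE; exact: AO.
  have h2 : x \in S m -> x \in O by rewrite !inE; exact: Sub.
  case: (x \in A) h1 => [/(_ isT) ->|_]; last case: (x \in S m) h2 => [/(_ isT) ->|_].
  - by case: (x \in S m); rewrite /= ?subrr ?subr0 ?normr0 ?normr1 ?addr0 ?add0r.
  - by rewrite /= sub0r normrN normr1 addr0.
  - by rewrite subrr normr0 addr_ge0.
rewrite (lebn_integralD measurableT i1 i2); [|by move=> x; rewrite lee_fin..].
rewrite !integral_indic// !setIT (splitr e) EFinD; apply: leeD.
  change (mu D1 <= (e / 2)%:E).
  have -> : mu D1 = mu O - mu A.
    by have := measureD mO mA (Ofin : (@lebn R n : {measure set E -> \bar R}) O < +oo); rewrite (setIidr AO).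
  by rewrite leeBlDl.
change (mu D2 <= (e / 2)%:E).
have -> : mu D2 = mu O - mu (S m).
  have := measureD mO (mS m) (Ofin : (@lebn R n : {measure set E -> \bar R}) O < +oo).
  by rewrite (setIidr (Sub m)).
rewrite -(fineK Ofn) -(fineK Sfn) -EFinB lee_fin.
by apply: le_trans (hm m (leqnn m)); exact: ler_norm.
Qed.

Lemma tame_approx_integrable (f : V -> R) :
  mu.-integrable setT (fun y : E => (f y)%:E) -> tame_approx f.
Proof.
move=> fi; have /integrableP[/measurable_EFinP mf _] := fi.
apply: (tame_approx_lim mf) => e e0.
have [g [gi _ gl]] := approximation_sfun_integrable measurableT fi.
have /fine_cvgP[/= gfin /cvgrPdist_le /(_ _ e0) gl'] := gl.
have [m [hm1 hm2]] : exists m, (\int[mu]_z `|(f z)%:E - (g m z)%:E| \is a fin_num) /\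
    (`|0 - fine (\int[mu]_z `|(f z)%:E - (g m z)%:E|)| <= e)%R.
  have : \forall m \near \oo, (\int[mu]_z `|(f z)%:E - (g m z)%:E| \is a fin_num) /\
    (`|0 - fine (\int[mu]_z `|(f z)%:E - (g m z)%:E|)| <= e)%R.
    by near=> m; split; near: m.
  by move=> [m _ /(_ m (leqnn m))]; exists m.
exists (g m); split; last first.
  rewrite -(fineK hm1) in hm2 *; rewrite lee_fin.
  by apply: le_trans hm2; rewrite sub0r normrN ler_norm.
have /integrableP[mg gfi] := gi m.
pose s : seq R := finmap.enum_fset (fset_set (range (g m))).
have gE (x : E) : (g m x = \sum_(i < size s) (s`_i * \1_(g m @^-1` [set s`_i]) x))%R.
  exact: fimfunEord.
have -> : (g m : V -> R) = (fun x => \sum_(i <- enum 'I_(size s)) (s`_i * \1_(g m @^-1` [set s`_i]) x))%R.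
  by apply/funext => x; rewrite gE big_enum.
elim: (enum _) => [|i r IH].
  rewrite (_ : (fun _ => _) = (fun=> 0%R)); first exact: tame_approx0.
  by apply/funext => x; rewrite big_nil.
rewrite (_ : (fun _ => _) = (fun x => s`_i * \1_(g m @^-1` [set s`_i]) x +
    \sum_(i <- r) (s`_i * \1_(g m @^-1` [set s`_i]) x))%R); last first.
  by apply/funext => x; rewrite big_cons.
apply: tame_approxD; last exact: IH.
(* The level set of the value 0 may have infinite measure; the others are finite by Chebyshev's
   inequality. *)
have [->|si] := eqVneq s`_i 0%R.
  rewrite (_ : (fun _ => _) = (fun=> 0%R)); first exact: tame_approx0.
  by apply/funext => x; rewrite mul0r.
apply: tame_approxZ; apply: tame_approx_indic; first exact: measurable_sfunP.
have t0 : (0 < `|s`_i| / 2)%R by rewrite divr_gt0 ?normr_gt0.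
apply: (@le_lt_trans _ _ (mu [set x : E | setT x /\ (`|s`_i| / 2)%:E < `|(g m x)%:E|])).
  apply: le_lebn => x /= ->; split => //; rewrite lte_fin.
  by rewrite ltr_pdivrMr// ltr_pMr ?normr_gt0// ltr1n.
have mag : measurable_fun setT (fun x : E => `|(g m x)%:E|) by exact: measurableT_comp.
apply: (le_lt_trans (chebyshev measurableT mag _ t0)) => [x|]; first exact: abse_ge0.
by rewrite lte_mul_pinfty// lee_fin invr_ge0 ltW.
Unshelve. all: by end_near. Qed.

(** A tame g is sampled at the corners of cells of level J. At a point of local constancy the sample
    equals g for large J, and bounded support gives a dominating function. *)
Lemma dyadic_approx (f : V -> R) (e : R) : (0 < e)%R ->
  mu.-integrable setT (fun y : E => (f y)%:E) ->
  exists h J, [/\ cellwise J h, bcs h & \int[mu]_y (`|f y - h y|)%:E <= e%:E].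
Proof.
move=> e0 fi; have [mf af] := tame_approx_integrable fi.
have e2 : (0 < e / 2)%R by rewrite divr_gt0.
have [g [[[mg [B gB] [N gN]] lg] fg]] := af _ e2.
pose h J (x : V) := g (corner J x).
have ch J : cellwise J (h J) by move=> x y xy; rewrite /h /corner xy.
have mh J : measurable_fun [set: E] (h J : E -> R) by exact: measurable_cellwise (ch J).
have hN J x : (N + n%:R < enorm x)%R -> h J x = 0%R.
  move=> xN; apply: gN; have := ler_enormD (corner J x) (x - corner J x)%R.
  rewrite addrC subrK => h1; rewrite -(ltrD2r n%:R); apply: (lt_le_trans xN).
  apply: (le_trans h1); rewrite lerD2l; apply: (le_trans (corner_dist J x)).
  by rewrite ler_pdivrMr ?pow2_gt0// ler_peMr// exprn_ege1// ler1n.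
have bh J : bcs (h J).
  by split; [exact: mh|exists B => x; exact: gB|exists (N + n%:R)%R => x; exact: hN].
have B0 : (0 <= B)%R by exact: le_trans (normr_ge0 _) (gB 0%R).
pose dom (x : E) : \bar R := (B * \1_(cball (N + n%:R) : set E) x)%:E.
have idom : mu.-integrable setT dom.
  apply: bcs_integrable; split.
  - apply: measurable_funM; first exact: measurable_cst.
    by apply: measurable_indic; exact: measurable_cball.
  - exists B => x; rewrite indicE normrM (ger0_norm B0).
    by case: (x \in _); rewrite ?normr1 ?normr0 ?mulr1 ?mulr0.
  - exists (N + n%:R)%R => x xN; rewrite indicE memNset ?mulr0// /cball /=.
    by apply/negP; rewrite -ltNge.
have cv : {ae mu, forall x : E, setT x -> (h J x)%:E @[J --> \oo] --> (g x)%:E}.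
  apply: ae_of_null; apply: sub_lebn0 lg => x h1 [d [d0 hd]]; apply: h1 => _.
  apply: cvg_near_cst.
  have /cvgrPdist_le/(_ _ d0) := cvg_geometric n%:R (ltac:(by rewrite ger0_norm ?invr_ge0// invf_lt1// ltr1n) : (`|2^-1 : R| < 1)%R).
  move=> [m _ hm]; exists m => // J /= mJ; congr EFin; apply: hd.
  apply: (le_trans (corner_dist J x)); have := hm J mJ.
  by rewrite /= sub0r normrN => h2; apply: le_trans h2; rewrite exprVn ler_norm.
have dm : {ae mu, forall x : E, forall J, setT x -> `|(h J x)%:E| <= dom x}.
  apply: aeW => x J _; rewrite /dom lee_fin.
  have [xN|xN] := leP (enorm (x : V)) (N + n%:R)%R.
    by rewrite indicE mem_set// mulr1; exact: gB.
  by rewrite (hN J _ xN) normr0 mulr_ge0.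
have [_ l1 _] := dominated_convergence measurableT
  (fun J => proj2 (measurable_EFinP _ _) (mh J)) (proj2 (measurable_EFinP _ _) mg) cv idom dm.
have /fine_cvgP[/= gfin /cvgrPdist_le /(_ _ e2) gl'] := l1.
have [J [hJ1 hJ2]] : exists J, (\int[mu]_z `|(h J z)%:E - (g z)%:E| \is a fin_num) /\
    (`|0 - fine (\int[mu]_z `|(h J z)%:E - (g z)%:E|)| <= e / 2)%R.
  have : \forall J \near \oo, (\int[mu]_z `|(h J z)%:E - (g z)%:E| \is a fin_num) /\
    (`|0 - fine (\int[mu]_z `|(h J z)%:E - (g z)%:E|)| <= e / 2)%R.
    by near=> J; split; near: J.
  by move=> [m _ /(_ m (leqnn m))]; exists m.
exists (h J), J; split; [exact: ch|exact: bh|].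
apply: (le_trans (L1_triangle mf mg (mh J))); rewrite (splitr e) EFinD; apply: leeD => //.
have -> : \int[mu]_y (`|g y - h J y|)%:E = \int[mu]_z `|(h J z)%:E - (g z)%:E|.
  by apply: eq_integral => z _; rewrite /= distrC.
rewrite -(fineK hJ1) in hJ2 *; rewrite lee_fin.
by apply: le_trans hJ2; rewrite sub0r normrN ler_norm.
Unshelve. all: by end_near. Qed.

End DyadicApproximation.

(** * From the maximal bound to principal values *)

Section AlmostEverywhere.
Context {R : realType} {n : nat}.
Local Notation V := 'rV[R]_n.
Local Notation E := (Rn R n).
Local Notation mu := (@lebn R n).
Local Notation v1 := (@v1 R n).
Local Open Scope ereal_scope.

Lemma half_pow_small (a e : R) : (0 < e)%R -> exists N : nat, (a * 2^-1 ^+ N <= e)%R.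
Proof.
move=> e0; have [N hN] := @expr_unbounded R 2 (a / e)%R (ltr1n _ 2).
by exists N; rewrite exprVn ler_pdivrMr ?exprn_gt0// mulrC -ler_pdivrMr// ltW.
Qed.

Lemma borel_cantelli_lebn (F : nat -> set V) (c : R) : (0 <= c)%R ->
  (forall k, mu (F k) <= (c * 2^-1 ^+ k)%:E) ->
  mu [set x | forall m, exists k, (m <= k)%N /\ F k x] = 0.
Proof.
move=> c0 hF; set X := [set x | _].
have half : (0 < 2^-1 :> R)%R by rewrite invr_gt0.
have Gfin : \sum_(k <oo) (2^-1 ^+ k.+1 : R)%:E < +oo.
  by apply: geometric_sum_lty; rewrite half invf_lt1// ltr1n.
set G := \sum_(k <oo) _ in Gfin.
have G0 : 0 <= G by apply: nneseries_ge0 => k _ _; rewrite lee_fin exprn_ge0// ltW.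
have XN (N : nat) : mu X <= (2 * c * 2^-1 ^+ N)%:E * G.
  apply: (@le_trans _ _ (mu (\bigcup_k F (N + k)%N))).
    by apply: le_lebn => x /(_ N)[k [Nk Fk]]; exists (k - N)%N => //; rewrite subnKC.
  apply: (le_trans (lebn_bigcup_le _)).
  rewrite -nneseriesZl; last by move=> k _; rewrite lee_fin exprn_ge0// ltW.
  apply: lee_nneseries => [*|k _]; first exact: lebn_ge0.
  apply: (le_trans (hF _)); rewrite -EFinM lee_fin exprD exprS.
  by rewrite le_eqVlt; apply/orP; left; apply/eqP; field.
apply/eqP; rewrite eq_le lebn_ge0 andbT; apply/lee_addgt0Pr => e e0; rewrite add0e.
have [N hN] := half_pow_small (2 * c * fine G)%R e0.
apply: (le_trans (XN N)); rewrite -(fineK (_ : G \is a fin_num)) ?ge0_fin_numE//.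
by rewrite -EFinM lee_fin mulrAC.
Qed.

Lemma kcut_mono (K : V -> R) (d e : R) (w : V) : (d <= e)%R -> (`|kcut K e w| <= `|kcut K d w|)%R.
Proof.
move=> de; rewrite /kcut !normrM; apply: ler_wpM2l => //.
rewrite !ger0_norm ?ler0n// ler_nat; case: (ltP e (enorm w)) => // ew.
by rewrite (le_lt_trans de ew).
Qed.

Lemma conv_integrable_mono (K f : V -> R) (d e : R) (x : V) : borel_fun K ->
  measurable_fun [set: E] (f : E -> R) -> (d <= e)%R ->
  conv_integrable (kcut K d) f x -> conv_integrable (kcut K e) f x.
Proof.
move=> bK mf de /integrableP[_ hd]; apply: (conv_integrableP (borel_kcut e bK) mf).
apply: le_lt_trans hd; apply: ge0_le_lower_integral => y _; first by rewrite lee_fin.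
rewrite abse_EFin lee_fin (normrM (kcut K e _)) (normrM (kcut K d _)).
apply: ler_wpM2r => //; exact: (kcut_mono K (x - (y : V))%R de).
Qed.

Variables (K : V -> R) (M L c : R).
Hypothesis n0 : (0 < n)%N.
Hypothesis bK : borel_fun K.
Hypothesis M3 : (3 <= M)%R.
Hypothesis hsm : forall (rho : R) (y : V), (0 < rho)%R -> (M * enorm y <= rho)%R ->
  \int[mu]_(x in outside rho) (`|K ((x : V) - y) - K x|)%:E <= 1.
Hypothesis L0 : (0 <= L)%R.
Hypothesis hsz : forall r s, (0 < r)%R -> (r <= s)%R ->
  \int[mu]_(x in shell r s) (`|K x|)%:E <= ((s / r) ^+ n * L)%:E.
Hypothesis hcanc : forall r s, (0 < r)%R -> (r <= s)%R ->
  \int[mu]_(x in shell r s) (K x)%:E = 0.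
Hypothesis hunif : forall e, (0 < e)%R -> loc_unif_integrable (kcut K e).
Hypothesis c0 : (0 <= c)%R.
Hypothesis weak : forall (f : V -> R) (l : R), bcs f -> (0 < l)%R ->
  mu [set x | l < `|Tj K f x|]%R <= (c / l)%:E * \int[mu]_y (`|f y|)%:E.

Definition trunc_good (f : V -> R) (x : V) : Prop :=
  (forall e, (0 < e)%R -> conv_integrable (kcut K e) f x) /\
  cvg (conv (kcut K e) f x @[e --> 0^'+]).

Let T (e : R) (f : V -> R) (x : V) : R := conv (kcut K e) f x.

Section Pointwise.
Variables (f : V -> R) (h : nat -> V -> R) (C0 : R) (x : V) (m : nat).
Hypothesis mf : measurable_fun [set: E] (f : E -> R).
Hypothesis C00 : (0 <= C0)%R.
Hypothesis bh : forall k, bcs (h k).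
Hypothesis hs : forall k e, (m <= k)%N -> (0 < e <= 1)%R ->
  (`|T e (fun y => h k.+1 y - h k y) x| <= C0 * 2^-1 ^+ k)%R.
Hypothesis hlim : forall p : nat, exists l0, forall l, (l0 <= l)%N ->
  \int[mu]_y (`|kcut K p.+1%:R^-1 (x - (y : V)) * (f y - h l y)|)%:E <= (2^-1 ^+ l : R)%:E.
Hypothesis hint : forall p : nat, conv_integrable (kcut K p.+1%:R^-1) f x.
Hypothesis hloc : forall k, loc_const (h k) x.

Lemma inv_nat_le (e : R) : (0 < e)%R -> exists p : nat, (p.+1%:R^-1 <= e)%R.
Proof.
by move=> e0; exists (Num.trunc e^-1); apply: ltW; rewrite invf_plt ?posrE// truncnS_gt.
Qed.

Lemma trunc_telescope k i e : (m <= k)%N -> (0 < e <= 1)%R ->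
  (`|T e (h (k + i)%N) x - T e (h k) x| <= 2 * C0 * (2^-1 ^+ k - 2^-1 ^+ (k + i)))%R.
Proof.
move=> mk e01; have /andP[e0 _] := e01; elim: i => [|i IH].
  by rewrite addn0 !subrr normr0 mulr0.
have := hs (leq_trans mk (leq_addr i k)) e01.
have -> : T e (fun y => h (k + i).+1 y - h (k + i) y)%R x = (T e (h (k + i).+1) x - T e (h (k + i)%N) x)%R.
  by apply: conv_sub; exact: (bcs_conv_integrable bK hsz).
rewrite addnS exprS => h1.
rewrite -(subrK (T e (h (k + i)%N) x) (T e (h (k + i).+1) x)) -addrA.
apply: (le_trans (ler_normD _ _)); apply: (le_trans (lerD h1 IH)); lra.
Qed.

(** The bound is uniform in e although [hlim] is not: h l and h k are compared by telescoping,
    uniformly in e, while f and h l are compared at this e alone, with l as large as e requires. *)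
Lemma trunc_approx k e : (m <= k)%N -> (0 < e <= 1)%R ->
  (`|T e f x - T e (h k) x| <= (2 * C0 + 1) * 2^-1 ^+ k)%R.
Proof.
move=> mk e01; have /andP[e0 _] := e01.
have [p pe] := inv_nat_le e0; have [l0 hl0] := hlim p.
pose i := (maxn k l0 - k)%N.
have ki : (k + i = maxn k l0)%N by rewrite subnKC// leq_maxl.
have := trunc_telescope i mk e01; rewrite ki => h1.
have := hl0 _ (leq_maxr k l0); set l := maxn k l0 in h1 * => h2.
have fi : conv_integrable (kcut K e) f x := conv_integrable_mono bK mf pe (hint p).
have hi : conv_integrable (kcut K e) (h l) x by exact: (bcs_conv_integrable bK hsz).
have h3 : (`|T e f x - T e (h l) x| <= 2^-1 ^+ l)%R.
  rewrite /T -conv_sub// /conv RintE.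
  have ii := conv_integrable_sub fi hi.
  rewrite -lee_fin; apply: le_trans h2.
  apply: (@le_trans _ _ (Rintegral mu setT (fun y : E => `|kcut K e (x - (y : V)) * (f y - h l y)|)%R)%:E).
    by rewrite lee_fin; exact: le_normr_Rintegral.
  rewrite /Rintegral fineK; last first.
    rewrite ge0_fin_numE; last by apply: integral_ge0 => y _; rewrite lee_fin.
    by have /integrableP[_] := ii.
  apply: ge0_le_lower_integral => y _; first by rewrite lee_fin.
  rewrite lee_fin (normrM (kcut K e _)) (normrM (kcut K p.+1%:R^-1 _)).
  by apply: ler_wpM2r => //; exact: kcut_mono.
have l1 : (2^-1 ^+ l <= 2^-1 ^+ k :> R)%R.
  by apply: ler_wiXn2l; [rewrite invr_ge0|rewrite invf_le1// ler1n|exact: leq_maxl].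
have l2 : (0 <= 2^-1 ^+ l :> R)%R by rewrite exprn_ge0// invr_ge0.
rewrite -(subrK (T e (h l) x) (T e f x)) -addrA.
apply: (le_trans (ler_normD _ _)); apply: (le_trans (lerD h3 h1)).
have C00' := C00; nra.
Qed.

(** The truncations of f are uniformly close to those of h k, which do not change once e is below
    the radius of local constancy; hence they are Cauchy as e tends to 0. *)
Lemma trunc_good_of : trunc_good f x.
Proof.
split=> [e e0|].
  have [p pe] := inv_nat_le e0; exact: conv_integrable_mono bK mf pe (hint p).
apply: cauchy_cvg; apply: cauchy_exP => eps eps0.
have e2 : (0 < eps / 2)%R by rewrite divr_gt0.
have [N hN] := half_pow_small (2 * C0 + 1)%R e2.
pose k := maxn m N; have mk : (m <= k)%N by exact: leq_maxl.
have [d [d0 hd]] := hloc k.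
exists (T d (h k) x).
suff : \forall e \near (0 : R)^'+, ball (T d (h k) x) eps (conv (kcut K e) f x) by [].
near=> e.
have e0 : (0 < e)%R by near: e; exact: nbhs_right_gt.
have e1 : (e <= 1)%R by near: e; exact: nbhs_right_le.
have ed : (e <= d)%R by near: e; exact: nbhs_right_le.
rewrite /ball /= distrC /T -(conv_kcut_loc_const bK hsz hcanc (bh k) e0 ed hd).
apply: (@le_lt_trans _ _ (eps / 2)%R); last by rewrite ltr_pdivrMr// ltr_pMr// ltr1n.
apply: (le_trans (@trunc_approx k e mk _)); first by rewrite e0 e1.
apply: le_trans hN; apply: ler_wpM2l; first by rewrite addr_ge0// mulr_ge0.
by apply: ler_wiXn2l; [rewrite invr_ge0|rewrite invf_le1// ler1n|exact: leq_maxr].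
Unshelve. all: by end_near. Qed.

End Pointwise.

Lemma trunc_good_ae (f : V -> R) : mu.-integrable setT (fun y : E => (f y)%:E) ->
  mu [set x | ~ trunc_good f x] = 0.
Proof.
move=> fi; have [v10|] := ltP 0%R v1; last first.
  by move=> v1le; apply: lebn_null_of_v1; apply/eqP; rewrite eq_le v1le v1_ge0.
have /integrableP[/measurable_EFinP mf _] := fi.
have [C0 [C1 [C00 [C10 hmax]]]] := maximal_weak n0 v10 bK M3 hsm L0 hsz hcanc c0 weak.
(* Accuracy dl 4^-k against level 2^-k leaves exceptional sets of measure O(2^-k). From 2 dl <= v1
   follows the smallness condition of [maximal_weak] for the differences s k at level 2^-k. *)
pose dl : R := (Num.min v1 1 / 2)%R.
have dl0 : (0 < dl)%R by rewrite divr_gt0// lt_min v10 ltr01.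
have q0 k : (0 < 4^-1 ^+ k :> R)%R by rewrite exprn_gt0// invr_gt0.
have [h hh] := choice (fun k => dyadic_approx (mulr_gt0 dl0 (q0 k)) fi).
have bh k : bcs (h k) by have [J []] := hh k.
have mh k : measurable_fun [set: E] (h k : E -> R) by case: (bh k).
have fh k : \int[mu]_y (`|f y - h k y|)%:E <= (dl * 4^-1 ^+ k)%:E by have [J []] := hh k.
have lch : mu [set x | exists k, ~ loc_const (h k) x] = 0.
  apply: lebn_null_exists => k; have [J [cJ _ _]] := hh k.
  apply: sub_lebn0 (interior_ae J) => x h1 h2; apply: h1; exact: interior_loc_const h2.
pose s k (y : V) := (h k.+1 y - h k y)%R.
have sI k : \int[mu]_y (`|s k y|)%:E <= (v1 * 4^-1 ^+ k)%:E.
  apply: (le_trans (L1_triangle (mh k.+1) mf (mh k))).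
  have -> : \int[mu]_y (`|h k.+1 y - f y|)%:E = \int[mu]_y (`|f y - h k.+1 y|)%:E.
    by apply: eq_integral => y _; rewrite distrC.
  apply: (le_trans (leeD (fh k.+1) (fh k))); rewrite -EFinD lee_fin -mulrDr exprS.
  have vm : (2 * dl <= v1)%R by rewrite /dl mulrCA mulfV// mulr1 ge_min lexx.
  have := q0 k; move: (4^-1 ^+ k)%R => t t0; nra.
have bs k : bcs (s k).
  have [_ [B1 hB1] [N1 hN1]] := bh k.+1; have [_ [B2 hB2] [N2 hN2]] := bh k; split.
  - exact: (measurable_funB (mh k.+1) (mh k)).
  - by exists (B1 + B2)%R => x; apply: (le_trans (ler_normB _ _)); exact: lerD.
  - exists (Num.max N1 N2) => x; rewrite gt_max => /andP[/hN1 e1 /hN2 e2].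
    by rewrite /s e1 e2 subrr.
have p0 k : (0 < 2^-1 ^+ k :> R)%R by rewrite exprn_gt0// invr_gt0.
have p4 k : (4^-1 ^+ k = 2^-1 ^+ k * 2^-1 ^+ k :> R)%R.
  by rewrite -exprMn; congr (_ ^+ k)%R; field.
have p1 k : (2^-1 ^+ k <= 1 :> R)%R by rewrite exprn_ile1// ?invr_ge0// invf_le1// ler1n.
pose X1 k : set V := [set x | exists e, (0 < e <= 1)%R /\ (C0 * 2^-1 ^+ k < `|T e (s k) x|)%R].
have X1k k : mu (X1 k) <= ((C1 * v1) * 2^-1 ^+ k)%:E.
  have [J1 [cJ1 _ _]] := hh k.+1; have [J2 [cJ2 _ _]] := hh k.
  have cs : cellwise (maxn J1 J2) (s k).
    move=> x y xy; rewrite /s (cJ1 x y) ?(cJ2 x y)//.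
      exact: cell_index_le (leq_maxr _ _) xy.
    exact: cell_index_le (leq_maxl _ _) xy.
  have sA : \int[mu]_y (`|s k y|)%:E <= (2^-1 ^+ k * v1)%:E.
    apply: (le_trans (sI k)); rewrite lee_fin p4 mulrC; apply: ler_wpM2r; first exact: ltW.
    by apply: ler_piMr => //; exact: ltW.
  apply: (le_trans (hmax _ _ _ cs (bs k) (p0 k) sA)).
  apply: (@le_trans _ _ ((C1 / 2^-1 ^+ k)%:E * (v1 * 4^-1 ^+ k)%:E)).
    by apply: lee_wpmul2l (sI k); rewrite lee_fin divr_ge0// ltW.
  rewrite -EFinM lee_fin p4 le_eqVlt; apply/orP; left; apply/eqP; field.
  by rewrite gt_eqF.
have null1 := borel_cantelli_lebn (mulr_ge0 C10 (ltW v10)) X1k.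
pose I p l (x : E) : \bar R :=
  \int[mu]_y (`|kcut K p.+1%:R^-1 ((x : V) - (y : V)) * (f y - h l y)|)%:E.
have I0 p l x : 0 <= I p l x by apply: integral_ge0 => y _; rewrite lee_fin.
have mfh l : measurable_fun [set: E] (fun y : E => f y - h l y)%R := measurable_funB mf (mh l).
have mI p l : measurable_fun setT (I p l).
  apply: (tonelli_measurable (F := fun z : E * E => (`|kcut K p.+1%:R^-1 ((z.1 : V) - (z.2 : V)) *
    (f z.2 - h l z.2)|)%:E) measurableT) => [|z]; last by rewrite lee_fin.
  apply: measurable_abs; apply: measurable_funM; first exact: (measurable_kcut _ bK coordm_sub).
  exact: (measurableT_comp (mfh l) (@measurable_snd _ _ E E)).
have inv0 (p : nat) : (0 < p.+1%:R^-1 :> R)%R by rewrite invr_gt0.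
(* Countably many truncations 1 / (p + 1) are enough, since each controls all larger ones; the balls
   of radius r + 1 are there because [hunif] is local. *)
have null2 : mu [set x | exists pr : nat * nat, forall j, exists l, (j <= l)%N /\
    (cball pr.2.+1%:R x /\ (2^-1 ^+ l : R)%:E < I pr.1 l x)] = 0.
  apply: lebn_null_exists => -[p r] /=.
  have [C [C'0 hC]] := hunif (inv0 p) (ltr0Sn R r).
  apply: (@borel_cantelli_lebn (fun l => [set x | cball r.+1%:R x /\ (2^-1 ^+ l : R)%:E < I p l x])
    (C * dl) (mulr_ge0 C'0 (ltW dl0))) => l.
  apply: (le_trans (chebyshev (measurable_cball _) (mI p l) (I0 p l) (p0 l))).
  apply: (@le_trans _ _ (((2^-1 ^+ l)^-1)%:E * (C%:E * (dl * 4^-1 ^+ l)%:E))).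
    apply: lee_wpmul2l; first by rewrite lee_fin invr_ge0 ltW.
    apply: (le_trans (conv_tonelli (borel_kcut _ bK) (mfh l) C'0 hC)).
    by apply: lee_wpmul2l (fh l); rewrite lee_fin.
  rewrite -!EFinM lee_fin p4 le_eqVlt; apply/orP; left; apply/eqP; field.
  by rewrite gt_eqF.
have null3 : mu [set x | exists p : nat, ~ conv_integrable (kcut K p.+1%:R^-1) f x] = 0.
  apply: lebn_null_exists => p.
  exact: (conv_integrable_ae (borel_kcut _ bK) (hunif (inv0 p)) fi).
pose N1 : set V := [set x | forall m, exists k, (m <= k)%N /\ X1 k x].
apply: (@sub_lebn0 _ _ _ ((N1 `|` [set x | exists pr : nat * nat, forall j, exists l, (j <= l)%N /\
    (cball pr.2.+1%:R x /\ (2^-1 ^+ l : R)%:E < I pr.1 l x)]) `|`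
  ([set x | exists p : nat, ~ conv_integrable (kcut K p.+1%:R^-1) f x] `|`
   [set x | exists k, ~ loc_const (h k) x]))); last first.
  apply/eqP; rewrite eq_le lebn_ge0 andbT; apply: (le_trans (lebn_setU_le _ _)).
  apply: (le_trans (leeD (lebn_setU_le _ _) (lebn_setU_le _ _))).
  by rewrite null1 null2 null3 lch !adde0.
move=> x bad; apply: contrapT => ok; apply: bad.
have o1 : ~ N1 x by move=> h1; apply: ok; left; left.
have o2 (p r : nat) : exists j, forall l, (j <= l)%N -> cball r.+1%:R x -> I p l x <= (2^-1 ^+ l : R)%:E.
  apply: contrapT => h1; apply: ok; left; right; exists (p, r) => j /=.
  apply: contrapT => h2; apply: h1; exists j => l jl xr.
  by rewrite leNgt; apply/negP => lt; apply: h2; exists l.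
have o3 p : conv_integrable (kcut K p.+1%:R^-1) f x.
  by apply: contrapT => h1; apply: ok; right; left; exists p.
have o4 k : loc_const (h k) x by apply: contrapT => h1; apply: ok; right; right; exists k.
have [m hm] : exists m, forall k, (m <= k)%N -> ~ X1 k x.
  apply: contrapT => h1; apply: o1 => m; apply: contrapT => h2; apply: h1; exists m => k mk Xk.
  by apply: h2; exists k.
apply: (@trunc_good_of f h C0 x m mf C00 bh _ _ o3 o4) => [k e mk e01|p].
  by rewrite leNgt; apply/negP => lt; apply: (hm k mk); exists e.
have [j hj] := o2 p (Num.trunc (enorm x)).
by exists j => l jl; apply: hj => //; rewrite /cball /= ltW// truncnS_gt.
Qed.

End AlmostEverywhere.

(** * Level sets of the kernel and behaviour at infinity *)

Section WeakNorm.
Context {R : realType} {n : nat}.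
Local Notation V := 'rV[R]_n.
Local Notation E := (Rn R n).
Local Notation mu := (@lebn R n).
Local Open Scope ereal_scope.

Lemma weak_norm_le (p a : R) (D : set V) (f : V -> R) : (0 < p)%R -> (0 <= a)%R ->
  (forall l, (0 < l)%R -> mu [set x | D x /\ (l < `|f x|)%R] <= ((a / l) `^ p)%:E) ->
  weak_norm p D f <= a%:E.
Proof.
move=> p0 a0 h; apply: ge_ereal_sup => _ [l l0 <-].
change (l%:E * poweR (mu [set x | D x /\ (l < `|f x|)%R]) p^-1 <= a%:E).
have := h l l0; have := lebn_ge0 [set x | D x /\ (l < `|f x|)%R].
case: (mu _) => [r| |]//; rewrite !lee_fin => r0 rle.
rewrite mulrC -ler_pdivlMr//.
have al : (0 <= a / l)%R by rewrite divr_ge0// ltW.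
have := ge0_ler_powR (ltW (_ : 0 < p^-1)%R) _ _ rle; rewrite invr_gt0 => /(_ p0).
rewrite !nnegrE => /(_ r0 (powR_ge0 _ _)) /le_trans; apply.
by rewrite -powRrM mulfV ?gt_eqF// powRr1.
Qed.

Lemma weak_norm_level (p a : R) (D : set V) (f : V -> R) : (0 < p)%R ->
  weak_norm p D f <= a%:E -> forall l, (0 < l)%R ->
  mu [set x | D x /\ (l < `|f x|)%R] <= ((a / l) `^ p)%:E.
Proof.
move=> p0 h l l0; have pi0 : (0 < p^-1)%R by rewrite invr_gt0.
have : l%:E * poweR (mu [set x | D x /\ (l < `|f x|)%R]) p^-1 <= a%:E.
  by apply: le_trans h; apply: ereal_sup_ubound; exists l.
have := lebn_ge0 [set x | D x /\ (l < `|f x|)%R].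
case: (mu _) => [r| |]//; last by move=> _; rewrite (eqy_poweR pi0)// gt0_muley ?lte_fin// leye_eq.
rewrite lee_fin => r0; rewrite poweR_EFin -EFinM !lee_fin mulrC -ler_pdivlMr// => rle.
have al : (0 <= a / l)%R by apply: le_trans rle; exact: powR_ge0.
have := ge0_ler_powR (ltW p0) _ _ rle; rewrite !nnegrE => /(_ (powR_ge0 _ _) al).
by rewrite -powRrM mulVf ?gt_eqF// powRr1.
Qed.

(** As p >= 1, k sets of measure (x / k)^p have total measure at most x^p. This stands in for a
    triangle inequality in weak L^p. *)
Lemma powR_div_le (p k x : R) : (1 <= p)%R -> (1 <= k)%R -> (0 <= x)%R ->
  ((x / k) `^ p <= x `^ p / k)%R.
Proof.
move=> p1 k1 x0; have k0 : (0 < k)%R by exact: lt_le_trans k1.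
have xk : (0 <= x / k)%R by rewrite divr_ge0// ltW.
rewrite ler_pdivlMr//; apply: (@le_trans _ _ ((x / k) `^ p * k `^ p)%R).
  apply: ler_wpM2l; first exact: powR_ge0.
  by rewrite -{1}[k]powRr1 ?(ltW k0)//; exact: ler_powR.
by rewrite -powRM ?(ltW k0)// divfK// gt_eqF.
Qed.

Lemma lebn_scale (s : R) (A : set V) : (0 < s)%R ->
  mu [set x | A (s^-1 *: x)%R] = (s ^+ n)%:E * mu A.
Proof.
move=> s0; have := @lebn_affine R n s^-1%R 0%R A; rewrite invr_eq0 gt_eqF// => /(_ isT).
rewrite normfV gtr0_norm// exprVn invrK => <-; congr (mu _).
by apply/seteqP; split => x; rewrite /affine /= addr0.
Qed.

End WeakNorm.

(** * Level sets of the kernel against the norm of Omega *)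

Section KernelLevels.
Context {R : realType} {n : nat} {alpha : R}.
Hypothesis n0 : (0 < n)%N.
Hypothesis alpha0 : 0 <= alpha.
Hypothesis alphan : alpha < n%:R.
Local Notation V := 'rV[R]_n.
Local Notation E := (Rn R n).
Local Notation mu := (@lebn R n).
Local Notation beta := (n%:R - alpha).
Local Notation q := (n%:R / (n%:R - alpha)).
Variable Omega : V -> R.
Hypothesis hom : homogeneous0 Omega.
Hypothesis dini : Lq_Dini q Omega.
Local Notation K := (omega_kernel alpha Omega).
Local Notation LqB := (@LqB R n alpha Omega).
Local Open Scope ereal_scope.

Let qge0 : (0 <= q)%R. Proof. exact: (q_ge0 alpha0 alphan). Qed.
Let beta0 : (0 < beta)%R. Proof. exact: beta_gt0. Qed.

Lemma kernel_at0 : K 0%R = 0%R.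
Proof. by rewrite /omega_kernel enorm0 powR0 ?gt_eqF// invr0 mulr0. Qed.

Lemma kernel_homogeneous (t : R) (w : V) : (0 < t)%R -> K (t *: w)%R = ((t `^ beta)^-1 * K w)%R.
Proof.
move=> t0; have [->|w0] := eqVneq w 0%R; first by rewrite scaler0 kernel_at0 mulr0.
rewrite /omega_kernel hom// enormZ gtr0_norm// powRM ?(ltW t0) ?enorm_ge0//.
by rewrite invfM; ring.
Qed.

(** Along a ray where |Omega| = t, |K| > 1 means |x| < radius t; the volume of that ball is
    proportional to t^q. *)
Definition radius (t : R) : R := (t `^ beta^-1)%R.

Lemma radius_gt0 t : (0 < t)%R -> (0 < radius t)%R.
Proof. by move=> t0; rewrite powR_gt0. Qed.

Lemma radius_beta t : (0 <= t)%R -> (radius t `^ beta)%R = t.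
Proof. by move=> t0; rewrite /radius -powRrM mulVf ?gt_eqF// powRr1. Qed.

Lemma radius_n t : (0 <= t)%R -> (radius t ^+ n = t `^ q)%R.
Proof. by move=> t0; rewrite -(powR_beta_q alphan) ?powR_ge0// radius_beta. Qed.

Lemma le_radius (x : V) (t : R) : (0 <= t)%R -> (enorm x <= radius t)%R = (enorm x `^ beta <= t)%R.
Proof.
move=> t0; apply/idP/idP => h.
  rewrite -(radius_beta t0); apply: ge0_ler_powR; rewrite ?nnegrE ?enorm_ge0 ?powR_ge0//.
  exact: ltW.
have b1 : (0 <= beta^-1)%R by rewrite invr_ge0 ltW.
have := ge0_ler_powR b1 _ _ h; rewrite !nnegrE => /(_ (powR_ge0 _ _) t0).
by rewrite -powRrM mulfV ?gt_eqF// powRr1// enorm_ge0.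
Qed.

Definition cone (s : R) (k : nat) : set E :=
  [set x : E | (2 ^+ k * s <= `|Omega x|)%R /\ (`|Omega x| < 2 ^+ k.+1 * s)%R].

Lemma measurable_absOmega : measurable_fun [set: E] (fun x : E => `|Omega x|%R).
Proof. exact: (measurableT_comp (@normr_measurable R setT) (Omega_measurable dini)). Qed.

Lemma measurable_cone s k : measurable (cone s k).
Proof.
have mO := measurable_absOmega.
have -> : cone s k = [set x : E | (2 ^+ k * s <= `|Omega x|)%R] `&`
   [set x : E | (`|Omega x| < 2 ^+ k.+1 * s)%R] by [].
apply: measurableI.
  by apply: measurable_set_le => //; exact: measurable_cst.
by apply: measurable_set_lt => //; exact: measurable_cst.
Qed.

Lemma trivIset_cone s : (0 <= s)%R -> trivIset setT (cone s).
Proof.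
move=> s0; have key j k x : (j < k)%N -> cone s j x -> ~ cone s k x.
  move=> jk [_ h1] [h2 _]; have := lt_le_trans h1 (le_refl _); rewrite ltNge => /negP; apply.
  apply: le_trans h2; apply: ler_wpM2r => //.
  by apply: ler_weXn2l => //; rewrite ler1n.
apply/trivIsetP => j k _ _ jk; apply/seteqP; split => // x [cj ck].
by case: (ltngtP j k) jk => // h _; [exact: key h cj ck|exact: key h ck cj].
Qed.

Lemma lebn_cone s k r : (0 < s)%R -> (0 < r)%R ->
  mu (cone s k `&` shell 0 r) = (r ^+ n)%:E * mu (cone s k `&` shell 0 1).
Proof.
move=> s0 r0.
have mC := measurable_cone s k.
have mI : measurable_fun setT (fun x : E => (\1_(cone s k) x)%:E : \bar R).
  by apply/measurable_EFinP; exact: measurable_indic.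
have := hom_ball_integral r0 mI; rewrite !integral_indic//; last 2 first.
- exact: measurable_shell.
- exact: measurable_shell.
apply=> [x|t x t0 x0]; first by rewrite lee_fin.
by rewrite !indicE; congr (_%:R%:E); congr nat_of_bool; rewrite /cone; apply/idP/idP; rewrite !inE /= hom.
Qed.

Lemma cone_exists s x : (0 < s)%R -> (s <= `|Omega x|)%R -> exists k, cone s k x.
Proof.
move=> s0 sO; have t1 : (1 <= `|Omega x| / s)%R by rewrite ler_pdivlMr// mul1r.
have [k /andP[h1 h2]] := @geometric_bracket_co R 2 _ (ltr1n _ 2) t1.
by exists k; split; [rewrite -ler_pdivlMr|rewrite -ltr_pdivrMr].
Qed.

(** On the cone with |Omega| about 2^k, |K| > 1 forces |x| <= radius (2^(k + 1)), and the measure of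
    this piece is at most 2^q times the integral of |Omega|^q over the cone in the unit ball. Where
    |Omega| < 1 the point lies in the unit ball. *)
Lemma kernel_level1_fin : mu [set x | (1 < `|K x|)%R] < +oo.
Proof.
have p0 k : (0 < 2 ^+ k * 1 :> R)%R by rewrite mulr1 exprn_gt0.
apply: (@le_lt_trans _ _ (mu (cball 1 `|` \bigcup_k (cone 1 k `&` shell 0 (radius (2 ^+ k.+1 * 1)))))).
  apply: le_lebn => x /= Kx.
  have x0 : (0 < enorm x)%R.
    by rewrite enorm_gt0; apply/eqP => xe; move: Kx; rewrite xe kernel_at0 normr0 ltr10.
  have xb : (0 < enorm x `^ beta)%R by rewrite powR_gt0.
  have Ox : (enorm x `^ beta < `|Omega x|)%R.
    by move: Kx; rewrite /omega_kernel normrM normfV (gtr0_norm xb) ltr_pdivlMr// mul1r.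
  have [hO|hO] := leP (1%R : R) (`|Omega x|)%R.
    right; have [k ck] := cone_exists ltr01 hO; exists k => //; split => //.
    rewrite /shell /= x0 le_radius ?(ltW (p0 _))//.
    by case: ck => _ h2; apply: ltW; exact: lt_trans h2.
  left; rewrite /cball /=; have := ltW (lt_trans Ox hO).
  by rewrite -le_radius// /radius powR1.
apply: (le_lt_trans (lebn_setU_le _ _)); apply: lte_add_pinfty; first exact: lebn_cball_lty.
apply: (le_lt_trans (lebn_bigcup_le _)).
apply: (@le_lt_trans _ _ ((2 `^ q)%:E * LqB)); last first.
  by rewrite lte_mul_pinfty ?LqB_lty ?lee_fin ?powR_ge0.
pose F k : set E := cone 1 k `&` shell 0 1.
have mF k : measurable (F k) by apply: measurableI; [exact: measurable_cone|exact: measurable_shell].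
have tF : trivIset setT F.
  apply/trivIsetP => j k _ _ jk; have /trivIsetP/(_ j k I I jk) := trivIset_cone ler01.
  by move=> e; apply/seteqP; split => // x [[cj _] [ck _]]; rewrite -e; split.
have mO := measurable_Omega_powR dini.
apply: (@le_trans _ _ (\sum_(k <oo) \int[mu]_(x in F k) ((2 `^ q)%:E * (`|Omega x| `^ q)%:E))).
  apply: lee_nneseries => [*|k _]; first exact: lebn_ge0.
  rewrite (lebn_cone k ltr01 (radius_gt0 (p0 _))) radius_n ?(ltW (p0 _))//.
  have -> : ((2 ^+ k.+1 * 1) `^ q)%:E * mu (cone 1 k `&` shell 0 1) =
     \int[mu]_(x in F k) cst ((2 ^+ k.+1 * 1) `^ q)%:E x by rewrite integral_cst.
  apply: ge0_le_lower_integral => x [[h1 _] _]; first by rewrite lee_fin powR_ge0.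
  rewrite -EFinM lee_fin -powRM//; apply: ge0_ler_powR; rewrite ?nnegrE ?(ltW (p0 _)) ?(mulr_ge0 _ (normr_ge0 _))//.
  by rewrite exprS -mulrA ler_pM2l.
have <- : \int[mu]_(x in \bigcup_k F k) ((2 `^ q)%:E * (`|Omega x| `^ q)%:E) =
   \sum_(k <oo) \int[mu]_(x in F k) ((2 `^ q)%:E * (`|Omega x| `^ q)%:E).
  pose H (x : E) : \bar R := (2 `^ q)%:E * (`|Omega x| `^ q)%:E.
  have mH : measurable_fun (\bigcup_k F k) H.
    by apply: measurable_funTS; exact: (measurable_funeM _ mO).
  have H0 x : (\bigcup_k F k) x -> 0 <= H x by move=> _; rewrite mule_ge0 ?lee_fin ?powR_ge0.
  by rewrite ge0_integral_bigcup; [|exact: mF|exact: mH|exact: H0|exact: tF].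
apply: (@le_trans _ _ (\int[mu]_(x in shell 0 1) ((2 `^ q)%:E * (`|Omega x| `^ q)%:E))).
  apply: ge0_subset_lower_integral => [x|x [k _ []]//].
  by rewrite mule_ge0 ?lee_fin ?powR_ge0.
have O0 (x : E) : 0 <= (`|Omega x| `^ q)%:E by rewrite lee_fin powR_ge0.
by rewrite (lebn_integralZl (measurable_shell _ _) mO O0 (powR_ge0 _ _)).
Qed.

(** Reverse slicing: on the cone with 2^k s <= |Omega| < 2^(k + 1) s, all points with 0 < |x| <=
    radius (2^k s / 2) have |K| > 1. In the constant 4 one factor 2 is the width of the cone, the
    other the halving that makes the inequality strict. *)
Lemma LqB_le_level1 : LqB <= (4 `^ q)%:E * mu [set x | (1 < `|K x|)%R].
Proof.
set W := mu _; apply/lee_addgt0Pr => e e0.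
(* Small enough for the region |Omega| < s to contribute at most s^q vB <= e. *)
pose s : R := ((e / (@vB R n + 1)) `^ q^-1)%R.
have s0 : (0 < s)%R by rewrite powR_gt0// divr_gt0// ltr_wpDl// vB_ge0.
have sq : (s `^ q * @vB R n <= e)%R.
  have q0 : (0 < q)%R by exact: (q_gt0 alpha0 alphan).
  have v1' : (0 < @vB R n + 1)%R by rewrite ltr_wpDl// vB_ge0.
  rewrite /s -powRrM mulVf ?gt_eqF// powRr1 ?divr_ge0 ?(ltW e0) ?(ltW v1')//.
  by rewrite mulrAC ler_pdivrMr// ler_pM2l// lerDl.
have p0 k : (0 < 2 ^+ k * s)%R by rewrite mulr_gt0// exprn_gt0.
pose F k : set E := cone s k `&` shell 0 1.
have mF k : measurable (F k) by apply: measurableI; [exact: measurable_cone|exact: measurable_shell].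
have tF : trivIset setT F.
  apply/trivIsetP => j k _ _ jk; have /trivIsetP/(_ j k I I jk) := trivIset_cone (ltW s0).
  by move=> e'; apply/seteqP; split => // x [[cj _] [ck _]]; rewrite -e'; split.
have mO := measurable_Omega_powR dini.
have O0 (x : E) : 0 <= (`|Omega x| `^ q)%:E by rewrite lee_fin powR_ge0.
pose G (x : E) := (`|Omega x| `^ q)%:E * (\1_(\bigcup_k F k) x)%:E.
have mUF : measurable (\bigcup_k F k) by exact: bigcupT_measurable.
have mG : measurable_fun setT G.
  have mi : measurable_fun setT (fun x : E => (\1_(\bigcup_k F k) x)%:E : \bar R).
    by apply/measurable_EFinP; exact: measurable_indic.
  exact: (emeasurable_funM mO mi).
have G0 x : 0 <= G x by rewrite mule_ge0// lee_fin.
have sq0 : 0 <= (s `^ q)%:E by rewrite lee_fin powR_ge0.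
apply: (@le_trans _ _ (\int[mu]_(x in shell 0 1) (G x + cst (s `^ q)%:E x))).
  apply: ge0_le_lower_integral => x sx //.
  rewrite /G /=; have [sO|sO] := leP s (`|Omega x|)%R.
    have [k ck] := cone_exists s0 sO; rewrite indicE mem_set; last by exists k.
    by rewrite mule1 leeDl.
  apply: (@le_trans _ _ (s `^ q)%:E); last by rewrite leeDr// G0.
  rewrite lee_fin; apply: ge0_ler_powR; rewrite ?nnegrE ?(ltW s0)//; exact: ltW.
rewrite lebn_integralD; [|exact: measurable_shell|exact: mG|exact: measurable_cst|exact: G0|by []].
apply: leeD; last first.
  have -> : \int[mu]_(x in shell 0 1) cst (s `^ q)%:E x = (s `^ q)%:E * mu (shell 0 1).
    by rewrite integral_cst//; exact: measurable_shell.
  apply: (@le_trans _ _ ((s `^ q)%:E * mu (cball 1))).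
    by apply: lee_wpmul2l => //; apply: le_lebn => x /andP[].
  by rewrite lebn_cball// expr1n mul1r -EFinM lee_fin.
apply: (@le_trans _ _ (\int[mu]_(x in \bigcup_k F k) (`|Omega x| `^ q)%:E)).
  rewrite [leLHS]integral_mkcond [leRHS]integral_mkcond.
  apply: ge0_le_lower_integral => x _; first by rewrite patchE; case: ifP.
  rewrite !patchE /G indicE; case: (x \in \bigcup_k F k); case: ifP => _ //=; rewrite ?mule1 ?mule0//.
rewrite ge0_integral_bigcup; [|exact: mF|exact: measurable_funTS|by move=> x _|exact: tF].
have r0 k : (0 < 2 ^+ k * s / 2)%R by rewrite divr_gt0.
apply: (@le_trans _ _ (\sum_(k <oo) ((4 `^ q)%:E * mu (cone s k `&` shell 0 (radius (2 ^+ k * s / 2)))))).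
  apply: lee_nneseries => [k _ _|k _]; first by apply: integral_ge0.
  apply: (@le_trans _ _ (\int[mu]_(x in F k) cst ((2 ^+ k.+1 * s) `^ q)%:E x)).
    apply: ge0_le_lower_integral => x [[_ h2] _] //.
    by rewrite lee_fin; apply: ge0_ler_powR; rewrite ?nnegrE ?(ltW (p0 _))//; exact: ltW.
  rewrite integral_cst// (_ : (_ * _) = ((2 ^+ k.+1 * s) `^ q)%:E * mu (cone s k `&` shell 0 1))//.
  rewrite (lebn_cone k s0 (radius_gt0 (r0 k))) radius_n ?(ltW (r0 _))// muleA -EFinM -powRM ?(ltW (r0 _))//.
  by rewrite (_ : (4 * (2 ^+ k * s / 2) = 2 ^+ k.+1 * s)%R)// exprS; field.
rewrite nneseriesZl; last by move=> *; exact: lebn_ge0.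
apply: lee_wpmul2l; first by rewrite lee_fin powR_ge0.
pose F' k : set E := cone s k `&` shell 0 (radius (2 ^+ k * s / 2)).
have mF' k : measurable (F' k) by apply: measurableI; [exact: measurable_cone|exact: measurable_shell].
have tF' : trivIset setT F'.
  apply/trivIsetP => j k _ _ jk; have /trivIsetP/(_ j k I I jk) := trivIset_cone (ltW s0).
  by move=> e'; apply/seteqP; split => // x [[cj _] [ck _]]; rewrite -e'; split.
apply: le_trans (lebn_sum_setI_le [set x | (1 < `|K x|)%R] mF' tF').
apply: lee_nneseries => [*|k _]; first exact: lebn_ge0.
apply: le_lebn => x [ck /andP[x0 xr]]; split; last by split => //; apply/andP.
have xb : (0 < enorm x `^ beta)%R by rewrite powR_gt0.
move: xr; rewrite /= le_radius ?(ltW (r0 _))// /omega_kernel normrM normfV (gtr0_norm xb) => xr.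
rewrite ltr_pdivlMr// mul1r; apply: (le_lt_trans xr).
case: ck => h1 _; apply: (lt_le_trans _ h1).
by rewrite ltr_pdivrMr// ltr_pMr// ltr1n.
Qed.

End KernelLevels.

(** * Behaviour of T f far from the origin *)

Section FarField.
Context {R : realType} {n : nat} {alpha : R}.
Hypothesis n0 : (0 < n)%N.
Hypothesis alpha0 : 0 <= alpha.
Hypothesis alphan : alpha < n%:R.
Local Notation V := 'rV[R]_n.
Local Notation E := (Rn R n).
Local Notation mu := (@lebn R n).
Local Notation v1 := (@v1 R n).
Local Notation beta := (n%:R - alpha).
Local Notation q := (n%:R / (n%:R - alpha)).
Variable Omega : V -> R.
Hypothesis hom : homogeneous0 Omega.
Hypothesis dini : Lq_Dini q Omega.
Local Notation K := (omega_kernel alpha Omega).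
Local Open Scope ereal_scope.

Variable K0 : V -> R.
Hypothesis gK : good_kernel q K0.
Hypothesis K0E : mu [set x | K0 x <> K x] = 0.
Hypothesis K0loc : (0 < alpha)%R -> \int[mu]_(x in cball 1) (`|K0 x|)%:E < +oo.
Hypothesis K0canc : alpha = 0%R -> forall r s, (0 < r)%R -> (r <= s)%R ->
  \int[mu]_(x in shell r s) (K0 x)%:E = 0.
Variable c : R.
Hypothesis hb : L1_weak_bound alpha Omega c.

Let bK : borel_fun K0 := gk_borel gK.
Let q1 : (1 <= q)%R. Proof. exact: (q_ge1 alpha0 alphan). Qed.
Let q0 : (0 < q)%R. Proof. exact: (q_gt0 alpha0 alphan). Qed.
Let c0 : (0 <= c)%R. Proof. by case: hb. Qed.

Definition TK (f : V -> R) (x : V) : R := if alpha == 0%R then Tj K0 f x else conv K0 f x.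

Definition tgood (f : V -> R) (x : V) : Prop :=
  if alpha == 0%R then trunc_good K0 f x else conv_integrable K0 f x.

(** Valid at every x: the points y where K0 (x - y) and K (x - y) differ form a reflected translate
    of a null set. *)
Lemma integral_kernel_repr (D : set E) (f : V -> R) (x : V) : measurable D ->
  measurable_fun [set: E] (f : E -> R) ->
  Defs.Rint mu D (fun y : E => K (x - (y : V)) * f y)%R =
  Defs.Rint mu D (fun y : E => K0 (x - (y : V)) * f y)%R.
Proof.
move=> mD mf; rewrite /Defs.Rint; congr fine.
have s0 : (-1 != 0 :> R)%R by rewrite oppr_eq0 oner_neq0.
apply: integral_eq_off_null; first exact: mD.
- apply/measurable_EFinP; apply: measurable_funM mf.
  have := measurableT_comp (kernel_measurable dini) (measurable_affine x s0).
  by apply: eq_measurable_fun => y _; rewrite /affine /= scaleN1r addrC.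
- by apply/measurable_EFinP; exact: measurable_conv_integrand.
apply: (@sub_lebn0 _ _ _ (affine (-1) x @^-1` [set w | K0 w <> K w])); last first.
  by rewrite lebn_affine// K0E mule0.
move=> y /= ne e; apply: ne; congr (_ * _)%:E.
by move: e; rewrite /affine scaleN1r addrC => ->.
Qed.

Lemma Rint_off_ball (k g : V -> R) (e : R) (x : V) :
  Defs.Rint mu [set y : E | (e < enorm (x - (y : V)))%R] (fun y : E => k (x - (y : V)) * g y)%R =
  conv (kcut k e) g x.
Proof.
rewrite /conv /Defs.Rint; congr fine; rewrite [LHS]integral_mkcond; apply: eq_integral => y _.
rewrite patchE /kcut; case: ifPn => [|]; first by rewrite inE /= => ->; rewrite mulr1.
by rewrite notin_setE /= => /negP/negPf ->; rewrite mulr0 mul0r.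
Qed.

Lemma Tf_TK (f : V -> R) (x : V) : measurable_fun [set: E] (f : E -> R) ->
  Tf alpha Omega f x = TK f x.
Proof.
move=> mf; rewrite /Tf /Tgen /TK; case: ifP => _; last first.
  exact: (integral_kernel_repr x measurableT mf).
suff -> : (fun e : R => Defs.Rint mu [set y : E | (e < enorm (x - (y : V)))%R]
    (fun y : E => K (x - (y : V)) * f y)%R) = (fun e => conv (kcut K0 e) f x) by [].
apply/funext => e; rewrite integral_kernel_repr; [exact: Rint_off_ball| |exact: mf].
by apply: measurable_set_bool; exact: measurable_off_ball.
Qed.

Lemma TK_weak (f : V -> R) (A l : R) : mu.-integrable setT (fun y : E => (f y)%:E) ->
  (0 <= A)%R -> \int[mu]_y (`|f y|)%:E <= A%:E -> (0 < l)%R ->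
  mu [set x | (l < `|TK f x|)%R] <= ((c * A / l) `^ q)%:E.
Proof.
move=> fi A0 fA l0; have /integrableP[/measurable_EFinP mf _] := fi.
have h : weak_norm q [set: V] (Tf alpha Omega f) <= (c * A)%:E.
  have [_ h] := hb; apply: (le_trans (h f fi)); rewrite EFinM.
  by apply: lee_wpmul2l fA; rewrite lee_fin.
apply: le_trans (weak_norm_level q0 h l0); apply: le_lebn => x /= hx.
by split => //; rewrite Tf_TK.
Qed.

Lemma tgood_ae (f : V -> R) : mu.-integrable setT (fun y : E => (f y)%:E) ->
  mu [set x | ~ tgood f x] = 0.
Proof.
move=> fi; rewrite /tgood; case: (eqVneq alpha 0%R) => [a0|an0]; last first.
  have a1 : (0 < alpha)%R by rewrite lt_neqAle eq_sym an0.
  exact: (conv_integrable_ae bK (unif_of_L1loc q1 gK (K0loc a1)) fi).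
have qE : q = 1%R by rewrite a0 subr0 divff// pnatr_eq0 -lt0n.
have [M [M2 hM]] := gk_smooth gK (ltr01 : (0 < 1 :> R)%R).
have [L [L0 hL]] := gk_size gK.
refine (@trunc_good_ae R n K0 (Num.max M 3)%R L c n0 bK _ _ L0 _ (K0canc a0) _ c0 _ f fi).
- by rewrite le_max lexx orbT.
- move=> rho y rho0 hy; have := hM rho y rho0; rewrite qE.
  have My : (M * enorm y <= rho)%R.
    by apply: le_trans hy; apply: ler_wpM2r; rewrite ?enorm_ge0// le_max lexx.
  move=> /(_ My) /(le_trans _); apply; apply: ge0_le_lower_integral => x _.
    by rewrite lee_fin.
  by rewrite powRr1.
- move=> r s r0 rs; apply: le_trans (hL r s r0 rs); rewrite qE.
  apply: ge0_le_lower_integral => x _; first by rewrite lee_fin.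
  by rewrite powRr1.
- by move=> e e0; exact: (kcut_unif q1 gK e0).
- move=> g l bg l0; have gi := bcs_integrable bg.
  have Ifin : \int[mu]_y (`|g y|)%:E \is a fin_num.
    rewrite ge0_fin_numE; last by apply: integral_ge0 => y _; rewrite lee_fin.
    by have /integrableP[_] := gi.
  have I0 : (0 <= fine (\int[mu]_y (`|g y|)%:E))%R.
    by rewrite fine_ge0//; apply: integral_ge0 => y _; rewrite lee_fin.
  have := TK_weak gi I0 (_ : _ <= (fine (\int[mu]_y (`|g y|)%:E))%:E) l0.
  rewrite fineK// => /(_ (lexx _)); rewrite qE powRr1; last first.
    by rewrite divr_ge0 ?(ltW l0)// mulr_ge0.
  by rewrite /TK a0 eqxx mulrAC EFinM fineK.
Qed.

Lemma TKD (f g : V -> R) (x : V) : tgood f x -> tgood g x ->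
  TK (f \+ g)%R x = (TK f x + TK g x)%R.
Proof.
rewrite /tgood /TK; case: ifP => _; last exact: conv_add.
move=> [fi cf] [gi cg]; rewrite /Tj; apply/cvg_lim => //.
apply: cvg_trans (cvgD cf cg); apply: near_eq_cvg; near=> e.
have e0 : (0 < e)%R by near: e; exact: nbhs_right_gt.
exact: esym (conv_add (fi e e0) (gi e e0)).
Unshelve. all: by end_near. Qed.

Lemma TK_off_support (f : V -> R) (N : R) (x : V) :
  (forall y, N < enorm y -> f y = 0)%R -> (N < enorm x)%R -> TK f x = conv K0 f x.
Proof.
move=> fN xN; rewrite /TK; case: ifP => // _; rewrite /Tj; apply/cvg_lim => //.
apply: cvg_near_cst; near=> e.
have ex : (e < enorm x - N)%R by near: e; apply: nbhs_right_lt; rewrite subr_gt0.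
rewrite /conv /Defs.Rint; congr fine; apply: eq_integral => y _.
have [yN|yN] := ltP N (enorm (y : V)); first by rewrite fN// !mulr0.
rewrite /kcut; have -> : (e < enorm (x - (y : V)))%R; last by rewrite mulr1.
by have := lerB_enorm x (y : V); lra.
Unshelve. all: by end_near. Qed.

Lemma lebn_eq_off_null (A B : set V) : mu [set x | ~ (A x <-> B x)] = 0 -> mu A = mu B.
Proof.
move=> h; have key (X Y : set V) : mu [set x | ~ (X x <-> Y x)] = 0 -> mu X <= mu Y.
  move=> h'; apply: (@le_trans _ _ (mu (Y `|` [set x | ~ (X x <-> Y x)]))).
    apply: le_lebn => x Xx; have [XY|nXY] := pselect (X x <-> Y x); last by right.
    by left; apply/XY.
  by apply: (le_trans (lebn_setU_le _ _)); rewrite h' adde0.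
apply/eqP; rewrite eq_le !key//.
by apply: sub_lebn0 h => x /= nBA AB; apply: nBA; split => /AB.
Qed.

Lemma level_K0 (P : V -> R -> Prop) :
  mu [set x | P x (K0 x)] = mu [set x | P x (K x)].
Proof.
apply: lebn_eq_off_null; apply: sub_lebn0 K0E => x /= h e; apply: h.
by rewrite e.
Qed.

Lemma kernel_level_scale (P : R -> R -> Prop) (s : R) : (0 < s)%R ->
  mu [set x | P (enorm x) (K x)] =
  (s ^+ n)%:E * mu [set x | P (s * enorm x)%R ((s `^ beta)^-1 * K x)%R].
Proof.
move=> s0; rewrite -(lebn_scale _ s0); congr (mu _); apply/seteqP.
have si : (0 < s^-1)%R by rewrite invr_gt0.
have e1 x : (s * enorm (s^-1 *: x))%R = enorm x.
  by rewrite enormZ gtr0_norm// mulrA mulfV ?mul1r// gt_eqF.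
have e2 x : ((s `^ beta)^-1 * K (s^-1 *: x))%R = K x.
  rewrite -(kernel_homogeneous alphan hom _ s0) scalerA mulfV ?scale1r// gt_eqF//.
by split => x /=; rewrite e1 e2.
Qed.

(** By homogeneity the level set at l is that at 1 dilated by radius (1 / l). W depends on Omega; it
    is the a priori bound on which [far_weak] rests, before [kernel_level_le] provides one in terms
    of c. *)
Lemma kernel_level_finite : exists W : R, (0 <= W)%R /\
  forall l, (0 < l)%R -> mu [set x | (l < `|K0 x|)%R] <= ((W / l) `^ q)%:E.
Proof.
have fin := kernel_level1_fin n0 alpha0 alphan hom dini.
have fn : mu [set x | (1 < `|K x|)%R] \is a fin_num by rewrite ge0_fin_numE// lebn_ge0.
set m := mu _ in fin fn.
have m0 : (0 <= fine m)%R by rewrite fine_ge0// lebn_ge0.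
exists (fine m `^ q^-1)%R; split; first exact: powR_ge0.
move=> l l0; rewrite (level_K0 (fun _ t => l < `|t|)%R).
have li : (0 < l^-1)%R by rewrite invr_gt0.
have r0 : (0 < @radius R n alpha l^-1)%R by exact: radius_gt0.
rewrite (kernel_level_scale (fun _ t => l < `|t|)%R r0).
rewrite radius_beta ?(ltW li)// radius_n ?(ltW li)//.
rewrite (_ : [set x | (l < `|l^-1^-1 * K x|)%R] = [set x | (1 < `|K x|)%R]); last first.
  by apply/seteqP; split => x /=; rewrite invrK (normrM l) (gtr0_norm l0) ltr_pMr.
rewrite -/m -(fineK fn) -EFinM lee_fin powRM ?powR_ge0 ?(ltW li)//.
by rewrite -powRrM mulVf ?gt_eqF// powRr1// mulrC.
Qed.

Lemma tail_integral_small (f : V -> R) (d : R) : (0 < d)%R ->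
  mu.-integrable setT (fun y : E => (f y)%:E) -> exists N : R, (0 < N)%R /\
  \int[mu]_y (`|f y * (N < enorm (y : V))%R%:R|)%:E <= d%:E.
Proof.
move=> d0 fi; have [h [_ [_ [_ _ [N hN]] fh]]] := dyadic_approx d0 fi.
exists (`|N| + 1)%R; split; first by rewrite ltr_wpDl.
apply: le_trans fh; apply: ge0_le_lower_integral => y _; first by rewrite lee_fin.
rewrite lee_fin; case: ltP => yN; last by rewrite mulr0 normr0.
rewrite mulr1 (hN y) ?subr0//; apply: le_lt_trans yN.
by apply: (le_trans (ler_norm N)); rewrite lerDl.
Qed.

(** f1 is the part of f in a large ball and f2 the rest. Three errors are kept below l / 3 each:
    smoothness of K for f1, the weak bound on T for f2, and the weak bound on K times the small
    integral of f2. Additivity of T holds off a null set. *)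
Lemma far_weak (f : V -> R) (eps : R) : (0 < eps)%R ->
  mu.-integrable setT (fun y : E => (f y)%:E) -> exists rho, (0 < rho)%R /\
  forall l, (0 < l)%R ->
  mu [set x | (rho < enorm x)%R /\ (l < `|TK f x - K0 x * Defs.Rint mu setT f|)%R]
    <= ((eps / l) `^ q)%:E.
Proof.
move=> eps0 fi; have /integrableP[/measurable_EFinP mf ffin] := fi.
have [W [W0 hW]] := kernel_level_finite.
have If0 : 0 <= \int[mu]_y (`|f y|)%:E by apply: integral_ge0 => y _; rewrite lee_fin.
have Ifin : \int[mu]_y (`|f y|)%:E \is a fin_num by rewrite ge0_fin_numE.
pose A : R := (fine (\int[mu]_y (`|f y|)%:E) + 1)%R.
have A0 : (0 < A)%R by rewrite ltr_wpDl// fine_ge0.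
have fA : \int[mu]_y (`|f y|)%:E <= A%:E by rewrite -(fineK Ifin) lee_fin lerDl.
have cW : (0 < 9 * (c + W + 1))%R by rewrite mulr_gt0// ltr_wpDl// addr_ge0.
(* At level l / 3 the two errors from f2 have weak constants 3 c d and 3 W d; by [powR_div_le] each
   takes a third of (eps / l)^q once it is at most eps / 3, hence the 9. *)
pose d : R := (eps / (9 * (c + W + 1)))%R.
have d0 : (0 < d)%R by rewrite divr_gt0.
have dE : (eps = 9 * (c + W + 1) * d)%R by rewrite /d mulrC divfK// gt_eqF.
have [N [N0 f2d]] := tail_integral_small d0 fi.
pose f1 (y : V) := (f y * (enorm y <= N)%R%:R)%R.
pose f2 (y : V) := (f y * (N < enorm y)%R%:R)%R.
have fE : f = (f1 \+ f2)%R.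
  by apply/funext => y; rewrite /f1 /f2 /= -mulrDr; case: leP => _; rewrite ?addr0 ?add0r mulr1.
have mcb (b : V -> bool) : measurable_fun [set: E] (b : E -> bool) ->
    mu.-integrable setT (fun y : E => (f y * (b y)%:R)%:E).
  move=> mb; apply/integrableP; split; first by apply/measurable_EFinP; exact: measurable_cut.
  apply: le_lt_trans ffin; apply: ge0_le_lower_integral => y _; first exact: abse_ge0.
  by rewrite lee_fin normrM; apply: ler_piMr => //; case: (b y); rewrite ?normr1 ?normr0.
have men : measurable_fun [set: E] (fun y : E => enorm (y : V)) by exact: measurable_enorm_id.
have f1i : mu.-integrable setT (fun y : E => (f1 y)%:E).
  by apply: mcb; apply: measurable_fun_ler => //; exact: measurable_cst.
have f2i : mu.-integrable setT (fun y : E => (f2 y)%:E).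
  by apply: mcb; apply: measurable_fun_ltr => //; exact: measurable_cst.
have f1A : \int[mu]_y (`|f1 y|)%:E <= A%:E.
  apply: le_trans fA; apply: ge0_le_lower_integral => y _; first by rewrite lee_fin.
  rewrite lee_fin /f1 normrM; apply: ler_piMr => //.
  by case: (enorm (y : V) <= N)%R; rewrite ?normr1 ?normr0.
have f1N y : (N < enorm y)%R -> f1 y = 0%R.
  by move=> yN; rewrite /f1 leNgt yN mulr0.
have RE : Defs.Rint mu setT f = (Defs.Rint mu setT f1 + Defs.Rint mu setT f2)%R.
  by rewrite {1}fE !RintE RintegralD.
have R2 : (`|Defs.Rint mu setT f2| <= d)%R.
  rewrite RintE; apply: (le_trans (le_normr_Rintegral measurableT f2i)).
  rewrite -lee_fin /Rintegral fineK//.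
  rewrite ge0_fin_numE; last by apply: integral_ge0 => y _; rewrite lee_fin.
  exact: le_lt_trans f2d (ltry _).
have A6 : (0 < (6 * A) `^ q)%R by rewrite powR_gt0// mulr_gt0.
(* Solves (2 A / (l / 3))^q e' = (eps / l)^q / 3, the share left to [near_weak]. *)
pose e' : R := (eps `^ q / (3 * (6 * A) `^ q))%R.
have e'0 : (0 < e')%R by rewrite divr_gt0 ?powR_gt0// mulr_gt0.
have [M [M2 hM]] := near_weak q1 gK e'0.
have MN : (0 < M * N)%R by rewrite mulr_gt0//; lra.
exists (M * N)%R; split => // l l0.
have l3 : (0 < l / 3)%R by rewrite divr_gt0.
have el : (0 <= eps / l)%R by rewrite divr_ge0 ?ltW.
pose X1 : set V := [set x | (M * N < enorm x)%R /\ ~ near_good K0 f1 (l / 3) x].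
pose X2 : set V := [set x | (l / 3 < `|TK f2 x|)%R].
pose X3 : set V := [set x | (l / 3 / d < `|K0 x|)%R].
pose X4 : set V := [set x | ~ tgood f1 x] `|` [set x | ~ tgood f2 x].
apply: (@le_trans _ _ (mu ((X1 `|` X2) `|` (X3 `|` X4)))).
  apply: le_lebn => x [xMN hx].
  have [near|] := pselect (near_good K0 f1 (l / 3) x); last by left; left.
  have [g1|] := pselect (tgood f1 x); last by right; right; left.
  have [g2|] := pselect (tgood f2 x); last by right; right; right.
  have [lt2|le2] := ltP (l / 3)%R (`|TK f2 x|)%R; first by left; right.
  have [lt3|le3] := ltP (l / 3 / d)%R (`|K0 x|)%R; first by right; left.
  exfalso; have xN : (N < enorm x)%R by nra.
  have TE : TK f x = (conv K0 f1 x + TK f2 x)%R.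
    by rewrite {1}fE (TKD g1 g2) (TK_off_support f1N xN).
  move: hx; rewrite TE RE ltNge => /negP; apply.
  case: near => _ n1.
  have k3 : (`|K0 x * Defs.Rint mu setT f2| <= l / 3)%R.
    rewrite normrM; apply: (@le_trans _ _ (l / 3 / d * d)%R); last by rewrite divfK// gt_eqF.
    exact: ler_pM.
  rewrite (_ : conv K0 f1 x + TK f2 x - _ = (conv K0 f1 x - K0 x * Defs.Rint mu setT f1) +
    (TK f2 x - K0 x * Defs.Rint mu setT f2))%R; last by ring.
  apply: (le_trans (ler_normD _ _)).
  have := ler_normB (TK f2 x) (K0 x * Defs.Rint mu setT f2)%R; lra.
have part x : (0 <= x)%R -> (x <= eps / l / 3)%R -> (x `^ q)%:E <= ((eps / l) `^ q / 3)%:E.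
  move=> x0 xle; rewrite lee_fin; apply: le_trans (powR_div_le q1 _ el); last by rewrite ler1n.
  by apply: ge0_ler_powR; rewrite ?nnegrE ?(ltW q0)// divr_ge0.
have three : ((eps / l) `^ q)%:E = ((eps / l) `^ q / 3)%:E + ((eps / l) `^ q / 3)%:E +
    (((eps / l) `^ q / 3)%:E + 0).
  by rewrite adde0 -!EFinD; congr EFin; lra.
rewrite three; apply: (le_trans (lebn_setU_le _ _)); apply: leeD.
  apply: (le_trans (lebn_setU_le _ _)); apply: leeD.
    apply: (le_trans (hM N A (l / 3)%R f1 N0 A0 l3 f1i f1A f1N)).
    rewrite lee_fin (_ : (2 * A / (l / 3) = 6 * A / l)%R); last by field; rewrite gt_eqF.
    have li : (0 <= l^-1)%R by rewrite invr_ge0 ltW.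
    rewrite !powRM ?mulr_ge0 ?(ltW A0) ?(ltW eps0)// /e' le_eqVlt; apply/orP; left; apply/eqP.
    have := gt_eqF A6; rewrite powRM ?(ltW A0)// => /negbT h6.
    by field; move: h6; rewrite mulf_eq0 negb_or => /andP[-> ->].
  apply: (le_trans (TK_weak f2i (ltW d0) f2d l3)); apply: part.
    by rewrite divr_ge0 ?(ltW l3)// mulr_ge0// ltW.
  rewrite (_ : (c * d / (l / 3) = 3 * c * d / l)%R); last by field; rewrite gt_eqF.
  rewrite (_ : (eps / l / 3 = eps / 3 / l)%R); last by field; rewrite gt_eqF.
  rewrite ler_pM2r ?invr_gt0//; move: dE (ltW d0) (mulr_ge0 W0 (ltW d0)) (mulr_ge0 c0 (ltW d0)).
  by move: (d) => d' ->; nra.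
apply: (le_trans (lebn_setU_le _ _)); apply: leeD; last first.
  by apply: (le_trans (lebn_setU_le _ _)); rewrite (tgood_ae f1i) (tgood_ae f2i) adde0.
apply: (le_trans (hW _ (divr_gt0 l3 d0))); apply: part.
  by rewrite divr_ge0// divr_ge0// ltW.
rewrite (_ : (W / (l / 3 / d) = 3 * W * d / l)%R); last by field; rewrite !gt_eqF.
rewrite (_ : (eps / l / 3 = eps / 3 / l)%R); last by field; rewrite gt_eqF.
rewrite ler_pM2r ?invr_gt0//; move: dE (ltW d0) (mulr_ge0 W0 (ltW d0)) (mulr_ge0 c0 (ltW d0)).
by move: (d) => d' ->; nra.
Qed.

(* [far_weak] for the indicator of a cube gives the bound far from the origin,
   uniformly in the level; homogeneity brings it to every scale. *)
Lemma kernel_level_le (eta l : R) : (0 < eta)%R -> (0 < l)%R ->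
  mu [set x | (l < `|K x|)%R] <= ((4 * (c + eta) / l) `^ q)%:E.
Proof.
move=> eta0 l0; have [v10|] := ltP 0%R v1; last first.
  move=> v1le; rewrite lebn_null_of_v1 ?lee_fin ?powR_ge0//.
  by apply/eqP; rewrite eq_le v1le v1_ge0.
pose f : V -> R := \1_(unit_cell (R := R) (n := n)).
have [bf _] : tame f by rewrite /f unit_cellE; exact: tame_box.
have mU : measurable (unit_cell (R := R) (n := n) : set E) := measurable_cellset 0 0%R.
have fi := bcs_integrable bf.
have fI : \int[mu]_y (f y)%:E = v1%:E.
  by rewrite -v1E integral_indic// setIT.
have fA : \int[mu]_y (`|f y|)%:E <= v1%:E.
  rewrite -fI; apply: ge0_le_lower_integral => y _; first by rewrite lee_fin.
  by rewrite lee_fin ger0_norm// /f indicE.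
have Rf : Defs.Rint mu setT f = v1 by rewrite /Defs.Rint fI.
have ev : (0 < v1 * eta)%R by rewrite mulr_gt0.
have [rho0 [rho00 hrho]] := far_weak ev fi; rewrite Rf in hrho.
have ce : (0 < c + eta)%R by rewrite ltr_wpDl.
have far t : (0 < t)%R -> mu [set x | (rho0 < enorm x)%R /\ (t < `|K x|)%R] <=
    ((4 * (c + eta) / t) `^ q)%:E.
  move=> t0; have tv : (0 < t * v1 / 2)%R by rewrite divr_gt0// mulr_gt0.
  rewrite -(level_K0 (fun x s => rho0 < enorm x /\ t < `|s|)%R).
  apply: (@le_trans _ _ (mu ([set x | (rho0 < enorm x)%R /\ (t * v1 / 2 < `|TK f x - K0 x * v1|)%R] `|`
     [set x | (t * v1 / 2 < `|TK f x|)%R]))).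
    apply: le_lebn => x [xr tK].
    have [h1|h1] := ltP (t * v1 / 2)%R (`|TK f x - K0 x * v1|)%R; first by left.
    right; rewrite /= ltNge; apply/negP => h2.
    have h3 : (`|K0 x * v1| <= t * v1)%R.
      have := ler_normB (TK f x) (TK f x - K0 x * v1)%R.
      by rewrite opprB addrC subrK; lra.
    by move: h3; rewrite (normrM (K0 x)) (gtr0_norm v10) ler_pM2r// leNgt tK.
  apply: (le_trans (lebn_setU_le _ _)).
  (* Where |K0| > t, either T f or T f - K0 v1 exceeds t v1 / 2. Both events have measure at most
     y^q, and 2 y^q <= (2 y)^q produces the constant 4. *)
  pose y : R := (2 * (c + eta) / t)%R.
  have y0 : (0 <= y)%R by rewrite divr_ge0 ?(ltW t0)// mulr_ge0// ltW.
  have yq x : (0 <= x)%R -> (x <= y)%R -> (x `^ q)%:E <= (y `^ q)%:E.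
    by move=> x0 xy; rewrite lee_fin; apply: ge0_ler_powR; rewrite ?nnegrE ?(ltW q0).
  apply: (@le_trans _ _ ((y `^ q)%:E + (y `^ q)%:E)).
    apply: leeD.
      apply: (le_trans (hrho _ tv)); apply: yq.
        by rewrite divr_ge0 ?(ltW tv)// ltW.
      rewrite (_ : (v1 * eta / (t * v1 / 2) = 2 * eta / t)%R); last by field; rewrite !gt_eqF.
      by rewrite /y ler_pM2r ?invr_gt0// ler_pM2l// lerDr.
    apply: (le_trans (TK_weak fi (ltW v10) fA tv)); apply: yq.
      by rewrite divr_ge0 ?(ltW tv)// mulr_ge0// ltW.
    rewrite (_ : (c * v1 / (t * v1 / 2) = 2 * c / t)%R); last by field; rewrite !gt_eqF.
    by rewrite /y ler_pM2r ?invr_gt0// ler_pM2l// lerDl ltW.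
  have y2 : (0 <= 4 * (c + eta) / t)%R by rewrite divr_ge0 ?(ltW t0)// mulr_ge0// ltW.
  have := powR_div_le q1 (_ : 1 <= 2)%R y2; rewrite ler1n => /(_ isT).
  rewrite (_ : (4 * (c + eta) / t / 2 = y)%R); last by rewrite /y; field; rewrite gt_eqF.
  by rewrite -EFinD lee_fin; lra.
have all rho : (0 < rho)%R -> mu [set x | (rho < enorm x)%R /\ (l < `|K x|)%R] <=
    ((4 * (c + eta) / l) `^ q)%:E.
  move=> r0; pose s := (rho / rho0)%R; have s0 : (0 < s)%R by rewrite divr_gt0.
  have sb : (0 < s `^ beta)%R by rewrite powR_gt0.
  rewrite (kernel_level_scale (fun u t => rho < u /\ l < `|t|)%R s0).
  rewrite (_ : [set x | _] = [set x | (rho0 < enorm x)%R /\ (l * s `^ beta < `|K x|)%R]); last first.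
    have e1 (x : V) : (rho < s * enorm x)%R = (rho0 < enorm x)%R.
      by rewrite /s mulrAC ltr_pdivlMr// ltr_pM2l.
    have e2 (x : V) : (l < `|(s `^ beta)^-1 * K x|)%R = (l * s `^ beta < `|K x|)%R.
      by rewrite (normrM (s `^ beta)^-1%R) normfV (gtr0_norm sb) mulrC ltr_pdivlMr.
    by apply/seteqP; split => x /=; rewrite e1 e2.
  apply: (@le_trans _ _ ((s ^+ n)%:E * ((4 * (c + eta) / (l * s `^ beta)) `^ q)%:E)).
    by apply: lee_wpmul2l; [rewrite lee_fin exprn_ge0// ltW|apply: far; rewrite mulr_gt0].
  rewrite -EFinM lee_fin -(powR_beta_q alphan) ?(ltW s0)// -powRM ?(ltW sb)//; last first.
    by rewrite divr_ge0 ?mulr_ge0// ltW// mulr_gt0.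
  rewrite (_ : (s `^ beta * (4 * (c + eta) / (l * s `^ beta)) = 4 * (c + eta) / l)%R)//.
  by field; rewrite !gt_eqF.
(* The bound is the same for all radii, so the excluded ball may shrink to the origin. *)
pose S (p : nat) : set E := [set x : E | (p.+1%:R^-1 < enorm (x : V))%R /\ (l < `|K x|)%R].
have mS p : measurable (S p).
  have -> : S p = [set x : E | (p.+1%:R^-1 < enorm (x : V))%R] `&` [set x : E | (l < `|K x|)%R] by [].
  apply: measurableI.
    by apply: measurable_set_lt; [exact: measurable_cst|exact: measurable_enorm_id].
  apply: measurable_set_lt; first exact: measurable_cst.
  exact: (measurableT_comp (@normr_measurable R setT) (kernel_measurable dini)).
have US : \bigcup_p S p = [set x | (l < `|K x|)%R].
  apply/seteqP; split => [x [p _ []]//|x /= lx].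
  have x0 : (0 < enorm x)%R.
    rewrite enorm_gt0; apply/eqP => xe; move: lx.
    by rewrite xe kernel_at0// normr0 ltNge (ltW l0).
  exists (Num.trunc (enorm x)^-1) => //; split => //=.
  by rewrite invf_plt ?posrE// truncnS_gt.
have mU' : measurable (\bigcup_p S p) by exact: bigcupT_measurable.
have ndS : nondecreasing_seq S.
  apply/nondecreasing_seqP => p; apply/subsetPset => x [h1 h2]; split => //=.
  by apply: le_lt_trans h1; rewrite lef_pV2 ?posrE// ler_nat.
have cv := @nondecreasing_cvg_mu _ E R (@lebn R n : {measure set E -> \bar R}) S mS mU' ndS.
rewrite -US -(cvg_lim (@ereal_hausdorff R) cv).
apply: lime_le; first by apply/cvg_ex; exists (mu (\bigcup_p S p)).
by apply: nearW => p; apply: all; rewrite invr_gt0.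
Qed.

End FarField.

(** * Densities and dilated measures *)

Section Dilations.
Context {R : realType} {n : nat}.
Local Notation V := 'rV[R]_n.
Local Notation E := (Rn R n).
Local Notation mu := (@lebn R n).
Local Open Scope ereal_scope.

(** No integrability of g is assumed: the identity holds for positive and negative parts separately,
    so it also covers points where the integral defining T is divergent. *)
Lemma density_exists (nu : {finite_measure set E -> \bar R}) : nu `<< mu ->
  exists f : V -> R, [/\ forall y, (0 <= f y)%R,
    mu.-integrable setT (fun y : E => (f y)%:E),
    fine (nu setT) = Defs.Rint mu setT f &
    forall (D : set E) (g : V -> R), measurable D -> measurable_fun [set: E] (g : E -> R) ->
    \int[nu]_(y in D) (g y)%:E = \int[mu]_(y in D) (g y * f y)%:E].
Proof.
move=> numu; pose f0 := Radon_Nikodym_SigmaFinite.f nu mu.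
have f00 y : 0 <= f0 y by exact: Radon_Nikodym_SigmaFinite.f_ge0.
have fE y : f0 y = (fine (f0 y))%:E by rewrite fineK//; exact: Radon_Nikodym_SigmaFinite.f_fin_num.
have fi : mu.-integrable setT (fun y : E => (fine (f0 y))%:E).
  rewrite (_ : (fun y : E => _) = f0); first exact: Radon_Nikodym_SigmaFinite.f_integrable.
  by apply/funext => y; rewrite -fE.
have f0' y : (0 <= fine (f0 y))%R by rewrite fine_ge0.
exists (fun y => fine (f0 y)); split => //.
  rewrite /Defs.Rint (Radon_Nikodym_SigmaFinite.f_integral numu measurableT).
  by congr fine; apply: eq_integral => y _; rewrite -fE.
move=> D g mD mg.
have mgE : measurable_fun D (fun y : E => (g y)%:E) by apply/measurable_funTS/measurable_EFinP.
rewrite integralE [RHS]integralE; congr (_ - _).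
  rewrite -(Radon_Nikodym_SigmaFinite.change_of_variables numu (funepos_ge0 _) mD (measurable_funepos mgE)).
  apply: eq_integral => y _; rewrite !funeposE -/f0 fE -!EFin_max -EFinM.
  by rewrite maxr_pMl// mul0r.
rewrite -(Radon_Nikodym_SigmaFinite.change_of_variables numu (funeneg_ge0 _) mD (measurable_funeneg mgE)).
apply: eq_integral => y _; rewrite !funenegE -/f0 fE -!EFinN -!EFin_max -EFinM.
by rewrite maxr_pMl// mul0r mulNr.
Qed.

(** [dilate nu t] is a bare set function; it coincides with the image of nu under y |-> t y. *)
Lemma dilate_integral (nu : {finite_measure set E -> \bar R}) (t : R) (D : set E) (g : V -> R) :
  (0 < t)%R -> measurable D -> measurable_fun [set: E] (g : E -> R) ->
  \int[dilate nu t]_(y in D) (g y)%:E =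
  \int[nu]_(y in (affine t 0%R : E -> E) @^-1` D) (g (t *: (y : V)))%:E.
Proof.
move=> t0 mD mg; have tn0 : (t != 0)%R by rewrite gt_eqF.
have ms := measurable_affine (0 : V)%R tn0.
have -> : dilate nu t = pushforward nu (affine t 0%R : E -> E).
  apply/funext => A; rewrite /dilate /pushforward; congr (nu _).
  apply/seteqP; split => [_ [y Ay <-]|y Ay] /=.
    by rewrite /affine /= addr0 scalerA mulfV// scale1r.
  exists (t *: y)%R; first by move: Ay; rewrite /affine /= addr0.
  by rewrite scalerA mulVf// scale1r.
have mgE : measurable_fun D (fun y : E => (g y)%:E) by apply/measurable_funTS/measurable_EFinP.
rewrite integralE [RHS]integralE; congr (_ - _).
  rewrite (@ge0_integral_pushforward _ _ E E R _ ms nu D _ mD (measurable_funepos mgE)) => [|y _].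
    by apply: eq_integral => y _; rewrite /= !funeposE /affine addr0.
  exact: funepos_ge0.
rewrite (@ge0_integral_pushforward _ _ E E R _ ms nu D _ mD (measurable_funeneg mgE)) => [|y _].
  by apply: eq_integral => y _; rewrite /= !funenegE /affine addr0.
exact: funeneg_ge0.
Qed.

Lemma convZ (k f : V -> R) (a : R) (x : V) : conv_integrable k f x ->
  conv k (fun y => a * f y)%R x = (a * conv k f x)%R.
Proof.
move=> fi; rewrite /conv !RintE -RintegralZl//.
by apply: eq_Rintegral => y _; rewrite mulrCA.
Qed.

Lemma cvg_at_right0_scale (g : R -> R) (t l : R) : (0 < t)%R ->
  g e @[e --> 0^'+] --> l -> g (e / t)%R @[e --> 0^'+] --> l.
Proof.
move=> t0 /cvgrPdist_le h; apply/cvgrPdist_le => eps eps0.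
have [d /= d0 hd] := h eps eps0; exists (d * t)%R; first by rewrite /= mulr_gt0.
move=> e /= ed e0; apply: hd; last by rewrite /= divr_gt0.
by rewrite /ball_ /= sub0r normrN normrM normfV (gtr0_norm t0) ltr_pdivrMr// -normrN -sub0r.
Qed.

End Dilations.

Section DilatedMeasures.
Context {R : realType} {n : nat} {alpha : R}.
Hypothesis n0 : (0 < n)%N.
Hypothesis alpha0 : 0 <= alpha.
Hypothesis alphan : alpha < n%:R.
Local Notation V := 'rV[R]_n.
Local Notation E := (Rn R n).
Local Notation mu := (@lebn R n).
Local Notation beta := (n%:R - alpha).
Local Notation q := (n%:R / (n%:R - alpha)).
Variable Omega : V -> R.
Hypothesis hom : homogeneous0 Omega.
Hypothesis dini : Lq_Dini q Omega.
Local Notation K := (omega_kernel alpha Omega).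
Local Open Scope ereal_scope.

Variable K0 : V -> R.
Hypothesis gK : good_kernel q K0.
Hypothesis K0E : mu [set x | K0 x <> K x] = 0.
Hypothesis K0loc : (0 < alpha)%R -> \int[mu]_(x in cball 1) (`|K0 x|)%:E < +oo.
Hypothesis K0canc : alpha = 0%R -> forall r s, (0 < r)%R -> (r <= s)%R ->
  \int[mu]_(x in shell r s) (K0 x)%:E = 0.
Variable c : R.
Hypothesis hb : L1_weak_bound alpha Omega c.

Let bK : borel_fun K0 := gk_borel gK.
Let q0 : (0 < q)%R. Proof. exact: (q_gt0 alpha0 alphan). Qed.
Local Notation TKa := (@TK R n alpha K0).
Local Notation tga := (@tgood R n alpha K0).

Lemma measurable_kernel_reflect (x : V) : measurable_fun [set: E] (fun y : E => K (x - (y : V)))%R.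
Proof.
have s0 : (-1 != 0 :> R)%R by rewrite oppr_eq0 oner_neq0.
have := measurableT_comp (kernel_measurable dini) (measurable_affine x s0).
by apply: eq_measurable_fun => y _; rewrite /affine /= scaleN1r addrC.
Qed.

Variable nu : {finite_measure set E -> \bar R}.
Variable f : V -> R.
Hypothesis fi : mu.-integrable setT (fun y : E => (f y)%:E).
Hypothesis nuT : fine (nu setT) = Defs.Rint mu setT f.
Hypothesis nuf : forall (D : set E) (g : V -> R), measurable D ->
  measurable_fun [set: E] (g : E -> R) ->
  \int[nu]_(y in D) (g y)%:E = \int[mu]_(y in D) (g y * f y)%:E.

Let mf : measurable_fun [set: E] (f : E -> R).
Proof. by have /integrableP[/measurable_EFinP ? _] := fi. Qed.

Lemma Rint_dilate (t : R) (x : V) (D : set E) : (0 < t)%R -> measurable D ->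
  Defs.Rint (dilate nu t) D (fun y : E => K (x - (y : V)) * 1)%R =
  Defs.Rint mu ((affine t 0%R : E -> E) @^-1` D)
    (fun y : E => K0 (t^-1 *: x - (y : V)) * ((t `^ beta)^-1 * f y))%R.
Proof.
move=> t0 mD; have tn0 : (t != 0)%R by rewrite gt_eqF.
have mg : measurable_fun [set: E] (fun y : E => K (x - (y : V)) * 1)%R.
  by apply: measurable_funM; [exact: measurable_kernel_reflect|exact: measurable_cst].
have mD' : measurable ((affine t 0%R : E -> E) @^-1` D).
  by rewrite -[X in measurable X]setTI; exact: (measurable_affine _ tn0 measurableT mD).
have scE (y : V) : (x - t *: y = t *: (t^-1 *: x - y))%R.
  by rewrite scalerBr scalerA mulfV// scale1r.
have KE (y : V) : (K (x - t *: y) * 1 = (t `^ beta)^-1 * K (t^-1 *: x - y))%R.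
  by rewrite mulr1 scE (kernel_homogeneous alphan hom _ t0).
rewrite -(integral_kernel_repr dini gK K0E (t^-1 *: x)%R mD'); last first.
  by apply: measurable_funM mf; exact: measurable_cst.
rewrite /Defs.Rint; congr fine; rewrite (dilate_integral nu t0 mD mg).
have mg' : measurable_fun [set: E] (fun y : E => K (x - t *: (y : V)) * 1)%R.
  under eq_fun do rewrite KE.
  by apply: measurable_funM; [exact: measurable_cst|exact: measurable_kernel_reflect].
rewrite (nuf (g := fun y => K (x - t *: y) * 1)%R mD' mg').
have mE (a b d : R) : (a * b * d = b * (a * d))%R by ring.
have pt (y : V) : (K (x - t *: y) * 1 * f y = K (t^-1 *: x - y) * ((t `^ beta)^-1 * f y))%R.
  exact: etrans (congr1 (fun z => z * f y)%R (KE y)) (mE _ _ _).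
by congr (integral _ _ _); apply/funext => y; congr EFin; exact: pt.
Qed.

(** K is homogeneous of degree -beta, so after y |-> t y a factor t^-beta comes out, x becomes x / t
    and a truncation at e becomes one at e / t. *)
Lemma Tmu_dilate (t : R) (x : V) : (0 < t)%R -> tga f (t^-1 *: x)%R ->
  Tmu alpha Omega (dilate nu t) x = ((t `^ beta)^-1 * TKa f (t^-1 *: x))%R.
Proof.
move=> t0; rewrite /Tmu /Tgen /tgood /TK; case: ifP => _; last first.
  by move=> gf; rewrite Rint_dilate// -convZ.
move=> [gf cf]; set u := (t^-1 *: x)%R in gf cf *; set a := (t `^ beta)^-1%R.
have e1 (e : R) : (0 < e)%R -> Defs.Rint (dilate nu t) [set y : E | (e < enorm (x - (y : V)))%R]
    (fun y : E => K (x - (y : V)) * 1)%R = (a * conv (kcut K0 (e / t)) f u)%R.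
  move=> e0; rewrite Rint_dilate//; last first.
    by apply: measurable_set_bool; exact: measurable_off_ball.
  rewrite -convZ; last by apply: gf; rewrite divr_gt0.
  have e2 (y : V) : (e < enorm (x - affine t 0 y))%R = (e / t < enorm (u - y))%R.
    rewrite /affine addr0 (_ : x - t *: y = t *: (u - y))%R; last first.
      by rewrite scalerBr scalerA mulfV ?gt_eqF// scale1r.
    by rewrite enormZ gtr0_norm// ltr_pdivrMr// mulrC.
  have -> : (affine t 0%R : E -> E) @^-1` [set y : E | (e < enorm (x - (y : V)))%R] =
      [set y : E | (e / t < enorm (u - (y : V)))%R] by apply/seteqP; split => y /=; rewrite e2.
  exact: Rint_off_ball.
apply/cvg_lim => //.
have h : (a * conv (kcut K0 (e / t)) f u)%R @[e --> 0^'+] -->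
    (a * lim (conv (kcut K0 e) f u @[e --> 0^'+]))%R.
  apply: cvgM; first exact: cvg_cst.
  exact: (cvg_at_right0_scale t0 cf).
move/cvgrPdist_le in h; apply/cvgrPdist_le => eps eps0; near=> e.
rewrite e1; first by near: e; exact: h.
by near: e; exact: nbhs_right_gt.
Unshelve. all: by end_near. Qed.

(** With u = x / t, the region |x| >= rho becomes |u| >= rho / t, which lies beyond rho0 when t <
    rho / rho0. The Jacobian t^n cancels the factor t^(-beta q) of the level, so the constant of
    [far_weak] is unchanged. *)
Lemma dilate_weak (rho eps : R) : (0 < rho)%R -> (0 < eps)%R ->
  exists t0 : R, (0 < t0)%R /\ forall t, (0 < t)%R -> (t < t0)%R ->
  weak_norm q [set x : V | ~ (enorm x < rho)%R]
    (fun x => Tmu alpha Omega (dilate nu t) x - K x * fine (nu [set: E]))%R <= eps%:E.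
Proof.
move=> r0 eps0.
have [rho0 [rho00 hfar]] := far_weak n0 alpha0 alphan hom dini gK K0E K0loc K0canc hb eps0 fi.
exists (rho / rho0)%R; split; first by rewrite divr_gt0.
move=> t t0 tr; rewrite nuT; set m := Defs.Rint mu setT f in hfar *.
have tb : (0 < t `^ beta)%R by rewrite powR_gt0.
apply: weak_norm_le => //; first exact: ltW.
move=> l l0; pose P : set V := [set u | (rho0 < enorm u)%R /\ (l * t `^ beta < `|TKa f u - K0 u * m|)%R].
pose N : set V := [set u | ~ tga f u] `|` [set u | K0 u <> K u].
have N0 : mu N = 0.
  apply/eqP; rewrite eq_le lebn_ge0 andbT; apply: (le_trans (lebn_setU_le _ _)).
  by rewrite K0E (tgood_ae n0 alpha0 alphan dini gK K0E K0loc K0canc hb fi) adde0.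
apply: (@le_trans _ _ (mu [set x | (P `|` N) (t^-1 *: x)%R])).
  apply: le_lebn => x [xr lx].
  have [g|] := pselect (tga f (t^-1 *: x)%R); last by right; left.
  have [k|] := pselect (K0 (t^-1 *: x)%R = K (t^-1 *: x)%R); last by right; right.
  have xE : x = (t *: (t^-1 *: x))%R by rewrite scalerA mulfV ?gt_eqF// scale1r.
  left; split.
    rewrite enormZ gtr0_norm ?invr_gt0// mulrC ltr_pdivlMr//.
    move: tr xr; rewrite ltr_pdivlMr// mulrC => h1 /negP; rewrite -leNgt; exact: lt_le_trans.
  move: lx; rewrite (Tmu_dilate t0 g) {2}xE (kernel_homogeneous alphan hom _ t0) -k.
  rewrite -mulrA -mulrBr (normrM (t `^ beta)^-1%R) normfV (gtr0_norm tb) mulrC ltr_pdivlMr//.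
rewrite lebn_scale//; apply: (@le_trans _ _ ((t ^+ n)%:E * ((eps / (l * t `^ beta)) `^ q)%:E)).
  apply: lee_wpmul2l; first by rewrite lee_fin exprn_ge0// ltW.
  apply: (le_trans (lebn_setU_le _ _)); rewrite N0 adde0; apply: hfar.
  by rewrite mulr_gt0.
rewrite -EFinM lee_fin -(powR_beta_q alphan) ?(ltW t0)// -powRM ?(ltW tb)//; last first.
  by rewrite divr_ge0 ?(ltW eps0)// ltW// mulr_gt0.
rewrite (_ : (t `^ beta * (eps / (l * t `^ beta)) = eps / l)%R)//.
by field; rewrite !gt_eqF.
Qed.

End DilatedMeasures.

Section FinalBounds.
Context {R : realType} {n : nat}.
Local Notation V := 'rV[R]_n.
Local Notation E := (Rn R n).
Local Notation mu := (@lebn R n).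
Local Open Scope ereal_scope.

Lemma weak_norm_ge0 (p : R) (D : set V) (f : V -> R) : 0 <= weak_norm p D f.
Proof.
apply: (@le_trans _ _ (1%:E * poweR (mu [set x | D x /\ (1 < `|f x|)%R]) p^-1)).
  by rewrite mul1e poweR_ge0.
by apply: ereal_sup_ubound; exists 1%R => //=; exact: ltr01.
Qed.

Lemma poweR_inv_le (p a : R) (x : \bar R) : (0 < p)%R -> (0 <= a)%R -> 0 <= x ->
  x <= (a `^ p)%:E -> poweR x p^-1 <= a%:E.
Proof.
move=> p0 a0; case: x => [x| |]//; rewrite !lee_fin => x0 xa.
have pi : (0 <= p^-1)%R by rewrite invr_ge0 ltW.
have := ge0_ler_powR pi _ _ xa; rewrite !nnegrE => /(_ x0 (powR_ge0 _ _)) /le_trans; apply.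
by rewrite -powRrM mulfV ?gt_eqF// powRr1.
Qed.

Lemma le_opnorm (alpha : R) (Omega : V -> R) (C : R) (x : \bar R) : (0 < C)%R ->
  (forall c, L1_weak_bound alpha Omega c -> x <= (C * c)%:E) ->
  x <= C%:E * T_opnorm alpha Omega.
Proof.
move=> C0 h; rewrite -lee_pdivrMl//; apply: le_ereal_inf_tmp => _ [c hc <-].
by rewrite lee_pdivrMl// -EFinM; exact: h.
Qed.

Lemma cvg_right0_ereal (g : R -> \bar R) : (forall t, 0 <= g t) ->
  (forall e, (0 < e)%R -> exists t0 : R, (0 < t0)%R /\
    forall t, (0 < t)%R -> (t < t0)%R -> g t <= e%:E) ->
  g t @[t --> 0^'+] --> 0.
Proof.
move=> g0 h.
have near e : (0 < e)%R -> \forall t \near (0 : R)^'+, g t <= e%:E.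
  move=> e0; have [t0 [t00 ht]] := h e e0; near=> t; apply: ht.
    by near: t; exact: nbhs_right_gt.
  by near: t; exact: nbhs_right_lt.
apply/fine_cvgP; split.
  have := near 1%R ltr01; apply: filterS => t gt.
  by rewrite ge0_fin_numE//; exact: le_lt_trans gt (ltry _).
apply/cvgrPdist_le => e e0; have := near e e0; apply: filterS => t gt.
have gfin : g t \is a fin_num by rewrite ge0_fin_numE//; exact: le_lt_trans gt (ltry _).
rewrite /= sub0r normrN ger0_norm ?fine_ge0//.
by rewrite -lee_fin fineK.
Unshelve. all: by end_near. Qed.

End FinalBounds.

(** * The three conclusions for an admissible constant c *)

Section Conclusions.
Context {R : realType} {n : nat} {alpha : R}.
Hypothesis n0 : (0 < n)%N.
Hypothesis alpha0 : 0 <= alpha.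
Hypothesis alphan : alpha < n%:R.
Local Notation V := 'rV[R]_n.
Local Notation E := (Rn R n).
Local Notation mu := (@lebn R n).
Local Notation q := (n%:R / (n%:R - alpha)).
Variable Omega : V -> R.
Hypothesis hom : homogeneous0 Omega.
Hypothesis dini : Lq_Dini q Omega.
Hypothesis canc : alpha = 0 -> sphere_integral (fun x => (Omega x)%:E) = 0%E.
Variable c : R.
Hypothesis hb : L1_weak_bound alpha Omega c.
Local Open Scope ereal_scope.

Let c0 : (0 <= c)%R. Proof. by case: hb. Qed.
Let q1 : (1 <= q)%R. Proof. exact: (q_ge1 alpha0 alphan). Qed.
Let q0 : (0 < q)%R. Proof. exact: (q_gt0 alpha0 alphan). Qed.

Lemma kernel_level_bound (eta l : R) : (0 < eta)%R -> (0 < l)%R ->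
  mu [set x | (l < `|omega_kernel alpha Omega x|)%R] <= ((4 * (c + eta) / l) `^ q)%:E.
Proof.
have [K0 [gK K0E K0loc K0canc]] := kernel_borel_repr n0 alpha0 alphan hom dini.
by apply: (kernel_level_le n0 alpha0 alphan hom dini gK K0E K0loc _ hb) => a0; exact: K0canc (canc a0).
Qed.

Lemma kernel_weak_norm_le : weak_norm q [set: V] (omega_kernel alpha Omega) <= (4 * c)%:E.
Proof.
apply/lee_addgt0Pr => e e0; rewrite -EFinD.
have e4 : (0 < e / 4)%R by rewrite divr_gt0.
have -> : (4 * c + e = 4 * (c + e / 4))%R by lra.
apply: weak_norm_le => [//||l l0]; first by rewrite mulr_ge0// addr_ge0// ltW.
apply: le_trans (kernel_level_bound e4 l0); by apply: le_lebn => x [].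
Qed.

(** 16 is the 4 of [LqB_le_level1] times the 4 of [kernel_level_bound]; n comes from the
    normalization of the surface measure. *)
Lemma Omega_norm_le : poweR (sphere_integral (fun x => (`|Omega x| `^ q)%:E)) q^-1
  <= (16 * n%:R * c)%:E.
Proof.
have n1 : (1 <= n%:R :> R)%R by rewrite ler1n.
apply/lee_addgt0Pr => e e0; rewrite -EFinD.
pose eta : R := (e / (16 * n%:R))%R.
have eta0 : (0 < eta)%R by rewrite divr_gt0// mulr_gt0// (lt_le_trans ltr01).
have -> : (16 * n%:R * c + e = n%:R * (16 * (c + eta)))%R.
  by rewrite /eta; field; rewrite pnatr_eq0 -lt0n.
have ce : (0 <= c + eta)%R by rewrite addr_ge0// ltW.
have y0 : (0 <= 16 * (c + eta))%R by rewrite mulr_ge0.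
have ny : (0 <= n%:R * (16 * (c + eta)))%R by rewrite mulr_ge0.
apply: (poweR_inv_le q0 ny).
  rewrite sphere_integralE mule_ge0 ?lee_fin//.
  by apply: integral_ge0 => x _; rewrite lee_fin powR_ge0.
rewrite (sphere_integral_hom (fun t => (`|t| `^ q)%:E) hom).
apply: (@le_trans _ _ (n%:R%:E * ((16 * (c + eta)) `^ q)%:E)).
  apply: lee_wpmul2l; first by rewrite lee_fin.
  change (@LqB R n alpha Omega <= ((16 * (c + eta)) `^ q)%:E).
  apply: (le_trans (LqB_le_level1 alpha0 alphan hom dini)).
  apply: (@le_trans _ _ ((4 `^ q)%:E * ((4 * (c + eta) / 1) `^ q)%:E)).
    apply: lee_wpmul2l; first by rewrite lee_fin powR_ge0.
    exact: kernel_level_bound.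
  rewrite -EFinM lee_fin divr1 -powRM ?mulr_ge0//.
  by rewrite (_ : (4 * (4 * (c + eta)) = 16 * (c + eta))%R)//; lra.
(* The factor n in front of the integral is absorbed by n <= n^q, as q >= 1. *)
have := powR_div_le q1 n1 ny; rewrite [(n%:R * _ / _)%R]mulrAC divff ?mul1r; last first.
  by rewrite pnatr_eq0 -lt0n.
by rewrite ler_pdivlMr ?ltr0n// mulrC -EFinM lee_fin.
Qed.

Lemma dilate_cvg (nu : {finite_measure set E -> \bar R}) (rho : R) : nu `<< mu -> (0 < rho)%R ->
  (fun t : R => weak_norm q [set x : V | ~ (enorm x < rho)%R]
     (fun x => Tmu alpha Omega (dilate nu t) x
               - omega_kernel alpha Omega x * fine (nu [set: E]))%R) @ 0^'+ --> 0.
Proof.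
move=> numu rho0.
have [K0 [gK K0E K0loc K0canc]] := kernel_borel_repr n0 alpha0 alphan hom dini.
have [f [_ fi nuT nuf]] := density_exists numu.
apply: cvg_right0_ereal => [t|e e0]; first exact: weak_norm_ge0.
apply: (dilate_weak n0 alpha0 alphan hom dini gK K0E K0loc _ hb fi nuT nuf rho0 e0) => a0.
exact: K0canc (canc a0).
Qed.

End Conclusions.

Theorem theorem1p9 (R : realType) (n : nat) (alpha : R) :
  (1 <= n)%N -> 0 <= alpha -> alpha < n%:R ->
  exists C : R, 0 < C /\
  forall Omega : 'rV[R]_n -> R,
    homogeneous0 Omega ->
    Lq_Dini (n%:R / (n%:R - alpha)) Omega ->
    (alpha = 0 -> sphere_integral (fun x => (Omega x)%:E) = 0%E) ->
    T_bounded alpha Omega ->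
    [/\ (* (1) *)
        measurable_fun [set: Rn R n] (omega_kernel alpha Omega : Rn R n -> R) /\
        (weak_norm (n%:R / (n%:R - alpha)) [set: 'rV[R]_n]
           (omega_kernel alpha Omega) < +oo)%E,
        (weak_norm (n%:R / (n%:R - alpha)) [set: 'rV[R]_n] (omega_kernel alpha Omega)
           <= C%:E * T_opnorm alpha Omega)%E,
        (* (2) *)
        LqS (n%:R / (n%:R - alpha)) Omega /\
        (poweR (sphere_integral
                  (fun x => (`|Omega x| `^ (n%:R / (n%:R - alpha)))%:E))
               (n%:R / (n%:R - alpha))^-1
           <= C%:E * T_opnorm alpha Omega)%E
      & (* (3) *)
        forall V : {finite_measure set Rn R n -> \bar R},
          V `<< (@lebn R n) ->
          forall rho : R, 0 < rho ->
            (fun t : R =>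
               weak_norm (n%:R / (n%:R - alpha))
                 [set x : 'rV[R]_n | ~ (enorm x < rho)]
                 (fun x => Tmu alpha Omega (dilate V t) x
                           - omega_kernel alpha Omega x * fine (V [set: Rn R n])))
              @ 0^'+ --> 0%E].
Proof.
move=> n0 alpha0 alphan; have n1 : (1 <= n%:R :> R) by rewrite ler1n.
(* One constant for both norms: 4 would do for the kernel, 16 n is the one for Omega. *)
exists (16 * n%:R); split; first by rewrite mulr_gt0// (lt_le_trans ltr01).
move=> Omega hom dini canc [c1 hc1].
have norm_le c : L1_weak_bound alpha Omega c ->
    (weak_norm (n%:R / (n%:R - alpha)) [set: 'rV[R]_n] (omega_kernel alpha Omega)
      <= (16 * n%:R * c)%:E)%E.
  move=> hc; apply: (le_trans (kernel_weak_norm_le n0 alpha0 alphan hom dini canc hc)).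
  have [cge0 _] := hc; rewrite lee_fin; apply: ler_wpM2r => //; lra.
have C0 : 0 < 16 * n%:R :> R by rewrite mulr_gt0// (lt_le_trans ltr01).
split.
- split; first exact: kernel_measurable dini.
  exact: le_lt_trans (norm_le c1 hc1) (ltry _).
- exact: le_opnorm.
- split; first by case: dini.
  apply: le_opnorm => // c hc; exact: (Omega_norm_le n0 alpha0 alphan hom dini canc hc).
- move=> V Vac rho rho0; exact: (dilate_cvg n0 alpha0 alphan hom dini canc hc1 Vac rho0).
Qed.
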